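(* Let $D\subset\mathbb C$ be a bounded simply connected Lipschitz domain, $1<p<\infty$, and $\alpha\in D$. Then every $F\in\mathcal H^{1,p}_\alpha(D)$ belongs to $\mathcal D^p_\alpha(D)$, and there is a constant $C>0$ independent of $F$ such that $$\|F\|_{\mathcal D^p_\alpha(D)}\le C\,\|F\|_{\mathcal H^{1,p}_\alpha(D)}\qquad\text{for all }F\in\mathcal H^{1,p}_\alpha(D).$$ That is, the holomorphic Sobolev-Hardy space is embedded in the Dirichlet space.
   Context: **Lipschitz domains.** A bounded domain $D\subset\mathbb C$ with boundary $bD$ is Lipschitz if there are finitely many open rectangles $R_j$ with sides parallel to the coordinate axes, angles $\theta_j$, and Lipschitz functions $\phi_j:\mathbb R\to\mathbb R$ such that the sets $e^{-i\theta_j}R_j$ cover $bD$ and $(e^{i\theta_j}D)\cap R_j=\{x+iy\in R_j:\ y>\phi_j(x)\}$. $\sigma$ is arc-length measure on $bD$. **Cones.** Fix a family $\{\Gamma(\zeta)\}_{\zeta\in bD}$ of truncated one-sided open cones with vertex $\zeta$ such that, for some choice of finitely many open rectangles $R_j$ with sides parallel to the coordinate axes, angles $\theta_j$ and Lipschitz functions $\phi_j:\mathbb R\to\mathbb R$ for which the sets $e^{-i\theta_j}R_j$ cover $bD$ and $(e^{i\theta_j}D)\cap R_j=\{x+iy\in R_j:\ y>\phi_j(x)\}$, and for some choice of relatively compact subrectangles $R_j'\subset R_j$ with $\{e^{-i\theta_j}R_j'\}$ still covering $bD$, for each $j$ there are truncated open cones $\Delta_1,\Delta_2$ with vertex $0$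 and axis along the positive $y$-axis with $$e^{-i\theta_j}\Delta_1+\zeta\subset\Gamma(\zeta)\subset\overline{\Gamma(\zeta)}\setminus\{\zeta\}\subset e^{-i\theta_j}\Delta_2+\zeta\subset D\cap e^{-i\theta_j}R_j$$ for all $\zeta\in bD\cap e^{-i\theta_j}R'_j$. The family is chosen so that the maximal functions $\zeta\mapsto\sup_{z\in\Gamma(\zeta)}|F(z)|$ are $\sigma$-measurable for continuous $F$. **Boundary functions.** For $F$ on $D$ and $\zeta\in bD$: $F^*(\zeta)=\sup_{z\in\Gamma(\zeta)}|F(z)|$ and $\dot F(\zeta)=\lim_{z\to\zeta,\,z\in\Gamma(\zeta)}F(z)$ when it exists (nontangential limit). **Spaces.** $\vartheta(D)$ is the set of holomorphic functions on $D$; $\mathcal H^p(D)=\{F\in\vartheta(D): F^*\in L^p(bD,\sigma)\}$ (every such $F$ has a nontangential limit $\dot F\in L^p(bD,\sigma)$ $\sigma$-a.e.); $\mathcal H^{1,p}_\alpha(D)=\{F\in\vartheta(D): F'\in\mathcal H^p(D),\ F(\alpha)=0\}$ with norm $\|F\|_{\mathcal H^{1,p}_\alpha(D)}=\|\dot{(F')}\|_{L^p(bD,\sigma)}$. The Dirichlet space is $$\mathcal D^p_\alpha(D)=\Big\{F\in\vartheta(D):F(\alpha)=0,\ \int_D|F'(z)|^p\,dV(z)<\infty\Big\},\qquad \|F\|_{\mathcal D^p_\alpha(D)}=\Big(\int_D|F'(z)|^p\,dV(z)\Big)^{1/p},$$ where $dV$ is Lebesgue measure on $\mathbb C$. *)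

(* Defs.v *)
From HB Require Import structures.
From mathcomp Require Import all_boot all_order all_algebra.
From mathcomp Require Import complex.
From mathcomp Require Import all_classical all_reals all_analysis.
From mathcomp Require Import measurable_realfun.

Set Implicit Arguments.
Unset Strict Implicit.
Unset Printing Implicit Defensive.

Import Order.TTheory GRing.Theory Num.Theory.
Import numFieldNormedType.Exports.

Local Open Scope classical_set_scope.
Local Open Scope ring_scope.

(* The complex plane is [R[i]^o]: the regular module carries the topology and
   the structure of a normed module over the field [R[i]], so that [derivable]
   and [derive1] are complex differentiability and the complex derivative. *)

(* The modulus with values in [R]; the norm [`|z|] of MathComp lies in [R[i]]. *)
Definition modulus (R : realType) (z : R[i]^o) : R := Normc.normc z.

Definition rot (R : realType) (t : R) (z : R[i]^o) : R[i]^o :=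
  (cos t +i* sin t)%C * z.

Section domains.
Variable R : realType.
Implicit Types (D : set R[i]^o).

Definition bd D : set R[i]^o := closure D `\` D°.

Definition bounded_domain D : Prop :=
  [/\ open D, connected D, D !=set0 & bounded_set D].

(* Every loop in [D] is homotopic in [D], with fixed base point, to a constant
   loop; meant for connected open sets. *)
Definition simply_connected D : Prop :=
  forall g : R -> R[i]^o,
    {within `[0, 1], continuous g} -> g @` `[0, 1] `<=` D -> g 0 = g 1 ->
  exists H : R * R -> R[i]^o,
    [/\ {within `[0, 1] `*` `[0, 1], continuous H},
        H @` (`[0, 1] `*` `[0, 1]) `<=` D,
        forall t, t \in `[0, 1] -> H (0, t) = g t /\ H (1, t) = g 0 &
        forall s, s \in `[0, 1] -> H (s, 0) = g 0 /\ H (s, 1) = g 0].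

Definition open_rectangle (Q : set R[i]^o) : Prop :=
  exists x1 x2 y1 y2 : R, [/\ x1 < x2, y1 < y2 &
    Q = [set z : R[i]^o |
          x1 < complex.Re z < x2 /\ y1 < complex.Im z < y2]].

Definition lipschitz_atlas D (n : nat) (Q : 'I_n -> set R[i]^o)
    (theta : 'I_n -> R) (phi : 'I_n -> R -> R) : Prop :=
  [/\ forall j, open_rectangle (Q j),
      forall j, lipschitz (phi j),
      bd D `<=` [set z | exists j, (rot (- theta j) @` Q j) z] &
      forall j, (rot (theta j) @` D) `&` Q j =
        [set z | Q j z /\ phi j (complex.Re z) < complex.Im z]].

Definition lipschitz_domain D : Prop :=
  exists n Q theta phi, @lipschitz_atlas D n Q theta phi.

End domains.

Section cones.
Variable R : realType.
Implicit Types (D : set R[i]^o).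

(* The one-sided cone with vertex [v] and axis along the unit vector [u], of
   slope [m] (the tangent of the half-opening) and height [h]; in the
   coordinate [(z - v) / u] it is [0 < Re < h], [|Im| < m Re]. *)
Definition trunc_cone (v u : R[i]^o) (m h : R) : set R[i]^o :=
  [set z | let w : R[i] := (z - v) * conjc u in
           0 < complex.Re w < h /\ `|complex.Im w| < m * complex.Re w].

Definition is_trunc_cone (v : R[i]^o) (S : set R[i]^o) : Prop :=
  exists u m h, [/\ modulus u = 1, 0 < m, 0 < h & S = trunc_cone v u m h].

Definition is_vertical_cone (S : set R[i]^o) : Prop :=
  exists m h, [/\ 0 < m, 0 < h & S = trunc_cone 0 (0 +i* 1)%C m h].

(* Only the values of [G] on [bd D] matter.  The measurability of the maximal
   functions is the separate condition [nt_measurable] below. *)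
Definition cone_family D (G : R[i]^o -> set R[i]^o) : Prop :=
  (forall z, bd D z -> is_trunc_cone z (G z)) /\
  exists n Q theta phi (Q' : 'I_n -> set R[i]^o),
  [/\ @lipschitz_atlas R D n Q theta phi,
      forall j, [/\ open_rectangle (Q' j), compact (closure (Q' j)) &
                    closure (Q' j) `<=` Q j],
      bd D `<=` [set z | exists j, (rot (- theta j) @` Q' j) z] &
      forall j, exists Delta1 Delta2,
        [/\ is_vertical_cone Delta1, is_vertical_cone Delta2 &
        forall z, bd D z -> (rot (- theta j) @` Q' j) z ->
        [/\ [set rot (- theta j) w + z | w in Delta1] `<=` G z,
            G z `<=` closure (G z) `\ z,
            closure (G z) `\ z `<=` [set rot (- theta j) w + z | w in Delta2] &
            [set rot (- theta j) w + z | w in Delta2] `<=`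
              D `&` (rot (- theta j) @` Q j)]]].

End cones.

Section arc_length.
Variable R : realType.
Local Open Scope ereal_scope.
Implicit Types (A D : set R[i]^o).

(* The maximum with 0 is for the empty set, whose [ereal_sup] is [-oo]. *)
Definition diam A : \bar R :=
  maxe 0 (ereal_sup [set (modulus (z.1 - z.2))%:E | z in A `*` A]).

Definition hausdorff_delta (d : R) A : \bar R :=
  ereal_inf [set \sum_(k <oo) diam (U k) | U in
    [set U : (set R[i]^o)^nat |
      A `<=` \bigcup_k U k /\ forall k, diam (U k) <= d%:E]].

(* The one-dimensional Hausdorff outer measure. *)
Definition hausdorff1 A : \bar R :=
  ereal_sup [set hausdorff_delta d A | d in [set d : R | (0 < d)%R]].

Definition arc_outer D A : \bar R := hausdorff1 (A `&` bd D).

Lemma diam_ge0 A : 0 <= diam A.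
Proof. by rewrite /diam le_max lexx. Qed.

#[local] Hint Resolve diam_ge0 : core.

Lemma diam0 : diam set0 = 0.
Proof.
by rewrite /diam setX0 image_set0 ereal_sup0; apply/max_idPl; rewrite leNye.
Qed.

Lemma hausdorff_delta_ge0 d A : 0 <= hausdorff_delta d A.
Proof.
apply: le_ereal_inf_tmp => _ [U _ <-].
by apply: nneseries_ge0 => k _ _; exact: diam_ge0.
Qed.

Lemma hausdorff_delta0 d : (0 < d)%R -> hausdorff_delta d set0 = 0.
Proof.
move=> d0; apply/eqP; rewrite eq_le hausdorff_delta_ge0 andbT.
apply: ereal_inf_lbound; exists (fun=> set0).
  by split => // k; rewrite diam0 lee_fin ltW.
by apply: eseries0 => k _ _; exact: diam0.
Qed.

Lemma le_hausdorff_delta d :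
  {homo hausdorff_delta d : A B / A `<=` B >-> A <= B}.
Proof.
move=> A B AB; apply: ereal_inf_le_tmp => _ [U [BU Ud] <-].
by exists U => //; split => //; exact: subset_trans BU.
Qed.

Lemma hausdorff_delta_sigma_subadditive d :
  sigma_subadditive (hausdorff_delta d).
Proof.
move=> A; have [[i ioo]|] := pselect (exists i, hausdorff_delta d (A i) = +oo).
  rewrite (eseries_pinfty _ _ ioo) ?leey// => n _.
  by rewrite -ltNye (lt_le_trans _ (hausdorff_delta_ge0 _ _)).
rewrite -forallNE => Aoo.
suff add2e (e : {posnum R}) : hausdorff_delta d (\bigcup_n A n) <=
    \sum_(i <oo) hausdorff_delta d (A i) + e%:num%:E.
  by apply/lee_addgt0Pr => _/posnumP[].
rewrite (le_trans _ (epsilon_trick _ _ _))//; last first.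
  by move=> n; exact: hausdorff_delta_ge0.
pose P n (B : (set R[i]^o)^nat) :=
  (A n `<=` \bigcup_k B k /\ forall k, diam (B k) <= d%:E) /\
  \sum_(k <oo) diam (B k) <=
    hausdorff_delta d (A n) + (e%:num / (2 ^ n.+1)%:R)%:E.
have [G PG] : {G : ((set R[i]^o)^nat)^nat & forall n, P n (G n)}.
  apply: (@choice _ _ P) => n; rewrite /P /hausdorff_delta.
  set S := (X in ereal_inf X); move infS : (ereal_inf S) => iS.
  case: iS infS => [r Sr|Soo|Soo].
  - have en1 : (0 < e%:num / (2 ^ n.+1)%:R)%R by [].
    have /(lb_ereal_inf_adherent en1) : ereal_inf S \is a fin_num by rewrite Sr.
    move=> [x [B AnB muBx] xS].
    by exists B; split => //; rewrite muBx -Sr; exact/ltW.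
  - by have := Aoo n; rewrite /hausdorff_delta Soo.
  - suff : lbound S 0 by move/le_ereal_inf_tmp; rewrite Soo.
    by move=> /= _ [B _ <-]; apply: nneseries_ge0 => *; exact: diam_ge0.
have G_ge0 x : 0 <= (diam \o uncurry G) x by exact: diam_ge0.
apply: (@le_trans _ _ (\esum_(i in setT) (diam \o uncurry G) i)).
  apply: ereal_inf_lbound => /=.
  have /card_esym/ppcard_eqP[f] := card_nat2.
  exists (uncurry G \o f).
    split=> [|k]; last by rewrite /=; case: (f k) => a b; exact: (PG a).1.2.
    apply: (@subset_trans _ (\bigcup_n \bigcup_k G n k)) => [t [i _]|].
      by move=> /((PG i).1.1) -[j _ ?]; exists i => //; exists j.
    move=> t [i _ [j _ Bijt]]; exists (f^-1%FUN (i, j)) => //=.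
    by rewrite invK ?inE.
  rewrite -(esum_pred_image (diam \o uncurry G) _ xpredT) ?[fun=> _]set_true//.
  by rewrite image_eq.
rewrite (_ : esum _ _ = \sum_(i <oo) \sum_(j <oo ) diam (G i j)); last first.
  pose J : nat -> set (nat * nat) := fun i => [set (i, j) | j in setT].
  rewrite (_ : setT = \bigcup_k J k); last first.
    by rewrite predeqE => -[a b]; split => // _; exists a => //; exists b.
  rewrite esum_bigcupT /=; last 2 first.
    - apply/trivIsetP => i j _ _ ij.
      rewrite predeqE => -[n m] /=; split => //= -[] [_] _ [<-{n} _].
      by move=> [m' _] [] /esym/eqP; rewrite (negbTE ij).
    - by move=> /= [n m]; exact: diam_ge0.
  rewrite -(image_id [set: nat]) -fun_true esum_pred_image//; last first.
    by move=> n _; apply: esum_ge0 => *; exact: diam_ge0.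
  apply: eq_eseriesr => /= j _.
  rewrite -(esum_pred_image (diam \o uncurry G) (pair j) predT)//=; last first.
    by move=> ? ? _ _; exact: (@can_inj _ _ _ snd).
  by congr esum; rewrite predeqE => -[a b]; split; move=> [i _ <-]; exists i.
apply: lee_lim.
- apply: is_cvg_nneseries => n *.
  by apply: nneseries_ge0 => m *; exact: (G_ge0 (n, m)).
- by apply: is_cvg_nneseries => n *; apply: adde_ge0 => //;
    exact: hausdorff_delta_ge0.
- by near=> n; apply: lee_sum => i _; exact: (PG i).2.
Unshelve. all: by end_near. Qed.

Lemma hausdorff_delta_le1 d A : (0 < d)%R -> hausdorff_delta d A <= hausdorff1 A.
Proof. by move=> d0; apply: ereal_sup_ubound; exists d. Qed.

Lemma hausdorff1_ge0 A : 0 <= hausdorff1 A.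
Proof.
exact: le_trans (hausdorff_delta_ge0 1 A) (hausdorff_delta_le1 _ ltr01).
Qed.

Lemma arc_outer0 D : arc_outer D set0 = 0.
Proof.
rewrite /arc_outer set0I; apply/eqP; rewrite eq_le hausdorff1_ge0 andbT.
by apply: ge_ereal_sup => _ [d d0 <-]; rewrite hausdorff_delta0.
Qed.

Lemma arc_outer_ge0 D A : 0 <= arc_outer D A.
Proof. exact: hausdorff1_ge0. Qed.

Lemma le_arc_outer D : {homo arc_outer D : A B / A `<=` B >-> A <= B}.
Proof.
move=> A B AB; apply: ge_ereal_sup => _ [d d0 <-].
apply: le_trans (hausdorff_delta_le1 _ d0).
by apply: le_hausdorff_delta; exact: setSI.
Qed.

Lemma arc_outer_sigma_subadditive D : sigma_subadditive (arc_outer D).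
Proof.
move=> F; apply: ge_ereal_sup => _ [d d0 <-].
rewrite setI_bigcupl.
apply: le_trans (hausdorff_delta_sigma_subadditive _ _) _.
apply: lee_nneseries => k _ *; first exact: hausdorff_delta_ge0.
exact: hausdorff_delta_le1.
Qed.

HB.instance Definition _ D := isOuterMeasure.Build R R[i]^o (arc_outer D)
  (arc_outer0 D) (@arc_outer_ge0 D) (@le_arc_outer D)
  (@arc_outer_sigma_subadditive D).

Definition arc_outer_measure D : {outer_measure set R[i]^o -> \bar R} :=
  arc_outer D.

End arc_length.

(* The plane with the Caratheodory sigma-algebra of [arc_outer D], whose
   elements are the sigma-measurable sets. *)
Notation arc_space D := (caratheodory_type (arc_outer_measure D)).

(* Arc length on [bD], as the one-dimensional Hausdorff measure of the trace on
   [bD]; it is a measure on the plane and vanishes off [bD], so functions on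
   [bD] are represented by functions on the plane with irrelevant values
   elsewhere. *)
Definition arc_length (R : realType) (D : set R[i]^o) :
    {measure set (arc_space D) -> \bar R} :=
  (arc_outer_measure D : set (arc_space D) -> \bar R).

Section spaces.
Variable R : realType.
Implicit Types (D : set R[i]^o) (F : R[i]^o -> R[i]^o) (p : R).
Implicit Types (G : R[i]^o -> set R[i]^o).

(* [F^*] *)
Definition nt_max G F (z : R[i]^o) : \bar R :=
  ereal_sup [set (modulus (F w))%:E | w in G z].

(* The nontangential limit; an unspecified value where it does not exist. *)
Definition nt_lim G F (z : R[i]^o) : R[i]^o :=
  lim (F w @[w --> within (G z) (nbhs z)]).

Definition nt_measurable D G : Prop :=
  forall F, {within D, continuous F} ->
    measurable_fun [set: arc_space D] (nt_max G F : arc_space D -> \bar R).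

Definition holomorphic D F : Prop := forall z, D z -> derivable F z 1.

Definition in_Lp D p (f : arc_space D -> \bar R) : Prop :=
  measurable_fun [set: arc_space D] f /\
  ('N[arc_length D]_(p%:E) [f] < +oo)%E.

Definition hardy D G p F : Prop :=
  holomorphic D F /\ @in_Lp D p (nt_max G F).

Definition sobolev_hardy D G p (alpha : R[i]^o) F : Prop :=
  [/\ holomorphic D F, hardy D G p (derive1 F) & F alpha = 0].

Definition sobolev_hardy_norm D G p F : \bar R :=
  'N[arc_length D]_(p%:E)
    [ (fun z => (modulus (nt_lim G (derive1 F) z))%:E) ].

Definition dirichlet_integral D p F : \bar R :=
  (\int[@lebesgue_measure R \x @lebesgue_measure R]_(
      w in [set w : R * R | D (w.1 +i* w.2)%C])
    ((modulus (derive1 F (w.1 +i* w.2)%C)) `^ p)%:E)%E.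

Definition dirichlet D p (alpha : R[i]^o) F : Prop :=
  [/\ holomorphic D F, F alpha = 0 & (dirichlet_integral D p F < +oo)%E].

Definition dirichlet_norm D p F : \bar R :=
  (dirichlet_integral D p F `^ p^-1)%E.

End spaces.

(* Main.v *)
Require Import Defs.
From HB Require Import structures.
From mathcomp Require Import all_boot all_order all_algebra.
From mathcomp Require Import complex.
From mathcomp Require Import ring lra.
From mathcomp Require Import all_classical all_reals all_analysis.
From mathcomp Require Import measurable_realfun.

Set Implicit Arguments.
Unset Strict Implicit.
Unset Printing Implicit Defensive.

Import Order.TTheory GRing.Theory Num.Theory.
Import numFieldNormedType.Exports.

Local Open Scope classical_set_scope.
Local Open Scope ring_scope.

(* Let f = F'.  In a chart where D lies above a Lipschitz graph gamma, |f| is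
   dominated on vertical cones by the maximal function N, which is integrable in
   the chart parameter.  The trace B of F on the graph satisfies
   |B(y) - B(x)| <= C int_x^y N, so it is differentiable almost everywhere, and
   where both B and gamma are differentiable f has the nontangential limit
   B' / gamma': subtract an affine function from F and test against a difference
   of squared Cauchy kernels.  Green's formula then bounds int_D f dbar(psi) by
   boundary integrals of g |psi| with g = |f| on bD, for test functions psi
   supported near a boundary point.  With a partition of unity and psi a smoothed
   Cauchy kernel this gives, for all z in D,
     |f(z)| <= C sum_i int g_i(x) / |z - gamma_i(x)| dx.
   Hoelder's inequality and Tonelli's theorem deduce
   int_D |f|^p <= C sum_i int g_i^p, and the right-hand side is at most a multiple
   of the p-th power of the norm of f on bD because projections to the chart axes
   do not increase lengths. *)

(** * Real and imaginary parts *)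

(** What has to be bridged is that [nt_lim] is a bare [lim]: a bound by boundary values says nothing
    until that limit is shown to exist almost everywhere and to be the density that Green's formula
    produces. The maximal function controls [f] only up to integrability along the boundary, so the
    limit is sought through [F], whose trace is absolutely continuous. Absolute values are enough in
    Green's formula: no orientation of [bD], no tangent field and no exact Cauchy formula enter,
    only inequalities for real parts, the phase being carried by the test function. A Lipschitz
    graph is never differentiated inside a test function; a moving average with the same Lipschitz
    constant replaces it. For a constant independent of [F], the discs, the arcs and their constants
    are fixed by compactness before [F] appears, and only the densities [arc_g] depend on it. Each
    density is estimated twice: by [nt_max], which makes the Dirichlet integral finite, and by
    [nt_lim], which gives the norm inequality. *)

Section complex_toolkit.
Variable R : realType.
Implicit Types (z w : R[i]^o) (x y : R).

(** Area integrals live on [R * R] and complex differentiability on [R[i]^o]; [cx] is the passage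
    between the two. *)
Definition cx (p : R * R) : R[i]^o := (p.1 +i* p.2)%C.
Definition re z : R := complex.Re z.
Definition im z : R := complex.Im z.

Lemma reE x y : re (x +i* y)%C = x. Proof. by []. Qed.
Lemma imE x y : im (x +i* y)%C = y. Proof. by []. Qed.
Lemma cplx_eta z : (re z +i* im z)%C = z. Proof. by case: z. Qed.
Lemma cplx_eqP z w : re z = re w -> im z = im w -> z = w.
Proof. by case: z w => [a b] [c d] /= -> ->. Qed.

Lemma reD z w : re (z + w) = re z + re w. Proof. by case: z w => [a b] [c d]. Qed.
Lemma imD z w : im (z + w) = im z + im w. Proof. by case: z w => [a b] [c d]. Qed.
Lemma reN z : re (- z) = - re z. Proof. by case: z. Qed.
Lemma imN z : im (- z) = - im z. Proof. by case: z. Qed.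
Lemma reB z w : re (z - w) = re z - re w. Proof. by rewrite reD reN. Qed.
Lemma imB z w : im (z - w) = im z - im w. Proof. by rewrite imD imN. Qed.
Lemma reM z w : re (z * w) = re z * re w - im z * im w.
Proof. by case: z w => [a b] [c d]. Qed.
Lemma imM z w : im (z * w) = re z * im w + im z * re w.
Proof. by case: z w => [a b] [c d]. Qed.
Lemma reC x : re x%:C%C = x. Proof. by []. Qed.
Lemma imC x : im x%:C%C = 0. Proof. by []. Qed.
Lemma reJ z : re (conjc z) = re z. Proof. by case: z. Qed.
Lemma imJ z : im (conjc z) = - im z. Proof. by case: z. Qed.
Lemma re0 : re 0 = 0. Proof. by []. Qed.
Lemma im0 : im 0 = 0. Proof. by []. Qed.
Lemma re1 : re 1 = 1. Proof. by []. Qed.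
Lemma im1 : im 1 = 0. Proof. by []. Qed.
Lemma re_i : re 'i%C = 0. Proof. by []. Qed.
Lemma im_i : im 'i%C = 1. Proof. by []. Qed.
Definition reimE := (reD, imD, reN, imN, reM, imM, reC, imC, reJ, imJ, re0, im0, re1, im1,
  re_i, im_i, reE, imE).

Lemma modulusE z : modulus z = Num.sqrt (re z ^+ 2 + im z ^+ 2).
Proof. by case: z. Qed.
Lemma modulus_sqr z : modulus z ^+ 2 = re z ^+ 2 + im z ^+ 2.
Proof. by rewrite modulusE sqr_sqrtr// addr_ge0// sqr_ge0. Qed.
Lemma normE z : `|z| = (modulus z)%:C%C. Proof. by case: z. Qed.
Lemma modulus_ge0 z : 0 <= modulus z. Proof. by rewrite modulusE sqrtr_ge0. Qed.
Lemma modulusM z w : modulus (z * w) = modulus z * modulus w.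
Proof. exact: Normc.normcM. Qed.
Lemma modulusV z : modulus z^-1 = (modulus z)^-1.
Proof. exact: Normc.normcV. Qed.
Lemma modulus0 : modulus (0 : R[i]^o) = 0. Proof. exact: Normc.normc0. Qed.
Lemma modulus1 : modulus (1 : R[i]^o) = 1. Proof. exact: Normc.normc1. Qed.
Lemma modulusN z : modulus (- z) = modulus z. Proof. exact: normcN. Qed.
Lemma modulusD z w : modulus (z + w) <= modulus z + modulus w.
Proof. exact: le_normcD. Qed.
Lemma modulusBC z w : modulus (z - w) = modulus (w - z).
Proof. by rewrite -modulusN opprB. Qed.
Lemma modulus_tri z w (v : R[i]^o) : modulus (z - w) <= modulus (z - v) + modulus (v - w).
Proof. by rewrite -[z in leLHS](subrK v) -addrA; exact: modulusD. Qed.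
Lemma modulusB z w : modulus z - modulus w <= modulus (z - w).
Proof.
by rewrite lerBlDr; apply: le_trans (modulusD _ _); rewrite subrK.
Qed.
Lemma modulus_eq0 z : (modulus z == 0) = (z == 0).
Proof.
apply/eqP/eqP => [|->]; last exact: modulus0.
exact: Normc.eq0_normc.
Qed.
Lemma modulus_gt0 z : (0 < modulus z) = (z != 0).
Proof. by rewrite lt_neqAle modulus_ge0 andbT eq_sym modulus_eq0. Qed.
Lemma modulusC x : modulus (x%:C%C : R[i]^o) = `|x|.
Proof. by rewrite modulusE !reimE expr0n addr0 sqrtr_sqr. Qed.
Lemma modulusJ z : modulus (conjc z) = modulus z.
Proof. by rewrite !modulusE !reimE sqrrN. Qed.
Lemma modulus_i : modulus ('i%C : R[i]^o) = 1.
Proof. by rewrite modulusE !reimE expr0n expr1n add0r sqrtr1. Qed.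
Lemma ler_re z : `|re z| <= modulus z.
Proof. by rewrite modulusE -sqrtr_sqr ler_wsqrtr// lerDl sqr_ge0. Qed.
Lemma ler_im z : `|im z| <= modulus z.
Proof. by rewrite modulusE -sqrtr_sqr ler_wsqrtr// lerDr sqr_ge0. Qed.
Lemma modulus_le z : modulus z <= `|re z| + `|im z|.
Proof.
rewrite -[leRHS]ger0_norm ?addr_ge0// -sqrtr_sqr modulusE ler_wsqrtr//.
rewrite sqrrD !real_normK ?num_real// -addrA lerD2l lerDr.
by rewrite mulrn_wge0// mulr_ge0.
Qed.
Lemma mulJ z : z * conjc z = (modulus z ^+ 2)%:C%C.
Proof.
by apply: cplx_eqP; rewrite modulus_sqr !reimE; ring.
Qed.
(* multiplying by [conjc z / |z|] turns [z] into its modulus *)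
Lemma modulus_phase z : exists2 u : R[i]^o, modulus u = 1 & u * z = (modulus z)%:C%C.
Proof.
have [->|z0] := eqVneq z 0; first by exists 1; rewrite ?modulus1// mulr0 modulus0.
have nz : (modulus z)%:C%C != 0 :> R[i].
  by apply/eqP => /(congr1 re); rewrite reC; apply/eqP; rewrite modulus_eq0.
have mz : modulus z != 0 by rewrite modulus_eq0.
exists (conjc z / (modulus z)%:C%C).
  by rewrite modulusM modulusV modulusJ modulusC ger0_norm ?modulus_ge0// divff.
by rewrite mulrAC [conjc z * z]mulrC mulJ expr2 rmorphM/= mulfK.
Qed.
Lemma re_le_modulus z : re z <= modulus z.
Proof. exact: le_trans (ler_norm _) (ler_re z). Qed.

(** The norm takes values in [R[i]], where [0 < e] forces the imaginary part of [e] to vanish; the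
    real part of the radius then serves as a real radius. *)
Lemma nbhs_modulus z (A : set R[i]^o) :
  nbhs z A <-> exists2 e : R, 0 < e & forall w, modulus (w - z) < e -> A w.
Proof.
split=> [/nbhs_ballP[e /= e0 eA]|[e e0 eA]].
  move: e0; rewrite ltcE => /andP[/eqP ie re0].
  exists (complex.Re e) => // w wz; apply: eA.
  rewrite -ball_normE /= distrC normE ltcE /=.
  by move: ie => /= ->; rewrite eqxx.
apply/nbhs_ballP; exists e%:C%C; first by rewrite /= ltcE /= eqxx.
move=> w; rewrite -ball_normE /= distrC normE ltcE /= => /andP[_ ?].
exact: eA.
Qed.
End complex_toolkit.

(** * Open sets and continuous functions in the product sigma-algebra of the plane *)

Section plane_measurability.
Variable R : realType.
Notation mu := (@lebesgue_measure R).
Notation mu2 := (@lebesgue_measure R \x @lebesgue_measure R)%E.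
Notation P := (measurableTypeR R * measurableTypeR R)%type.
Lemma ball2E (w v : R * R) (e : R) :
  ball w e v <-> `|w.1 - v.1| < e /\ `|w.2 - v.2| < e.
Proof. by case: w v => [a b] [c d]; split => [[]|[]]. Qed.

Lemma nbhs2P (w : R * R) (A : set (R * R)) : nbhs w A <->
  exists2 e : R, 0 < e & forall v, `|w.1 - v.1| < e -> `|w.2 - v.2| < e -> A v.
Proof.
split=> [/nbhs_ballP[e /= e0 eA]|[e e0 eA]].
  by exists e => // v v1 v2; apply: eA; apply/ball2E.
by apply/nbhs_ballP; exists e => // v /ball2E[]; exact: eA.
Qed.

(** An open set is the countable union of the squares with rational centre and half-side
    [1 / (n + 1)] that it contains, and squares are measurable rectangles. *)
Lemma open_measurable2 (A : set (R * R)) : open A -> measurable (A : set P).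
Proof.
move=> oA.
pose B (q : rat * rat) (n : nat) : set P :=
  `]ratr q.1 - n.+1%:R^-1, ratr q.1 + n.+1%:R^-1[%classic `*`
  `]ratr q.2 - n.+1%:R^-1, ratr q.2 + n.+1%:R^-1[%classic.
pose C (q : rat * rat) (n : nat) : set P := if `[< B q n `<=` A >] then B q n else set0.
have -> : A = \bigcup_q \bigcup_n C q n.
  apply/seteqP; split => [w Aw|w [q _] [n _]]; last first.
    by rewrite /C; case: ifPn => // /asboolP; exact.
  have /nbhs2P[e e0 eA] : nbhs w A by rewrite nbhsE; exists A => //; split.
  have [n ne] : exists n : nat, n.+1%:R^-1 < e / 2.
    have := @near_infty_natSinv_lt R (PosNum (divr_gt0 e0 (ltr0Sn R 1))).
    by move=> [n _ /(_ n)] /(_ (leqnn _)) /= ?; exists n.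
  have n0 : 0 < n.+1%:R^-1 :> R by rewrite invr_gt0.
  have ratd (x d : R) : 0 < d -> exists q : rat, `|x - ratr q| < d.
    move=> d0; have /rat_in_itvoo[q /itvP qx] : x - d < x + d by lra.
    by exists q; rewrite distrC ltr_distl !qx.
  have [q1 hq1] := ratd w.1 _ n0; have [q2 hq2] := ratd w.2 _ n0.
  exists (q1, q2) => //; exists n => //; rewrite /C ifT.
    by split; rewrite /= in_itv/= -ltr_distl.
  have close (x y z d : R) : d < e / 2 -> `|x - z| < d -> z - d < y < z + d -> `|x - y| < e.
    by rewrite !ltr_distl => ? /andP[? ?] /andP[? ?]; lra.
  apply/asboolP => v [] /=; rewrite !in_itv /= => v1 v2; apply: eA.
    exact: (close _ _ (ratr q1) _ ne hq1).
  exact: (close _ _ (ratr q2) _ ne hq2).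
apply: countable_bigcupT_measurable; first exact: countableP.
move=> q; apply: bigcupT_measurable => n; rewrite /C; case: ifPn => // _.
by apply: measurableX; exact: measurable_itv.
Qed.

Lemma open_continuous_measurable2 (D : set (R * R)) (f : R * R -> R) : open D ->
  (forall w, D w -> {for w, continuous f}) -> measurable_fun (D : set P) (f : P -> R).
Proof.
move=> oD cf; apply: (measurability _ (RGenOpens.measurableE R)) => _ [_ [a [b ->]] <-].
apply: open_measurable2; rewrite openE => w [Dw fw].
apply: filterI; first by apply: open_nbhs_nbhs; split.
by apply: cf => //; apply: open_nbhs_nbhs; split => //; exact: interval_open.
Qed.

End plane_measurability.

(** * Complex-valued functions of real variables *)

Section complex_valued_calculus.
Variable R : realType.

(** Continuity here, and derivatives in [cderiv], are taken on real and imaginary parts, so that the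
    real mean value theorem, the fundamental theorem of calculus and the measurability of real
    functions apply directly. *)
Definition ccont (T : topologicalType) (f : T -> R[i]) (x : T) :=
  (re (f y) @[y --> x] --> re (f x)) /\ (im (f y) @[y --> x] --> im (f x)).

Definition cderiv (g : R -> R[i]) (x : R) (l : R[i]) :=
  is_derive x 1 (fun t => re (g t)) (re l) /\ is_derive x 1 (fun t => im (g t)) (im l).

Section ccont.
Variable T : topologicalType.
Implicit Types (f g : T -> R[i]) (x : T).

Lemma ccont_near f g x : (\forall y \near x, f y = g y) -> ccont f x -> ccont g x.
Proof.
move=> fg [cr ci]; have fgx := nbhs_singleton fg.
split; [move: cr|move: ci]; rewrite fgx; apply: cvg_trans;
  by apply: near_eq_cvg; near=> y; congr (_ _); rewrite (near fg y).
Unshelve. all: by end_near. Qed.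

Lemma ccont_cst c x : ccont (fun=> c) x.
Proof. by split; exact: cvg_cst. Qed.

Lemma ccontD f g x : ccont f x -> ccont g x -> ccont (fun y => f y + g y) x.
Proof.
move=> [fr fi] [gr gi]; split.
  under eq_fun do rewrite reD.
  by rewrite reD; exact: cvgD.
under eq_fun do rewrite imD.
by rewrite imD; exact: cvgD.
Qed.

Lemma ccontN f x : ccont f x -> ccont (fun y => - f y) x.
Proof.
move=> [fr fi]; split.
  under eq_fun do rewrite reN.
  by rewrite reN; exact: cvgN.
under eq_fun do rewrite imN.
by rewrite imN; exact: cvgN.
Qed.

Lemma ccontB f g x : ccont f x -> ccont g x -> ccont (fun y => f y - g y) x.
Proof. by move=> cf cg; apply: ccontD => //; exact: ccontN. Qed.

Lemma ccontM f g x : ccont f x -> ccont g x -> ccont (fun y => f y * g y) x.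
Proof.
move=> [fr fi] [gr gi]; split.
  under eq_fun do rewrite reM.
  by rewrite reM; apply: cvgB; exact: cvgM.
under eq_fun do rewrite imM.
by rewrite imM; apply: cvgD; exact: cvgM.
Qed.

Lemma ccont_real (u : T -> R) x : u y @[y --> x] --> u x -> ccont (fun y => (u y)%:C%C) x.
Proof. by move=> cu; split => //; exact: cvg_cst. Qed.

Lemma ccont_modulus f x : ccont f x -> modulus (f y) @[y --> x] --> modulus (f x).
Proof.
move=> [fr fi]; rewrite modulusE; under eq_fun do rewrite modulusE.
 apply: continuous_comp; last exact: sqrt_continuous.
by apply: cvgD; apply: cvgM.
Qed.

Lemma ccontP f x :
  ccont f x <-> forall e, 0 < e -> \forall y \near x, modulus (f y - f x) < e.
Proof.
split=> [[fr fi] e e0|fe].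
  have e20 : 0 < e / 2 by rewrite divr_gt0.
  move/cvgrPdist_lt : fr => /(_ _ e20) fr.
  move/cvgrPdist_lt : fi => /(_ _ e20) fi.
  near=> y; apply: le_lt_trans (modulus_le _) _; rewrite reB imB.
  rewrite (splitr e) ltrD// distrC.
    by near: y; exact: fr.
  by near: y; exact: fi.
split; apply/cvgrPdist_lt => e e0; near=> y; rewrite distrC -?reB -?imB;
  [apply: le_lt_trans (ler_re _) _|apply: le_lt_trans (ler_im _) _];
  by near: y; exact: fe.
Unshelve. all: by end_near. Qed.

End ccont.

Lemma ccont_comp (S T : topologicalType) (h : S -> T) (f : T -> R[i]) x :
  h y @[y --> x] --> h x -> ccont f (h x) -> ccont (fun y => f (h y)) x.
Proof. by move=> hx [fr fi]; split; [exact: (cvg_comp _ _ hx fr)|exact: (cvg_comp _ _ hx fi)]. Qed.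

Lemma is_derive_add (f g : R -> R) (x a b : R) : is_derive x 1 f a -> is_derive x 1 g b ->
  is_derive x 1 (fun t => f t + g t) (a + b).
Proof. by move=> fa gb; exact: is_deriveD. Qed.
Lemma is_derive_opp (f : R -> R) (x a : R) : is_derive x 1 f a ->
  is_derive x 1 (fun t => - f t) (- a).
Proof. by move=> fa; exact: is_deriveN. Qed.
Lemma is_derive_sub (f g : R -> R) (x a b : R) : is_derive x 1 f a -> is_derive x 1 g b ->
  is_derive x 1 (fun t => f t - g t) (a - b).
Proof. by move=> fa gb; apply: is_derive_add => //; exact: is_derive_opp. Qed.
Lemma is_derive_mul (f g : R -> R) (x a b : R) : is_derive x 1 f a -> is_derive x 1 g b ->
  is_derive x 1 (fun t => f t * g t) (f x * b + a * g x).
Proof.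
move=> fa gb; have := @is_deriveM _ _ _ _ _ _ _ _ fa gb.
by rewrite /GRing.scale/= [g x * a]mulrC.
Qed.

Lemma cderivD f g x l m : cderiv f x l -> cderiv g x m ->
  cderiv (fun t => f t + g t) x (l + m).
Proof.
move=> [fr fi] [gr gi]; split; rewrite ?reD ?imD.
  by under eq_fun do rewrite reD; exact: is_derive_add.
by under eq_fun do rewrite imD; exact: is_derive_add.
Qed.

Lemma cderivN f x l : cderiv f x l -> cderiv (fun t => - f t) x (- l).
Proof.
move=> [fr fi]; split; rewrite ?reN ?imN.
  by under eq_fun do rewrite reN; exact: is_derive_opp.
by under eq_fun do rewrite imN; exact: is_derive_opp.
Qed.

Lemma cderivM f g x l m : cderiv f x l -> cderiv g x m ->
  cderiv (fun t => f t * g t) x (f x * m + l * g x).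
Proof.
move=> [fr fi] [gr gi]; split.
  under eq_fun do rewrite reM.
  apply: (is_derive_eq (is_derive_sub (is_derive_mul fr gr) (is_derive_mul fi gi))).
  by rewrite !reimE; ring.
under eq_fun do rewrite imM.
apply: (is_derive_eq (is_derive_add (is_derive_mul fr gi) (is_derive_mul fi gr))).
by rewrite !reimE; ring.
Qed.

Lemma cderiv_real (u : R -> R) (x l : R) : is_derive x 1 u l ->
  cderiv (fun t => (u t)%:C%C) x l%:C%C.
Proof. by move=> ul; split => //; rewrite imC; exact: is_derive_cst. Qed.

Lemma cderiv_cst c x : cderiv (fun=> c) x 0.
Proof. by split; exact: is_derive_cst. Qed.

Lemma is_derive_cont (f : R -> R) (x a : R) : is_derive x 1 f a -> f y @[y --> x] --> f x.
Proof. by move=> fa; apply/differentiable_continuous/derivable1_diffP; exact: (@ex_derive _ _ _ _ _ _ _ fa). Qed.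

End complex_valued_calculus.

(** * Test functions and their dbar derivatives *)

Section test_functions.
Variable R : realType.
Implicit Types (psi chi d e : R * R -> R[i]) (w : R * R).

(* [psi] is continuously differentiable and [d] is [2 dbar psi] *)
Definition test psi d := exists psix psiy : R * R -> R[i], forall w,
  [/\ cderiv (fun x => psi (x, w.2)) w.1 (psix w),
      cderiv (fun y => psi (w.1, y)) w.2 (psiy w),
      ccont psi w, ccont psix w /\ ccont psiy w & d w = psix w + 'i%C * psiy w].

Lemma test_cont psi d w : test psi d -> ccont psi w /\ ccont d w.
Proof.
move=> [px [py] H]; split; first by case: (H w).
have -> : d = fun w => px w + 'i%C * py w by apply/funext => v; case: (H v).
case: (H w) => _ _ _ [cx cy] _; apply: ccontD => //; apply: ccontM => //; exact: ccont_cst.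
Qed.

Lemma test_ext psi d psi' d' : test psi d -> psi =1 psi' -> d =1 d' -> test psi' d'.
Proof. by move=> H /funext <- /funext <-. Qed.

Lemma testM psi d chi e : test psi d -> test chi e ->
  test (fun w => psi w * chi w) (fun w => psi w * e w + d w * chi w).
Proof.
move=> [px [py] Hp] [qx [qy] Hq].
exists (fun w => psi w * qx w + px w * chi w), (fun w => psi w * qy w + py w * chi w) => w.
case: (Hp w) => p1 p2 p3 [p4 p5] p6; case: (Hq w) => q1 q2 q3 [q4 q5] q6; split.
- by have := cderivM p1 q1; rewrite -surjective_pairing.
- by have := cderivM p2 q2; rewrite -surjective_pairing.
- exact: ccontM.
- by split; apply: ccontD; exact: ccontM.
- by rewrite p6 q6; ring.
Qed.

Lemma testD psi d chi e : test psi d -> test chi e ->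
  test (fun w => psi w + chi w) (fun w => d w + e w).
Proof.
move=> [px [py] Hp] [qx [qy] Hq].
exists (fun w => px w + qx w), (fun w => py w + qy w) => w.
case: (Hp w) => p1 p2 p3 [p4 p5] p6; case: (Hq w) => q1 q2 q3 [q4 q5] q6; split.
- exact: cderivD.
- exact: cderivD.
- exact: ccontD.
- by split; exact: ccontD.
- by rewrite p6 q6; ring.
Qed.

Lemma test_cst c : test (fun=> c) (fun=> 0).
Proof.
exists (fun=> 0), (fun=> 0) => w; split; do ?exact: cderiv_cst; do ?exact: ccont_cst.
  by split; exact: ccont_cst.
by rewrite mulr0 addr0.
Qed.

Lemma testZ c psi d : test psi d -> test (fun w => c * psi w) (fun w => c * d w).
Proof.
move=> /(testM (test_cst c)) H; apply: test_ext H _ _ => w //.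
by rewrite mul0r addr0.
Qed.

Lemma testN psi d : test psi d -> test (fun w => - psi w) (fun w => - d w).
Proof. by move=> /(testZ (-1)) H; apply: test_ext H _ _ => w; rewrite mulN1r. Qed.

Lemma testB psi d chi e : test psi d -> test chi e ->
  test (fun w => psi w - chi w) (fun w => d w - e w).
Proof. by move=> H /testN; exact: testD. Qed.

Lemma test_fst : test (fun w => (w.1)%:C%C) (fun=> 1).
Proof.
exists (fun=> 1), (fun=> 0) => w; split => /=.
- by apply: cderiv_real; exact: is_derive_id.
- exact: cderiv_cst.
- by apply: ccont_real; exact: cvg_fst.
- by split; exact: ccont_cst.
- by rewrite mulr0 addr0.
Qed.

Lemma test_snd : test (fun w => (w.2)%:C%C) (fun=> 'i%C).
Proof.
exists (fun=> 0), (fun=> 1) => w; split => /=.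
- exact: cderiv_cst.
- by apply: cderiv_real; exact: is_derive_id.
- by apply: ccont_real; exact: cvg_snd.
- by split; exact: ccont_cst.
- by rewrite mulr1 add0r.
Qed.

Lemma mul_ii : 'i%C * 'i%C = -1 :> R[i].
Proof. by apply: cplx_eqP; rewrite !reimE; ring. Qed.

Lemma test_cx : test (@cx R) (fun=> 0).
Proof.
apply: test_ext (testD test_fst (testZ 'i%C test_snd)) _ _ => w.
  by apply: cplx_eqP; rewrite !reimE; ring.
by rewrite mul_ii subrr.
Qed.

Lemma test_conj : test (fun w => conjc (cx w)) (fun=> 2).
Proof.
apply: test_ext (testD test_fst (testZ (- 'i%C) test_snd)) _ _ => w.
  by apply: cplx_eqP; rewrite !reimE; ring.
by rewrite mulNr mul_ii opprK.
Qed.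

Lemma test_comp (q q' : R -> R) (u : R * R -> R) d :
  (forall w, is_derive (u w) 1 q (q' (u w))) ->
  (forall w, q' s @[s --> u w] --> q' (u w)) ->
  test (fun w => (u w)%:C%C) d ->
  test (fun w => (q (u w))%:C%C) (fun w => (q' (u w))%:C%C * d w).
Proof.
move=> qd cq [ux [uy] H].
(* The imaginary part of [(u w)%:C%C] is constantly [0], so the partial derivatives of [u] are real
   and the real chain rule for [q] yields the complex ones. *)
have real w : im (ux w) = 0 /\ im (uy w) = 0.
  case: (H w) => -[_ ix] [_ iy] _ _ _; split.
    have := is_derive_cst (0 : R) w.1 (1 : R) => h.
    by rewrite -(@derive_val _ _ _ _ _ _ _ ix) -(@derive_val _ _ _ _ _ _ _ h).
  have := is_derive_cst (0 : R) w.2 (1 : R) => h.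
  by rewrite -(@derive_val _ _ _ _ _ _ _ iy) -(@derive_val _ _ _ _ _ _ _ h).
exists (fun w => (q' (u w))%:C%C * ux w), (fun w => (q' (u w))%:C%C * uy w) => w.
case: (H w) => -[h1 _] [h2 _] [h3 _] [h4 h5] h6; case: (real w) => ix iy.
have qw := qd w; rewrite [in X in is_derive (u X)](surjective_pairing w) in qw.
have cq' : ccont (fun w => (q' (u w))%:C%C) w.
  by apply: ccont_real; exact: (cvg_comp _ _ h3 (cq w)).
split.
- have := is_derive1_comp (f := q) (g := fun x => u (x, w.2)) qw h1 => H1.
  by have := cderiv_real H1; congr cderiv; apply: cplx_eqP; rewrite !reimE ?ix; ring.
- have := is_derive1_comp (f := q) (g := fun x => u (w.1, x)) qw h2 => H1.
  by have := cderiv_real H1; congr cderiv; apply: cplx_eqP; rewrite !reimE ?iy; ring.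
- have /differentiable_continuous h : differentiable q (u w).
    by apply/derivable1_diffP; exact: (@ex_derive _ _ _ _ _ _ _ (qd w)).
  by apply: ccont_real; exact: (cvg_comp _ _ h3 h).
- by split; exact: ccontM.
- by rewrite h6; ring.
Qed.

End test_functions.

(** * Green's formula *)

Lemma derive_near0 (R : realType) (f : R -> R) (x a : R) : (\forall y \near x, f y = 0) ->
  is_derive x 1 f a -> a = 0.
Proof.
move=> f0 fa.
have h0 : is_derive x 1 (fun=> 0 : R) (0 : R) by exact: is_derive_cst.
have h1 : is_derive x 1 f 0.
  apply: near_eq_is_derive h0.
  by near=> y; rewrite (near f0 y).
by rewrite -(@derive_val _ _ _ _ _ _ _ fa) (@derive_val _ _ _ _ _ _ _ h1).
Unshelve. all: by end_near. Qed.

Section green.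
Variable R : realType.
Notation mu := (@lebesgue_measure R).
Notation mu2 := (@lebesgue_measure R \x @lebesgue_measure R)%E.
Notation P := (measurableTypeR R * measurableTypeR R)%type.

Definition box (M : R) : set (R * R) := [set w | `|w.1| < M /\ `|w.2| < M].

Lemma open_box M : open (box M).
Proof.
rewrite openE => w [w1 w2]; apply/nbhs2P.
exists (Num.min (M - `|w.1|) (M - `|w.2|)); first by rewrite lt_min !subr_gt0 w1.
have close (a b : R) : `|a - b| < M - `|a| -> `|b| < M.
  rewrite distrC ltrBrDr; apply: le_lt_trans.
  by rewrite -{1}[b](subrK a) ler_normD.
by move=> v; rewrite !lt_min => /andP[h1 _] /andP[_ h2]; split; exact: close h1 || exact: close h2.
Qed.

Lemma cvg_pairl (x y : R) : (t, y) @[t --> x] --> (x, y).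
Proof.
move=> A /nbhs2P[e e0 eA]; apply/nbhs_ballP; exists e => // t xt.
by apply: eA; rewrite //= subrr normr0.
Qed.

Lemma cvg_pairr (x y : R) : (x, t) @[t --> y] --> (x, y).
Proof.
move=> A /nbhs2P[e e0 eA]; apply/nbhs_ballP; exists e => // t xt.
by apply: eA; rewrite //= subrr normr0.
Qed.

Lemma measurable_box M : measurable (box M : set P).
Proof. by apply: open_measurable2; exact: open_box. Qed.

Lemma box_fin M : (mu2 (box M : set P) < +oo)%E.
Proof.
have -> : box M = `]-M, M[%classic `*` `]-M, M[%classic.
  by apply/seteqP; split => w /=; rewrite /box/= !in_itv/= !ltr_norml.
rewrite product_measure1E; [|exact: measurable_itv..].
by rewrite lte_mul_pinfty// ?fin_num_measure//= lebesgue_measure_itv; case: ifP => //; rewrite -EFinD ltry.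
Qed.

Lemma compact_bounded_continuous (T : topologicalType) (g : T -> R) (A : set T) : compact A ->
  (forall w, A w -> g v @[v --> w] --> g w) -> exists2 C, 0 < C & forall w, A w -> `|g w| <= C.
Proof.
move=> cA cg; have /compact_bounded : compact (g @` A).
  by apply: continuous_compact => //; apply/continuous_in_subspaceT => w /set_mem; exact: cg.
move=> [M [Mr H]]; exists (`|M| + 1); first by rewrite ltr_pwDr.
by move=> w Aw; apply: (H (`|M| + 1)); [rewrite (le_lt_trans (ler_norm _))// ltrDl|exists w].
Qed.

Lemma compact_closed_box M : compact [set w : R * R | `|w.1| <= M /\ `|w.2| <= M].
Proof.
have -> : [set w : R * R | `|w.1| <= M /\ `|w.2| <= M] = `[-M, M]%classic `*` `[-M, M]%classic.
  by apply/seteqP; split => w /=; rewrite !in_itv/= !ler_norml.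
by apply: compact_setX; exact: segment_compact.
Qed.

Lemma integrable_bounded (D : set P) (g : P -> R) (M C : R) :
  measurable D -> D `<=` box M -> measurable_fun D g -> (forall w, D w -> `|g w| <= C) ->
  mu2.-integrable D (EFin \o g).
Proof.
move=> mD DM mg gC; apply: measurable_bounded_integrable => //.
  apply: le_lt_trans (box_fin M); apply: le_measure => //; rewrite inE//; exact: measurable_box.
exists C; split; first exact: num_real.
by move=> x Cx w Dw /=; apply: le_trans (gC _ Dw) (ltW _).
Qed.

Section compact_support.
Variables (g : R * R -> R) (M : R).
Hypothesis g0 : forall w, ~ box M w -> g w = 0.
Hypothesis cg : forall w, g v @[v --> w] --> g w.

Lemma measurable_cont : measurable_fun (setT : set P) g.
Proof. by apply: (@open_continuous_measurable2 R setT g); [exact: openT|move=> w _; exact: cg]. Qed.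

Lemma integrable_cont : mu2.-integrable setT (EFin \o (g : P -> R)).
Proof.
have [C C0 HC] := compact_bounded_continuous (@compact_closed_box M) (fun w _ => @cg w).
have /(_ mu2) := integrable_mkcond (EFin \o (g : P -> R)) (@measurable_box M).
have -> : (EFin \o (g : P -> R)) \_ (box M : set P) = EFin \o g.
  apply/funext => w; rewrite /patch; case: ifPn => // /negP; rewrite inE => /g0 gw.
  by rewrite /= gw.
move=> <-; apply: (integrable_bounded (M := M) (C := C)) => //.
- exact: measurable_box.
- by apply: measurable_funTS; exact: measurable_cont.
- by move=> w [w1 w2]; apply: HC; split; exact: ltW.
Qed.
End compact_support.

Lemma FTC_compact_support (k kx : R -> R) (M : R) :
  (forall x : R, is_derive x 1 k (kx x)) -> (forall x, kx y @[y --> x] --> kx x) ->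
  (forall x, M <= `|x| -> k x = 0) -> (\int[mu]_x (kx x)%:E = 0)%E.
Proof.
move=> dk ckx k0.
have kx0 x : `|M| < `|x| -> kx x = 0.
  move=> Mx; apply: derive_near0 (dk x).
  near=> y; rewrite /= k0// (le_trans (ler_norm _))// ltW//; near: y.
  by apply: (@cvgr_gt _ _ _ (nbhs_filter x) (fun y => `|y|) `|x|) => //; apply: norm_continuous.
pose N : R := `|M| + 1.
have N0 : - N < N by rewrite gtrN// ltr_pwDr.
have NE x : x \notin `[- N, N] -> kx x = 0.
  rewrite in_itv/= -ler_norml -ltNge => h; apply: kx0; apply: lt_trans h.
  by rewrite ltrDl.
have -> : (\int[mu]_x (kx x)%:E = \int[mu]_(x in `[(- N)%R, N]) (kx x)%:E)%E.
  rewrite [RHS]integral_mkcond; apply: eq_integral => x _; rewrite /patch; case: ifPn => // h.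
  by rewrite NE//; apply: contra h; rewrite inE.
have ck x : k y @[y --> x] --> k x by apply: is_derive_cont (dk x).
rewrite (continuous_FTC2 (F := k)) //.
- have MN : M <= `|N| by rewrite /N ger0_norm ?addr_ge0// (le_trans (ler_norm _))// lerDl.
  by rewrite (k0 _ MN) k0 ?normrN// sube0.
- by apply: continuous_subspaceT => x; exact: ckx.
- split; first by move=> x _; exact: (@ex_derive _ _ _ _ _ _ _ (dk x)).
    exact: cvg_at_right_filter.
  exact: cvg_at_left_filter.
- by move=> x _; rewrite derive1E (@derive_val _ _ _ _ _ _ _ (dk x)).
Unshelve. all: by end_near. Qed.

Section partial_derivatives.
Variables (k g : R * R -> R) (M : R).
Hypothesis k0 : forall w, ~ box M w -> k w = 0.
Hypothesis cg : forall w, g v @[v --> w] --> g w.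

Lemma green_x : (forall w : R * R, is_derive w.1 1 (fun x => k (x, w.2)) (g w)) ->
  mu2.-integrable setT (EFin \o (g : P -> R)) /\ (\int[mu2]_w (g w)%:E = 0)%E.
Proof.
move=> dk.
have ig : mu2.-integrable setT (EFin \o (g : P -> R)).
  (* Enlarging the box leaves room for a neighbourhood on which [k] vanishes identically, whence its
     derivative [g] vanishes too. *)
  apply: (@integrable_cont g (`|M| + 1)) => // w wM.
  apply: derive_near0 (dk w).
  have [w2|w2] := ltP `|w.2| M; last by near=> x; rewrite /= k0// => -[_ /=]; rewrite ltNge w2.
  have w1 : `|M| < `|w.1|.
    rewrite ltNge; apply/negP => h1; apply: wM; split; first by rewrite ltr_pwDr.
    by apply: lt_trans w2 _; rewrite ltr_pwDr// ler_norm.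
  near=> x; rewrite /= k0// => -[/= xM _].
  have : `|M| < `|x|.
    near: x; apply: (@cvgr_gt _ _ _ (nbhs_filter w.1) (fun y => `|y|) `|w.1|) => //.
    exact: norm_continuous.
  by rewrite ltNge => /negP; apply; apply: le_trans (ltW xM) (ler_norm _).
split => //; rewrite -(integral21_prod_meas1 ig) integral0_eq// => y _.
apply: (@FTC_compact_support (fun x => k (x, y)) (fun x => g (x, y)) M).
- by move=> x; exact: (dk (x, y)).
- move=> x; apply: (cvg_comp (fun t : R => (t, y)) g); last exact: cg.
  exact: cvg_pairl.
- by move=> x Mx; apply: k0 => -[/=]; rewrite ltNge Mx.
Unshelve. all: by end_near. Qed.

Lemma green_y : (forall w : R * R, is_derive w.2 1 (fun y => k (w.1, y)) (g w)) ->
  mu2.-integrable setT (EFin \o (g : P -> R)) /\ (\int[mu2]_w (g w)%:E = 0)%E.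
Proof.
move=> dk.
have ig : mu2.-integrable setT (EFin \o (g : P -> R)).
  apply: (@integrable_cont g (`|M| + 1)) => // w wM.
  apply: derive_near0 (dk w).
  have [w1|w1] := ltP `|w.1| M; last by near=> x; rewrite /= k0// => -[/=]; rewrite ltNge w1.
  have w2 : `|M| < `|w.2|.
    rewrite ltNge; apply/negP => h1; apply: wM; split; last by rewrite ltr_pwDr.
    by apply: lt_trans w1 _; rewrite ltr_pwDr// ler_norm.
  near=> x; rewrite /= k0// => -[/= _ xM].
  have : `|M| < `|x|.
    near: x; apply: (@cvgr_gt _ _ _ (nbhs_filter w.2) (fun y => `|y|) `|w.2|) => //.
    exact: norm_continuous.
  by rewrite ltNge => /negP; apply; apply: le_trans (ltW xM) (ler_norm _).
split => //; rewrite -(integral12_prod_meas1 ig) integral0_eq// => x _.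
apply: (@FTC_compact_support (fun y => k (x, y)) (fun y => g (x, y)) M).
- by move=> y; exact: (dk (x, y)).
- move=> y; apply: (cvg_comp (fun t : R => (x, t)) g); last exact: cg.
  exact: cvg_pairr.
- by move=> y My; apply: k0 => -[/= _]; rewrite ltNge My.
Unshelve. all: by end_near. Qed.
End partial_derivatives.

(** Since [re (kx + i ky) = re kx - im ky], one integration in each variable is enough. Nothing is
    lost by keeping only the real part: a modulus is recovered later by multiplying the test
    function by a phase. *)
Lemma green (k d : R * R -> R[i]) (M : R) : test k d -> (forall w, ~ box M w -> k w = 0) ->
  mu2.-integrable setT (fun w => (re (d w))%:E) /\ (\int[mu2]_w (re (d w))%:E = 0)%E.
Proof.
move=> [kx [ky H]] k0.
have [i1 e1] : mu2.-integrable setT (EFin \o (fun w : P => re (kx w))) /\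
    (\int[mu2]_w (re (kx w))%:E = 0)%E.
  apply: (@green_x (fun w => re (k w)) (fun w => re (kx w)) M).
  - by move=> w /k0 ->.
  - by move=> w; case: (H w) => _ _ _ [[]].
  - by move=> w; case: (H w) => -[].
have [i2 e2] : mu2.-integrable setT (EFin \o (fun w : P => im (ky w))) /\
    (\int[mu2]_w (im (ky w))%:E = 0)%E.
  apply: (@green_y (fun w => im (k w)) (fun w => im (ky w)) M).
  - by move=> w /k0 ->.
  - by move=> w; case: (H w) => _ _ _ [_ []].
  - by move=> w; case: (H w) => _ [].
have -> : (fun w : P => (re (d w))%:E) =
    ((EFin \o (fun w : P => re (kx w))) \- (EFin \o (fun w : P => im (ky w))))%E.
  apply/funext => w; case: (H w) => _ _ _ _ ->.
  by rewrite /= -EFinB; congr EFin; rewrite !reimE; ring.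
split; first exact: integrableB.
by rewrite integralB// e1 e2 sube0.
Qed.

End green.

(** * Weakly holomorphic functions *)

Section weakly_holomorphic.
Variable R : realType.
Notation mu := (@lebesgue_measure R).
Notation mu2 := (@lebesgue_measure R \x @lebesgue_measure R)%E.
Notation P := (measurableTypeR R * measurableTypeR R)%type.
Implicit Types (D C : set (R * R)) (F f psi d : R * R -> R[i]).

(* [F] is holomorphic at the points of [D], with continuous derivative [f] *)
Definition hol D F f := forall w, D w ->
  [/\ cderiv (fun x => F (x, w.2)) w.1 (f w),
      cderiv (fun y => F (w.1, y)) w.2 ('i%C * f w), ccont F w & ccont f w].

Definition supported C psi := forall w, ~ C w -> psi w = 0.

(** This is [dbar F = 0] in the sense of distributions. Unlike [hol], it passes to locally uniform
    limits, because no derivative of [F] occurs in it. *)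
Definition weakly_hol D F := forall C psi d, compact C -> C `<=` D -> test psi d ->
  supported C psi ->
  mu2.-integrable setT (fun w : P => (re (F w * d w))%:E) /\
  (\int[mu2]_w (re (F w * d w))%:E = 0)%E.

Lemma near_supported C psi w : closed C -> supported C psi -> ~ C w ->
  \forall v \near w, psi v = 0.
Proof.
move=> cC sC nC; have : nbhs w (~` C) by apply: open_nbhs_nbhs; split => //; exact: closed_openC.
by apply: filterS => v; exact: sC.
Qed.

Lemma supported_test C psi (psix psiy : R * R -> R[i]) : closed C -> supported C psi ->
  (forall w : R * R, cderiv (fun x => psi (x, w.2)) w.1 (psix w)) ->
  (forall w : R * R, cderiv (fun y => psi (w.1, y)) w.2 (psiy w)) ->
  supported C psix /\ supported C psiy.
Proof.
move=> cC sC hx hy; split=> w nC.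
  have n0 : \forall x \near w.1, psi (x, w.2) = 0.
    have := near_supported cC sC nC; rewrite {1}(surjective_pairing w); exact: cvg_pairl.
  have [h1 h2] := hx w; apply: cplx_eqP.
    by apply: derive_near0 h1; near=> x; rewrite (near n0 x).
  by apply: derive_near0 h2; near=> x; rewrite (near n0 x).
have n0 : \forall x \near w.2, psi (w.1, x) = 0.
  have := near_supported cC sC nC; rewrite {1}(surjective_pairing w); exact: cvg_pairr.
have [h1 h2] := hy w; apply: cplx_eqP.
  by apply: derive_near0 h1; near=> x; rewrite (near n0 x).
by apply: derive_near0 h2; near=> x; rewrite (near n0 x).
Unshelve. all: by end_near. Qed.

Lemma test_supported C psi d : closed C -> supported C psi -> test psi d -> supported C d.
Proof.
move=> cC sC [px [py H]].
have [sx sy] : supported C px /\ supported C py.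
  by apply: (supported_test cC sC) => w; case: (H w).
by move=> w nC; case: (H w) => _ _ _ _ ->; rewrite sx// sy// mulr0 addr0.
Qed.

Lemma hausdorff2 : hausdorff_space (R * R)%type.
Proof. exact: norm_hausdorff. Qed.

Lemma compact_sub_box C : compact C -> exists M, C `<=` box M.
Proof.
move=> cC.
have [c1 _ h1] : exists2 c, 0 < c & forall w, C w -> `|w.1| <= c.
  by apply: compact_bounded_continuous cC _ => w _; exact: cvg_fst.
have [c2 _ h2] : exists2 c, 0 < c & forall w, C w -> `|w.2| <= c.
  by apply: compact_bounded_continuous cC _ => w _; exact: cvg_snd.
exists (c1 + c2 + 1) => w Cw; have := h1 _ Cw; have := h2 _ Cw.
have := normr_ge0 w.1; have := normr_ge0 w.2.
by move=> *; split; lra.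
Qed.

(** Green's formula for [F psi]: the terms [f psi] and [i (i f psi)] cancel, which leaves
    [2 dbar (F psi) = F d]. Off [C], where [F] may fail to be differentiable, the product vanishes
    in a whole neighbourhood. *)
Lemma hol_weakly D F f : hol D F f -> weakly_hol D F.
Proof.
move=> hF C psi d cC CD [px [py H]] sC.
have clC : closed C by apply: compact_closed => //; exact: hausdorff2.
have [sx sy] : supported C px /\ supported C py.
  by apply: (supported_test clC sC) => w; case: (H w).
have [M CM] := compact_sub_box cC.
apply: (@green R (fun w => F w * psi w) _ M); last first.
  by move=> w nM; rewrite sC ?mulr0// => /CM.
exists (fun w => F w * px w + f w * psi w), (fun w => F w * py w + 'i%C * f w * psi w) => w.
case: (H w) => h1 h2 h3 [h4 h5] h6.
have [Cw|nCw] := pselect (C w).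
  have [f1 f2 f3 f4] := hF _ (CD _ Cw); split.
  - by have := cderivM f1 h1; rewrite -surjective_pairing.
  - by have := cderivM f2 h2; rewrite -surjective_pairing.
  - exact: ccontM.
  - split; first by apply: ccontD; exact: ccontM.
    by apply: ccontD; do ?exact: ccontM; apply: ccontM => //; apply: ccontM => //; exact: ccont_cst.
  - have -> : 'i%C * (F w * py w + 'i%C * f w * psi w) =
       'i%C * F w * py w + ('i%C * 'i%C) * f w * psi w by ring.
    by rewrite h6 mul_ii; ring.
have n0 := near_supported clC sC nCw.
have nx : \forall v \near w, px v = 0 by exact: (near_supported clC sx nCw).
have ny : \forall v \near w, py v = 0 by exact: (near_supported clC sy nCw).
split.
- rewrite sx// sC// !mulr0 addr0.
  have /= n1 : \forall x \near w.1, psi (x, w.2) = 0.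
    by move: n0; rewrite {1}(surjective_pairing w); exact: cvg_pairl.
  have [k1 k2] := cderiv_cst 0 w.1; split.
    by apply: near_eq_is_derive k1; near=> x; rewrite (near n1 x)// mulr0.
  by apply: near_eq_is_derive k2; near=> x; rewrite (near n1 x)// mulr0.
- rewrite sy// sC// !mulr0 addr0.
  have /= n1 : \forall x \near w.2, psi (w.1, x) = 0.
    by move: n0; rewrite {1}(surjective_pairing w); exact: cvg_pairr.
  have [k1 k2] := cderiv_cst 0 w.2; split.
    by apply: near_eq_is_derive k1; near=> x; rewrite (near n1 x)// mulr0.
  by apply: near_eq_is_derive k2; near=> x; rewrite (near n1 x)// mulr0.
- by apply: ccont_near (ccont_cst 0 w); near=> v; rewrite (near n0 v)// mulr0.
- split; apply: ccont_near (ccont_cst 0 w); near=> v; rewrite (near n0 v)//.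
    by rewrite (near nx v)// !mulr0 addr0.
  by rewrite (near ny v)// !mulr0 addr0.
- by rewrite h6 (sx _ nCw) (sy _ nCw) (sC _ nCw) !(mulr0, addr0).
Unshelve. all: by end_near. Qed.

Lemma MVT_re (g : R -> R[i]) (g' : R -> R[i]) x h : (forall y, x <= y <= x + h -> cderiv g y (g' y)) -> 0 < h ->
  exists2 c, x <= c <= x + h & re (g (x + h)) - re (g x) = re (g' c) * h.
Proof.
move=> dg h0.
have xh : x < x + h by rewrite ltrDl.
have [||c] := @MVT R (fun t => re (g t)) (fun t => re (g' t)) x (x + h) xh.
- by move=> y /itvP yI; case: (dg y) => //; rewrite !yI.
- apply: derivable_within_continuous => y /itvP yI.
  have [|h1 _] := dg y; first by rewrite !yI.
  exact: (@ex_derive _ _ _ _ _ _ _ h1).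
- by move=> /itvP cI ->; exists c; rewrite ?cI//; congr (_ * _); ring.
Qed.

Lemma MVT_im (g : R -> R[i]) (g' : R -> R[i]) x h : (forall y, x <= y <= x + h -> cderiv g y (g' y)) -> 0 < h ->
  exists2 c, x <= c <= x + h & im (g (x + h)) - im (g x) = im (g' c) * h.
Proof.
move=> dg h0.
have xh : x < x + h by rewrite ltrDl.
have [||c] := @MVT R (fun t => im (g t)) (fun t => im (g' t)) x (x + h) xh.
- by move=> y /itvP yI; case: (dg y) => //; rewrite !yI.
- apply: derivable_within_continuous => y /itvP yI.
  have [|_ h1] := dg y; first by rewrite !yI.
  exact: (@ex_derive _ _ _ _ _ _ _ h1).
- by move=> /itvP cI ->; exists c; rewrite ?cI//; congr (_ * _); ring.
Qed.

Definition diffq F (h : R) (w : R * R) : R[i] := (h^-1)%:C%C * (F (w.1 + h, w.2) - F w).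

Lemma cderiv_shift (g : R -> R[i]) x h l : cderiv g (x + h) l -> cderiv (fun t => g (t + h)) x l.
Proof.
have sh : is_derive x 1 (fun t : R => t + h) (1 : R).
  by have := is_derive_add (is_derive_id x (1 : R)) (is_derive_cst h x (1 : R)); rewrite addr0.
move=> [h1 h2]; split.
  by have := is_derive1_comp (f := fun t => re (g t)) (g := fun t => t + h) h1 sh; rewrite mulr1.
by have := is_derive1_comp (f := fun t => im (g t)) (g := fun t => t + h) h2 sh; rewrite mulr1.
Qed.

Lemma cvg_shift (w : R * R) h : (v.1 + h, v.2) @[v --> w] --> (w.1 + h, w.2).
Proof.
move=> A /nbhs2P[e e0 eA]; apply/nbhs2P; exists e => // v v1 v2.
by apply: eA => //=; rewrite opprD addrACA subrr addr0.
Qed.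

Lemma hol_diffq D F f h : hol D F f ->
  hol [set w | D w /\ D (w.1 + h, w.2)] (diffq F h) (diffq f h).
Proof.
move=> hF w [/hF[h1 h2 h3 h4] /hF[/= k1 k2 k3 k4]].
have cst x := cderiv_cst (h^-1)%:C%C x.
have ccst := ccont_cst (h^-1)%:C%C w; split.
- have := cderivM (cst w.1) (cderivD (cderiv_shift k1) (cderivN h1)).
  by rewrite mul0r addr0.
- have := cderivM (cst w.2) (cderivD k2 (cderivN h2)).
  by rewrite mul0r addr0 /diffq; congr cderiv; ring.
- exact: (ccontM ccst (ccontB (@ccont_comp R _ _ (fun v => (v.1 + h, v.2)) F w (@cvg_shift w h) k3) h3)).
- exact: (ccontM ccst (ccontB (@ccont_comp R _ _ (fun v => (v.1 + h, v.2)) f w (@cvg_shift w h) k4) h4)).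
Qed.

(** By the mean value theorem the real and imaginary parts of the quotient are those of [f] at two
    points of a horizontal segment, and both are controlled by the continuity of [f]. Compactness
    makes the step [h] uniform. *)
Lemma diffq_cvg D F f C e : open D -> hol D F f -> compact C -> C `<=` D -> 0 < e ->
  exists2 h, 0 < h & forall w, C w -> D (w.1 + h, w.2) /\ modulus (diffq F h w - f w) <= e.
Proof.
move=> oD hF /compact_near_coveringP cC CD e0.
pose Q (h : R) (w : R * R) := D (w.1 + h, w.2) /\ modulus (diffq F h w - f w) <= e.
suff /(cC R (0^'+) Q (at_right_proper_filter 0)) H : forall x : R * R, C x ->
    \forall x' \near x & i \near 0^'+, Q i x'.
  have [r [r0 Hr]] := @filter_ex _ _ (at_right_proper_filter (0:R)) _ (filterI (nbhs_right_gt 0) H).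
  by exists r => // w Cw; exact: Hr.
move=> x /CD Dx.
(* Each of the two parts costs two comparisons with the value at [x], hence four quarters of [e]. *)
have e4 : 0 < e / 4 by rewrite divr_gt0.
have [_ _ _ /ccontP/(_ _ e4) fx] := hF _ Dx.
have /nbhs2P[r r0 rD] : nbhs x (D `&` [set v | modulus (f v - f x) < e / 4]).
  by apply: filterI => //; apply: open_nbhs_nbhs; split.
have r2 : 0 < r / 2 by rewrite divr_gt0.
exists (ball x (r / 2), [set h : R | 0 < h /\ h < r / 2]).
  by split; [exact: nbhsx_ballx|apply: filterI; [exact: nbhs_right_gt|exact: nbhs_right_lt]].
move=> [v h] [/= /ball2E[v1 v2] [h0 hr]].
have near_x y : v.1 <= y <= v.1 + h -> (D `&` [set v | modulus (f v - f x) < e / 4]) (y, v.2).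
  move=> /andP[vy yv]; apply: rD => /=.
    by clear -v1 yv vy hr; move: v1; rewrite !ltr_norml => /andP[? ?]; lra.
  by rewrite (lt_trans v2)// ltr_pdivrMr// ltr_pMr// ltr1n.
have dv y : v.1 <= y <= v.1 + h -> cderiv (fun t => F (t, v.2)) y (f (y, v.2)).
  by move=> /near_x [/hF[]].
have vh : v.1 <= v.1 + h <= v.1 + h by rewrite lexx andbT lerDl ltW.
have vv : v.1 <= v.1 <= v.1 + h by rewrite lexx lerDl ltW.
have [c1 /near_x[_ /= k1] E1] := MVT_re dv h0.
have [c2 /near_x[_ /= k2] E2] := MVT_im dv h0.
split; first by have [] := near_x _ vh.
have [_ /= k3] := near_x _ vv; rewrite -surjective_pairing in k3.
apply: le_trans (modulus_le _) _; rewrite /diffq reB imB !reimE !mul0r subr0 addr0.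
rewrite -surjective_pairing in E1 E2; rewrite E1 E2.
rewrite [_ * h]mulrC mulKf ?gt_eqF// [_ * h]mulrC mulKf ?gt_eqF//.
have t1 : `|re (f (c1, v.2)) - re (f v)| < e / 2.
  have -> : re (f (c1, v.2)) - re (f v) = re (f (c1, v.2) - f x) - re (f v - f x).
    by rewrite !reB; ring.
  have := ler_re (f (c1, v.2) - f x); have := ler_re (f v - f x).
  by clear -k3 k1; have := ler_normB (re (f (c1, v.2) - f x)) (re (f v - f x)); lra.
have t2 : `|im (f (c2, v.2)) - im (f v)| < e / 2.
  have -> : im (f (c2, v.2)) - im (f v) = im (f (c2, v.2) - f x) - im (f v - f x).
    by rewrite !imB; ring.
  have := ler_im (f (c2, v.2) - f x); have := ler_im (f v - f x).
  by clear -k3 k2; have := ler_normB (im (f (c2, v.2) - f x)) (im (f v - f x)); lra.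
by clear -t2 t1; lra.
Qed.

(* The derivative is a locally uniform limit of the weakly holomorphic difference
   quotients, so no regularity of [f] beyond continuity is needed. *)
Lemma hol_weakly_deriv D F f : open D -> hol D F f -> weakly_hol D f.
Proof.
move=> oD hF C psi d cC CD tp sC.
have clC : closed C by apply: compact_closed => //; exact: hausdorff2.
have sd := test_supported clC sC tp.
have cd w : ccont d w by case: (test_cont w tp).
have [M CM] := compact_sub_box cC.
have Md0 w : ~ box M w -> d w = 0 by move=> nM; apply: sd => /CM.
have cfd w : ccont (fun v => f v * d v) w.
  have [Cw|nC] := pselect (C w).
    by have [_ _ _ cf] := hF _ (CD _ Cw); exact: ccontM.
  apply: ccont_near (ccont_cst 0 w).
  by have := near_supported clC sd nC; apply: filterS => v ->; rewrite mulr0.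
have int : mu2.-integrable setT (EFin \o (fun w : P => re (f w * d w))).
  apply: (integrable_cont (M := M)); first by move=> w /Md0 ->; rewrite mulr0.
  by move=> w; have [] := cfd w.
have intd : mu2.-integrable setT (EFin \o (fun w : P => modulus (d w))).
  apply: (integrable_cont (M := M)); first by move=> w /Md0 ->; rewrite modulus0.
  by move=> w; exact: ccont_modulus.
split => //.
set I := (X in X = 0%E).
have Ifin : I \is a fin_num by exact: integrable_fin_num.
set K := (\int[mu2]_w (modulus (d w))%:E)%E.
have Kfin : K \is a fin_num by exact: integrable_fin_num.
have K0 : (0 <= K)%E by apply: integral_ge0 => w _; rewrite lee_fin modulus_ge0.
(* [K] is finite because [d] is continuous with compact support, and the difference quotient is
   within [e] of [f] on that support. *)
suff H e : 0 < e -> (`|I| <= e%:E * K)%E.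
  apply/eqP; rewrite -abse_eq0 eq_le abse_ge0 andbT; apply/lee_addgt0Pr => e e0; rewrite add0e.
  have k1 : 0 < fine K + 1 by rewrite ltr_wpDl// fine_ge0.
  apply: le_trans (H _ (divr_gt0 e0 k1)) _.
  rewrite -[K]fineK// -EFinM lee_fin -mulrA ler_piMr//; first exact: ltW.
  by rewrite mulrC ler_pdivrMr// mul1r lerDl.
move=> e0; have [h h0 Hh] := diffq_cvg oD hF cC CD e0.
have [ih eh] : mu2.-integrable setT (fun w : P => (re (diffq F h w * d w))%:E) /\
  (\int[mu2]_w (re (diffq F h w * d w))%:E = 0)%E.
  by apply: (hol_weakly (hol_diffq (h := h) hF) cC _ tp sC) => w Cw; split; [exact: CD|case: (Hh _ Cw)].
have -> : I = (\int[mu2]_w (re ((f w - diffq F h w) * d w))%:E)%E.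
  rewrite -[I]sube0 -eh /I -integralB//; apply: eq_integral => w _.
  by rewrite -EFinB -reB -mulrBl.
have ifd : mu2.-integrable setT (fun w : P => (re ((f w - diffq F h w) * d w))%:E).
  apply: eq_integrable (integrableB measurableT int ih) => // w _.
  by rewrite /= -EFinB -reB -mulrBl.
apply: le_trans (le_abse_integral _ _ _) _ => //; first exact: (measurable_int mu2).
rewrite /K -integralZl//; apply: ge0_le_integral => //.
- by apply: measurableT_comp => //; exact: (measurable_int mu2).
- by apply: measurable_funeM; exact: (measurable_int mu2).
- move=> w _ /=; rewrite -EFinM lee_fin; apply: le_trans (ler_re _) _; rewrite modulusM.
  have [Cw|nC] := pselect (C w); last by rewrite sd// modulus0 !mulr0.
  by rewrite ler_wpM2r ?modulus_ge0// modulusBC; case: (Hh _ Cw).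
Qed.

End weakly_holomorphic.

(** * Rotations and graph coordinates *)

Section change_of_variables.
Variable R : realType.
Notation mu := (@lebesgue_measure R).
Notation mu2 := (@lebesgue_measure R \x @lebesgue_measure R)%E.
Notation P := (measurableTypeR R * measurableTypeR R)%type.

Lemma lebesgue_measure_shift (a : R) (A : set (measurableTypeR R)) : measurable A ->
  pushforward mu (fun x : measurableTypeR R => (x + a : measurableTypeR R)) A = mu A.
Proof.
have mf : measurable_fun setT (fun x : measurableTypeR R => (x + a : measurableTypeR R)).
  by apply: measurable_funD => //; exact: measurable_cst.
move=> mA; apply/esym/(@lebesgue_measure_unique R
  (pushforward mu (fun x : measurableTypeR R => (x + a : measurableTypeR R)))) => //= _ [[b c]] _ <-.
rewrite /pushforward.
have -> : (fun x : measurableTypeR R => (x + a : measurableTypeR R)) @^-1` `]b, c]%classic = `](b - a), (c - a)]%classic.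
  by apply/seteqP; split => x /=; rewrite !in_itv/= ltrBlDr lerBrDr.
rewrite !lebesgue_measure_itv/= !lte_fin ltrD2r; case: ifP => // _.
by rewrite -!EFinD; congr EFin; ring.
Qed.

Lemma ge0_integral_shift (h : R -> \bar R) (a : R) :
  measurable_fun (setT : set (measurableTypeR R)) h -> (forall x, (0 <= h x)%E) ->
  (\int[mu]_x h (x + a)%R = \int[mu]_x h x)%E.
Proof.
move=> mh h0.
have mf : measurable_fun setT (fun x : measurableTypeR R => (x + a : measurableTypeR R)).
  by apply: measurable_funD => //; exact: measurable_cst.
have := @ge0_integral_pushforward _ _ _ _ R _ mf mu setT h measurableT mh (fun y _ => h0 y).
rewrite preimage_setT => <-.
by apply: eq_measure_integral => A mA _; exact: lebesgue_measure_shift.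
Qed.

Lemma measurable_fst2 : measurable_fun setT (fun w : P => (w.1 : R)).
Proof. exact: measurable_fst. Qed.
Lemma measurable_snd2 : measurable_fun setT (fun w : P => (w.2 : R)).
Proof. exact: measurable_snd. Qed.

Lemma measurable_to_pair (f g : P -> R) : measurable_fun setT f -> measurable_fun setT g ->
  measurable_fun setT (fun w => ((f w, g w) : P)).
Proof. by move=> mf mg; exact: measurable_fun_pair. Qed.

Lemma tonelli_xy (H : P -> \bar R) : measurable_fun setT H -> (forall w, (0 <= H w)%E) ->
  (\int[mu2]_w H w = \int[mu]_x \int[mu]_y H (x, y))%E.
Proof. by move=> mH H0; exact: fubini_tonelli1. Qed.

Lemma tonelli_yx (H : P -> \bar R) : measurable_fun setT H -> (forall w, (0 <= H w)%E) ->
  (\int[mu2]_w H w = \int[mu]_y \int[mu]_x H (x, y))%E.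
Proof. by move=> mH H0; exact: fubini_tonelli2. Qed.

Section maps.
Variable H : P -> \bar R.
Hypothesis mH : measurable_fun setT H.
Hypothesis H0 : forall w, (0 <= H w)%E.

Lemma measurable_shear_y (phi : R -> R) : measurable_fun (setT : set (measurableTypeR R)) phi ->
  measurable_fun setT (fun w : P => H (w.1, w.2 + phi w.1)).
Proof.
move=> mphi; apply: (measurableT_comp mH); apply: measurable_to_pair; first exact: measurable_fst2.
apply: measurable_funD; first exact: measurable_snd2.
by apply: (measurableT_comp mphi); exact: measurable_fst2.
Qed.

Lemma integral_shear_y (phi : R -> R) : measurable_fun (setT : set (measurableTypeR R)) phi ->
  (\int[mu2]_w H (w.1, w.2 + phi w.1)%R = \int[mu2]_w H w)%E.
Proof.
move=> mphi; rewrite (tonelli_xy (measurable_shear_y mphi) (fun w => H0 _)) (tonelli_xy mH H0).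
apply: eq_integral => x _; rewrite /= (ge0_integral_shift (h := fun y => H (x, y)))//.
by apply: (measurableT_comp mH); exact: measurable_pair1.
Qed.

Lemma measurable_shear_x (a : R) : measurable_fun setT (fun w : P => H (w.1 + a * w.2, w.2)).
Proof.
apply: (measurableT_comp mH); apply: measurable_to_pair; last exact: measurable_snd2.
apply: measurable_funD; first exact: measurable_fst2.
by apply: measurable_funM; [exact: measurable_cst|exact: measurable_snd2].
Qed.

Lemma integral_shear_x (a : R) :
  (\int[mu2]_w H (w.1 + a * w.2, w.2)%R = \int[mu2]_w H w)%E.
Proof.
rewrite (tonelli_yx (measurable_shear_x a) (fun w => H0 _)) (tonelli_yx mH H0).
apply: eq_integral => y _; rewrite /= (ge0_integral_shift (h := fun x => H (x, y)))//.
by apply: (measurableT_comp mH); exact: measurable_pair2.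
Qed.

End maps.

Definition rotm (c s : R) (w : P) : P := (c * w.1 - s * w.2, s * w.1 + c * w.2).

Lemma measurable_rotm c s : measurable_fun setT (rotm c s).
Proof.
apply: measurable_to_pair.
  by apply: measurable_funB; apply: measurable_funM; do ?exact: measurable_cst;
    [exact: measurable_fst2|exact: measurable_snd2].
by apply: measurable_funD; apply: measurable_funM; do ?exact: measurable_cst;
  [exact: measurable_fst2|exact: measurable_snd2].
Qed.

(* A rotation is a product of three shears, unless it is the half turn. *)
Lemma integral_rotm (H : P -> \bar R) c s : c ^+ 2 + s ^+ 2 = 1 ->
  measurable_fun setT H -> (forall w, (0 <= H w)%E) ->
  (\int[mu2]_w H (rotm c s w) = \int[mu2]_w H w)%E.
Proof.
have shears (c' s' : R) (K : P -> \bar R) : c' ^+ 2 + s' ^+ 2 = 1 -> c' != -1 ->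
    measurable_fun setT K -> (forall w, (0 <= K w)%E) ->
    (\int[mu2]_w K (rotm c' s' w) = \int[mu2]_w K w)%E.
  move=> cs cN1 mK K0.
  have c1 : 1 + c' != 0 by rewrite addrC -[1]opprK subr_eq0.
  (* [a] is minus the tangent of half the angle: the rotation is the horizontal shear by [a], the
     vertical shear by [s'], and the horizontal shear by [a] again. It is undefined only for the
     half turn. *)
  pose a := - s' / (1 + c').
  rewrite -[RHS](integral_shear_x mK K0 a).
  have m1 := measurable_shear_x mK a.
  have mb : measurable_fun (setT : set (measurableTypeR R)) (fun x : R => s' * x).
    by apply: measurable_funM => //; exact: measurable_cst.
  have m2 := measurable_shear_y m1 mb.
  rewrite -[RHS](@integral_shear_y _ m1 _ _ mb)//.
  rewrite -[RHS](@integral_shear_x _ m2 _ a)//.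
  apply: eq_integral => w _; congr K; rewrite /rotm /=.
  have e1 : 1 + a * s' = c'.
    rewrite /a; apply: (mulIf c1); rewrite mulrDl mul1r mulrAC mulfVK//.
    have e : s' * s' = 1 - c' ^+ 2 by rewrite -cs; ring.
    by rewrite mulNr e; ring.
  have e2 : a * (1 + c') = - s' by rewrite /a mulfVK.
  congr pair; last by rewrite -e1; ring.
  transitivity ((1 + a * s') * w.1 + a * (1 + (1 + a * s')) * w.2); last by ring.
  by rewrite e1 e2; ring.
move=> cs mH H0; have [cN1|/shears] := eqVneq c (-1); last exact.
have s0 : s = 0.
  apply/eqP; rewrite -sqrf_eq0; apply/eqP.
  by have -> : s ^+ 2 = c ^+ 2 + s ^+ 2 - c ^+ 2 by [ring]; rewrite cs cN1; ring.
(* The half turn is treated as two quarter turns, each of which is a product of shears. *)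
have q : (0 : R) ^+ 2 + 1 ^+ 2 = 1 by ring.
have nN1 : (0 : R) != -1 by rewrite eq_sym oppr_eq0 oner_eq0.
rewrite -[RHS](shears _ _ _ q nN1)// -[RHS](shears _ _ _ q nN1)//.
  by apply: eq_integral => w _; congr H; rewrite /rotm/= cN1 s0; congr pair; ring.
by apply: measurableT_comp => //; exact: measurable_rotm.
Qed.

Section graph_coordinates.
Variables (c s : R) (phi : R -> R).
Hypothesis cs : c ^+ 2 + s ^+ 2 = 1.
Hypothesis mphi : measurable_fun (setT : set (measurableTypeR R)) phi.

(* the point at height [t] above the graph of [phi], in the frame rotated by the
   angle of cosine [c] and sine [- s] *)
Definition gpt (x t : R) : R * R :=
  (c * x + s * (phi x + t), - s * x + c * (phi x + t)).

Lemma measurable_gpt : measurable_fun setT (fun w : P => (gpt w.1 w.2 : P)).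
Proof.
have m1 := measurable_fst2; have m2 := measurable_snd2.
have m3 : measurable_fun setT (fun w : P => phi w.1 + w.2).
  by apply: measurable_funD => //; exact: (measurableT_comp mphi).
by apply: measurable_to_pair; apply: measurable_funD; apply: measurable_funM => //;
  exact: measurable_cst.
Qed.

(** The rotation and the shear by [phi] both preserve area, so these coordinates have Jacobian [1]
    although [phi] need not be differentiable. The height is integrated last because [f] is
    estimated on slices of constant height. *)
Lemma integral_gpt (H : P -> \bar R) : measurable_fun setT H -> (forall w, (0 <= H w)%E) ->
  (\int[mu2]_w H w = \int[mu]_t \int[mu]_x H (gpt x t))%E.
Proof.
move=> mH H0.
have cs' : c ^+ 2 + (- s) ^+ 2 = 1 by rewrite sqrrN.
rewrite -(integral_rotm cs' mH H0).
have mHr : measurable_fun setT (fun w => H (rotm c (- s) w)).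
  by apply: (measurableT_comp mH); exact: measurable_rotm.
rewrite -(integral_shear_y mHr (fun w => H0 _) mphi).
rewrite (tonelli_yx (measurable_shear_y mHr mphi) (fun w => H0 _)).
apply: eq_integral => t _; apply: eq_integral => x _; congr H.
by rewrite /rotm /gpt /=; congr pair; ring.
Qed.

End graph_coordinates.
End change_of_variables.

(** * Cutoffs of class C^1 and regularised graphs *)

Section smoothing.
Variable R : realType.
Notation mu := (@lebesgue_measure R).

Lemma is_derive_quad (f : R -> R) (x a C : R) :
  (forall h, `|f (x + h) - f x - a * h| <= C * h ^+ 2) -> is_derive x 1 f a.
Proof.
move=> H.
have C0 : 0 <= C by have := le_trans (normr_ge0 _) (H 1); rewrite expr1n mulr1.
have cv : h^-1 *: ((f \o shift x) (h *: (1 : R)) - f x) @[h --> 0^'] --> a.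
  apply/cvgrPdist_lt => e e0; near=> h.
  have h0 : h != 0 by near: h; exact: nbhs_dnbhs_neq.
  rewrite /= /GRing.scale/= mulr1 [h + x]addrC.
  have -> : a - h^-1 * (f (x + h) - f x) = - (h^-1 * (f (x + h) - f x - a * h)).
    by field.
  rewrite normrN normrM normfV; apply: (@le_lt_trans _ _ (C * `|h|)).
    rewrite mulrC ler_pdivrMr ?normr_gt0//; apply: le_trans (H h) _.
    by rewrite -mulrA -normrM -expr2 ger0_norm ?sqr_ge0.
  have hC : `|h| < e / (C + 1).
    near: h; apply: dnbhs0_lt; by rewrite divr_gt0// ltr_wpDl.
  apply: (@le_lt_trans _ _ ((C + 1) * `|h|)); first by rewrite ler_wpM2r// lerDl.
  by rewrite mulrC -ltr_pdivlMr// ltr_wpDl.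
apply: DeriveDef; first by apply/cvg_ex; exists a; exact: cv.
exact: cvg_lim cv.
Unshelve. all: by end_near. Qed.

(** The square of the positive part is continuously differentiable, which is all that [test]
    requires; composing it with itself gives a cutoff without exponentials. *)
Definition pos2 (t : R) : R := Num.max t 0 ^+ 2.

Lemma is_derive_pos2 (t : R) : is_derive t 1 pos2 (2 * Num.max t 0).
Proof.
apply: (@is_derive_quad _ _ _ 1) => h; rewrite mul1r /pos2 ler_norml.
by have [t0|t0] := leP t 0; have [s0|s0] := leP (t + h) 0; apply/andP; split; nra.
Qed.

Lemma continuous_max0 : continuous (fun t : R => Num.max t 0).
Proof. by move=> t; apply: continuous_max; [exact: cvg_id|exact: cvg_cst]. Qed.

(* [0] on [`]-oo, 1]], [1] on [[2, +oo[] *)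
Definition step (t : R) : R := pos2 (1 - pos2 (2 - t)).
Definition step' (t : R) : R := 2 * Num.max (1 - pos2 (2 - t)) 0 * (2 * Num.max (2 - t) 0).

Lemma is_derive_step (t : R) : is_derive t 1 step (step' t).
Proof.
have d1 : is_derive t 1 (fun u : R => 2 - u) (-1).
  by have := is_derive_sub (is_derive_cst (2 : R) t (1 : R)) (is_derive_id t (1 : R)); rewrite sub0r.
have d2 := is_derive1_comp (f := pos2) (g := fun u => 2 - u) (is_derive_pos2 (2 - t)) d1.
have d3 := is_derive_sub (is_derive_cst (1 : R) t (1 : R)) d2.
have d4 := is_derive1_comp (f := pos2) (g := fun u => 1 - pos2 (2 - u)) (is_derive_pos2 _) d3.
by apply: (is_derive_eq d4); rewrite /step'; ring.
Qed.

Lemma continuous_step' : continuous step'.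
Proof.
have c1 : continuous (fun t : R => Num.max (2 - t) 0).
  move=> t; apply: (cvg_comp (fun t => 2 - t) (fun t : R => Num.max t 0)); last exact: continuous_max0.
  by apply: cvgB; [exact: cvg_cst|exact: cvg_id].
have c2 : continuous (fun t : R => Num.max (1 - pos2 (2 - t)) 0).
  move=> t; apply: (cvg_comp (fun t => 1 - pos2 (2 - t)) (fun t : R => Num.max t 0)); last exact: continuous_max0.
  by apply: cvgB; [exact: cvg_cst|apply: cvgM; exact: c1].
move=> t; apply: cvgM; first by apply: cvgM; [exact: cvg_cst|exact: c2].
by apply: cvgM; [exact: cvg_cst|exact: c1].
Qed.

Lemma step_bounds t : 0 <= step t <= 1.
Proof.
rewrite /step /pos2; set a := Num.max (2 - t) 0 ^+ 2.
have a0 : 0 <= a by rewrite sqr_ge0.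
by have [h|h] := leP (1 - a) 0; rewrite ?expr0n//= ?lexx ?ler01//; apply/andP; split; nra.
Qed.

Lemma step_le1 t : t <= 1 -> step t = 0.
Proof.
move=> t1; rewrite /step /pos2 [Num.max (2 - t) 0]max_l; last lra.
by rewrite max_r ?expr0n//; nra.
Qed.

Lemma step_ge2 t : 2 <= t -> step t = 1.
Proof.
move=> t1; rewrite /step /pos2 [Num.max (2 - t) 0]max_r; last lra.
by rewrite expr0n/= subr0 max_l// expr1n.
Qed.

Lemma step'_le1 t : t <= 1 -> step' t = 0.
Proof.
move=> t1; rewrite /step' /pos2 [Num.max (2 - t) 0]max_l; last lra.
by rewrite max_r ?mulr0 ?mul0r//; nra.
Qed.

Lemma step'_ge2 t : 2 <= t -> step' t = 0.
Proof.
by move=> t1; rewrite /step' /pos2 [Num.max (2 - t) 0]max_r ?mulr0//; lra.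
Qed.

Lemma step'_bounds t : `|step' t| <= 4.
Proof.
have [/step'_le1 ->|t1] := leP t 1; first by rewrite normr0.
have [/step'_ge2 ->|t2] := leP 2 t; first by rewrite normr0.
rewrite /step' /pos2 [Num.max (2 - t) 0]max_l; last lra.
rewrite max_l; last nra.
set u := 2 - t; have [u0 u1] : 0 <= u /\ u <= 1 by rewrite /u; split; lra.
have v0 : 0 <= 1 - u ^+ 2 by nra.
have v1 : 1 - u ^+ 2 <= 1 by rewrite lerBlDr lerDl sqr_ge0.
have := ler_pM v0 u0 v1 u1; have := mulr_ge0 v0 u0.
move: (1 - u ^+ 2) => v h1 h2; rewrite ger0_norm; lra.
Qed.

Section moving_average.
Variables (phi : R -> R) (L eta : R).
Hypothesis lip : forall x y, `|phi x - phi y| <= L * `|x - y|.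
Hypothesis eta0 : 0 < eta.

(** A Lipschitz [phi] may not enter a [test] function. Its average over [[x, x + eta]] is of class
    C^1, its derivative is again bounded by [L], and it stays within [L * eta] of [phi]. *)
Definition movavg (x : R) : R := eta^-1 * \int[mu]_(t in `[x, x + eta]) phi t.

Lemma lip_cont : continuous phi.
Proof.
have L0 : 0 <= L by have := le_trans (normr_ge0 _) (lip 1 0); rewrite subr0 normr1 mulr1.
move=> x; apply/cvgrPdist_lt => e e0; near=> y.
apply: le_lt_trans (lip _ _) _; apply: (@le_lt_trans _ _ ((L + 1) * `|x - y|)).
  by rewrite ler_wpM2r// lerDl.
rewrite mulrC -ltr_pdivlMr ?ltr_wpDl//.
by near: y; apply: cvgr_dist_lt; rewrite ?divr_gt0 ?ltr_wpDl.
Unshelve. all: by end_near. Qed.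

Lemma integrable_lip a b : mu.-integrable `[a, b] (EFin \o phi).
Proof.
by apply: continuous_compact_integrable; [exact: segment_compact|apply: continuous_subspaceT; exact: lip_cont].
Qed.

Lemma is_derive_movavg (x : R) : is_derive x 1 movavg (eta^-1 * (phi (x + eta) - phi x)).
Proof.
(* The base point [x - 1] lies to the left of both [x] and [x + eta], so the fundamental theorem of
   calculus applies at each of them. *)
pose Phi y := \int[mu]_(t in `[(x - 1), y]) phi t.
have dPhi y : x - 1 < y -> is_derive y 1 Phi (phi y).
  move=> xy; have yy : y < y + 1 by rewrite ltrDl.
  have [||| d1 d2] := @continuous_FTC1 R phi (BLeft (x - 1)) y (y + 1) yy.
  - exact: integrable_lip.
  - by rewrite lte_fin.
  - exact: lip_cont.
  by rewrite derive1E in d2; exact: (DeriveDef d1 d2).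
have sh : is_derive x 1 (fun t : R => t + eta) (1 : R).
  by have := is_derive_add (is_derive_id x (1 : R)) (is_derive_cst eta x (1 : R)); rewrite addr0.
have e1 : x - 1 < x + eta by rewrite ltrBlDr -addrA ltrDl addr_gt0.
have e2 : x - 1 < x by rewrite ltrBlDr ltrDl.
have := is_derive1_comp (f := Phi) (g := fun t => t + eta) (dPhi _ e1) sh; rewrite mulr1 => k1.
have := is_derive_mul (is_derive_cst (eta^-1) x (1 : R)) (is_derive_sub k1 (dPhi _ e2)).
rewrite mul0r addr0 => k2.
apply: near_eq_is_derive k2; near=> y.
have y1 : x - 1 < y by near: y; exact: lt_nbhsr.
rewrite /movavg; congr (_ * _); rewrite /Phi /=.
rewrite (@Rintegral_itvB R phi (BLeft (x - 1)) (BRight (y + eta)) y) ?bnd_simp; last 3 first.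
- exact: integrable_lip.
- exact: ltW.
- by rewrite lerDl ltW.
rewrite Rintegral_itv_obnd_cbnd//.
by apply: integrableS (integrable_lip y (y + eta)) => //; exact: subset_itv_oc_cc.
Unshelve. all: by end_near. Qed.

Lemma movavg_dist x : `|movavg x - phi x| <= L * eta.
Proof.
have e1 : x <= x + eta by rewrite lerDl ltW.
have -> : movavg x - phi x = eta^-1 * \int[mu]_(t in `[x, x + eta]) (phi t - phi x).
  rewrite RintegralB//; last 2 first.
  - exact: integrable_lip.
  - by apply: continuous_compact_integrable; [exact: segment_compact|apply: continuous_subspaceT; exact: cst_continuous].
  rewrite mulrBr; congr (_ - _); rewrite Rintegral_cst//= lebesgue_measure_itv/= lte_fin ltrDl eta0.
  by rewrite -EFinD/= addrAC subrr add0r mulrCA mulVf ?mulr1// gt_eqF.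
have i1 : mu.-integrable `[x, x + eta] (EFin \o (fun t => phi t - phi x)).
  apply: continuous_compact_integrable; [exact: segment_compact|apply: continuous_subspaceT].
  by move=> t; apply: cvgB; [exact: lip_cont|exact: cvg_cst].
have i2 : mu.-integrable `[x, x + eta] (EFin \o (fun _ => L * eta)).
  by apply: continuous_compact_integrable; [exact: segment_compact|apply: continuous_subspaceT; exact: cst_continuous].
rewrite normrM (ger0_norm (x := eta^-1)) ?invr_ge0 ?(ltW eta0)// [eta^-1 * _]mulrC ler_pdivrMr//.
apply: le_trans (le_normr_Rintegral _ _) _ => //.
apply: (@le_trans _ _ (\int[mu]_(t in `[x, x + eta]) (L * eta))).
  apply: le_Rintegral => //; first exact: integrable_norm.
  move=> t /= /[!in_itv]/= /andP[xt tx]; apply: le_trans (lip _ _) _.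
  have L0 : 0 <= L by have := le_trans (normr_ge0 _) (lip 1 0); rewrite subr0 normr1 mulr1.
  by rewrite ler_wpM2l// ger0_norm ?subr_ge0// lerBlDl.
by rewrite Rintegral_cst//= lebesgue_measure_itv/= lte_fin ltrDl eta0 -EFinD/= addrAC subrr add0r.
Qed.

Lemma movavg_deriv_bound x : `|eta^-1 * (phi (x + eta) - phi x)| <= L.
Proof.
rewrite normrM (ger0_norm (x := eta^-1)) ?invr_ge0 ?(ltW eta0)// [eta^-1 * _]mulrC ler_pdivrMr//.
by apply: le_trans (lip _ _) _; rewrite addrAC subrr add0r ger0_norm// ltW.
Qed.

End moving_average.
End smoothing.

(** * Green's formula near a Lipschitz graph *)

Lemma absorb_error (F : realFieldType) (a b e : F) : 0 <= a -> 0 <= b ->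
  18 * a + 18 * b < e -> 3 * a <= e / 2.
Proof. by move=> a0 b0 le; lra. Qed.

Section chart.
Variable R : realType.
Notation mu := (@lebesgue_measure R).
Notation mu2 := (@lebesgue_measure R \x @lebesgue_measure R)%E.
Notation P := (measurableTypeR R * measurableTypeR R)%type.

Lemma cvg_to_pair (T : Type) (F : set_system T) (FF : Filter F) (f g : T -> R) (a b : R) :
  f x @[x --> F] --> a -> g x @[x --> F] --> b -> ((f x, g x) : R * R) @[x --> F] --> (a, b).
Proof.
move=> /cvgrPdist_lt fa /cvgrPdist_lt gb A /nbhs2P[e e0 eA].
near=> x; apply: eA => /=; near: x; [exact: fa|exact: gb].
Unshelve. all: by end_near. Qed.

Lemma cvg_seq_right (u : nat -> R) (a : R) : (forall n, a < u n) -> u n @[n --> \oo] --> a ->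
  u n @[n --> \oo] --> a^'+.
Proof.
move=> au ua A HA; have : \forall n \near \oo, a < u n -> A (u n) by exact: ua _ HA.
by apply: filterS => n /(_ (au n)).
Qed.

Variables (c s L : R) (phi : R -> R).
Hypothesis cs : c ^+ 2 + s ^+ 2 = 1.
Hypothesis lip : forall x y, `|phi x - phi y| <= L * `|x - y|.
Notation gpt := (gpt c s phi).

(** [gX] and [gY] are the coordinates in the rotated frame and [gT] is the height above the graph;
    [(gX, gT)] inverts [gpt]. *)
Definition gX (w : R * R) : R := c * w.1 - s * w.2.
Definition gY (w : R * R) : R := s * w.1 + c * w.2.
Definition gT (w : R * R) : R := gY w - phi (gX w).

Lemma gptK w : gpt (gX w) (gT w) = w.
Proof.
rewrite /gpt /gT subrKC; case: w => x y; rewrite /gX /gY /=; congr pair.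
  transitivity ((c ^+ 2 + s ^+ 2) * x); first by ring.
  by rewrite cs mul1r.
transitivity ((c ^+ 2 + s ^+ 2) * y); first by ring.
by rewrite cs mul1r.
Qed.

Lemma gX_gpt x t : gX (gpt x t) = x.
Proof.
rewrite /gX /=; transitivity ((c ^+ 2 + s ^+ 2) * x); first by ring.
by rewrite cs mul1r.
Qed.

Lemma gT_gpt x t : gT (gpt x t) = t.
Proof.
rewrite /gT gX_gpt /gY /=.
transitivity ((c ^+ 2 + s ^+ 2) * (phi x + t) - phi x); first by ring.
by rewrite cs; ring.
Qed.

Lemma continuous_gX : continuous gX.
Proof.
move=> w; apply: cvgB; apply: cvgM; do ?exact: cvg_cst; [exact: cvg_fst|exact: cvg_snd].
Qed.

Lemma continuous_gY : continuous gY.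
Proof.
move=> w; apply: cvgD; apply: cvgM; do ?exact: cvg_cst; [exact: cvg_fst|exact: cvg_snd].
Qed.

Lemma continuous_gT : continuous gT.
Proof.
move=> w; apply: cvgB; first exact: continuous_gY.
exact: (cvg_comp _ _ (@continuous_gX w) (lip_cont lip (x := gX w))).
Qed.

Lemma continuous_gpt (w : R * R) : (gpt v.1 v.2) @[v --> w] --> gpt w.1 w.2.
Proof.
have k : phi v.1 + v.2 @[v --> w] --> phi w.1 + w.2.
  apply: cvgD; last exact: cvg_snd.
  by apply: (cvg_comp fst phi); [exact: cvg_fst|exact: lip_cont].
by apply: cvg_to_pair; apply: cvgD; apply: cvgM; do ?exact: cvg_cst; do ?exact: cvg_fst.
Qed.

Lemma continuous_gptl t (x : R) : gpt y t @[y --> x] --> gpt x t.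
Proof. exact: (cvg_comp _ _ (@cvg_pairl _ x t) (@continuous_gpt (x, t))). Qed.

Lemma continuous_gptr x (t : R) : gpt x u @[u --> t] --> gpt x t.
Proof. exact: (cvg_comp _ _ (@cvg_pairr _ x t) (@continuous_gpt (x, t))). Qed.

Lemma modulus_rot (w v : R * R) : modulus (cx w - cx v) ^+ 2 = (gX w - gX v) ^+ 2 + (gY w - gY v) ^+ 2.
Proof.
rewrite modulus_sqr /cx !reimE /gX /gY -[LHS]mul1r -cs; ring.
Qed.

Definition gpatch x0 rho a h : set (R * R) := [set w | `|gX w - x0| <= rho /\ a <= gT w <= h].

Lemma compact_patch x0 rho a h : compact (gpatch x0 rho a h).
Proof.
have -> : gpatch x0 rho a h = (fun v => gpt v.1 v.2) @` (`[x0 - rho, x0 + rho]%classic `*` `[a, h]%classic).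
  apply/seteqP; split => [w [w1 w2]|_ [[x t] [/= x1 t1] <-]].
    exists (gX w, gT w); last by rewrite /= gptK.
    by split; rewrite /= in_itv//= -ler_distl.
  split; first by rewrite gX_gpt ler_distl; move: x1; rewrite in_itv.
  by rewrite gT_gpt; move: t1; rewrite in_itv.
apply: continuous_compact; last by apply: compact_setX; exact: segment_compact.
by apply: continuous_subspaceT => w; exact: continuous_gpt.
Qed.

Lemma closed_patch x0 rho a h : closed (gpatch x0 rho a h).
Proof. by apply: compact_closed; [exact: hausdorff2|exact: compact_patch]. Qed.

Lemma mphi : measurable_fun (setT : set (measurableTypeR R)) phi.
Proof. exact: continuous_measurable_fun (lip_cont lip). Qed.

Lemma measurable_strip k : measurable ([set v | 0 < gT v < k] : set P).
Proof.
have -> : [set v | 0 < gT v < k] = gT @^-1` `]0, k[%classic.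
  by apply/seteqP; split => w /=; rewrite in_itv.
rewrite -[X in measurable X]setTI.
have := @open_continuous_measurable2 R setT gT openT (fun w _ => @continuous_gT w).
by apply => //; exact: measurable_itv.
Qed.

Lemma strip_le (H : P -> \bar R) (k m : R) : 0 < k -> 0 <= m ->
  measurable_fun setT H -> (forall w, (0 <= H w)%E) ->
  (forall x t, ~ (0 < t < k) -> H (gpt x t) = 0%E) ->
  (forall t, 0 < t < k -> (\int[mu]_x H (gpt x t) <= m%:E)%E) ->
  (\int[mu2]_w H w <= (k * m)%:E)%E.
Proof.
move=> k0 m0 mH H0 Hz Hm; rewrite (integral_gpt cs mphi mH H0).
have mHg : measurable_fun setT (fun w : P => H (gpt w.1 w.2)).
  by apply: (measurableT_comp mH); exact: measurable_gpt mphi.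
have mG : measurable_fun setT (fun t : measurableTypeR R => \int[mu]_x H (gpt x t))%E.
  by apply: (@measurable_fun_fubini_tonelli_G _ _ _ _ _ mu (fun w : P => H (gpt w.1 w.2))) => // w; exact: H0.
apply: (@le_trans _ _ (\int[mu]_(t in `]0%R, k[) m%:E)%E).
  rewrite [leRHS]integral_mkcond; apply: ge0_le_integral => //.
  - by move=> t _; apply: integral_ge0.
  - by apply/(measurable_restrictT _ _).1 => //; exact: measurable_cst.
  - move=> t _; rewrite /patch; case: ifPn.
      by rewrite inE/= in_itv/= => tk; exact: Hm.
    rewrite notin_setE/= in_itv/= => tk.
    by rewrite integral0_eq// => x _; exact: Hz.
by rewrite integral_cst//= lebesgue_measure_itv/= lte_fin k0 -EFinD subr0 -EFinM mulrC.
Qed.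

Variables (x0 rho h : R) (D : set (R * R)).
Hypothesis (rho0 : 0 < rho) (h0 : 0 < h) (oD : open D).
Hypothesis chartD : forall x t, `|x - x0| < rho -> `|t| < h -> (D (gpt x t) <-> 0 < t).
Notation I := (`](x0 - rho)%R, (x0 + rho)%R[%classic : set (measurableTypeR R)).

Lemma chart_itv x : I x <-> `|x - x0| < rho.
Proof. by rewrite /= in_itv/= ltr_distl. Qed.

(** The argument of the cutoff is the height above the regularised graph in units of [eps]. The
    values of [2 dbar] on [gX] and [gY] are the constants [c - i s] and [s + i c] of modulus one,
    whence a gradient of size [(1 + L) / eps]. *)
Lemma test_arg (eps eta : R) : 0 < eta ->
  test (fun w => ((gY w - movavg phi eta (gX w)) / eps)%:C%C)
   (fun w => (eps^-1)%:C%C * ((s%:C%C + 'i%C * c%:C%C) -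
      (eta^-1 * (phi (gX w + eta) - phi (gX w)))%:C%C * (c%:C%C - 'i%C * s%:C%C))).
Proof.
move=> eta0.
have tX : test (fun w => (gX w)%:C%C) (fun=> (c%:C%C - 'i%C * s%:C%C)).
  apply: test_ext (testB (testZ c%:C%C (test_fst R)) (testZ s%:C%C (test_snd R))) _ _ => w.
    by rewrite /gX rmorphB !rmorphM.
  by ring.
have tY : test (fun w => (gY w)%:C%C) (fun=> (s%:C%C + 'i%C * c%:C%C)).
  apply: test_ext (testD (testZ s%:C%C (test_fst R)) (testZ c%:C%C (test_snd R))) _ _ => w.
    by rewrite /gY rmorphD !rmorphM.
  by ring.
have tm : test (fun w => (movavg phi eta (gX w))%:C%C) (fun w =>
  (eta^-1 * (phi (gX w + eta) - phi (gX w)))%:C%C * (c%:C%C - 'i%C * s%:C%C)).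
  apply: (@test_comp R _ (fun x => eta^-1 * (phi (x + eta) - phi x)) gX) tX.
    by move=> w; exact: is_derive_movavg lip eta0 (gX w).
  move=> w; apply: cvgM; first exact: cvg_cst.
  apply: cvgB; last exact: (lip_cont lip).
  apply: (cvg_comp (fun x => x + eta) phi); last exact: (lip_cont lip).
  by apply: cvgD; [exact: cvg_id|exact: cvg_cst].
apply: test_ext (testZ (eps^-1)%:C%C (testB tY tm)) _ _ => w //.
by rewrite -rmorphB -rmorphM mulrC.
Qed.

Lemma modulus_frame : modulus ((s%:C%C + 'i%C * c%:C%C) : R[i]^o) = 1 /\ modulus ((c%:C%C - 'i%C * s%:C%C) : R[i]^o) = 1.
Proof.
by split; rewrite modulusE !reimE -[RHS]sqrtr1; congr (Num.sqrt _);
  (transitivity (c ^+ 2 + s ^+ 2); [ring|exact: cs]).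
Qed.

Section estimate.
Variables (f psi d : R * R -> R[i]) (N : R -> \bar R) (g : R -> R) (rho' h' : R).
Hypothesis fc : forall w, D w -> ccont f w.
Hypothesis fw : weakly_hol D f.
Hypothesis tpsi : test psi d.
Hypotheses (rho'0 : 0 < rho' < rho) (h'0 : 0 < h' < h).
Hypothesis spsi : supported (gpatch x0 rho' (- h') h') psi.
Hypothesis mN : measurable_fun (setT : set (measurableTypeR R)) N.
Hypothesis N0 : forall x, (0 <= N x)%E.
Hypothesis IN : (\int[mu]_(x in I) N x < +oo)%E.
Hypothesis fN : forall x t, `|x - x0| < rho -> 0 < t < h -> ((modulus (f (gpt x t)))%:E <= N x)%E.

Let L0 : 0 <= L.
Proof. by have := le_trans (normr_ge0 _) (lip 1 0); rewrite subr0 normr1 mulr1. Qed.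

Let patchD w : gpatch x0 rho' (- h') h' w -> (D w <-> 0 < gT w).
Proof.
move=> [w1 /andP[w2 w3]]; rewrite -{1}(gptK w); apply: chartD.
  by apply: le_lt_trans w1 _; case/andP: rho'0.
by rewrite (@le_lt_trans _ _ h') ?ler_norml ?w2//; case/andP: h'0.
Qed.

Let sd : supported (gpatch x0 rho' (- h') h') d.
Proof. exact: (test_supported (@closed_patch _ _ _ _) spsi tpsi). Qed.

Let cpsi w : ccont psi w. Proof. by case: (test_cont w tpsi). Qed.
Let cd w : ccont d w. Proof. by case: (test_cont w tpsi). Qed.

Let fD : P -> R := (fun w => modulus (f w)) \_ D.

Let mfD : measurable_fun setT fD.
Proof.
apply/(measurable_restrictT _ _).1; first exact: open_measurable2.
by apply: open_continuous_measurable2 => // w Dw; apply: ccont_modulus; exact: fc.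
Qed.

Let fD_ge0 w : 0 <= fD w.
Proof. by rewrite /fD patchE; case: ifP => // _; exact: modulus_ge0. Qed.

Let mI : measurable I. Proof. exact: measurable_itv. Qed.

Lemma continuous_slice (a : R * R -> R[i]) t : 0 < t < h -> (forall w, ccont a w) ->
  measurable_fun I (fun x => modulus (f (gpt x t)) * modulus (a (gpt x t))).
Proof.
move=> /andP[t0 th] ca; apply: open_continuous_measurable_fun; first exact: interval_open.
move=> x /set_mem /chart_itv xI.
have Dx : D (gpt x t) by apply/chartD => //; rewrite gtr0_norm.
apply: cvgM.
  apply: (cvg_comp (fun y => gpt y t) (fun w => modulus (f w))); first exact: continuous_gptl.
  by apply: ccont_modulus; exact: fc.
apply: (cvg_comp (fun y => gpt y t) (fun w => modulus (a w))); first exact: continuous_gptl.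
exact: ccont_modulus.
Qed.

Lemma strip_estimate (a : R * R -> R[i]) (k m : R) : 0 < k <= h -> 0 <= m ->
  (forall w, ccont a w) -> supported (gpatch x0 rho' (- h') h') a ->
  (forall t, 0 < t < k ->
     (\int[mu]_(x in I) (modulus (f (gpt x t)) * modulus (a (gpt x t)))%:E <= m%:E)%E) ->
  (\int[mu2]_w ((fD w * modulus (a w))%:E * (\1_[set v | 0 < gT v < k] w)%:E) <= (k * m)%:E)%E.
Proof.
move=> /andP[k0 kh] m0 ca sa Hm.
have mS := measurable_strip k.
apply: strip_le => //.
- apply: emeasurable_funM; apply/measurable_EFinP; last exact: measurable_indic.
  apply: measurable_funM => //; apply: open_continuous_measurable2; first exact: openT.
  by move=> w _; exact: ccont_modulus.
- by move=> w; rewrite -EFinM lee_fin !mulr_ge0// modulus_ge0.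
- by move=> x t nt; rewrite indicE memNset ?mule0//= gT_gpt.
- move=> t tk; have /andP[t0 tk'] := tk; apply: le_trans (Hm t tk).
  rewrite [leRHS]integral_mkcond le_eqVlt; apply/orP; left; apply/eqP.
  apply: eq_integral => x _; rewrite indicE mem_set/= ?gT_gpt// mule1 patchE.
  case: ifPn => [/set_mem/chart_itv xI|/negP xI].
    rewrite /fD patchE mem_set//; apply/chartD => //.
    by rewrite gtr0_norm// (lt_le_trans tk').
  rewrite sa ?modulus0 ?mulr0// => -[]; rewrite gX_gpt => xr _; apply: xI.
  by apply/mem_set/chart_itv; apply: le_lt_trans xr _; case/andP: rho'0.
Qed.

Lemma bounded_compact_support (a : R * R -> R[i]) : (forall w, ccont a w) ->
  supported (gpatch x0 rho' (- h') h') a -> exists2 C, 0 < C & forall w, modulus (a w) <= C.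
Proof.
move=> ca sa.
have [C C0 HC] := compact_bounded_continuous (@compact_patch x0 rho' (- h') h')
   (fun w _ => ccont_modulus (ca w)).
exists C => // w; have [wp|nw] := pselect (gpatch x0 rho' (- h') h' w).
  by have := HC _ wp; rewrite ger0_norm ?modulus_ge0.
by rewrite sa// modulus0 ltW.
Qed.

Lemma slice_N (a : R * R -> R[i]) C t : 0 < t < h -> (forall w, ccont a w) ->
  0 <= C -> (forall w, modulus (a w) <= C) ->
  (\int[mu]_(x in I) (modulus (f (gpt x t)) * modulus (a (gpt x t)))%:E <= C%:E * \int[mu]_(x in I) N x)%E.
Proof.
move=> th ca C0 HC; rewrite -ge0_integralZl//; last exact: measurable_funTS.
apply: ge0_le_integral => //.
- by move=> x _; rewrite lee_fin mulr_ge0 ?modulus_ge0.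
- by apply/measurable_EFinP; exact: continuous_slice.
- by apply: measurable_funeM; exact: measurable_funTS.
- move=> x /chart_itv xI; rewrite mulrC EFinM.
  apply: lee_pmul; rewrite ?lee_fin ?modulus_ge0//; exact: fN.
Qed.

Let iN : (\int[mu]_(x in I) N x)%E \is a fin_num.
Proof. by rewrite ge0_fin_numE//; exact: integral_ge0. Qed.
Let nN := fine (\int[mu]_(x in I) N x)%E.
Let nN0 : 0 <= nN. Proof. by apply: fine_ge0; exact: integral_ge0. Qed.

(** Continuity of [f] inside [D] gives nothing up to the boundary. Every slice, however, is
    dominated by a multiple of the integral of [N], and the heights range over an interval of length
    [h]. *)
Lemma integrable_fd : mu2.-integrable D (fun w => (re (f w * d w))%:E).
Proof.
have [C C0 HC] := bounded_compact_support cd sd.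
have mD : measurable (D : set P) by exact: open_measurable2.
have mfd : measurable_fun (D : set P) (fun w => (re (f w * d w))%:E).
  apply/measurable_EFinP; apply: open_continuous_measurable2 => // w Dw.
  by case: (ccontM (fc Dw) (cd w)).
apply/integrableP; split => //.
apply: (@le_lt_trans _ _ (h * (C * nN))%:E); last exact: ltry.
apply: le_trans (@strip_estimate d h (C * nN) _ _ cd sd _).
- rewrite integral_mkcond; apply: ge0_le_integral => //.
  + by move=> w _; apply: erestrict_ge0 => v _; exact: abse_ge0.
  + by apply/(measurable_restrictT _ _).1 => //; exact: measurableT_comp.
  + apply: emeasurable_funM; apply/measurable_EFinP.
      apply: measurable_funM => //; apply: open_continuous_measurable2; first exact: openT.
      by move=> w _; exact: ccont_modulus.
    by apply: measurable_indic; exact: measurable_strip.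
  + move=> w _; rewrite patchE; case: ifPn => [/set_mem Dw|_]; last first.
      by rewrite -EFinM lee_fin !mulr_ge0// modulus_ge0.
    have [wp|nw] := pselect (gpatch x0 rho' (- h') h' w); last first.
      by rewrite sd// mulr0 modulus0 mulr0 mul0e abse0.
    rewrite indicE mem_set ?mule1/=; last first.
      rewrite ((patchD wp).1 Dw)/=; case: wp => _ /andP[_ w2].
      by apply: le_lt_trans w2 _; case/andP: h'0.
    rewrite lee_fin /fD patchE mem_set//; apply: le_trans (ler_re _) _.
    by rewrite modulusM.
- by rewrite h0 lexx.
- by rewrite mulr_ge0// ltW.
- move=> t th; rewrite EFinM /nN fineK//; apply: slice_N => //; exact: ltW.
Qed.

Hypothesis mg : measurable_fun I g.
Hypothesis g0 : forall x, 0 <= g x.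
Hypothesis fg : {ae mu, forall x, I x -> modulus (f (gpt x t)) @[t --> 0^'+] --> g x}.

(** Dominated convergence, with a multiple of [N] as majorant, works along sequences of heights. If
    the bound failed at arbitrarily small heights, a sequence of such heights tending to [0] would
    contradict it. *)
Lemma slice_limit : (\int[mu]_(x in I) (g x * modulus (psi (gpt x 0)))%:E)%E \is a fin_num /\
  forall k, 0 < k -> exists2 e, 0 < e & forall t, 0 < t < e ->
   (\int[mu]_(x in I) (modulus (f (gpt x t)) * modulus (psi (gpt x t)))%:E <=
    \int[mu]_(x in I) (g x * modulus (psi (gpt x 0)))%:E + k%:E)%E.
Proof.
have [C C0 HC] := bounded_compact_support cpsi spsi.
pose M t : \bar R := (\int[mu]_(x in I) (modulus (f (gpt x t)) * modulus (psi (gpt x t)))%:E)%E.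
pose F x : \bar R := (g x * modulus (psi (gpt x 0)))%:E.
have mF : measurable_fun I F.
  apply/measurable_EFinP; apply: measurable_funM => //; apply: measurable_funTS.
  apply: continuous_measurable_fun => x.
  apply: (cvg_comp (fun y => gpt y 0) (fun w => modulus (psi w))); first exact: continuous_gptl.
  exact: ccont_modulus.
have lim (u : nat -> R) : (forall n, 0 < u n < h) -> u n @[n --> \oo] --> 0 ->
    mu.-integrable I F /\ M (u n) @[n --> \oo] --> (\int[mu]_(x in I) F x)%E.
  move=> u0 ul.
  have [] := @dominated_convergence _ _ R mu I mI
     (fun n x => (modulus (f (gpt x (u n))) * modulus (psi (gpt x (u n))))%:E) F
     (fun x => C%:E * N x)%E _ mF _ _ _.
  - by move=> n; apply/measurable_EFinP; exact: continuous_slice.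
  - apply: filterS fg => x fx Ix; apply/cvg_EFin; first by apply: nearW.
    have ur : u n @[n --> \oo] --> 0^'+.
      by apply: cvg_seq_right ul => n; case/andP: (u0 n).
    rewrite /=; apply: cvgM; first exact: (cvg_comp _ _ ur (fx Ix)).
    apply: (cvg_comp u (fun t => modulus (psi (gpt x t))) ul).
    apply: (cvg_comp (fun t => gpt x t) (fun w => modulus (psi w))); first exact: continuous_gptr.
    exact: ccont_modulus.
  - apply/integrableP; split; first by apply: measurable_funeM; exact: measurable_funTS.
    under eq_integral do rewrite gee0_abs ?mule_ge0// ?lee_fin ?(ltW C0)//.
    rewrite ge0_integralZl//; last by rewrite lee_fin ltW.
      by rewrite lte_mul_pinfty// lee_fin ltW.
    exact: measurable_funTS.
  - apply: aeW => x n /chart_itv xI; rewrite gee0_abs ?lee_fin ?mulr_ge0 ?modulus_ge0//.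
    rewrite mulrC EFinM; apply: lee_pmul; rewrite ?lee_fin ?modulus_ge0//.
    exact: fN.
  - by move=> iF _ cF; split.
have seq0 k : 0 < k -> k / n.+1%:R @[n --> \oo] --> (0 : R).
  move=> k0; rewrite -[X in _ --> X](mulr0 k); apply: cvgM; first exact: cvg_cst.
  exact: cvg_harmonic.
have [iF _] : mu.-integrable I F /\ True.
  split => //; have h2 : 0 < h / 2 by rewrite divr_gt0.
  case: (lim (fun n => h / 2 / n.+1%:R)) => //; last exact: seq0.
  move=> n; rewrite divr_gt0//= ltr_pdivrMr// (@lt_le_trans _ _ h)//.
    by rewrite ltr_pdivrMr// ltr_pMr// ltr1n.
  by rewrite ler_pMr// ler1n.
have Ffin := integrable_fin_num mI iF.
split => // k k0; apply: contrapT => nex.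
have /choice[u Hu] : forall n : nat, exists t, (0 < t < Num.min h (n.+1%:R^-1)) /\
    ~ (M t <= \int[mu]_(x in I) F x + k%:E)%E.
  move=> n; apply: contrapT => H; apply: nex; exists (Num.min h (n.+1%:R^-1)).
    by rewrite lt_min h0 invr_gt0 ltr0n.
  by move=> t tn; apply: contrapT => H2; apply: H; exists t.
have uh n : 0 < u n < h by case: (Hu n) => /andP[-> /=]; rewrite lt_min => /andP[].
have u0 : u n @[n --> \oo] --> 0.
  apply: (@squeeze_cvgr _ _ _ _ (fun=> 0) (fun n => n.+1%:R^-1)).
  - apply: nearW => n; case: (Hu n) => /andP[u1]; rewrite lt_min => /andP[_ u2] _.
    by rewrite !ltW.
  - exact: cvg_cst.
  - exact: cvg_harmonic.
have [_ Mu] := lim u uh u0.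
have : \forall n \near \oo, (M (u n) < \int[mu]_(x in I) F x + k%:E)%E.
  apply: (Mu [set y | (y < \int[mu]_(x in I) F x + k%:E)%E]).
  apply: open_nbhs_nbhs; split; first exact: open_ereal_lt_ereal.
  by rewrite /= lteDl.
move=> [n _ /(_ n (leqnn _))] /= /ltW; exact: (Hu n).2.
Qed.

(* Green's formula for [psi] times a smooth cutoff vanishing below height [eps]:
   the gradient of the cutoff has size [1 / eps] and lives in a strip of width
   [O(eps)], so that it produces an average of [f psi] over the strip. *)
Lemma chart_bound :
  (`|\int[mu2]_(w in D) (re (f w * d w))%:E| <=
   (12 * (1 + L))%:E * \int[mu]_(x in I) (g x * modulus (psi (gpt x 0)))%:E)%E.
Proof.
have [Ffin lim] := slice_limit; set M0 := (\int[mu]_(x in I) _)%E in Ffin lim *.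
have M00 : (0 <= M0)%E by apply: integral_ge0 => x _; rewrite lee_fin mulr_ge0// modulus_ge0.
have [Cd Cd0 HCd] := bounded_compact_support cd sd.
have mD : measurable (D : set P) by exact: open_measurable2.
pose m0 := fine M0; have m00 : 0 <= m0 by exact: fine_ge0.
have cL : 0 < 1 + L by rewrite ltr_pwDl.
apply/lee_addgt0Pr => e e0.
(* The slice error [k] is multiplied in the end by [3 eps * K = 12 (1 + L)], so it contributes
   [e / 2]; the other half of [e] is left for the term with [d]. *)
pose k := e / (24 * (1 + L)).
have k0 : 0 < k by rewrite divr_gt0// mulr_gt0.
have [e1 e10 He1] := lim k k0.
pose e2 := e / (6 * Cd * (nN + 1)).
have e20 : 0 < e2 by rewrite divr_gt0// !mulr_gt0// ltr_wpDl.
pose eps := Num.min (Num.min h e1) e2 / 6.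
have eps0 : 0 < eps by rewrite divr_gt0// !lt_min h0 e10.
have [eh ee1 ee2] : [/\ 3 * eps < h, 3 * eps < e1 & 3 * eps < e2].
  have lt6 (m : R) : 0 < m -> Num.min (Num.min h e1) e2 <= m -> 3 * eps < m.
    by rewrite /eps => m_gt0; set x := Num.min _ _ => xm; lra.
  by split; apply: lt6 => //; rewrite !ge_min lexx ?orbT.
(* The regularised graph is then within [eps / 2] of the true one, so that [arg <= 1] below height
   [eps / 2] and [arg >= 2] above height [3 eps]. *)
pose eta := eps / (2 * (1 + L)).
have eta0 : 0 < eta by rewrite divr_gt0// mulr_gt0.
have etaL : L * eta <= eps / 2.
  have <- : (1 + L) * eta = eps / 2.
    by rewrite /eta; field; rewrite gt_eqF.
  by rewrite ler_wpM2r ?(ltW eta0)// lerDr.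
pose arg w := (gY w - movavg phi eta (gX w)) / eps.
have targ := test_arg eps eta0.
set darg := (X in test _ X) in targ.
have tst := test_comp (fun w => is_derive_step (arg w)) (fun w => continuous_step' (x := arg w)) targ.
have tPsi := testM tpsi tst.
have argT w : gT w - eps / 2 <= arg w * eps <= gT w + eps / 2.
  rewrite /arg divfK ?gt_eqF// /gT; have := movavg_dist lip eta0 (gX w).
  by rewrite ler_norml => /andP[? ?]; apply/andP; split; lra.
have arg_le1 w : gT w <= eps / 2 -> arg w <= 1.
  by move=> Tw; have /andP[_ h2] := argT w; rewrite -(ler_pM2r eps0) mul1r; lra.
have arg_ge2 w : 3 * eps <= gT w -> 2 <= arg w.
  by move=> Tw; have /andP[h1 _] := argT w; rewrite -(ler_pM2r eps0); lra.
have dargb w : modulus (darg w) <= (1 + L) / eps.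
  rewrite /darg modulusM modulusC ger0_norm ?invr_ge0 ?(ltW eps0)// [eps^-1 * _]mulrC ler_pM2r ?invr_gt0//.
  have [f1 f2] := modulus_frame.
  apply: le_trans (modulusD _ _) _; rewrite f1 modulusN modulusM f2 mulr1 modulusC lerD2l.
  exact: (movavg_deriv_bound lip eta0).
pose C := gpatch x0 rho' (eps / 2) h'.
have CD : C `<=` D.
  move=> w [w1 /andP[w2 w3]]; apply/patchD; last by apply: lt_le_trans w2; rewrite divr_gt0.
  by split=> //; rewrite w3 andbT; have /andP[h'1 _] := h'0; lra.
have sPsi : supported C (fun w => psi w * (step (arg w))%:C%C).
  move=> w nC; have [wp|nw] := pselect (gpatch x0 rho' (- h') h' w); last by rewrite spsi// mul0r.
  rewrite step_le1 ?mulr0// arg_le1//; rewrite leNgt; apply/negP => Tw; apply: nC.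
  by case: wp => w1 /andP[_ w3]; split => //; rewrite w3 ltW.
have [iPsi zPsi] := fw (@compact_patch _ _ _ _) CD tPsi sPsi.
set u2 := (fun w : P => (re (f w * _))%:E) in iPsi zPsi.
have iD : mu2.-integrable setT ((fun w => (re (f w * d w))%:E) \_ D).
  by apply/(integrable_mkcond _ mD).1; exact: integrable_fd.
rewrite integral_mkcond -[X in (`|X|)%E]sube0 -zPsi -integralB//.
(* [K] bounds the gradient of the cutoff: [4] bounds [step'] and [(1 + L) / eps] bounds [darg]. Over
   the strip of width [3 eps] it becomes the constant [12 (1 + L)] of the statement. *)
set K := 4 * (1 + L) / eps.
have K0 : 0 <= K by apply: divr_ge0; [apply: mulr_ge0 => //; exact: ltW|exact: ltW].
pose S : set P := [set v | 0 < gT v < 3 * eps].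
pose B w := (((fD w * modulus (d w))%:E * (\1_S w)%:E) +
             K%:E * ((fD w * modulus (psi w))%:E * (\1_S w)%:E))%E.
have eh' : 0 < 3 * eps <= h by rewrite mulr_gt0//= ltW.
have b1 := @strip_estimate d (3 * eps) (Cd * nN) eh' (mulr_ge0 (ltW Cd0) nN0) cd sd.
have b2 := @strip_estimate psi (3 * eps) (m0 + k) eh' (addr_ge0 m00 (ltW k0)) cpsi spsi.
have mfa (a : R * R -> R[i]) : (forall w, ccont a w) ->
    measurable_fun setT (fun w : P => ((fD w * modulus (a w))%:E * (\1_S w)%:E))%E.
  move=> ca; apply: emeasurable_funM; apply/measurable_EFinP.
    apply: measurable_funM => //; apply: open_continuous_measurable2; first exact: openT.
    by move=> w _; exact: ccont_modulus.
  by apply: measurable_indic; exact: measurable_strip.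
have fa0 (a : R * R -> R[i]) w : (0 <= (fD w * modulus (a w))%:E * (\1_S w)%:E)%E.
  by rewrite -EFinM lee_fin !mulr_ge0// modulus_ge0.
apply: (@le_trans _ _ (\int[mu2]_w B w)%E).
  have iu : mu2.-integrable setT (((fun w => (re (f w * d w))%:E) \_ D) \- u2)%E by exact: integrableB.
  apply: le_trans (le_abse_integral _ _ _) _ => //; first exact: (measurable_int mu2).
  apply: ge0_le_integral => //.
  - by apply: measurableT_comp => //; exact: (measurable_int mu2).
  - by apply: emeasurable_funD; [exact: mfa|apply: measurable_funeM; exact: mfa].
  move=> w _; have B0 : (0 <= B w)%E by rewrite adde_ge0// mule_ge0// lee_fin.
  have [wp|nw] := pselect (gpatch x0 rho' (- h') h' w); last first.
    have e1' : ((fun w => (re (f w * d w))%:E) \_ D) w = 0%E.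
      by rewrite patchE; case: ifP => // _; rewrite (sd nw) mulr0.
    by rewrite e1' /u2 (spsi nw) (sd nw) !(mulr0, mul0r, addr0, re0) sube0 abse0.
  have [Tpos|Tneg] := ltP 0 (gT w); last first.
    have nD : ~ D w by move=> /(patchD wp).1; rewrite ltNge Tneg.
    have a1 : arg w <= 1 by apply: arg_le1; apply: le_trans Tneg _; rewrite divr_ge0 ?ltW.
    rewrite patchE memNset// /u2 -/(arg w) step'_le1// step_le1//.
    by rewrite !(mulr0, mul0r, addr0, re0) sube0 abse0.
  have Dw := (patchD wp).2 Tpos.
  rewrite patchE mem_set// /u2 -/(arg w) -EFinB -reB -mulrBr.
  have [Tbig|Tsmall] := leP (3 * eps) (gT w).
    have a2 := arg_ge2 _ Tbig.
    by rewrite step'_ge2// step_ge2// !(mul0r, mulr0, add0r, mulr1) subrr mulr0 re0 abse0.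
  rewrite /B indicE mem_set/= ?mule1; last by rewrite /S/= Tpos Tsmall.
  rewrite -EFinM -EFinD lee_fin /fD patchE mem_set//.
  apply: le_trans (ler_re _) _; rewrite modulusM [X in _ <= X](_ : _ = modulus (f w) *
    (modulus (d w) + K * modulus (psi w))); last by ring.
  rewrite ler_wpM2l ?modulus_ge0//.
  have -> : d w - (psi w * ((step' (arg w))%:C%C * darg w) + d w * (step (arg w))%:C%C) =
    d w * (1 - step (arg w))%:C%C - psi w * ((step' (arg w))%:C%C * darg w).
    by rewrite rmorphB; ring.
  have KE : modulus ((step' (arg w))%:C%C * darg w : R[i]^o) <= K.
    rewrite modulusM modulusC /K -mulrA; apply: ler_pM => //; first exact: modulus_ge0.
    exact: step'_bounds.
  apply: le_trans (modulusD _ _) _; rewrite modulusN (modulusM (d w)) (modulusM (psi w)) modulusC lerD//.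
    rewrite ler_piMr ?modulus_ge0//; have /andP[s0 s1] := step_bounds (arg w).
    by rewrite ger0_norm ?subr_ge0// gerBl.
  by rewrite mulrC ler_wpM2r ?modulus_ge0.
rewrite ge0_integralD//; last 3 first.
- exact: mfa.
- by move=> w _; rewrite mule_ge0// lee_fin.
- by apply: measurable_funeM; exact: mfa.
rewrite ge0_integralZl//; last exact: mfa.
have t1 : (\int[mu2]_w ((fD w * modulus (d w))%:E * (\1_S w)%:E) <= (3 * eps * (Cd * nN))%:E)%E.
  apply: b1 => t /andP[t0 te]; rewrite EFinM /nN fineK//; apply: slice_N => //.
    by rewrite t0 (lt_trans te).
  exact: ltW.
have t2 : (\int[mu2]_w ((fD w * modulus (psi w))%:E * (\1_S w)%:E) <= (3 * eps * (m0 + k))%:E)%E.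
  apply: b2 => t /andP[t0 te]; rewrite EFinD /m0 fineK//; apply: He1.
  by rewrite t0 (lt_trans te).
apply: le_trans (leeD t1 (lee_wpmul2l _ t2)) _; first by rewrite lee_fin.
rewrite -EFinM -EFinD -[M0]fineK// -EFinM -EFinD lee_fin -/m0.
have -> : K * (3 * eps * (m0 + k)) = 12 * (1 + L) * m0 + e / 2.
  by rewrite /K /k; field; rewrite !gt_eqF.
have : 3 * eps * (Cd * nN) <= e / 2.
  have q : 0 < 6 * Cd * (nN + 1) by rewrite !mulr_gt0// ltr_wpDl.
  move: ee2; rewrite /e2 ltr_pdivlMr// => ee2.
  have ec : 0 <= eps * Cd by apply: mulr_ge0; exact: ltW.
  have ecn : 0 <= eps * Cd * nN by exact: mulr_ge0.
  move: ee2; have -> : 3 * eps * (6 * Cd * (nN + 1)) = 18 * (eps * Cd * nN) + 18 * (eps * Cd) by ring.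
  have -> : 3 * eps * (Cd * nN) = 3 * (eps * Cd * nN) by ring.
  exact: absorb_error ecn ec.
by move=> le; rewrite addrCA lerD2l [leRHS]splitr lerD2r.
Qed.

End estimate.
End chart.

(** * Differentiability almost everywhere *)

Section ae_derivable.
Variable R : realType.
Notation mu := (@lebesgue_measure R).
Notation RR := (measurableTypeR R).

Lemma stieltjes_itv (V : cumulative R R) (x y : R) : x <= y ->
  lebesgue_stieltjes_measure V `]x, y]%classic = (V y - V x)%:E.
Proof.
move=> xy; rewrite /lebesgue_stieltjes_measure /measure_extension measurable_mu_extE/=; last exact: is_ocitv.
by rewrite wlength_itv_bnd.
Qed.

Section density.
Variable n : RR -> \bar R.
Hypothesis mn : measurable_fun setT n.
Hypothesis n0 : forall x, (0 <= n x)%E.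

Definition dens (A : set RR) : \bar R := (\int[mu]_(x in A) n x)%E.
Let dens0 : dens set0 = 0%E. Proof. by rewrite /dens integral_set0. Qed.
Let dens_ge0 A : (0 <= dens A)%E. Proof. by apply: integral_ge0. Qed.
Let dens_sa : semi_sigma_additive dens.
Proof.
move=> F mF tF mU; rewrite /dens ge0_integral_bigcup//; last exact: measurable_funTS.
by apply: is_cvg_nneseries => i _ _; exact: integral_ge0.
Qed.

Definition dens_measure : {measure set RR -> \bar R} :=
  HB.pack dens (isMeasure.Build _ _ _ dens dens0 dens_ge0 dens_sa).
End density.

Variables n u : R -> R.
Hypothesis n0 : forall x, 0 <= n x.
Hypothesis intn : mu.-integrable setT (EFin \o n).
Hypothesis un : forall x y, x <= y ->
  `|u y - u x| <= \int[mu]_(t in `]x, y]) n t.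
Let W (x : R) : R := \int[mu]_(t in `]-oo, x]) n t.

Let intn_on A : measurable A -> mu.-integrable A (EFin \o n).
Proof. by move=> mA; exact: (integrableS measurableT). Qed.

Lemma Rintegral_ocitvE (f : R -> R) : mu.-integrable setT (EFin \o f) ->
  forall x y, x <= y ->
  \int[mu]_(t in `]x, y]) f t =
  \int[mu]_(t in `]-oo, y]) f t - \int[mu]_(t in `]-oo, x]) f t.
Proof.
move=> intf x y xy; have fi A : measurable A -> mu.-integrable A (EFin \o f).
  by move=> mA; exact: (integrableS measurableT).
rewrite (_ : `]-oo, y]%classic = `]-oo, x] `|` `]x, y]); last first.
  by rewrite -itv_bndbnd_setU// bnd_simp.
rewrite Rintegral_setU//; first by rewrite addrAC subrr add0r.
- by apply: fi; apply: measurableU; exact: measurable_itv.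
- apply/disj_setPS => z [] /=; rewrite !in_itv/= => zx /andP[xz _].
  by move: (lt_le_trans xz zx); rewrite ltxx.
Qed.

Lemma Wcont (e : R) : 0 < e -> exists2 d : R, 0 < d &
  forall x y, x <= y -> y - x < d -> \int[mu]_(t in `]x, y]) n t < e.
Proof.
move=> e0; have [d [d0 H]] := integral_normr_continuous intn e0.
exists d => // x y xy yx.
have Hxy : (mu `]x, y]%classic < d%:E)%E ->
  \int[mu]_(t in `]x, y]) `|n t| < e := H `]x, y]%classic (measurable_itv _).
move: (lebesgue_measure_itv `]x, y]) => /=; rewrite lte_fin.
case: ifPn => [xy'|nxy].
  rewrite -EFinD => E; rewrite E lte_fin in Hxy; apply: le_lt_trans (Hxy yx).
  rewrite le_eqVlt; apply/orP; left; apply/eqP.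
  by apply: eq_Rintegral => t _; rewrite ger0_norm.
by move=> _; rewrite set_itv_ge ?Rintegral_set0// bnd_simp.
Qed.

Lemma monotone_nondecreasing (v : R -> R) :
  (forall x y, x <= y -> 0 <= v y - v x <= 2 * \int[mu]_(t in `]x, y]) n t) ->
  nondecreasing v /\ right_continuous v.
Proof.
move=> vn; split=> [x y xy|x].
  by have /andP[] := vn _ _ xy; rewrite subr_ge0.
apply/cvgrPdist_lt => e e0.
have [d d0 Hd] := Wcont (divr_gt0 e0 (ltr0n R 2)).
exists d => //= y /= xyd xy.
have /andP[v0 vle] := vn _ _ (ltW xy).
rewrite distrC ger0_norm//; apply: le_lt_trans vle _.
rewrite -ltr_pdivlMl// mulrC; apply: Hd; first exact: ltW.
by move: xyd; rewrite distrC gtr0_norm// subr_gt0.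
Qed.

Definition cumulative_of (v : R -> R) (nd : nondecreasing v)
  (rc : right_continuous v) : cumulative R R :=
  HB.pack v (isCumulative.Build R _ R v nd rc).

(** The Stieltjes measure of [v] is dominated by the measure of density [2 n], so it has a density
    by Radon-Nikodym and [v] is an indefinite integral. The companion [v'] turns domination into an
    equality on half-open intervals, which extends to Borel sets by uniqueness of measures, as a
    mere inequality on intervals would not. *)
Lemma monotone_density (v v' : R -> R) :
  (forall x y, x <= y -> 0 <= v y - v x) ->
  (forall x y, x <= y -> 0 <= v' y - v' x) ->
  (forall x y, x <= y -> (v y - v x) + (v' y - v' x) =
     2 * \int[mu]_(t in `]x, y]) n t) ->
  {ae mu, forall x, derivable v x 1}.
Proof.
move=> vm vm' E.
have [nv rv] : nondecreasing v /\ right_continuous v.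
  apply: monotone_nondecreasing => x y xy; rewrite vm//= -E//.
  by rewrite lerDl vm'.
have [nv' rv'] : nondecreasing v' /\ right_continuous v'.
  apply: monotone_nondecreasing => x y xy; rewrite vm'//= -E//.
  by rewrite lerDr vm.
pose V := cumulative_of nv rv; pose V' := cumulative_of nv' rv'.
have [nW rW] : nondecreasing (v \+ v') /\ right_continuous (v \+ v').
  apply: monotone_nondecreasing => x y xy /=.
  rewrite -E// opprD addrACA lexx andbT addr_ge0 ?vm ?vm'//.
pose VW := cumulative_of nW rW.
have m2 : measurable_fun [set: RR] (fun t : RR => (2 * n t)%:E).
  by apply/measurable_EFinP; apply: measurable_funM => //;
    apply/measurable_EFinP; exact: (measurable_int _ intn).
have p2 (t : RR) : (0 <= (2 * n t)%:E)%E by rewrite lee_fin mulr_ge0.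
pose ms := measure_add (lebesgue_stieltjes_measure V) (lebesgue_stieltjes_measure V').
have EW A : measurable A -> lebesgue_stieltjes_measure VW A = ms A.
  apply: lebesgue_stieltjes_measure_unique => X [[a b] _ <-] /=.
  have [ab|ba] := leP a b; last first.
    by rewrite set_itv_ge ?measure0// bnd_simp -leNgt ltW.
  rewrite [RHS]measure_addE (stieltjes_itv VW ab).
  rewrite [X in _ = (X + _)%E](stieltjes_itv V ab).
  rewrite [X in _ = (_ + X)%E](stieltjes_itv V' ab) -EFinD.
  by congr EFin => /=; ring.
have ED A : measurable A -> lebesgue_stieltjes_measure VW A = dens_measure m2 p2 A.
  apply: lebesgue_stieltjes_measure_unique => X [[a b] _ <-] /=.
  have [ab|ba] := leP a b; last first.
    rewrite set_itv_ge; last by rewrite bnd_simp -leNgt ltW.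
    by rewrite measure0 /dens integral_set0.
  rewrite (stieltjes_itv VW ab) /= opprD addrACA E// /dens_measure/= /dens.
  rewrite EFinM fineK; last first.
    by apply: integrable_fin_num => //; apply: intn_on; exact: measurable_itv.
  have mn' : measurable_fun `]a, b]%classic (EFin \o n).
    by apply: measurable_funTS; exact: (measurable_int _ intn).
  have nn' t : `]a, b]%classic t -> (0 <= (EFin \o n) t)%E by rewrite lee_fin.
  have k0 : (0 <= 2%:E :> \bar R)%E by rewrite lee_fin.
  by have := ge0_integralZl mu (measurable_itv _) mn' nn' k0 => <-.
pose lv := lebesgue_stieltjes_measure V.
have lv_le A : measurable A -> (lv A <= dens_measure m2 p2 A)%E.
  by move=> mA; rewrite -ED// EW// /ms measure_addE leeDl.
have lvT : (lv setT < +oo)%E.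
  apply: le_lt_trans (lv_le _ measurableT) _ => /=; rewrite /dens.
  have i2 : mu.-integrable setT (fun t : RR => (2 * n t)%:E).
    by apply: eq_integrable (integrableZl measurableT (2 : R) intn).
  have /integrableP[_] := i2.
  by under eq_integral do rewrite gee0_abs//.
have dom : mfrestr measurableT lvT `<< mu.
  apply/null_content_dominatesP => A mA muA.
  have lvA0 : lv A = 0%E.
    apply/eqP; rewrite eq_le measure_ge0 andbT; apply: le_trans (lv_le _ mA) _.
    rewrite /= /dens; have := null_set_integral mA _ muA.
    by move=> ->//; exact: measurable_funTS.
  apply/eqP; rewrite eq_le measure_ge0 andbT -lvA0 /mfrestr /mrestr.
  by rewrite setIT.
have [r [r0 rfin intr rE]] := radon_nikodym_sigma_finite dom.
pose rr (t : R) : R := fine (r t).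
have rrE : r = EFin \o rr by apply/funext => t /=; rewrite fineK.
have intrr : mu.-integrable setT (EFin \o rr) by rewrite -rrE.
have vE x y : x <= y -> v y - v x = \int[mu]_(t in `]x, y]) rr t.
  move=> xy; apply: EFin_inj.
  have E1 : lv `]x, y]%classic = (\int[mu]_(t in `]x, y]) r t)%E.
    transitivity (lv (`]x, y]%classic `&` setT)); first by rewrite setIT.
    by apply: rE; exact: measurable_itv.
  rewrite -(stieltjes_itv V xy) [LHS]E1 rrE fineK//.
  apply: integrable_fin_num => //; apply: (integrableS measurableT) => //.
have : {ae mu, forall x, derivable (fun x : R => (\int[mu]_(t in `]-oo, x]) rr t) : R) x 1}.
  have := @FTC1Ny R rr.
  have fi A : measurable A -> mu.-integrable A (EFin \o rr).
    by move=> mA; exact: (integrableS measurableT).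
  move=> /(_ (fun y => fi _ (measurable_itv _))).
  move=> /(_ (open_integrable_locally openT intrr)).
  apply: filterS; first exact: (ae_filter_ringOfSetsType mu).
  by move=> x [].
apply: filterS; first exact: (ae_filter_ringOfSetsType mu).
move=> x dx.
pose c := v 0 - \int[mu]_(t in `]-oo, 0]) rr t.
rewrite (_ : v = (fun x : R => (\int[mu]_(t in `]-oo, x]) rr t + c : R))).
  exact: derivableD dx (derivable_cst _ _ _).
apply/funext => y; rewrite /c.
have [y0|/ltW y0] := leP y 0.
  have := vE _ _ y0; rewrite Rintegral_ocitvE// => H.
  by rewrite -[v y](subKr (v 0)) H opprB addrCA.
have := vE _ _ y0; rewrite Rintegral_ocitvE// => /eqP; rewrite subr_eq => /eqP ->.
by rewrite addrA addrAC.
Qed.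

(** Write [u = (u + W) - W], where [W] is the primitive of [n]. Both terms are nondecreasing; the
    companion of [u + W] is [W - u] and that of [W] is [W], each pair adding up to [2 W]. *)
Lemma ae_derivable_of_integral_bound : {ae mu, forall x, derivable u x 1}.
Proof.
have intn0 x y : x <= y -> 0 <= \int[mu]_(t in `]x, y]) n t.
  by move=> xy; apply: Rintegral_ge0.
have WE x y : x <= y -> W y - W x = \int[mu]_(t in `]x, y]) n t.
  by move=> xy; rewrite -Rintegral_ocitvE.
have d1 : {ae mu, forall x, derivable (fun x => u x + W x : R) x 1}.
  apply: (@monotone_density _ (fun x => W x - u x)) => x y xy;
    have := WE _ _ xy; have := un xy; rewrite ?ler_norml => + E.
  - rewrite -E => /andP[h1 h2]; lra.
  - rewrite -E => /andP[h1 h2]; lra.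
  - rewrite -E => _; lra.
have d2 : {ae mu, forall x, derivable W x 1}.
  apply: (@monotone_density _ W) => x y xy; have := WE _ _ xy => E.
  - by rewrite E intn0.
  - by rewrite E intn0.
  - rewrite -E; lra.
apply: filterS2 d1 d2; first exact: (ae_filter_ringOfSetsType mu).
move=> x d1 d2.
rewrite (_ : u = (fun x => u x + W x) \- W); first by apply: (derivableB d1 d2).
by apply/funext => y /=; rewrite addrK.
Qed.

End ae_derivable.

Section ae_derivable_on.
Variable R : realType.
Notation mu := (@lebesgue_measure R).
Notation RR := (measurableTypeR R).

(** [N] may be [+oo] on a null set. There [fine] replaces it by [0] without changing integrals, and
    extension by zero gives a real integrable function on the whole line. *)
Lemma real_majorant (a b C : R) (N : RR -> \bar R) :
  measurable_fun setT N -> (forall x, (0 <= N x)%E) ->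
  (\int[mu]_(x in `]a, b[) N x < +oo)%E -> 0 <= C ->
  exists n : R -> R, [/\ forall x, 0 <= n x, mu.-integrable setT (EFin \o n) &
    forall x y, a < x -> x <= y -> y < b ->
    (\int[mu]_(t in `]x, y]) n t)%:E = (C%:E * \int[mu]_(t in `]x, y]) N t)%E].
Proof.
move=> mN N0 IN C0.
have mI : measurable (`]a, b[%classic : set RR) by exact: measurable_itv.
have iN : mu.-integrable `]a, b[ N.
  apply/integrableP; split; first exact: measurable_funTS.
  by under eq_integral do rewrite gee0_abs//.
have mfN : measurable_fun setT (fine \o N).
  by apply: measurableT_comp.
have iN' : mu.-integrable `]a, b[ (EFin \o (fine \o N)).
  apply: (le_integrable mI _ _ iN) => [|x _].
    by apply: measurable_funTS; exact/measurable_EFinP.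
  rewrite /= (gee0_abs (N0 x)) ger0_norm ?fine_ge0//.
  by case: (N x) (N0 x) => //= _; rewrite leey.
pose n := (fun x : RR => C * (fine (N x))) \_ `]a, b[.
have nE0 : EFin \o n = (fun x => C%:E * (EFin \o (fine \o N)) x)%E \_ `]a, b[.
  by apply/funext => x; rewrite /n !patchE /= patchE; case: ifPn.
have intn : mu.-integrable setT (EFin \o n).
  by rewrite nE0; apply/(integrable_mkcond _ mI); exact: integrableZl.
have n0 x : 0 <= n x.
  rewrite /n patchE; case: ifPn => // _.
  by rewrite mulr_ge0// fine_ge0.
exists n; split=> // x y ax xy yb.
have sub : `]x, y]%classic `<=` `]a, b[%classic.
  move=> t /=; rewrite !in_itv/= => /andP[xt ty].
  by rewrite (lt_trans ax xt) (le_lt_trans ty yb).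
rewrite fineK; last first.
  apply: integrable_fin_num => //; apply: (integrableS measurableT) => //.
have -> : (\int[mu]_(t in `]x, y]) (n t)%:E =
    \int[mu]_(t in `]x, y]) (C%:E * (fine (N t))%:E))%E.
  apply: eq_integral => t; rewrite inE => ht.
  by rewrite /n patchE mem_set ?EFinM//; exact: sub.
have mxy : measurable (`]x, y]%classic : set RR) by exact: measurable_itv.
have mfxy : measurable_fun (`]x, y]%classic : set RR) (fun t : RR => (fine (N t))%:E).
  by apply: measurable_funTS; exact/measurable_EFinP.
have fxy0 t : `]x, y]%classic t -> (0 <= (fine (N t))%:E)%E.
  by rewrite lee_fin fine_ge0.
have CC : (0 <= C%:E)%E by rewrite lee_fin.
have := ge0_integralZl mu mxy mfxy fxy0 CC => ->; congr (_ * _)%E.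
apply: ae_eq_integral => //; first exact: measurable_funTS.
have [A [mA A0 sA]] := integrable_ae mI iN; exists A; split=> //.
by apply: subset_trans sA => t /= nt ht; apply: nt => xyt; rewrite fineK// ht//; exact: sub.
Qed.

(** The bound holds only inside []a, b[], so [u] is composed with the projection [cl k] onto a
    compact subinterval. Every point of []a, b[] is interior to one of these subintervals, where
    [cl k] is the identity. *)
Lemma ae_derivable_on (a b C : R) (u : R -> R) (N : RR -> \bar R) :
  measurable_fun setT N -> (forall x, (0 <= N x)%E) ->
  (\int[mu]_(x in `]a, b[) N x < +oo)%E -> 0 <= C ->
  (forall x y, a < x -> x <= y -> y < b ->
    ((`|u y - u x|)%:E <= C%:E * \int[mu]_(t in `]x, y]) N t)%E) ->
  {ae mu, forall x, a < x < b -> derivable u x 1}.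
Proof.
move=> mN N0 IN C0 uN.
have [n [n0 intn nE]] := real_majorant mN N0 IN C0.
pose ak k : R := a + k.+1%:R^-1; pose bk k : R := b - k.+1%:R^-1.
pose cl k x := Num.max (ak k) (Num.min x (bk k)).
have cl_le k x y : x <= y -> cl k x <= cl k y.
  move=> xy; rewrite /cl ge_max le_max lexx/= le_max; apply/orP; right.
  by rewrite le_min !ge_min xy lexx orbT.
have : {ae mu, forall x, forall k, derivable (u \o cl k) x 1}.
  apply: ae_foralln => k; apply: (ae_derivable_of_integral_bound n0 intn).
  move=> x y xy /=.
  have : cl k x <= cl k y by exact: cl_le.
  rewrite le_eqVlt => /predU1P[->|clxy].
    by rewrite subrr normr0; apply: Rintegral_ge0.
  have k0 : 0 < k.+1%:R^-1 :> R by rewrite invr_gt0.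
  have [h1 h2] : ak k <= cl k x /\ cl k y = Num.min y (bk k).
    split; first by rewrite /cl le_max lexx.
    move: clxy; rewrite {2 3}/cl; case: (leP (ak k)) => // _.
    by rewrite ltNge /cl le_max lexx.
  have ax : a < cl k x by apply: lt_le_trans h1; rewrite ltrDl.
  have xx : x <= cl k x.
    rewrite /cl le_max le_min lexx /=.
    case: (leP x (bk k)) => [|bx]; rewrite ?orbT// orbF.
    move: clxy; rewrite h2 {1}/cl (min_r (ltW bx)) (min_r (le_trans (ltW bx) xy)).
    by rewrite gt_max ltxx andbF.
  have yb : cl k y < b.
    by rewrite h2 gt_min; apply/orP; right; rewrite ltrBlDr ltrDl.
  have yy : cl k y <= y by rewrite h2 ge_min lexx.
  apply: (@le_trans _ _ (\int[mu]_(t in `]cl k x, cl k y]) n t)).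
    rewrite -lee_fin (nE _ _ ax (ltW clxy) yb); exact: (uN _ _ ax (ltW clxy) yb).
  rewrite -lee_fin !fineK.
  - apply: ge0_subset_integral => //.
    + by apply: measurable_funTS; exact: (measurable_int _ intn).
    + by move=> t _; rewrite lee_fin.
    + move=> t /=; rewrite !in_itv/= => /andP[t1 t2].
      by rewrite (le_lt_trans xx t1) (le_trans t2 yy).
  - by apply: integrable_fin_num => //; apply: (integrableS measurableT).
  - by apply: integrable_fin_num => //; apply: (integrableS measurableT).
apply: filterS; first exact: (ae_filter_ringOfSetsType mu).
move=> x H /andP[ax xb].
have e0 : 0 < Num.min (x - a) (b - x) by rewrite lt_min !subr_gt0 ax.
have [k _ /(_ k (leqnn k))] := near_infty_natSinv_lt (PosNum e0).
rewrite /= lt_min => /andP[h1 h2].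
apply: near_eq_derivable (H k).
have nx : \forall y \near x, ak k < y < bk k.
  have hx : x \in `](ak k), (bk k)[ by rewrite in_itv/= /ak /bk; apply/andP; split; move: h1 h2; set z := k.+1%:R^-1; clearbody z => h1 h2; lra.
  have := near_in_itv hx; apply: filterS => y; by rewrite in_itv.
near=> y => /=; rewrite /cl.
have /andP[y1 y2] : ak k < y < bk k by near: y.
by rewrite (min_l (ltW y2)) (max_r (ltW y1)).
Unshelve. all: by end_near. Qed.
End ae_derivable_on.

(** * Traces on a graph *)

Section segment.
Variable R : realType.
Implicit Types (F f : R * R -> R[i]) (w p q v : R * R).

(** Complex differentiability without division: the case [v = w] is harmless, and restriction to a
    segment is immediate. *)
Definition cdiff F f w := forall e : R, 0 < e -> \forall v \near w,
  modulus (F v - F w - f w * (cx v - cx w)) <= e * modulus (cx v - cx w).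

Definition seg p q (t : R) : R * R := (p.1 + t * (q.1 - p.1), p.2 + t * (q.2 - p.2)).

Lemma seg_continuous p q (t : R) : seg p q y @[y --> t] --> seg p q t.
Proof.
apply: cvg_to_pair => /=; apply: cvgD; try exact: cvg_cst; apply: cvgMl;
  exact: cvg_id.
Qed.

Lemma cx_seg p q t : cx (seg p q t) = cx p + t%:C%C * (cx q - cx p).
Proof. by apply: cplx_eqP; rewrite /cx !reimE /=; ring. Qed.

Lemma is_derive_from_dist (g : R -> R) (t l C : R) :
  (forall e, 0 < e -> \forall y \near t, `|g y - g t - l * (y - t)| <= e * (C * `|y - t|)) ->
  is_derive t 1 g l.
Proof.
move=> H.
have H' : h^-1 * (g (h + t) - g t) @[h --> 0^'] --> l.
  apply/cvgrPdist_le => e e0.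
  have C1 : 0 < `|C| + 1 by rewrite ltr_wpDl.
  have /nbhs_ballP[d /= d0 Hd] := H _ (divr_gt0 e0 C1).
  near=> h.
  have h0 : h != 0 by near: h; exact: nbhs_dnbhs_neq.
  have hh : `|g (h + t) - g t - l * h| <= e / (`|C| + 1) * (C * `|h|).
    have := Hd (h + t); rewrite /ball/= opprD addrCA subrr addr0 normrN addrK; apply.
    by near: h; exact: dnbhs0_lt.
  rewrite distrC -[l](mulKf h0) -mulrBr normrM normfV.
  rewrite [h * l]mulrC ler_pdivrMl ?normr_gt0//; apply: le_trans hh _.
  apply: (@le_trans _ _ (e / (`|C| + 1) * ((`|C| + 1) * `|h|))).
    rewrite ler_wpM2l ?divr_ge0 ?(ltW e0) ?(ltW C1)// ler_wpM2r//.
    by apply: le_trans (ler_norm _) _; rewrite lerDl.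
  by rewrite mulrA divfK ?gt_eqF// mulrC.
apply: DeriveDef; first by apply/cvg_ex; exists l; rewrite /= /GRing.scale/=; under eq_fun do rewrite mulr1.
by apply: cvg_lim => //; rewrite /= /GRing.scale/=; under eq_fun do rewrite mulr1.
Unshelve. all: by end_near. Qed.

Lemma cderiv_seg F f p q t : cdiff F f (seg p q t) ->
  cderiv (fun t => F (seg p q t)) t (f (seg p q t) * (cx q - cx p)).
Proof.
move=> dF.
have H e : 0 < e -> \forall y \near t,
  modulus (F (seg p q y) - F (seg p q t) - (f (seg p q t) * (cx q - cx p)) * (y - t)%:C%C) <=
   e * (modulus (cx q - cx p) * `|y - t|).
  move=> e0; move: (@seg_continuous p q t _ (dF _ e0)).
  rewrite -/(nbhs _ _) nbhs_simpl; apply: (@filterS _ (nbhs t)) => y; rewrite /preimage /mkset.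
  rewrite !cx_seg; have -> : cx p + y%:C%C * (cx q - cx p) - (cx p + t%:C%C * (cx q - cx p)) =
    (y - t)%:C%C * (cx q - cx p) by rewrite rmorphB/=; ring.
  by rewrite modulusM modulusC [`|_| * _]mulrC [_%:C%C * (_ - _)]mulrC !mulrA.
split; apply: (@is_derive_from_dist _ _ _ (modulus (cx q - cx p))) => e /H;
  apply: filterS => y; apply: le_trans.
  by apply: le_trans (ler_re _); rewrite !reimE mulr0 subr0.
by apply: le_trans (ler_im _); rewrite !reimE mulr0 add0r.
Qed.

(** The mean value theorem fails for complex values. A phase [u] first makes the difference of the
    end values real and nonnegative, then the real theorem is applied to the real part. *)
Lemma segment_bound F f p q (M : R) :
  (forall t, 0 <= t <= 1 -> cdiff F f (seg p q t) /\ modulus (f (seg p q t)) <= M) ->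
  modulus (F q - F p) <= M * modulus (cx q - cx p).
Proof.
move=> H.
have [u [u1 uE]] := modulus_phase (F q - F p).
pose g t := u * F (seg p q t).
have dg y : 0 <= y <= 0 + 1 -> cderiv g y (u * (f (seg p q y) * (cx q - cx p))).
  rewrite add0r => /H[/cderiv_seg d _].
  by have := cderivM (cderiv_cst u y) d; rewrite mul0r addr0.
have [c] := MVT_re dg ltr01; rewrite add0r mulr1 => /H[_ fM].
have E1 : seg p q 1 = q by case: p q {H g dg c fM uE} => a b [a' b']; rewrite /seg /= !mul1r !addrA !(addrC a) !(addrC b) !addrK.
have E0 : seg p q 0 = p by case: p q {H g dg c fM uE E1} => a b [a' b']; rewrite /seg /= !mul0r !addr0.
rewrite /g E1 E0 -reB -mulrBr uE reC => ->.
apply: le_trans (re_le_modulus _) _; rewrite !modulusM u1 mul1r.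
by rewrite ler_wpM2r// modulus_ge0.
Qed.

End segment.

Section convergence.
Variable R : realType.
Notation mu := (@lebesgue_measure R).

Lemma ae_itv_exists (P : R -> Prop) (a b : R) : a < b -> {ae mu, forall x, P x} ->
  exists2 x, a < x < b & P x.
Proof.
move=> ab [A [mA A0 sA]]; apply: contrapT => nP.
have sub : `]a, b[%classic `<=` A.
  move=> x /=; rewrite in_itv/= => xab; apply: sA => Px; apply: nP; by exists x.
have : (mu `]a, b[%classic <= 0)%E.
  rewrite -A0; apply: le_measure; rewrite ?inE//; exact: measurable_itv.
have := lebesgue_measure_itv `]a, b[; rewrite /= lte_fin ab => ->.
by rewrite -EFinD lee_fin subr_le0 leNgt ab.
Qed.

Lemma cvg_right_cauchy (g : R -> R) :
  (forall e, 0 < e -> exists2 d, 0 < d & forall t t', 0 < t < d -> 0 < t' < d -> `|g t - g t'| < e) ->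
  exists b, forall e, 0 < e -> exists2 d, 0 < d & forall t, 0 < t < d -> `|g t - b| < e.
Proof.
move=> H; have cv : cvg (g t @[t --> 0^'+]).
  apply: cauchy_cvg; apply: cauchy_exP => e e0.
  have [d d0 Hd] := H _ e0; exists (g (d / 2)).
  exists d => //= t /=; rewrite sub0r normrN => td t0.
  rewrite /ball /=; apply: Hd; last by rewrite t0 -(gtr0_norm t0).
  by rewrite divr_gt0//= ltr_pdivrMr// mulr_natr mulr2n ltrDl.
exists (lim (g t @[t --> 0^'+])) => e e0.
have /cvgrPdist_lt/(_ _ e0) := cv.
move=> [d /= d0 Hd]; exists d => // t /andP[t0 td].
by rewrite distrC; apply: Hd => //=; rewrite sub0r normrN gtr0_norm.
Qed.

Lemma ccvg_right_cauchy (g : R -> R[i]) :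
  (forall e, 0 < e -> exists2 d, 0 < d & forall t t', 0 < t < d -> 0 < t' < d -> modulus (g t - g t') < e) ->
  exists b, forall e, 0 < e -> exists2 d, 0 < d & forall t, 0 < t < d -> modulus (g t - b) < e.
Proof.
move=> H.
have [|br Hr] := @cvg_right_cauchy (fun t => re (g t)).
  move=> e /H[d d0 Hd]; exists d => // t t' td td'.
  by apply: le_lt_trans (Hd _ _ td td'); rewrite -reB ler_re.
have [|bi Hi] := @cvg_right_cauchy (fun t => im (g t)).
  move=> e /H[d d0 Hd]; exists d => // t t' td td'.
  by apply: le_lt_trans (Hd _ _ td td'); rewrite -imB ler_im.
exists (br +i* bi)%C => e e0.
have e2 : 0 < e / 2 by rewrite divr_gt0.
have [d1 d10 H1] := Hr _ e2; have [d2 d20 H2] := Hi _ e2.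
exists (Num.min d1 d2); first by rewrite lt_min d10.
move=> t /andP[t0]; rewrite lt_min => /andP[td1 td2].
apply: le_lt_trans (modulus_le _) _; rewrite reB imB !reimE (splitr e).
by rewrite ltrD ?H1 ?H2 ?t0.
Qed.

End convergence.

(** * The trace on the graph of a function whose derivative is dominated on cones *)

Section trace.
Variable R : realType.
Notation mu := (@lebesgue_measure R).
Notation RR := (measurableTypeR R).
Variables (c s L : R) (phi : R -> R).
Hypothesis cs : c ^+ 2 + s ^+ 2 = 1.
Hypothesis lip : forall x y, `|phi x - phi y| <= L * `|x - y|.
Notation gpt := (gpt c s phi).
Notation gX := (gX c s).
Notation gY := (gY c s).

Definition pnt (X Y : R) : R * R := (c * X + s * Y, - s * X + c * Y).

Lemma gX_pnt X Y : gX (pnt X Y) = X.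
Proof. by rewrite /gX /pnt /=; transitivity ((c ^+ 2 + s ^+ 2) * X); [ring|rewrite cs mul1r]. Qed.
Lemma gY_pnt X Y : gY (pnt X Y) = Y.
Proof. by rewrite /gY /pnt /=; transitivity ((c ^+ 2 + s ^+ 2) * Y); [ring|rewrite cs mul1r]. Qed.
Lemma seg_pnt X Y X' Y' t : seg (pnt X Y) (pnt X' Y') t = pnt (X + t * (X' - X)) (Y + t * (Y' - Y)).
Proof. by rewrite /seg /pnt /=; congr pair; ring. Qed.
Lemma modulus_pnt X Y X' Y' : modulus (cx (pnt X Y) - cx (pnt X' Y')) ^+ 2 = (X - X') ^+ 2 + (Y - Y') ^+ 2.
Proof. by rewrite (modulus_rot cs) !gX_pnt !gY_pnt. Qed.
Lemma modulus_pnt_le X Y X' Y' (a b : R) : `|X - X'| <= a -> `|Y - Y'| <= b ->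
  modulus (cx (pnt X Y) - cx (pnt X' Y')) <= a + b.
Proof.
move=> ha hb; have a0 := le_trans (normr_ge0 _) ha; have b0 := le_trans (normr_ge0 _) hb.
rewrite -(@ler_pXn2r _ 2)// ?nnegrE ?modulus_ge0 ?addr_ge0//.
rewrite modulus_pnt -(real_normK (num_real (X - X'))) -(real_normK (num_real (Y - Y'))).
have n1 := normr_ge0 (X - X'); have n2 := normr_ge0 (Y - Y'); nra.
Qed.

Variables (x0 rho h m : R) (F f : R * R -> R[i]) (N : RR -> \bar R).
Hypotheses (m0 : 0 < m) (h0 : 0 < h) (rho0 : 0 < rho).
Hypothesis cone : forall y a b, `|y - x0| < rho -> `|a| < m * b -> 0 < b < h ->
  cdiff F f (pnt (y + a) (phi y + b)) /\ ((modulus (f (pnt (y + a) (phi y + b))))%:E <= N y)%E.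
Hypothesis mN : measurable_fun setT N.
Hypothesis N0 : forall x, (0 <= N x)%E.
Notation I := (`](x0 - rho)%R, (x0 + rho)%R[%classic : set RR).
Hypothesis IN : (\int[mu]_(x in I) N x < +oo)%E.

Let L0 : 0 <= L.
Proof. by have := lip 1 0; rewrite subr0 normr1 mulr1; apply: le_trans. Qed.

Lemma conv_gt0 (a b t : R) : 0 <= t <= 1 -> 0 < a -> 0 < b -> 0 < a + t * (b - a).
Proof.
move=> /andP[t0 t1] a0 b0; have [<-|tn] := eqVneq 0 t; first by rewrite mul0r addr0.
have tp : 0 < t by rewrite lt_neqAle tn.
have := mulr_gt0 tp b0; have := mulr_ge0 (_ : 0 <= 1 - t) (ltW a0); rewrite subr_ge0 => /(_ t1); nra.
Qed.

(** The truncated cone above the graph point over [y] is convex, so the segment between two of its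
    points stays inside and [N y] bounds the derivative along it. *)
Lemma segment_cone y X Y X' Y' : `|y - x0| < rho ->
  `|X - y| < m * (Y - phi y) -> `|X' - y| < m * (Y' - phi y) ->
  0 < Y - phi y < h -> 0 < Y' - phi y < h ->
  ((modulus (F (pnt X' Y') - F (pnt X Y)))%:E <=
    N y * (modulus (cx (pnt X' Y') - cx (pnt X Y)))%:E)%E.
Proof.
move=> yI XY XY' Yh Yh'; set d := modulus (_ - cx _).
have d0 : 0 <= d by exact: modulus_ge0.
have [dz|dn] := eqVneq d 0.
  have /eqP E : cx (pnt X' Y') - cx (pnt X Y) == 0 by rewrite -modulus_eq0 -/d dz.
  have [E1 E2] : X' - X = 0 /\ Y' - Y = 0.
    have := modulus_pnt X' Y' X Y; rewrite E modulus0 expr0n/= => /esym/eqP.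
    by rewrite paddr_eq0 ?sqr_ge0// !sqrf_eq0 => /andP[/eqP-> /eqP->].
  have -> : X' = X by lra.
  have -> : Y' = Y by lra.
  by rewrite subrr modulus0 mule_ge0.
have dp : 0 < d by rewrite lt_neqAle eq_sym dn.
have := N0 y; case NE : (N y) => [M||//] M0; last by rewrite gt0_mulye ?lte_fin// leey.
rewrite -EFinM lee_fin; apply: (@segment_bound _ F f) => t t01.
rewrite seg_pnt.
have [] := @cone y (X + t * (X' - X) - y) (Y + t * (Y' - Y) - phi y) yI.
- move: XY XY'; rewrite !ltr_norml => /andP[a1 a2] /andP[b1 b2]; apply/andP; split.
    have := @conv_gt0 (m * (Y - phi y) + (X - y)) (m * (Y' - phi y) + (X' - y)) t t01; nra.
  have := @conv_gt0 (m * (Y - phi y) - (X - y)) (m * (Y' - phi y) - (X' - y)) t t01; nra.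
- move: Yh Yh' => /andP[k1 k2] /andP[k3 k4]; apply/andP; split.
    have := conv_gt0 t01 k1 k3; lra.
  have := @conv_gt0 (h - (Y - phi y)) (h - (Y' - phi y)) t t01; lra.
by rewrite ![_ + (_ - _)]addrC !subrK NE lee_fin.
Qed.

Variable n : R -> R.
Hypothesis n0 : forall x, 0 <= n x.
Hypothesis intn : mu.-integrable setT (EFin \o n).
Hypothesis nE : forall x y, x0 - rho < x -> x <= y -> y < x0 + rho ->
  ((\int[mu]_(t in `]x, y]) n t)%:E = (1 + L)%:E * \int[mu]_(t in `]x, y]) N t)%E.

Let chartI x : (`|x - x0| < rho) = (x0 - rho < x < x0 + rho).
Proof. by rewrite ltr_distl. Qed.

Lemma Rint_split x y z : x <= y -> y <= z ->
  \int[mu]_(t in `]x, z]) n t = \int[mu]_(t in `]x, y]) n t + \int[mu]_(t in `]y, z]) n t.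
Proof.
move=> xy yz; rewrite !(Rintegral_ocitvE intn)//; last exact: le_trans yz.
ring.
Qed.

(** If [y - x] is small compared with [t], the two points at height [t] belong to the cone over
    every [z] between [x] and [y]. Averaging the resulting bound over [z] replaces a value of [N],
    possibly infinite, by its integral, and the length [y - x] cancels. *)
Lemma trace_step x y t : `|x - x0| < rho -> `|y - x0| < rho -> x <= y -> 0 < t -> 2 * t < h ->
  2 * ((1 + m * L) * (y - x)) <= m * t ->
  modulus (F (gpt y t) - F (gpt x t)) <= \int[mu]_(z in `]x, y]) n z.
Proof.
move=> xI yI; rewrite le_eqVlt => /predU1P[->|xy] t0 th st.
  by rewrite subrr modulus0; apply: Rintegral_ge0.
set v := modulus _; have v0 : 0 <= v by exact: modulus_ge0.
move: (xI) (yI); rewrite !chartI => /andP[x1 x2] /andP[y1 y2].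
rewrite -lee_fin (nE x1 (ltW xy) y2).
have d0 : 0 < y - x by rewrite subr_gt0.
have mL0 : 0 <= m * L by rewrite mulr_ge0// ltW.
have Ld : L * (y - x) <= t / 2.
  by rewrite -(ler_pM2l m0); have := ltW d0; nra.
have dt : y - x < m * (t - L * (y - x)) by nra.
have vN z : `]x, y]%classic z -> (v%:E <= N z * ((1 + L) * (y - x))%:E)%E.
  rewrite /= in_itv/= => /andP[xz zy].
  have zI : `|z - x0| < rho by rewrite chartI (lt_trans x1 xz) (le_lt_trans zy y2).
  have /andP[p1 p2] : - (L * (y - x)) <= phi x - phi z <= L * (y - x).
    rewrite -ler_norml; apply: le_trans (lip _ _) _; rewrite ler_wpM2l//.
    by rewrite ler0_norm; lra.
  have /andP[p3 p4] : - (L * (y - x)) <= phi y - phi z <= L * (y - x).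
    rewrite -ler_norml; apply: le_trans (lip _ _) _; rewrite ler_wpM2l//.
    by rewrite ger0_norm; lra.
  apply: le_trans (@segment_cone z x (phi x + t) y (phi y + t) zI _ _ _ _) _.
  - by rewrite ltr0_norm ?subr_lt0//; nra.
  - by rewrite ger0_norm ?subr_ge0//; nra.
  - by apply/andP; split; lra.
  - by apply/andP; split; lra.
  rewrite lee_wpmul2l// lee_fin mulrDl mul1r; apply: modulus_pnt_le.
    by rewrite ger0_norm// ltW.
  rewrite (_ : phi y + t - _ = phi y - phi x); last by ring.
  by apply: le_trans (lip _ _) _; rewrite ger0_norm// ltW.
have mxy : measurable (`]x, y]%classic : set RR) by exact: measurable_itv.
have mNxy : measurable_fun (`]x, y]%classic : set RR) N by exact: measurable_funTS.
have dL0 : 0 <= (1 + L) * (y - x) by apply: mulr_ge0; [exact: addr_ge0|exact: ltW].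
have I1 : (\int[mu]_(z in `]x, y]) v%:E = v%:E * (y - x)%:E)%E.
  rewrite integral_cst//; congr (_ * _)%E.
  by have := lebesgue_measure_itv `]x, y]; rewrite /= lte_fin xy -EFinD.
have I2 : (\int[mu]_(z in `]x, y]) (N z * ((1 + L) * (y - x))%:E) =
   (\int[mu]_(z in `]x, y]) N z) * ((1 + L) * (y - x))%:E)%E.
  by apply: ge0_integralZr => //; rewrite ?lee_fin.
have I3 : (v%:E * (y - x)%:E <= (\int[mu]_(z in `]x, y]) N z) * ((1 + L) * (y - x))%:E)%E.
  rewrite -I1 -I2; apply: ge0_le_integral => //.
  by apply: emeasurable_funM => //; exact: measurable_cst.
rewrite -(@lee_pmul2r _ (y - x)%:E) ?lte_fin//; apply: le_trans I3 _.
by rewrite EFinM muleA [X in (X * _ <= _)%E]muleC.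
Qed.

(** The restriction of [trace_step] depends on [t] but its conclusion does not. A chain of steps of
    length at most [d], with [2 (1 + m L) d = m t], therefore gives a bound that survives [t]
    tending to [0]. *)
Lemma trace_lip x y t : `|x - x0| < rho -> `|y - x0| < rho -> x <= y -> 0 < t -> 2 * t < h ->
  modulus (F (gpt y t) - F (gpt x t)) <= \int[mu]_(z in `]x, y]) n z.
Proof.
move=> xI yI xy t0 th.
have mL1 : 0 < 1 + m * L by rewrite ltr_pwDl// mulr_ge0// ltW.
pose d : R := m * t / 2 / (1 + m * L).
have d0 : 0 < d by rewrite !divr_gt0// mulr_gt0.
suff H k : forall x, `|x - x0| < rho -> x <= y -> y - x <= k%:R * d ->
    modulus (F (gpt y t) - F (gpt x t)) <= \int[mu]_(z in `]x, y]) n z.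
  have [k hk] : exists k, y - x <= k%:R * d.
    exists (Num.bound ((y - x) / d)); rewrite -ler_pdivrMr//.
    by apply: ltW; apply: archi_boundP; rewrite divr_ge0 ?subr_ge0// ltW.
  exact: (H k).
elim: k => [|k IH] {xI xy}x xI xy yx.
  have -> : y = x by move: yx; rewrite mul0r; lra.
  by rewrite subrr modulus0; apply: Rintegral_ge0.
have dd : 2 * ((1 + m * L) * d) = m * t by rewrite /d; field; rewrite gt_eqF.
have [yd|dy] := leP (y - x) d.
  by apply: trace_step => //; rewrite -dd ler_wpM2l// ler_wpM2l// ltW.
move: (xI) (yI); rewrite !chartI => /andP[x1 x2] /andP[y1 y2].
have zI : `|x + d - x0| < rho by rewrite chartI; apply/andP; split; lra.
have xd : x <= x + d by lra.
have dy' : x + d <= y by lra.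
have h1 := IH _ zI dy' _.
have h2 : modulus (F (gpt (x + d) t) - F (gpt x t)) <= \int[mu]_(z in `]x, x + d]) n z.
  apply: trace_step => //.
  by rewrite (addrAC x) subrr add0r dd.
rewrite (Rint_split xd dy') (_ : F (gpt y t) - F (gpt x t) =
  (F (gpt (x + d) t) - F (gpt x t)) + (F (gpt y t) - F (gpt (x + d) t))); last by ring.
apply: le_trans (modulusD _ _) _; apply: lerD => //; apply: h1.
move: yx; rewrite -natr1 mulrDl mul1r; move: (_%:R * d) => z zz; lra.
Qed.

Lemma trace_vertical x t t' : `|x - x0| < rho -> 0 < t -> t < h -> 0 < t' -> t' < h ->
  ((modulus (F (gpt x t') - F (gpt x t)))%:E <= N x * `|t' - t|%:E)%E.
Proof.
move=> xI t0 th t'0 t'h.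
have H := @segment_cone x x (phi x + t) x (phi x + t') xI.
rewrite subrr normr0 ![phi x + _ - phi x]addrAC subrr !add0r t0 t'0 th t'h !mulr_gt0// in H.
apply: le_trans (H isT isT isT isT) _.
rewrite lee_wpmul2l// lee_fin -[leRHS]add0r; apply: modulus_pnt_le.
  by rewrite subrr normr0.
by rewrite (_ : phi x + t' - _ = t' - t)//; ring.
Qed.

(** Vertical convergence needs a finite [N], which may fail over [x] itself. A neighbour [x'] with
    finite [N x'] and little mass of [n] in between serves instead, so the trace exists at every
    point and not only almost everywhere. *)
Lemma good_point x (e : R) : `|x - x0| < rho -> 0 < e -> exists x',
  [/\ `|x' - x0| < rho, x <= x', \int[mu]_(z in `]x, x']) n z < e & (N x' < +oo)%E].
Proof.
move=> xI e0; have [d d0 Hd] := Wcont n0 intn e0.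
have mI : measurable I by exact: measurable_itv.
have iN : mu.-integrable I N.
  apply/integrableP; split; first exact: measurable_funTS.
  by under eq_integral do rewrite gee0_abs//.
move: (xI); rewrite chartI => /andP[x1 x2].
have [] := @ae_itv_exists R _ x (Num.min (x + d) (x0 + rho)) _ (integrable_ae mI iN).
  by rewrite lt_min x2 ltrDl d0.
move=> x' /andP[xx']; rewrite lt_min => /andP[x'd x'r] finN.
have x'I : `|x' - x0| < rho by rewrite chartI (lt_trans x1 xx').
exists x'; split=> //; first exact: ltW.
  by apply: Hd; [exact: ltW|rewrite ltrBlDl].
by rewrite ltey_eq finN// /= in_itv/= -chartI.
Qed.

Lemma trace_diff x x' t t' (M : R) : `|x - x0| < rho -> `|x' - x0| < rho -> x <= x' ->
  N x' = M%:E -> 0 < t -> 2 * t < h -> 0 < t' -> 2 * t' < h ->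
  modulus (F (gpt x t') - F (gpt x t)) <= 2 * \int[mu]_(z in `]x, x']) n z + M * `|t' - t|.
Proof.
move=> xI x'I xx' NM t0 th t'0 t'h.
have h1 := trace_lip xI x'I xx' t0 th; have h2 := trace_lip xI x'I xx' t'0 t'h.
have h3 : modulus (F (gpt x' t') - F (gpt x' t)) <= M * `|t' - t|.
  rewrite -lee_fin EFinM -NM; apply: trace_vertical => //; lra.
rewrite (_ : F (gpt x t') - F (gpt x t) = - (F (gpt x' t') - F (gpt x t')) +
  ((F (gpt x' t') - F (gpt x' t)) + (F (gpt x' t) - F (gpt x t)))); last by ring.
have := modulusD (- (F (gpt x' t') - F (gpt x t')))
  ((F (gpt x' t') - F (gpt x' t)) + (F (gpt x' t) - F (gpt x t))).
have := modulusD (F (gpt x' t') - F (gpt x' t)) (F (gpt x' t) - F (gpt x t)).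
rewrite modulusN; lra.
Qed.

Lemma trace_cvg x : `|x - x0| < rho -> exists b, forall e, 0 < e ->
  exists2 d, 0 < d & forall t, 0 < t < d -> modulus (F (gpt x t) - b) < e.
Proof.
move=> xI; apply: (@ccvg_right_cauchy R (fun t => F (gpt x t))) => e e0.
have e4 : 0 < e / 4 by rewrite divr_gt0.
have [x' [x'I xx' ne Noo]] := good_point xI e4.
have [M NM] : exists M, N x' = M%:E.
  by exists (fine (N x')); rewrite fineK// ge0_fin_numE.
have M0 : 0 <= M by rewrite -lee_fin -NM.
exists (Num.min (h / 2) (e / 4 / (M + 1))).
  by rewrite lt_min !divr_gt0// ltr_wpDl.
move=> t t' /andP[t0]; rewrite lt_min => /andP[th te] /andP[t'0]; rewrite lt_min => /andP[t'h t'e].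
have H := @trace_diff x x' t' t M xI x'I xx' NM t'0 _ t0 _.
apply: le_lt_trans (H _ _) _; [lra|lra|].
have ltM u : 0 < u -> u < e / 4 / (M + 1) -> M * u < e / 4.
  move=> u0; rewrite ltr_pdivlMr ?ltr_wpDl// => ue.
  by apply: le_lt_trans ue; rewrite mulrC ler_wpM2l ?(ltW u0)// lerDl.
have k1 := ltM _ t0 te; have k2 := ltM _ t'0 t'e.
have : M * `|t - t'| <= M * t + M * t'.
  rewrite -mulrDr ler_wpM2l//; apply: le_trans (ler_normB _ _) _.
  by rewrite !gtr0_norm.
lra.
Qed.

Lemma trace_exists : exists B : R -> R[i],
  (forall x, `|x - x0| < rho -> forall e, 0 < e -> exists2 d, 0 < d &
     forall t, 0 < t < d -> modulus (F (gpt x t) - B x) < e) /\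
  (forall x y, `|x - x0| < rho -> `|y - x0| < rho -> x <= y ->
     modulus (B y - B x) <= \int[mu]_(z in `]x, y]) n z).
Proof.
pose Q (x : R) (b : R[i]) := `|x - x0| < rho -> forall e, 0 < e -> exists2 d, 0 < d &
     forall t, 0 < t < d -> modulus (F (gpt x t) - b) < e.
have HQ x : exists b, Q x b.
  have [xI|nI] := boolP (`|x - x0| < rho); first by have [b hb] := trace_cvg xI; exists b => _.
  by exists 0 => xI; rewrite xI in nI.
have [B HB] := choice HQ.
exists B; split=> // x y xI yI xy.
apply/ler_addgt0Pr => e e0; have e2 : 0 < e / 2 by rewrite divr_gt0.
have [d1 d10 H1] := HB _ xI _ e2; have [d2 d20 H2] := HB _ yI _ e2.
pose t := Num.min (Num.min d1 d2) (h / 2) / 2.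
have mn : 0 < Num.min (Num.min d1 d2) (h / 2) by rewrite !lt_min d10 d20 divr_gt0.
have t0 : 0 < t by rewrite divr_gt0.
have : t < Num.min (Num.min d1 d2) (h / 2) by rewrite /t ltr_pdivrMr// mulr_natr mulr2n ltrDl.
rewrite !lt_min => /andP[/andP[td1 td2] th].
have h1 := H1 t; have h2 := H2 t; rewrite t0 td1 in h1; rewrite t0 td2 in h2.
have {}h1 := h1 isT; have {}h2 := h2 isT.
have h3 := @trace_lip x y t xI yI xy t0.
have {}h3 : modulus (F (gpt y t) - F (gpt x t)) <= \int[mu]_(z in `]x, y]) n z by apply: h3; lra.
rewrite (_ : B y - B x = - (F (gpt y t) - B y) + ((F (gpt y t) - F (gpt x t)) + (F (gpt x t) - B x))); last by ring.
have := modulusD (- (F (gpt y t) - B y)) ((F (gpt y t) - F (gpt x t)) + (F (gpt x t) - B x)).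
have := modulusD (F (gpt y t) - F (gpt x t)) (F (gpt x t) - B x).
rewrite modulusN; lra.
Qed.

(** All values are compared with the one at height [h / 4] over a single good point: vertically at
    cost [K * h], horizontally at the cost of the total integral of [n]. *)
Lemma trace_bounded : exists2 M, 0 <= M & forall x t, `|x - x0| < rho -> 0 < t -> 2 * t < h ->
  modulus (F (gpt x t)) <= M.
Proof.
have I0 : `|x0 - x0| < rho by rewrite subrr normr0.
have [x' [x'I _ _ Noo]] := good_point I0 ltr01.
have [K NK] : exists K, N x' = K%:E.
  by exists (fine (N x')); rewrite fineK// ge0_fin_numE.
have K0 : 0 <= K by rewrite -lee_fin -NK.
pose J := \int[mu]_z n z.
have JE x y : \int[mu]_(z in `]x, y]) n z <= J.
  rewrite -lee_fin /J !fineK.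
  - apply: ge0_subset_integral => //.
    + exact: (measurable_int _ intn).
    + by move=> z _; rewrite lee_fin.
  - exact: integrable_fin_num.
  - apply: integrable_fin_num => //; apply: (integrableS measurableT) => //.
have J0 : 0 <= J by apply: Rintegral_ge0.
have h4 : 0 < h / 4 by rewrite divr_gt0.
exists (modulus (F (gpt x' (h / 4))) + K * h + J).
  by rewrite !addr_ge0 ?modulus_ge0// mulr_ge0// ltW.
move=> x t xI t0 th.
have k1 : modulus (F (gpt x' t) - F (gpt x' (h / 4))) <= K * h.
  have := @trace_vertical x' (h / 4) t x'I h4 _ t0 _.
  rewrite NK -EFinM lee_fin => H; apply: le_trans (H _ _) _; [lra|lra|].
  rewrite ler_wpM2l// ler_norml; apply/andP; split; lra.
have k2 : modulus (F (gpt x t) - F (gpt x' t)) <= J.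
  have [xx|/ltW xx] := leP x x'.
    by rewrite -modulusN opprB; apply: le_trans (JE x x'); exact: trace_lip.
  by apply: le_trans (JE x' x); exact: trace_lip.
rewrite (_ : F (gpt x t) = F (gpt x' (h / 4)) + (F (gpt x' t) - F (gpt x' (h / 4))) + (F (gpt x t) - F (gpt x' t))); last by ring.
have := modulusD (F (gpt x' (h / 4)) + (F (gpt x' t) - F (gpt x' (h / 4)))) (F (gpt x t) - F (gpt x' t)).
have := modulusD (F (gpt x' (h / 4))) (F (gpt x' t) - F (gpt x' (h / 4))).
lra.
Qed.

End trace.

(** * Smoothed Cauchy kernels *)

Section kernels.
Variable R : realType.
Implicit Types (z w p : R * R) (tau r : R).

Definition dist z w : R := modulus (cx w - cx z).

Lemma dist_ge0 z w : 0 <= dist z w. Proof. exact: modulus_ge0. Qed.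
Lemma distC z w : dist z w = dist w z. Proof. by rewrite /dist modulusBC. Qed.
Lemma dist_tri z w p : dist z w <= dist z p + dist p w.
Proof. by rewrite [leRHS]addrC /dist; exact: modulus_tri. Qed.

Lemma test_sub z : test (fun w => cx w - cx z) (fun=> 0).
Proof. by apply: test_ext (testB (@test_cx R) (test_cst (cx z))) _ _ => // w; rewrite subr0. Qed.

Lemma test_subJ z : test (fun w => conjc (cx w - cx z)) (fun=> 2).
Proof.
apply: test_ext (testB (@test_conj R) (test_cst (conjc (cx z)))) _ _ => w.
  by rewrite -rmorphB.
by rewrite subr0.
Qed.

Lemma test_dist_sqr z : test (fun w => (dist z w ^+ 2)%:C%C) (fun w => 2 * (cx w - cx z)).
Proof.
apply: test_ext (testM (test_sub z) (test_subJ z)) _ _ => w; first exact: mulJ.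
by rewrite mul0r addr0 mulrC.
Qed.

Definition den tau z w : R := dist z w ^+ 2 + tau ^+ 2.
(* The Cauchy kernel [1 / (w - z)] smoothed at scale [tau], and its [2 dbar]. *)
Definition cauchy_ker tau z w : R[i] := conjc (cx w - cx z) * ((den tau z w)^-1)%:C%C.
Definition poisson tau z w : R := 2 * tau ^+ 2 / den tau z w ^+ 2.

Lemma den_gt0 tau z w : 0 < tau -> 0 < den tau z w.
Proof. by move=> t0; rewrite /den ltr_wpDl ?sqr_ge0// exprn_gt0. Qed.

Lemma test_cauchy_ker tau z : 0 < tau ->
  test (cauchy_ker tau z) (fun w => (poisson tau z w)%:C%C).
Proof.
move=> t0.
pose q (x : R) := (x + tau ^+ 2)^-1; pose q' (x : R) := - ((x + tau ^+ 2) ^+ 2)^-1.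
have X0 w : dist z w ^+ 2 + tau ^+ 2 != 0 by rewrite gt_eqF// den_gt0.
have d1 (x : R) : is_derive x 1 (fun y : R => y + tau ^+ 2) (1 : R).
  by have := is_derive_add (is_derive_id x (1 : R)) (is_derive_cst (tau ^+ 2) x (1 : R)); rewrite addr0.
have tq : test (fun w => (q (dist z w ^+ 2))%:C%C)
    (fun w => (q' (dist z w ^+ 2))%:C%C * (2 * (cx w - cx z))).
  apply: test_comp (test_dist_sqr z) => w.
    have d2 := d1 (dist z w ^+ 2).
    by have := @is_deriveV R _ (dist z w ^+ 2) _ _ (X0 w) d2; rewrite /GRing.scale/= mulr1.
  apply: cvgN; apply: cvgV; first by rewrite expf_neq0// X0.
  by apply: cvgM; (apply: cvgD; [exact: cvg_id|exact: cvg_cst]).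
apply: test_ext (testM (test_subJ z) tq) _ _ => w //.
rewrite mulrCA [X in _ * X]mulrCA [conjc _ * _]mulrC mulJ -/(dist z w) /poisson /q' /q /den.
apply: cplx_eqP; rewrite !reimE; last by ring.
have := X0 w; set a := dist z w ^+ 2 => h.
by field.
Qed.

Lemma cauchy_ker_le tau z w : 0 < tau -> dist z w * modulus (cauchy_ker tau z w) <= 1.
Proof.
move=> t0; rewrite /cauchy_ker modulusM modulusJ -/(dist z w) modulusC.
rewrite ger0_norm ?invr_ge0 ?(ltW (den_gt0 _ _ t0))// mulrA ler_pdivrMr ?den_gt0//.
by rewrite mul1r /den expr2 lerDl sqr_ge0.
Qed.

Lemma cauchy_ker_leV tau z w : 0 < tau -> 0 < dist z w -> modulus (cauchy_ker tau z w) <= (dist z w)^-1.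
Proof.
by move=> t0 d0; rewrite -[leRHS]mul1r ler_pdivlMr// mulrC cauchy_ker_le.
Qed.

(** The smoothed form of [1/a - 1/b = (b - a) / (a b)]. Clearing denominators leaves the extra term
    [tau^2 conj (a - b)], absorbed because [d d' (d d' + tau^2) <= (d^2 + tau^2) (d'^2 + tau^2)]. *)
Lemma cauchy_ker_dist tau z z' w : 0 < tau ->
  dist z w * dist z' w * modulus (cauchy_ker tau z w - cauchy_ker tau z' w) <= dist z z'.
Proof.
move=> t0; set a := cx w - cx z; set b := cx w - cx z'.
have Da := den_gt0 z w t0; have Db := den_gt0 z' w t0.
have E : (cauchy_ker tau z w - cauchy_ker tau z' w) * (den tau z w * den tau z' w)%:C%C =
    conjc a * conjc b * (b - a) + (tau ^+ 2)%:C%C * conjc (a - b).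
  rewrite /cauchy_ker -/a -/b mulrBl.
  have -> : conjc a * ((den tau z w)^-1)%:C%C * (den tau z w * den tau z' w)%:C%C =
    conjc a * (den tau z' w)%:C%C.
    by rewrite -mulrA -rmorphM/= mulrA mulVf ?gt_eqF// mul1r.
  have -> : conjc b * ((den tau z' w)^-1)%:C%C * (den tau z w * den tau z' w)%:C%C =
    conjc b * (den tau z w)%:C%C.
    by rewrite -mulrA -rmorphM/= [den tau z w * _]mulrC mulrA mulVf ?gt_eqF// mul1r.
  have -> : (den tau z w)%:C%C = a * conjc a + (tau ^+ 2)%:C%C by rewrite mulJ rmorphD.
  have -> : (den tau z' w)%:C%C = b * conjc b + (tau ^+ 2)%:C%C by rewrite mulJ rmorphD.
  by rewrite [conjc (a - b)]rmorphB/=; ring.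
have ab : modulus (a - b) = dist z z'.
  by rewrite /dist /a /b; congr modulus; ring.
rewrite -(ler_pM2r (mulr_gt0 Da Db)).
have := congr1 (@modulus R) E; rewrite modulusM modulusC ger0_norm ?(ltW (mulr_gt0 Da Db))// => E2.
have h1 : modulus (conjc a * conjc b * (b - a) + (tau ^+ 2)%:C%C * conjc (a - b)) <=
    dist z z' * (dist z w * dist z' w + tau ^+ 2).
  apply: le_trans (modulusD _ _) _; rewrite !modulusM !modulusJ modulusC (modulusBC b) ab.
  rewrite ger0_norm ?sqr_ge0// -/(dist z w) -/(dist z' w).
  by rewrite mulrDr [_ * dist z z']mulrC [tau ^+ 2 * _]mulrC.
rewrite -E2 in h1; move: h1; set mm := modulus _; set d := dist z w; set d' := dist z' w.
have d0 : 0 <= d by exact: dist_ge0.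
have d'0 : 0 <= d' by exact: dist_ge0.
rewrite /den -/d -/d' => h1.
have dd0 : 0 <= d * d' by rewrite mulr_ge0.
have := ler_wpM2l dd0 h1; rewrite -!mulrA => h2.
apply: le_trans h2 _; rewrite [leLHS](_ : _ = dist z z' * (d * d' * (d * d' + tau ^+ 2))); last by ring.
rewrite ler_wpM2l ?dist_ge0//.
have t2 := sqr_ge0 tau; have := mulr_ge0 t2 (sqr_ge0 (d - d')); have := mulr_ge0 t2 dd0; have := mulr_ge0 t2 t2.
move: (tau ^+ 2) t2 => T t2; lra.
Qed.

(** Away from its pole, dbar of the squared kernel is of order [tau^2]; it disappears once [tau] is
    chosen small. *)
Lemma cauchy_ker_poisson_le tau z w : 0 < tau -> 0 < dist z w ->
  modulus (cauchy_ker tau z w) * poisson tau z w <= 2 * tau ^+ 2 / dist z w ^+ 5.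
Proof.
move=> t0 d0; have D0 := den_gt0 z w t0.
have p0 : 0 <= poisson tau z w by rewrite /poisson divr_ge0 ?sqr_ge0// mulr_ge0 ?sqr_ge0.
apply: le_trans (ler_wpM2r p0 (cauchy_ker_leV t0 d0)) _.
have t2 : 0 <= 2 * tau ^+ 2 by apply: mulr_ge0 => //; exact: sqr_ge0.
rewrite /poisson mulrCA (ler_wpM2l t2)//.
have D2 := exprn_gt0 2 D0; have D5 := exprn_gt0 5 d0; have DD := mulr_gt0 d0 D2.
rewrite -invfM lef_pV2 ?posrE//.
rewrite [X in X <= _](_ : _ = dist z w * (dist z w ^+ 2) ^+ 2); last by ring.
rewrite ler_wpM2l ?(ltW d0)// ler_pXn2r ?nnegrE ?sqr_ge0 ?(ltW D0)//.
by rewrite /den lerDl sqr_ge0.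
Qed.

Lemma poisson_ge0 tau z w : 0 <= poisson tau z w.
Proof. by rewrite /poisson divr_ge0 ?sqr_ge0// mulr_ge0 ?sqr_ge0. Qed.

(** The squared distance is used because it is smooth at the centre. The transition ends at
    [sqrt 2 * r]; the radius [3/2 * r] of later statements is a rational majorant, as [9/4 >= 2]. *)
Definition cutoff z r w : R := 1 - step (dist z w ^+ 2 / r ^+ 2).
Definition dcutoff z r w : R[i] :=
  (- (step' (dist z w ^+ 2 / r ^+ 2) * 2 / r ^+ 2))%:C%C * (cx w - cx z).

Lemma test_cutoff z r : test (fun w => (cutoff z r w)%:C%C) (dcutoff z r).
Proof.
have h : test (fun w => (dist z w ^+ 2 / r ^+ 2)%:C%C)
    (fun w => (r ^- 2)%:C%C * (2 * (cx w - cx z))).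
  apply: test_ext (testZ (r ^- 2)%:C%C (test_dist_sqr z)) _ _ => w //.
  by rewrite -rmorphM/= mulrC.
have h2 := test_comp (fun w => is_derive_step _) (fun w => @continuous_step' _ _) h.
apply: test_ext (testB (test_cst 1) h2) _ _ => w.
  by rewrite /cutoff rmorphB/=.
by rewrite /dcutoff; apply: cplx_eqP; rewrite !reimE; ring.
Qed.

Lemma cutoff_bounds z r w : 0 <= cutoff z r w <= 1.
Proof. by rewrite /cutoff; have := step_bounds (dist z w ^+ 2 / r ^+ 2); lra. Qed.

Lemma cutoff_in z r w : 0 < r -> dist z w <= r -> cutoff z r w = 1 /\ dcutoff z r w = 0.
Proof.
move=> r0 dr; have : dist z w ^+ 2 / r ^+ 2 <= 1.
  by rewrite ler_pdivrMr ?exprn_gt0// mul1r ler_pXn2r ?nnegrE ?dist_ge0// ltW.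
move=> h; rewrite /cutoff /dcutoff step_le1// step'_le1// subr0; split=> //.
by rewrite !mul0r oppr0 mul0r.
Qed.

Lemma cutoff_out z r w : 0 < r -> 3/2 * r <= dist z w -> cutoff z r w = 0 /\ dcutoff z r w = 0.
Proof.
move=> r0 dr; have : 2 <= dist z w ^+ 2 / r ^+ 2.
  rewrite ler_pdivlMr ?exprn_gt0//; nra.
move=> h; rewrite /cutoff /dcutoff step_ge2// step'_ge2// subrr; split=> //.
by rewrite !mul0r oppr0 mul0r.
Qed.

(** [12 = 4 * 2 * 3/2]: the bound of [step'], the factor from the squared distance, and the largest
    distance at which the derivative is nonzero. *)
Lemma dcutoff_le z r w : 0 < r -> modulus (dcutoff z r w) <= 12 / r.
Proof.
move=> r0; have [d1|d1] := leP (3/2 * r) (dist z w).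
  by have [_ ->] := cutoff_out r0 d1; rewrite modulus0 divr_ge0// ltW.
have r2 : 0 < r ^+ 2 by rewrite exprn_gt0.
have := step'_bounds (dist z w ^+ 2 / r ^+ 2).
rewrite /dcutoff modulusM modulusC -/(dist z w) normrN; set a := step' _ => a4.
rewrite normrM normrM (gtr0_norm (_ : 0 < 2))// normfV (gtr0_norm r2).
rewrite mulrAC ler_pdivrMr// expr2 mulrA divfK ?gt_eqF//.
move: a4; set b := `|a| => a4; have b0 : 0 <= b by exact: normr_ge0.
have := dist_ge0 z w; nra.
Qed.

Lemma continuous_dist z w : dist z v @[v --> w] --> dist z w.
Proof. by apply: ccont_modulus; have [] := test_cont w (test_sub z). Qed.

End kernels.

(** * Lower bounds by symmetry about a point *)

Section symmetric_squares.
Variable R : realType.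
Notation mu := (@lebesgue_measure R).
Notation mu2 := (@lebesgue_measure R \x @lebesgue_measure R)%E.
Notation P := (measurableTypeR R * measurableTypeR R)%type.
Implicit Types (z w : P).

Definition refl z w : P := (2 * z.1 - w.1, 2 * z.2 - w.2).
Definition sq z (r : R) : set P := [set w | `|w.1 - z.1| <= r /\ `|w.2 - z.2| <= r].

Lemma integral_shift2 (H : P -> \bar R) (a b : R) : measurable_fun setT H -> (forall w, (0 <= H w)%E) ->
  (\int[mu2]_w H (w.1 + a, w.2 + b)%R = \int[mu2]_w H w)%E.
Proof.
move=> mH H0.
have ms : measurable_fun setT (fun w : P => H (w.1 + a, w.2 + b)).
  apply: (measurableT_comp mH); apply: measurable_to_pair;
    apply: measurable_funD; do ?exact: measurable_cst; [exact: measurable_fst2|exact: measurable_snd2].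
have mb : measurable_fun setT (fun w : P => H (w.1, w.2 + b)).
  apply: (measurableT_comp mH); apply: measurable_to_pair; first exact: measurable_fst2.
  by apply: measurable_funD; do ?exact: measurable_cst; exact: measurable_snd2.
transitivity (\int[mu2]_w H (w.1, w.2 + b)%R)%E.
  rewrite (tonelli_yx ms (fun w => H0 _)) (tonelli_yx mb (fun w => H0 _)).
  apply: eq_integral => y _ /=; rewrite (ge0_integral_shift (h := fun x => H (x, y + b)))//.
  by apply: (measurableT_comp mH); exact: measurable_pair2.
rewrite (tonelli_xy mb (fun w => H0 _)) (tonelli_xy mH H0).
apply: eq_integral => x _ /=; rewrite (ge0_integral_shift (h := fun y => H (x, y)))//.
by apply: (measurableT_comp mH); exact: measurable_pair1.
Qed.

Lemma integral_refl (H : P -> \bar R) z : measurable_fun setT H -> (forall w, (0 <= H w)%E) ->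
  (\int[mu2]_w H (refl z w) = \int[mu2]_w H w)%E.
Proof.
move=> mH H0; rewrite -(integral_shift2 (2 * z.1) (2 * z.2) mH H0).
have ms : measurable_fun setT (fun w : P => H (w.1 + 2 * z.1, w.2 + 2 * z.2)).
  apply: (measurableT_comp mH); apply: measurable_to_pair;
    apply: measurable_funD; do ?exact: measurable_cst; [exact: measurable_fst2|exact: measurable_snd2].
have cs : (-1 : R) ^+ 2 + 0 ^+ 2 = 1 by rewrite sqrrN expr1n expr0n addr0.
rewrite -(integral_rotm cs ms (fun w => H0 _)); apply: eq_integral => w _.
by congr H; rewrite /refl /rotm /=; congr pair; ring.
Qed.

Lemma integral_odd (O : P -> R) z : mu2.-integrable setT (EFin \o O) ->
  (forall w, O (refl z w) = - O w) -> (\int[mu2]_w (O w)%:E = 0)%E.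
Proof.
move=> iO oO; rewrite integralE.
have mO : measurable_fun setT (EFin \o O) by exact: measurable_int iO.
have -> : (\int[mu2]_w ((EFin \o O)^\- w) = \int[mu2]_w ((EFin \o O)^\+ w))%E.
  rewrite -(@integral_refl ((EFin \o O)^\+)%E z) => [|//|//].
  - by apply: eq_integral => w _; rewrite funenegE funeposE /= oO EFinN.
  - exact: measurable_funepos.
rewrite subee//; apply: integrable_fin_num => //; exact: integrable_funepos.
Qed.

Lemma measurable_sq z r : measurable (sq z r).
Proof.
have -> : sq z r = `[z.1 - r, z.1 + r]%classic `*` `[z.2 - r, z.2 + r]%classic.
  by apply/seteqP; split => w /=; rewrite /sq/= !in_itv/= !ler_distl.
by apply: measurableX; exact: measurable_itv.
Qed.

(** Only the square with offsets in [[tau / 2, tau]] is used. Its area is [tau^2 / 4], and the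
    kernels of scale [tau] are comparable with [1 / tau^2] there. *)
Lemma square_mass (W : P -> R) z (r tau m : R) : 0 < tau -> tau <= r ->
  measurable_fun setT W -> (forall w, 0 <= W w) -> 0 <= m ->
  (forall w, tau / 2 <= w.1 - z.1 <= tau -> tau / 2 <= w.2 - z.2 <= tau -> m / tau ^+ 2 <= W w) ->
  ((m / 4)%:E <= \int[mu2]_(w in sq z r) (W w)%:E)%E.
Proof.
move=> t0 tr mW W0 m0 Wm.
pose Q : set P := `[z.1 + tau / 2, z.1 + tau]%classic `*` `[z.2 + tau / 2, z.2 + tau]%classic.
have mQ : measurable Q by apply: measurableX; exact: measurable_itv.
have QE : mu2 Q = ((tau / 2) ^+ 2)%:E.
  have len a : mu `[a + tau / 2, a + tau]%classic = (tau / 2)%:E.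
    have := lebesgue_measure_itv `[(a + tau / 2), (a + tau)]; rewrite /= lte_fin.
    have -> : a + tau / 2 < a + tau by rewrite ltrD2l ltr_pdivrMr// mulr_natr mulr2n ltrDl.
    by move=> ->; rewrite -EFinD; congr EFin; field.
  rewrite /Q product_measure1E; [|exact: measurable_itv..].
  by rewrite [X in (X * _)%E]len [X in (_ * X)%E]len -EFinM expr2.
apply: (@le_trans _ _ (\int[mu2]_(w in Q) (m / tau ^+ 2)%:E)%E).
  have := integral_cst mu2 mQ (m / tau ^+ 2)%:E => ->; rewrite [X in (_ * X)%E]QE -EFinM lee_fin.
  rewrite (_ : m / tau ^+ 2 * _ = m / 4)//; field; by rewrite gt_eqF.
apply: (@le_trans _ _ (\int[mu2]_(w in Q) (W w)%:E)%E).
  apply: ge0_le_integral => //.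
  - by move=> w _; rewrite lee_fin divr_ge0// sqr_ge0.
  - by apply/measurable_EFinP; exact: measurable_funTS.
  move=> w [/=]; rewrite !in_itv/= => /andP[h1 h2] /andP[h3 h4]; rewrite lee_fin.
  by apply: Wm; apply/andP; split; lra.
apply: ge0_subset_integral => //; first exact: measurable_sq.
- by apply/measurable_EFinP; exact: measurable_funTS.
- by move=> w _; rewrite lee_fin.
- by move=> w [/=]; rewrite !in_itv/= => /andP[h1 h2] /andP[h3 h4];
    split; rewrite ler_norml; apply/andP; split; lra.
Qed.

(** The common form of the two kernel arguments. On the small square the integrand dominates, up to
    a bounded error, an odd part [O] with integral zero plus [beta] times an approximate identity
    [W] of mass at least [m / 4]; elsewhere it is at least [- C]. *)
Lemma integral_lower_bound (D : set P) (A O W : P -> R) z (r tau m beta C M : R) :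
  measurable D -> sq z r `<=` D -> mu2.-integrable D (EFin \o A) ->
  mu2.-integrable setT (EFin \o O) -> (forall w, O (refl z w) = - O w) ->
  (forall w, ~ sq z r w -> O w = 0) ->
  0 < tau -> tau <= r -> measurable_fun setT W -> (forall w, 0 <= W w) ->
  mu2.-integrable (sq z r) (EFin \o W) -> 0 <= m ->
  (forall w, tau / 2 <= w.1 - z.1 <= tau -> tau / 2 <= w.2 - z.2 <= tau -> m / tau ^+ 2 <= W w) ->
  0 <= beta -> 0 <= C ->
  (forall w, D w -> O w + beta * (W w * \1_(sq z r) w) - C * \1_(box M : set P) w <= A w) ->
  ((beta * (m / 4) - C * fine (mu2 (box M : set P)))%:E <= \int[mu2]_(w in D) (A w)%:E)%E.
Proof.
move=> mD sD iA iO oO O0 t0 tr mW W0 iW m0 Wm b0 C0 lA.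
have mS := measurable_sq z r; have mB := @measurable_box R M.
have iOD : mu2.-integrable D (EFin \o O) by exact: (integrableS measurableT).
have iWS : mu2.-integrable D (EFin \o (fun w => W w * \1_(sq z r) w)).
  apply: (integrableS measurableT) => //.
  have -> : EFin \o (fun w => W w * \1_(sq z r) w) = (EFin \o W) \_ (sq z r).
    by apply/funext => w; rewrite patchE /= indicE; case: (w \in _); rewrite ?mulr1 ?mulr0.
  by apply/(integrable_mkcond _ mS).
have iB : mu2.-integrable D (EFin \o (fun w => \1_(box M : set P) w)).
  apply: (integrableS measurableT) => //.
  have -> : EFin \o (fun w => \1_(box M : set P) w) = (fun=> 1%E : \bar R) \_ (box M : set P).
    by apply/funext => w; rewrite patchE /= indicE; case: (w \in _).
  apply/(integrable_mkcond _ mB); apply: measurable_bounded_integrable => //.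
    exact: box_fin.
  by exists 1; split => // x x1 w _; rewrite /= normr1 ltW.
have iL : mu2.-integrable D (EFin \o (fun w => O w + beta * (W w * \1_(sq z r) w) - C * \1_(box M : set P) w)).
  have h1 := integrableZl mD beta iWS; have h2 := integrableZl mD C iB.
  by have := integrableB mD (integrableD mD iOD h1) h2; apply: eq_integrable.
apply: (@le_trans _ _ (\int[mu2]_(w in D) (O w + beta * (W w * \1_(sq z r) w) - C * \1_(box M : set P) w)%:E)%E); last first.
  by apply: le_integral => // w; rewrite inE => Dw; rewrite lee_fin; exact: lA.
have h1 := integrableZl mD beta iWS; have h2 := integrableZl mD C iB.
under eq_integral do rewrite EFinB EFinD.
rewrite integralB//; last by have := integrableD mD iOD h1; apply: eq_integrable.
rewrite integralD//.
have -> : (\int[mu2]_(w in D) (O w)%:E = 0)%E.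
  rewrite -(integral_odd iO oO) [LHS]integral_mkcond; apply: eq_integral => w _.
  rewrite patchE; case: ifPn => // /negP; rewrite inE => nD.
  by rewrite O0//; apply: contra_not nD; exact: sD.
rewrite add0e; under eq_integral do rewrite EFinM.
rewrite integralZl//.
under [X in (_ - X)%E]eq_integral do rewrite EFinM.
rewrite integralZl// EFinB; apply: leeB.
  rewrite EFinM lee_wpmul2l//; apply: le_trans (square_mass t0 tr mW W0 m0 Wm) _.
  have -> : (\int[mu2]_(w in sq z r) (W w)%:E = \int[mu2]_(w in D) (W w * \1_(sq z r) w)%:E)%E.
    rewrite [LHS]integral_mkcond [RHS]integral_mkcond; apply: eq_integral => w _.
    rewrite !patchE indicE; case: (boolP (w \in sq z r)) => h; rewrite ?mulr1 ?mulr0.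
      by rewrite mem_set//; apply: sD; rewrite inE in h.
    by case: ifP.
  by [].
rewrite EFinM lee_wpmul2l// fineK; last by rewrite ge0_fin_numE// box_fin.
rewrite integral_indic//.
by apply: le_measure; rewrite ?inE//; exact: measurableI.
Qed.

End symmetric_squares.

(** * Nontangential limits *)

Section fatou_tools.
Variable R : realType.
Notation mu := (@lebesgue_measure R).
Implicit Types (z w : R * R).

Lemma integral_poisson_le (a b x1 delta : R) : a < b -> 0 < delta ->
  (\int[mu]_(x in `]a, b[) (delta / (delta ^+ 2 + (x - x1) ^+ 2))%:E <= pi%:E)%E.
Proof.
move=> ab d0.
have pos (x : R) : 0 < delta ^+ 2 + (x - x1) ^+ 2 by rewrite ltr_pwDl ?exprn_gt0// sqr_ge0.
have cf : continuous (fun x : R => delta / (delta ^+ 2 + (x - x1) ^+ 2)).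
  move=> x; apply: cvgM; first exact: cvg_cst.
  apply: cvgV; first by rewrite gt_eqF.
  apply: cvgD; first exact: cvg_cst.
  by rewrite expr2; apply: cvgM; apply: cvgB; [exact: cvg_id|exact: cvg_cst|exact: cvg_id|exact: cvg_cst].
have dF (x : R) : is_derive x 1 (fun x : R => atan (delta^-1 * (x - x1))) (delta / (delta ^+ 2 + (x - x1) ^+ 2)).
  have d1 : is_derive x 1 (fun x : R => delta^-1 * (x - x1)) delta^-1.
    have := is_derive_mul (is_derive_cst (delta^-1) x (1 : R))
      (is_derive_sub (is_derive_id x (1 : R)) (is_derive_cst x1 x (1 : R))).
    by rewrite mul0r addr0 subr0 mulr1.
  have d2 := is_derive1_atan (delta^-1 * (x - x1)).
  have := is_derive1_comp (f := atan) (g := fun x : R => delta^-1 * (x - x1)) d2 d1.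
  congr is_derive; have := pos x; have := pos 0 => p0 px; field.
  rewrite (gt_eqF d0)/=; apply/andP; split; first by rewrite gt_eqF.
  by [].
apply: (@le_trans _ _ (\int[mu]_(x in `[a, b]) (delta / (delta ^+ 2 + (x - x1) ^+ 2))%:E)%E).
  apply: ge0_subset_integral => //.
  - by apply/measurable_EFinP; apply: measurable_funTS; exact: continuous_measurable_fun.
  - by move=> x _; rewrite lee_fin divr_ge0 ?(ltW d0) ?(ltW (pos x)).
  - by move=> x /=; rewrite !in_itv/= => /andP[/ltW-> /ltW->].
rewrite (@continuous_FTC2 R _ (fun x : R => atan (delta^-1 * (x - x1))) a b ab).
- by rewrite -EFinB lee_fin; have := atan_ltpi2 (delta^-1 * (b - x1)); have := atan_gtNpi2 (delta^-1 * (a - x1)); lra.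
- exact: continuous_subspaceT.
- split.
  + by move=> x _; exact: (@ex_derive _ _ _ _ _ _ _ (dF x)).
  + by apply: cvg_at_right_filter; exact: is_derive_cont (dF a).
  + by apply: cvg_at_left_filter; exact: is_derive_cont (dF b).
- by move=> x _; rewrite derive1E; exact: (@derive_val _ _ _ _ _ _ _ (dF x)).
Qed.

Lemma cauchy_ker_sqr_diff (tau l D : R) z z' w : 0 < tau -> 0 < l -> l <= dist z w -> l <= dist z' w ->
  dist z z' <= D ->
  modulus (cauchy_ker tau z w ^+ 2 - cauchy_ker tau z' w ^+ 2) <= 2 * D / l ^+ 3.
Proof.
move=> t0 l0 lz lz' zD.
have d0 := lt_le_trans l0 lz; have d'0 := lt_le_trans l0 lz'.
have D0 : 0 <= D by apply: le_trans zD; exact: dist_ge0.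
have k1 : modulus (cauchy_ker tau z w) <= l^-1.
  by apply: le_trans (cauchy_ker_leV t0 d0) _; rewrite lef_pV2.
have k2 : modulus (cauchy_ker tau z' w) <= l^-1.
  by apply: le_trans (cauchy_ker_leV t0 d'0) _; rewrite lef_pV2.
have k3 : modulus (cauchy_ker tau z w - cauchy_ker tau z' w) <= D / l ^+ 2.
  rewrite ler_pdivlMr ?exprn_gt0//; apply: le_trans (zD); apply: le_trans (cauchy_ker_dist z z' w t0).
  by rewrite mulrC ler_wpM2r ?modulus_ge0// expr2 ler_pM// ltW.
rewrite subr_sqr modulusM.
apply: (@le_trans _ _ (D / l ^+ 2 * (l^-1 + l^-1))).
  apply: ler_pM; rewrite ?modulus_ge0//.
  by apply: le_trans (modulusD _ _) _; rewrite lerD.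
rewrite le_eqVlt; apply/orP; left; apply/eqP; field; by rewrite gt_eqF.
Qed.

Lemma cutoff_cauchy_test (tau r : R) z1 z z' : 0 < tau ->
  test (fun w => (cutoff z1 r w)%:C%C * (cauchy_ker tau z w ^+ 2 - cauchy_ker tau z' w ^+ 2))
    (fun w => (cutoff z1 r w)%:C%C * (2 * cauchy_ker tau z w * (poisson tau z w)%:C%C
       - 2 * cauchy_ker tau z' w * (poisson tau z' w)%:C%C)
     + dcutoff z1 r w * (cauchy_ker tau z w ^+ 2 - cauchy_ker tau z' w ^+ 2)).
Proof.
move=> t0; have k1 := test_cauchy_ker z t0; have k2 := test_cauchy_ker z' t0.
apply: test_ext (testM (test_cutoff z1 r) (testB (testM k1 k1) (testM k2 k2))) _ _ => w.
  by rewrite !expr2.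
by rewrite !expr2; ring.
Qed.

Lemma modulus_norm_sub (a b : R[i]) : `|modulus a - modulus b| <= modulus (a - b).
Proof.
have h1 := modulusB b a; have h2 := modulusB a b.
by rewrite (modulusBC b) in h1; rewrite ler_norml; apply/andP; split; lra.
Qed.

(** This lemma and the three after it isolate the linear arithmetic of [fatou_bound], where the
    variables stand for long kernel expressions. *)
Lemma sum_lower_in (o w a1 a2 a3 y1 y2 t3 d : R) : o + w <= a1 -> a2 <= y1 -> - t3 <= a3 ->
  0 <= y2 -> y1 + y2 <= d -> o + w - (t3 + d) <= a1 - a2 + a3.
Proof. lra. Qed.

Lemma sum_lower_out (a1 a2 a3 y1 y2 t3 d : R) : - y2 <= a1 -> a2 <= y1 -> - t3 <= a3 ->
  y1 + y2 <= d -> - (t3 + d) <= a1 - a2 + a3.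
Proof. lra. Qed.

Lemma disc_arith (dw dz d r1 r : R) : 0 < r -> dw <= d + dz -> dz <= 2 * r1 -> d <= r / 4 -> r1 <= r / 8 ->
  dw <= r.
Proof. lra. Qed.

Lemma disc_arith' (dw r : R) : 0 < r -> 3/2 * r <= dw -> dw <= r -> False.
Proof. lra. Qed.

End fatou_tools.

(** * The squared Cauchy kernel as an approximate derivative *)

Section plane_kernel.
Variable R : realType.
Notation mu2 := (@lebesgue_measure R \x @lebesgue_measure R)%E.
Notation P := (measurableTypeR R * measurableTypeR R)%type.
Implicit Types (z w : R * R) (tau r : R).

Lemma integrable_sq (g : R * R -> R) z r : (forall w, g v @[v --> w] --> g w) ->
  mu2.-integrable (sq z r) (EFin \o (g : P -> R)).
Proof.
move=> cg; pose M : R := `|z.1| + `|z.2| + `|r| + 1.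
have sM : sq z r `<=` box M.
  move=> w [h1 h2]; have k1 := ler_normD (w.1 - z.1) z.1; have k2 := ler_normD (w.2 - z.2) z.2.
  rewrite !subrK in k1 k2; have k3 := ler_norm r; have k4 := normr_ge0 z.1; have k5 := normr_ge0 z.2.
  by split; rewrite /M; lra.
have [C C0 HC] := compact_bounded_continuous (@compact_closed_box R M) (fun w _ => @cg w).
apply: (@integrable_bounded R _ _ M C) => //; first exact: measurable_sq.
  by apply: measurable_funTS; exact: measurable_cont.
by move=> w /sM[w1 w2]; apply: HC; split; exact: ltW.
Qed.

(** By [sqr_ker_massE], [2 dbar] of the squared kernel is [conj (w - z)] times this function, which
    is even about [z]. Over a symmetric square it kills constants, while a linear term [a (w - z)]
    is weighted by the positive kernel [sqr_ker_mass * dist^2]: the derivative [a] is extracted. *)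
Definition sqr_ker_mass tau z w : R := 2 * poisson tau z w / den tau z w.

Lemma sqr_ker_mass_ge0 tau z w : 0 < tau -> 0 <= sqr_ker_mass tau z w.
Proof. by move=> t0; rewrite /sqr_ker_mass divr_ge0 ?(ltW (den_gt0 _ _ t0))// mulr_ge0// poisson_ge0. Qed.

Lemma continuous_den tau z w : den tau z v @[v --> w] --> den tau z w.
Proof.
apply: cvgD; last exact: cvg_cst.
by rewrite expr2; apply: cvgM; exact: continuous_dist.
Qed.

Lemma continuous_poisson tau z w : 0 < tau -> poisson tau z v @[v --> w] --> poisson tau z w.
Proof.
move=> t0; apply: cvgM; first exact: cvg_cst.
apply: cvgV; first by rewrite expf_neq0// gt_eqF// den_gt0.
by rewrite expr2; apply: cvgM; exact: continuous_den.
Qed.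

Lemma continuous_sqr_ker_mass tau z w : 0 < tau -> sqr_ker_mass tau z v @[v --> w] --> sqr_ker_mass tau z w.
Proof.
move=> t0; apply: cvgM; last first.
  by apply: cvgV; [rewrite gt_eqF// den_gt0|exact: continuous_den].
by apply: cvgM; [exact: cvg_cst|exact: continuous_poisson].
Qed.

Lemma sqr_ker_massE tau z w : 2 * cauchy_ker tau z w * (poisson tau z w)%:C%C =
  conjc (cx w - cx z) * (sqr_ker_mass tau z w)%:C%C.
Proof. by rewrite /cauchy_ker /sqr_ker_mass !rmorphM/=; ring. Qed.

Lemma small_square z w tau : 0 < tau -> tau / 2 <= w.1 - z.1 <= tau -> tau / 2 <= w.2 - z.2 <= tau ->
  tau ^+ 2 / 2 <= dist z w ^+ 2 /\ den tau z w <= 3 * tau ^+ 2.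
Proof.
move=> t0 /andP[a1 a2] /andP[b1 b2]; rewrite /den /dist modulus_sqr /cx !reimE /=.
have := t0; rewrite !expr2; split; nra.
Qed.

(** With [dist^2 >= tau^2 / 2] and [den <= 3 tau^2], the product [4 tau^2 dist^2 / den^3] is at
    least [2 / (27 tau^2)]. *)
Lemma sqr_ker_mass_ge z w tau : 0 < tau -> tau / 2 <= w.1 - z.1 <= tau -> tau / 2 <= w.2 - z.2 <= tau ->
  2 / 27 / tau ^+ 2 <= sqr_ker_mass tau z w * dist z w ^+ 2.
Proof.
move=> t0 h1 h2; have [k1 k2] := small_square t0 h1 h2.
have D0 := den_gt0 z w t0; have T2 := exprn_gt0 2 t0.
rewrite /sqr_ker_mass /poisson.
have D3 : den tau z w ^+ 3 <= 27 * tau ^+ 6.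
  rewrite (_ : 27 * tau ^+ 6 = (3 * tau ^+ 2) ^+ 3); last by ring.
  by rewrite ler_pXn2r ?nnegrE ?(ltW D0)// mulr_ge0// ltW.
have D3p := exprn_gt0 3 D0.
rewrite [leRHS](_ : _ = 4 * tau ^+ 2 * dist z w ^+ 2 / den tau z w ^+ 3); last by field; rewrite gt_eqF.
rewrite ler_pdivlMr//.
apply: (@le_trans _ _ (2 / 27 / tau ^+ 2 * (27 * tau ^+ 6))).
  by rewrite ler_wpM2l// divr_ge0 ?(ltW T2)// divr_ge0.
rewrite [leLHS](_ : _ = 4 * tau ^+ 2 * (tau ^+ 2 / 2)); last by field; rewrite gt_eqF.
by rewrite ler_wpM2l// mulr_ge0// ltW.
Qed.

Lemma dist_sq_le z w r : sq z r w -> dist z w <= 2 * r.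
Proof.
move=> [h1 h2]; apply: le_trans (modulus_le _) _.
by rewrite /cx !reimE /=; lra.
Qed.

Lemma dist_sq_ge z w r : ~ sq z r w -> r <= dist z w.
Proof.
move=> ns; rewrite leNgt; apply/negP => dr; apply: ns.
have := ler_re (cx w - cx z); have := ler_im (cx w - cx z); rewrite -/(dist z w) /cx !reimE /= => h1 h2.
by split; lra.
Qed.

Lemma cx_refl z w : cx (refl z w) - cx z = - (cx w - cx z).
Proof. by apply: cplx_eqP; rewrite /refl /cx !reimE /=; ring. Qed.

Lemma dist_refl z w : dist z (refl z w) = dist z w.
Proof. by rewrite /dist cx_refl modulusN. Qed.

Lemma indic_sq_refl z w r : \1_(sq z r) (refl z w) = \1_(sq z r) w :> R.
Proof.
have e1 : 2 * z.1 - w.1 - z.1 = - (w.1 - z.1) by ring.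
have e2 : 2 * z.2 - w.2 - z.2 = - (w.2 - z.2) by ring.
rewrite !indicE (_ : (refl z w \in sq z r) = (w \in sq z r))//.
by apply/idP/idP; rewrite !inE /sq /refl /= e1 e2 !normrN.
Qed.

End plane_kernel.

(** * Bounding the derivative near the graph by the trace *)

Section fatou.
Variable R : realType.
Notation mu := (@lebesgue_measure R).
Notation mu2 := (@lebesgue_measure R \x @lebesgue_measure R)%E.
Notation P := (measurableTypeR R * measurableTypeR R)%type.
Variables (c s L : R) (phi : R -> R).
Hypothesis cs : c ^+ 2 + s ^+ 2 = 1.
Hypothesis lip : forall x y, `|phi x - phi y| <= L * `|x - y|.
Notation gpt := (gpt c s phi).
Notation gX := (gX c s).
Notation gY := (gY c s).
Notation gT := (gT c s phi).

Let L0 : 0 <= L.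
Proof. by have := lip 1 0; rewrite subr0 normr1 mulr1; apply: le_trans. Qed.

Lemma dist_gX w v : `|gX w - gX v| <= dist v w.
Proof.
rewrite -(@ler_pXn2r _ 2)// ?nnegrE ?dist_ge0// /dist (modulus_rot cs) real_normK ?num_real//.
by rewrite lerDl sqr_ge0.
Qed.
Lemma dist_gY w v : `|gY w - gY v| <= dist v w.
Proof.
rewrite -(@ler_pXn2r _ 2)// ?nnegrE ?dist_ge0// /dist (modulus_rot cs) real_normK ?num_real//.
by rewrite lerDr sqr_ge0.
Qed.
Lemma gY_gpt x t : gY (gpt x t) = phi x + t.
Proof. exact: gY_pnt. Qed.
Lemma dist_gT x w : `|gT w| <= (1 + L) * dist (gpt x 0) w.
Proof.
have h1 := dist_gX w (gpt x 0); have h2 := dist_gY w (gpt x 0).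
rewrite gX_gpt// in h1; rewrite gY_gpt addr0 in h2.
have h3 := lip (gX w) x.
have h4 : L * `|gX w - x| <= L * dist (gpt x 0) w by rewrite ler_wpM2l.
move: h2 h3; rewrite /gT !ler_norml => /andP[a1 a2] /andP[b1 b2]; apply/andP; split; lra.
Qed.

(** The pole lies [delta] below the graph and the point lies on or above it. Horizontal and vertical
    distances each bound [dist] from below, and the slope [L] accounts for the difference of the
    graph heights. *)
Lemma lower_reflected x1 x t delta : 0 <= t ->
  delta + `|x - x1| <= (2 + L) * dist (gpt x1 (- delta)) (gpt x t).
Proof.
move=> t0; have h1 := dist_gX (gpt x t) (gpt x1 (- delta)); have h2 := dist_gY (gpt x t) (gpt x1 (- delta)).
rewrite !gX_gpt// in h1; rewrite !gY_gpt in h2.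
have h4 : L * `|x - x1| <= L * dist (gpt x1 (- delta)) (gpt x t) by rewrite ler_wpM2l.
move: h2 (lip x x1); rewrite !ler_norml => /andP[a1 a2] /andP[b1 b2]; lra.
Qed.

(** The counterpart of [lower_reflected] for the pole in [D], where the separation from the graph
    comes from the nontangential condition with aperture [kappa]. *)
Lemma lower_nontangential kappa x1 x z : 0 < kappa ->
  kappa * dist (gpt x1 0) z <= dist (gpt x 0) z ->
  dist (gpt x1 0) z + `|x - x1| <= (1 + 2 / kappa) * dist z (gpt x 0).
Proof.
move=> k0 kd; have h1 := dist_gX (gpt x 0) (gpt x1 0); rewrite !gX_gpt// in h1.
have h2 := dist_tri (gpt x1 0) (gpt x 0) z.
have h3 : dist (gpt x1 0) z <= kappa^-1 * dist z (gpt x 0).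
  by rewrite ler_pdivlMl// distC (distC z) in kd *; rewrite (distC z).
have : 2 / kappa * dist z (gpt x 0) = 2 * (kappa^-1 * dist z (gpt x 0)) by rewrite mulrA.
lra.
Qed.

Variables (x0 rho h : R) (D : set (R * R)).
Hypothesis (h0 : 0 < h) (oD : open D).
Hypothesis chartD : forall x t, `|x - x0| < rho -> `|t| < h -> (D (gpt x t) <-> 0 < t).
Notation I := (`](x0 - rho)%R, (x0 + rho)%R[%classic : set (measurableTypeR R)).
Variables (A : R * R -> R[i]) (M : R) (b : R -> R[i]) (x1 r : R).
Hypothesis Ac : forall w, D w -> ccont A w.
Hypothesis Aw : weakly_hol D A.
Hypothesis M0 : 0 <= M.
Hypothesis AM : forall x t, `|x - x0| < rho -> 0 < t < h -> modulus (A (gpt x t)) <= M.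
Hypothesis mb : measurable_fun I (fun x => modulus (b x)).
Hypothesis Ab : forall x, `|x - x0| < rho -> forall e, 0 < e -> exists2 d, 0 < d &
  forall t, 0 < t < d -> modulus (A (gpt x t) - b x) < e.
Hypothesis (r0 : 0 < r) (rX : `|x1 - x0| + 3/2 * r < rho) (rT : (1 + L) * (3/2 * r) < h).
Let z1 := gpt x1 0.

Lemma disc_chart w : dist z1 w <= 3/2 * r ->
  [/\ `|gX w - x0| <= `|x1 - x0| + 3/2 * r, `|gX w - x0| < rho,
      `|gT w| <= (1 + L) * (3/2 * r) & `|gT w| < h].
Proof.
move=> dw; have h1 := dist_gX w z1; rewrite gX_gpt// in h1.
have h2 : `|gX w - x0| <= `|x1 - x0| + 3/2 * r.
  by have := ler_normD (gX w - x1) (x1 - x0); rewrite addrA subrK; lra.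
have h3 : `|gT w| <= (1 + L) * (3/2 * r).
  by apply: le_trans (dist_gT x1 w) _; rewrite ler_wpM2l ?addr_ge0.
by split=> //; [exact: le_lt_trans rX|exact: le_lt_trans rT].
Qed.

Lemma disc_domain w : D w -> dist z1 w <= 3/2 * r -> 0 < gT w /\ modulus (A w) <= M.
Proof.
move=> Dw dw; have [_ h1 _ h2] := disc_chart dw.
have t0 : 0 < gT w by apply/(chartD h1 h2); rewrite gptK.
split=> //; rewrite -(gptK phi cs w); apply: AM => //.
by rewrite t0/= -(gtr0_norm t0).
Qed.

Lemma boundary_le x : `|x - x0| < rho -> modulus (b x) <= M.
Proof.
move=> xI; apply/ler_addgt0Pr => e e0; have [d d0 Hd] := Ab xI e0.
pose t := Num.min d h / 2.
have m0 : 0 < Num.min d h by rewrite lt_min d0.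
have t0 : 0 < t by rewrite divr_gt0.
have : t < Num.min d h by rewrite /t ltr_pdivrMr// mulr_natr mulr2n ltrDl.
rewrite lt_min => /andP[td th].
have h1 := Hd t; rewrite t0 td in h1; have {}h1 := h1 isT.
have h2 := @AM x t xI; rewrite t0 th in h2; have {}h2 := h2 isT.
have := modulusD (A (gpt x t)) (- (A (gpt x t) - b x)).
by rewrite modulusN opprB addrC subrK; lra.
Qed.

(** Near [x1] the bound [B <= eta * y] turns the cubic kernel into [eta] times a Poisson kernel,
    whose integral is at most [pi] whatever [delta]. At distance [d0] or more the kernel itself is
    at most [delta / d0^3]. The total is thus of order [eta] plus a multiple of [delta]. *)
Lemma boundary_kernel_le (delta eta d0 y B S : R) : 0 < delta -> 0 <= eta -> 0 < d0 -> 0 <= B -> B <= M ->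
  0 <= y -> S = delta + y -> (y < d0 -> B <= eta * y) ->
  B * (delta / S ^+ 3) <= eta * (delta / (delta ^+ 2 + y ^+ 2)) + M * delta / d0 ^+ 3.
Proof.
move=> de0 eta0 d00 B0 BM y0 SE By.
have S0 : 0 < S by rewrite SE; lra.
have S3 := exprn_gt0 3 S0; have D3 := exprn_gt0 3 d00.
have Q0 : 0 < delta ^+ 2 + y ^+ 2 by have := exprn_gt0 2 de0; have := sqr_ge0 y; lra.
have t1 : 0 <= eta * (delta / (delta ^+ 2 + y ^+ 2)) by rewrite mulr_ge0// divr_ge0// ltW.
have t2 : 0 <= M * delta / d0 ^+ 3 by rewrite divr_ge0 ?mulr_ge0// ltW.
have [yd|dy] := ltP y d0.
  apply: le_trans (_ : eta * (delta / (delta ^+ 2 + y ^+ 2)) <= _); last by rewrite lerDl.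
  apply: (@le_trans _ _ (eta * y * (delta / S ^+ 3))).
    by rewrite ler_wpM2r ?By// divr_ge0 ?(ltW S3)// ltW.
  rewrite -mulrA ler_wpM2l// mulrCA ler_wpM2l ?(ltW de0)// ler_pdivrMr// mulrC ler_pdivlMr//.
  by rewrite SE; nra.
apply: le_trans (_ : M * delta / d0 ^+ 3 <= _); last by rewrite lerDr.
rewrite mulrA; apply: ler_pM; rewrite ?mulr_ge0 ?invr_ge0 ?(ltW de0) ?(ltW S3)//.
  by rewrite ler_wpM2r// ltW.
rewrite lef_pV2 ?posrE// ler_pXn2r ?nnegrE ?(ltW d00) ?(ltW S0)//; lra.
Qed.

Lemma dist_reflected delta : 0 <= delta -> dist z1 (gpt x1 (- delta)) = delta.
Proof.
move=> d0; apply/eqP; rewrite -(@eqrXn2 _ 2) ?dist_ge0//.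
rewrite /dist (modulus_rot cs) !gX_gpt// !gY_gpt subrr expr0n add0r; apply/eqP; ring.
Qed.

Let Mb : R := `|z1.1| + `|z1.2| + 2 * r.
Let V : R := fine (mu2 (box Mb : set P)).

Lemma disc_box w : dist z1 w <= 3/2 * r -> box Mb w.
Proof.
move=> dw; have := ler_re (cx w - cx z1); have := ler_im (cx w - cx z1).
rewrite -/(dist z1 w) /Mb /cx; move: z1 dw => z dw; rewrite !reimE /= => h1 h2.
have k1 := ler_normD (w.1 - z.1) z.1; have k2 := ler_normD (w.2 - z.2) z.2.
rewrite !subrK in k1 k2; have k4 := normr_ge0 z.1; have k5 := normr_ge0 z.2; have hr := r0.
by split => /=; lra.
Qed.

Lemma modulus2 : modulus (2 : R[i]^o) = 2.
Proof.
have -> : (2 : R[i]^o) = (2 : R)%:C%C by rewrite rmorph_nat.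
by rewrite modulusC gtr0_norm.
Qed.

Section pole.
Variables (tau kappa delta q : R) (z : R * R) (u a : R[i]).
Hypotheses (t0 : 0 < tau) (Dz : D z) (zd : dist z1 z = delta) (de0 : 0 < delta) (der : delta <= r / 4).
Hypotheses (k0 : 0 < kappa) (u1 : modulus u = 1) (qE : q = 3 + L + 2 / kappa).
Let zs := gpt x1 (- delta).
Let chi w := cutoff z1 r w.
Let psi w : R[i] := u * ((chi w)%:C%C * (cauchy_ker tau z w ^+ 2 - cauchy_ker tau zs w ^+ 2)).
Let d w : R[i] := u * ((chi w)%:C%C * (2 * cauchy_ker tau z w * (poisson tau z w)%:C%C
       - 2 * cauchy_ker tau zs w * (poisson tau zs w)%:C%C)
     + dcutoff z1 r w * (cauchy_ker tau z w ^+ 2 - cauchy_ker tau zs w ^+ 2)).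

Let hL0 : 0 <= L. Proof. exact: L0. Qed.
Let k20 : 0 < 2 / kappa. Proof. by rewrite divr_gt0. Qed.
Let q0 : 0 < q.
Proof. by have := hL0; have := k20; rewrite qE; lra. Qed.

Lemma pole_dist : dist z zs <= 2 * delta.
Proof.
by have := dist_tri z zs z1; rewrite (distC z z1) zd dist_reflected ?(ltW de0)//; lra.
Qed.

(** The poles are at most [2 delta] apart and both at distance at least [S / q] from the boundary
    point, hence the bound [2 (2 delta) / (S / q)^3]; [q] is the sum of the constants of
    [lower_nontangential] and [lower_reflected]. *)
Lemma psi_boundary x : kappa * delta <= dist (gpt x 0) z ->
  modulus (psi (gpt x 0)) <= 4 * q ^+ 3 * (delta / (delta + `|x - x1|) ^+ 3).
Proof.
move=> kz; set S := delta + _.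
have S0 : 0 < S by have := normr_ge0 (x - x1); rewrite /S; have := de0; lra.
have l0 : 0 < S / q by rewrite divr_gt0// q0.
have l1 : S / q <= dist z (gpt x 0).
  rewrite ler_pdivrMr ?q0// mulrC; rewrite -zd in kz.
  have := lower_nontangential k0 kz; rewrite -/z1 zd -/S => H; apply: le_trans H _.
  by rewrite ler_wpM2r ?dist_ge0// qE; have := hL0; lra.
have l2 : S / q <= dist zs (gpt x 0).
  rewrite ler_pdivrMr ?q0// mulrC.
  apply: le_trans (lower_reflected x1 x delta (lexx 0)) _.
  by rewrite ler_wpM2r ?dist_ge0// qE; have := k20; lra.
have := cauchy_ker_sqr_diff t0 l0 l1 l2 pole_dist.
rewrite /psi !modulusM u1 mul1r modulusC => H.
have /andP[c0 c1] := cutoff_bounds z1 r (gpt x 0).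
rewrite ger0_norm//; apply: le_trans (ler_wpM2r (modulus_ge0 _) c1) _.
rewrite mul1r; apply: le_trans H _.
rewrite le_eqVlt; apply/orP; left; apply/eqP; field.
by rewrite (gt_eqF S0) gt_eqF// q0.
Qed.

Lemma d_out w : 3/2 * r <= dist z1 w -> d w = 0.
Proof.
by move=> dw; rewrite /d /chi; have [-> ->] := cutoff_out r0 dw; rewrite !mul0r addr0 mulr0.
Qed.

(** The reflected pole stays at distance at least [delta / q] from the part of [D] in the disc, so
    its dbar contributes only order [tau^2]. *)
Lemma d_reflected w : D w -> dist z1 w <= 3/2 * r ->
  modulus (A w * (u * ((chi w)%:C%C * (2 * cauchy_ker tau zs w * (poisson tau zs w)%:C%C)))) <=
  4 * M * q ^+ 5 / delta ^+ 5 * tau ^+ 2.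
Proof.
move=> Dw dw; have [tw AwM] := disc_domain Dw dw.
have l2 : delta / q <= dist zs w.
  rewrite ler_pdivrMr ?q0// mulrC.
  have := lower_reflected x1 (gX w) delta (ltW tw); rewrite gptK// => H.
  apply: le_trans (_ : (2 + L) * dist zs w <= _); first by apply: le_trans H; rewrite lerDl.
  by rewrite ler_wpM2r ?dist_ge0// qE; have := k20; lra.
have l0 : 0 < delta / q by rewrite divr_gt0// q0.
have dz0 := lt_le_trans l0 l2.
have H := cauchy_ker_poisson_le t0 dz0.
have H2 : 2 * tau ^+ 2 / dist zs w ^+ 5 <= 2 * tau ^+ 2 / (delta / q) ^+ 5.
  apply: ler_wpM2l; first by apply: mulr_ge0 => //; exact: sqr_ge0.
  by rewrite lef_pV2 ?posrE ?exprn_gt0// ler_pXn2r ?nnegrE ?dist_ge0// ltW.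
have /andP[c0 c1] := cutoff_bounds z1 r w.
have p0 := poisson_ge0 tau zs w.
move: (cauchy_ker tau zs w) (poisson tau zs w) p0 H => K1 P1 p0 H.
rewrite !modulusM u1 mul1r (modulusC (chi w)) (modulusC P1) (ger0_norm c0) (ger0_norm p0).
rewrite modulus2.
apply: (@le_trans _ _ (M * (1 * (2 * (2 * tau ^+ 2 / (delta / q) ^+ 5))))); last first.
  rewrite le_eqVlt; apply/orP; left; apply/eqP; field.
  by rewrite (gt_eqF de0) gt_eqF// q0.
have mk := modulus_ge0 K1.
apply: ler_pM => //; rewrite ?modulus_ge0//; first by rewrite !mulr_ge0.
apply: ler_pM => //; first by rewrite !mulr_ge0.
by rewrite -mulrA ler_wpM2l//; exact: le_trans H H2.
Qed.

(** The gradient of the cutoff lives outside radius [r], at distance at least [r / 2] from both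
    poles, where the two squared kernels nearly cancel. This gain of a factor [delta] is the purpose
    of the second pole. The constant is [384 = 12 * 4 * 2^3]. *)
Lemma d_cutoff w : D w -> dist z1 w <= 3/2 * r ->
  modulus (A w * (u * (dcutoff z1 r w * (cauchy_ker tau z w ^+ 2 - cauchy_ker tau zs w ^+ 2)))) <=
  384 * M * delta / r ^+ 4.
Proof.
move=> Dw dw; have [tw AwM] := disc_domain Dw dw.
have r4 := exprn_gt0 4 r0.
have [dr|dr] := leP (dist z1 w) r.
  have [_ ->] := cutoff_in r0 dr; rewrite mul0r !mulr0 modulus0.
  by apply: divr_ge0; [apply: mulr_ge0 (ltW de0); apply: mulr_ge0 M0; exact: ler0n|exact: ltW].
have l0 : 0 < r / 2 by rewrite divr_gt0.
have l1 : r / 2 <= dist z w.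
  by have := dist_tri z1 w z; rewrite zd; have := der; lra.
have l2 : r / 2 <= dist zs w.
  by have := dist_tri z1 w zs; rewrite dist_reflected ?(ltW de0)//; have := der; lra.
have H := cauchy_ker_sqr_diff t0 l0 l1 l2 pole_dist.
have H2 := dcutoff_le z1 w r0.
move: (dcutoff z1 r w) (cauchy_ker tau z w ^+ 2 - _) H H2 => dc Kd H H2.
rewrite !modulusM u1 mul1r.
apply: (@le_trans _ _ (M * (12 / r * (2 * (2 * delta) / (r / 2) ^+ 3)))); last first.
  rewrite le_eqVlt; apply/orP; left; apply/eqP; field; by rewrite gt_eqF.
apply: ler_pM => //; rewrite ?modulus_ge0//; first by rewrite mulr_ge0 ?modulus_ge0.
by apply: ler_pM => //; rewrite modulus_ge0.
Qed.

Lemma d_far r1 w : 0 < r1 -> D w -> dist z1 w <= 3/2 * r -> r1 <= dist z w ->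
  modulus (A w * (u * ((chi w)%:C%C * (2 * cauchy_ker tau z w * (poisson tau z w)%:C%C)))) <=
  4 * M / r1 ^+ 5 * tau ^+ 2.
Proof.
move=> l0 Dw dw l2; have [tw AwM] := disc_domain Dw dw.
have dz0 := lt_le_trans l0 l2.
have H := cauchy_ker_poisson_le t0 dz0.
have H2 : 2 * tau ^+ 2 / dist z w ^+ 5 <= 2 * tau ^+ 2 / r1 ^+ 5.
  apply: ler_wpM2l; first by apply: mulr_ge0 => //; exact: sqr_ge0.
  by rewrite lef_pV2 ?posrE ?exprn_gt0// ler_pXn2r ?nnegrE ?dist_ge0// ltW.
have /andP[c0 c1] := cutoff_bounds z1 r w.
have p0 := poisson_ge0 tau z w.
move: (cauchy_ker tau z w) (poisson tau z w) p0 H => K1 P1 p0 H.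
rewrite !modulusM u1 mul1r (modulusC (chi w)) (modulusC P1) (ger0_norm c0) (ger0_norm p0).
rewrite modulus2.
apply: (@le_trans _ _ (M * (1 * (2 * (2 * tau ^+ 2 / r1 ^+ 5))))); last first.
  rewrite le_eqVlt; apply/orP; left; apply/eqP; field; by rewrite (gt_eqF l0).
have mk := modulus_ge0 K1.
apply: ler_pM => //; rewrite ?modulus_ge0//; first by rewrite !mulr_ge0.
apply: ler_pM => //; first by rewrite !mulr_ge0.
by rewrite -mulrA ler_wpM2l//; exact: le_trans H H2.
Qed.

(** Expand [A w = A z + a (w - z) + E]. The first term gives the odd part, the second gives
    [modulus a] times the mass thanks to the phase [u], and [E] costs at most [delta] times the same
    mass. *)
Lemma d_near w : dist z1 w <= r -> u * a = (modulus a)%:C%C ->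
  modulus (A w - A z - a * (cx w - cx z)) <= delta * dist z w ->
  sqr_ker_mass tau z w * re (u * (A z * conjc (cx w - cx z))) + (modulus a - delta) * (sqr_ker_mass tau z w * dist z w ^+ 2) <=
  re (A w * (u * ((chi w)%:C%C * (2 * cauchy_ker tau z w * (poisson tau z w)%:C%C)))).
Proof.
move=> dw ua dA; have [cw _] := cutoff_in r0 dw; rewrite /chi cw rmorph1 mul1r sqr_ker_massE.
set v := cx w - cx z; set k := sqr_ker_mass tau z w; have k00 : 0 <= k := sqr_ker_mass_ge0 z w t0.
set E := A w - A z - a * v in dA.
have -> : A w * (u * (conjc v * k%:C%C)) =
    (u * (A z * conjc v) + (modulus a * dist z w ^+ 2)%:C%C + u * E * conjc v) * k%:C%C.
  have -> : A w = A z + a * v + E by rewrite /E; ring.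
  have -> : (modulus a * dist z w ^+ 2)%:C%C = u * a * (v * conjc v) by rewrite ua mulJ -rmorphM.
  ring.
have -> t : re (t * k%:C%C) = k * re t by rewrite !reimE; ring.
rewrite !reD reC [leLHS](_ : _ = k * (re (u * (A z * conjc v)) + (modulus a - delta) * dist z w ^+ 2)); last by ring.
rewrite ler_wpM2l//.
have hE : `|re (u * E * conjc v)| <= delta * dist z w ^+ 2.
  apply: le_trans (ler_re _) _; rewrite !modulusM u1 mul1r modulusJ -/(dist z w) expr2 mulrA.
  by rewrite ler_wpM2r ?dist_ge0.
move: hE; rewrite ler_norml => /andP[hE _]; lra.
Qed.

End pole.

Lemma integral_kernel_le (delta eta b1 k : R) (G : R -> R) : 0 < rho -> 0 < delta -> 0 <= eta -> 0 <= b1 -> 0 <= k -> measurable_fun I G ->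
  (forall x, `|x - x0| < rho -> 0 <= G x <= k * (eta * (delta / (delta ^+ 2 + (x - x1) ^+ 2)) + b1)) ->
  (\int[mu]_(x in I) (G x)%:E <= (k * (eta * pi + 2 * rho * b1))%:E)%E.
Proof.
move=> rho0 de0 eta0 b10 k0 mG HG.
have mI : measurable I by exact: measurable_itv.
have ab : x0 - rho < x0 + rho by lra.
have pos (x : R) : 0 < delta ^+ 2 + (x - x1) ^+ 2 by rewrite ltr_pwDl ?exprn_gt0// sqr_ge0.
have cf : continuous (fun x : R => delta / (delta ^+ 2 + (x - x1) ^+ 2)).
  move=> x; apply: cvgM; first exact: cvg_cst.
  apply: cvgV; first by rewrite gt_eqF.
  apply: cvgD; first exact: cvg_cst.
  by rewrite expr2; apply: cvgM; apply: cvgB; [exact: cvg_id|exact: cvg_cst|exact: cvg_id|exact: cvg_cst].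
have mf : measurable_fun I (fun x : measurableTypeR R => (delta / (delta ^+ 2 + (x - x1) ^+ 2))%:E).
  by apply/measurable_EFinP; apply: measurable_funTS; exact: continuous_measurable_fun.
have p0 x : (0 <= (delta / (delta ^+ 2 + (x - x1) ^+ 2))%:E)%E by rewrite lee_fin divr_ge0 ?(ltW de0) ?(ltW (pos x)).
have eta0' : (0 <= eta%:E)%E by rewrite lee_fin.
have k0' : (0 <= k%:E)%E by rewrite lee_fin.
have m1 : measurable_fun I (fun x : measurableTypeR R => (eta%:E * (delta / (delta ^+ 2 + (x - x1) ^+ 2))%:E)%E).
  by apply: emeasurable_funM => //; exact: measurable_cst.
have m2 : measurable_fun I (fun x : measurableTypeR R => (eta%:E * (delta / (delta ^+ 2 + (x - x1) ^+ 2))%:E + b1%:E)%E).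
  by apply: emeasurable_funD => //; exact: measurable_cst.
apply: (@le_trans _ _ (\int[mu]_(x in I) (k%:E * (eta%:E * (delta / (delta ^+ 2 + (x - x1) ^+ 2))%:E + b1%:E)))%E).
  apply: ge0_le_integral => //.
  - by move=> x /=; rewrite in_itv/= -ltr_distl lee_fin => /HG/andP[].
  - exact/measurable_EFinP.
  - by apply: emeasurable_funM => //; exact: measurable_cst.
  - by move=> x /=; rewrite in_itv/= -ltr_distl => /HG/andP[_ H]; rewrite lee_fin.
rewrite ge0_integralZl//; last by move=> x _; rewrite adde_ge0 ?mule_ge0// lee_fin.
rewrite ge0_integralD//; last by move=> x _; rewrite mule_ge0.
rewrite ge0_integralZl// EFinM lee_wpmul2l// EFinD; apply: leeD.
  by rewrite EFinM lee_wpmul2l//; exact: integral_poisson_le.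
rewrite integral_cst//.
have := lebesgue_measure_itv `](x0 - rho), (x0 + rho)[; rewrite /= lte_fin ab => ->.
by rewrite -EFinD -EFinM lee_fin mulrC ler_wpM2r//; lra.
Qed.

(* The test function is the difference of the squared Cauchy kernels centred at
   [z] and at the point [gpt x1 (- delta)] on the other side of the graph. *)
Lemma fatou_bound z (a : R[i]) (kappa delta q eta d0 : R) :
  D z -> dist z1 z = delta -> 0 < delta -> delta <= r / 4 ->
  0 < kappa -> (forall x, `|x - x0| < rho -> kappa * delta <= dist (gpt x 0) z) ->
  cdiff A (fun=> a) z -> q = 3 + L + 2 / kappa -> 0 <= eta -> 0 < d0 ->
  (forall x, `|x - x0| < rho -> `|x - x1| < d0 -> modulus (b x) <= eta * `|x - x1|) ->
  (modulus a - delta) / 54 <= (delta + 384 * M * delta / r ^+ 4) * V +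
    12 * (1 + L) * (4 * q ^+ 3 * (eta * pi + 2 * rho * (M * delta / d0 ^+ 3))).
Proof.
move=> Dz zd de0 der k0 kz dA qE eta0 d00 beta.
have V0 : 0 <= V by rewrite fine_ge0.
have k20 : 0 < 2 / kappa by rewrite divr_gt0.
have hL0 : 0 <= L := L0.
have q0 : 0 < q by rewrite qE; lra.
have rho0 : 0 < rho by apply: le_lt_trans rX; rewrite addr_ge0// mulr_ge0// ltW.
have Md0 : 0 <= M * delta := mulr_ge0 M0 (ltW de0).
have b1 : 0 <= M * delta / d0 ^+ 3 := divr_ge0 Md0 (exprn_ge0 3 (ltW d00)).
have [c384 c384E] : exists x : R, x = 384 by exists 384.
rewrite -c384E.
have c3840 : 0 <= c384 by rewrite c384E; exact: ler0n.
have T30 : 0 <= c384 * M * delta / r ^+ 4.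
  by have := mulr_ge0 c3840 Md0; rewrite mulrA => H; exact: divr_ge0 H (exprn_ge0 4 (ltW r0)).
set T3 := c384 * M * delta / r ^+ 4 in T30 *.
have R2 : 0 <= 12 * (1 + L) * (4 * q ^+ 3 * (eta * pi + 2 * rho * (M * delta / d0 ^+ 3))).
  apply: mulr_ge0; first by rewrite mulr_ge0// addr_ge0.
  apply: mulr_ge0; first by rewrite mulr_ge0// exprn_ge0// ltW.
  apply: addr_ge0; first by rewrite mulr_ge0// pi_ge0.
  by apply: mulr_ge0 => //; apply: mulr_ge0 => //; exact: ltW.
have [/ltW ad|da] := ltP (modulus a) delta.
  apply: (@le_trans _ _ 0); first by rewrite pmulr_lle0 ?subr_le0.
  apply: addr_ge0 => //; apply: mulr_ge0 => //; apply: addr_ge0 => //; exact: ltW.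
have [e1 e10 He1] : exists2 e, 0 < e & forall w, `|z.1 - w.1| < e -> `|z.2 - w.2| < e ->
    D w /\ modulus (A w - A z - a * (cx w - cx z)) <= delta * dist z w.
  apply/nbhs2P; near=> w; split; last by near: w; exact: dA.
  by near: w; exact: open_nbhs_nbhs.
pose r1 := Num.min e1 (r / 8) / 2.
have r10 : 0 < r1 by rewrite divr_gt0// lt_min e10 divr_gt0.
have [r1e r1r] : r1 < e1 /\ r1 <= r / 8.
  have m0' : 0 < Num.min e1 (r / 8) by rewrite lt_min e10 divr_gt0.
  have m1 : Num.min e1 (r / 8) <= e1 by rewrite ge_min lexx.
  have m2 : Num.min e1 (r / 8) <= r / 8 by rewrite ge_min lexx orbT.
  by rewrite /r1; split; lra.
have Hsq w : sq z r1 w -> D w /\ modulus (A w - A z - a * (cx w - cx z)) <= delta * dist z w.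
  by move=> [w1 w2]; apply: He1; rewrite distrC; [exact: le_lt_trans w1 r1e|exact: le_lt_trans w2 r1e].
pose K : R := 4 * M * q ^+ 5 / delta ^+ 5 + 4 * M / r1 ^+ 5.
have K0 : 0 <= K.
  apply: addr_ge0; apply: divr_ge0; do ?exact: exprn_ge0 (ltW _).
    by apply: mulr_ge0; [exact: mulr_ge0|exact: exprn_ge0 (ltW q0)].
  exact: mulr_ge0.
(* [K] collects the coefficients of [tau^2] in [d_reflected] and [d_far]; the smoothing scale,
   chosen after all the rest, makes their total at most [delta]. *)
have [tau [t0 tr tK]] : exists tau, [/\ 0 < tau, tau <= r1 & tau ^+ 2 * K <= delta].
  have K1 : 0 < K + 1 by rewrite ltr_wpDl.
  exists (Num.min r1 (Num.min 1 (delta / (K + 1)))); split.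
  - by rewrite !lt_min r10 ltr01 divr_gt0.
  - by rewrite ge_min lexx.
  set t := Num.min _ _; have t0 : 0 < t by rewrite !lt_min r10 ltr01 divr_gt0.
  have t1 : t <= 1 by rewrite !ge_min lexx !orbT.
  have t2 : t * (K + 1) <= delta by rewrite -ler_pdivlMr// !ge_min lexx !orbT.
  by rewrite expr2; nra.
have [u u1 uE] := modulus_phase a.
pose zs := gpt x1 (- delta).
have zszs : dist z zs <= 2 * delta.
  have := dist_tri z zs z1; rewrite (distC z z1) zd dist_reflected ?(ltW de0)//; lra.
pose chi w := cutoff z1 r w.
pose psi w : R[i] := u * ((chi w)%:C%C * (cauchy_ker tau z w ^+ 2 - cauchy_ker tau zs w ^+ 2)).
pose d w : R[i] := u * ((chi w)%:C%C * (2 * cauchy_ker tau z w * (poisson tau z w)%:C%C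
       - 2 * cauchy_ker tau zs w * (poisson tau zs w)%:C%C)
     + dcutoff z1 r w * (cauchy_ker tau z w ^+ 2 - cauchy_ker tau zs w ^+ 2)).
have tpsi : test psi d by apply: testZ; exact: cutoff_cauchy_test.
pose rho' := `|x1 - x0| + 3/2 * r; pose h' := (1 + L) * (3/2 * r).
have rho'0 : 0 < rho' < rho.
  by rewrite /rho' rX andbT ltr_wpDl// mulr_gt0.
have h'0 : 0 < h' < h.
  by rewrite /h' rT andbT mulr_gt0 ?mulr_gt0// ltr_pwDl.
have spsi : supported (gpatch c s phi x0 rho' (- h') h') psi.
  move=> w nw; have [dw|dw] := ltP (dist z1 w) (3/2 * r).
    have [k1 _ k2 _] := disc_chart (ltW dw).
    by exfalso; apply: nw; split => //; rewrite -ler_norml.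
  by rewrite /psi /chi; have [-> _] := cutoff_out r0 dw; rewrite mul0r mulr0.
have fg : {ae mu, forall x, I x -> modulus (A (gpt x t)) @[t --> 0^'+] --> modulus (b x)}.
  apply: aeW => x /= xI; have {}xI : `|x - x0| < rho by rewrite in_itv/= -ltr_distl in xI.
  apply/cvgrPdist_lt => e e0; have [dd dd0 Hd] := Ab xI e0.
  exists dd => //= t /=; rewrite sub0r normrN => td tp.
  have tdd : t < dd by apply: le_lt_trans td; exact: ler_norm.
  have := Hd t; rewrite tp tdd => /(_ isT).
  by apply: le_lt_trans; rewrite distrC; exact: modulus_norm_sub.
have IM : (\int[mu]_(x in I) M%:E < +oo)%E.
  rewrite integral_cst; last exact: measurable_itv.
  have := lebesgue_measure_itv `](x0 - rho), (x0 + rho)[; rewrite /= lte_fin => ->.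
  by case: ifPn => _; rewrite -?EFinD -?EFinM ?mule0 ltry.
have fN x t : `|x - x0| < rho -> 0 < t < h -> ((modulus (A (gpt x t)))%:E <= M%:E)%E.
  by move=> xI th; rewrite lee_fin; exact: AM.
have M0e (x : R) : (0 <= M%:E)%E by rewrite lee_fin.
have ub := chart_bound cs lip h0 oD chartD Ac Aw tpsi rho'0 h'0 spsi
  (@measurable_cst _ _ _ _ _ M%:E) M0e IM fN mb (fun x => modulus_ge0 _) fg.
have iA := integrable_fd cs lip h0 oD chartD Ac tpsi rho'0 h'0 spsi
  (@measurable_cst _ _ _ _ _ M%:E) M0e IM fN.
have bd : (\int[mu]_(x in I) (modulus (b x) * modulus (psi (gpt x 0)))%:E <=
    (4 * q ^+ 3 * (eta * pi + 2 * rho * (M * delta / d0 ^+ 3)))%:E)%E.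
  have q30 : 0 <= 4 * q ^+ 3 by apply: mulr_ge0 => //; exact: exprn_ge0 (ltW q0).
  apply: (@integral_kernel_le delta) => // [|x xI].
    apply: measurable_funM => //; apply: measurable_funTS; apply: continuous_measurable_fun => x.
    have [cpsi _] := test_cont (gpt x 0) tpsi.
    exact: (cvg_comp _ _ (@continuous_gptl _ _ _ _ _ lip 0 x) (ccont_modulus cpsi)).
  have bx0 := modulus_ge0 (b x); have psi0 := modulus_ge0 (psi (gpt x 0)).
  rewrite mulr_ge0//=.
  have h1 := psi_boundary t0 zd de0 k0 u1 qE (kz x xI).
  apply: le_trans (ler_wpM2l bx0 h1) _; rewrite mulrCA ler_wpM2l//.
  apply: le_trans (boundary_kernel_le de0 eta0 d00 bx0 (boundary_le xI) (normr_ge0 (x - x1)) erefl _) _.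
    by move=> xd; exact: beta.
  by rewrite real_normK ?num_real.
(* The contribution of the constant [A z], odd about [z] and cut off to the small square. *)
pose O (w : P) : R := sqr_ker_mass tau z w * re (u * (A z * conjc (cx w - cx z))) * \1_(sq z r1) w.
have lb := @integral_lower_bound R D (fun w => re (A w * d w)) O
  (fun w => sqr_ker_mass tau z w * dist z w ^+ 2) z r1 tau (2 / 27) (modulus a - delta) (T3 + delta) Mb.
have lbE : (((modulus a - delta) * (2 / 27 / 4) - (T3 + delta) * fine (mu2 (box Mb : set P)))%:E <=
         \int[mu2]_(w in D) (re (A w * d w))%:E)%E.
  have rr : 0 < r := r0.
  have sqD w : sq z r1 w -> dist z1 w <= r.
    by move=> /dist_sq_le H; have := dist_tri z1 w z; rewrite zd => H2; exact: disc_arith rr H2 H der r1r.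
  have cW w : sqr_ker_mass tau z v * dist z v ^+ 2 @[v --> w] --> sqr_ker_mass tau z w * dist z w ^+ 2.
    by apply: cvgM; [exact: continuous_sqr_ker_mass|rewrite expr2; apply: cvgM; exact: continuous_dist].
  apply: lb => //.
  - exact: open_measurable2.
  - by move=> w /Hsq[].
  - have mS := measurable_sq z r1.
    have -> : EFin \o O = (EFin \o (fun w => sqr_ker_mass tau z w * re (u * (A z * conjc (cx w - cx z))))) \_ (sq z r1).
      by apply/funext => w; rewrite patchE /= /O indicE; case: (w \in _); rewrite ?mulr1 ?mulr0.
    apply/(integrable_mkcond _ mS); apply: integrable_sq => w; apply: cvgM; first exact: continuous_sqr_ker_mass.
    have [cc _] := test_cont w (testZ u (testZ (A z) (test_subJ z))).
    by case: cc.
  - move=> w; rewrite /O indic_sq_refl cx_refl /sqr_ker_mass /den /poisson /den dist_refl.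
    by rewrite rmorphN/= !mulrN reN; ring.
  - by move=> w nw; rewrite /O indicE memNset// mulr0.
  - by apply: measurable_cont => w; exact: cW.
  - by move=> w; rewrite mulr_ge0 ?sqr_ker_mass_ge0// sqr_ge0.
  - exact: integrable_sq.
  - by move=> w; exact: sqr_ker_mass_ge.
  - by rewrite subr_ge0.
  - by rewrite addr_ge0// ltW.
  move=> w Dw.
  have [dw|/ltW dw] := leP (dist z1 w) (3/2 * r); last first.
    have -> : d w = 0 by apply: d_out.
    rewrite mulr0.
    have nsq : ~ sq z r1 w by move=> /sqD; exact: disc_arith' rr dw.
    rewrite /O indicE memNset// !mulr0 add0r sub0r re0 oppr_le0 mulr_ge0//.
    by rewrite addr_ge0// ltW.
  have -> : \1_(box Mb : set P) w = 1 :> R by rewrite indicE mem_set//; exact: disc_box.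
  have h2 := d_reflected t0 de0 k0 u1 qE Dw dw.
  have h3 := d_cutoff t0 zd de0 der u1 Dw dw; rewrite -c384E -/T3 in h3.
  have Ew : re (A w * d w) = re (A w * (u * ((chi w)%:C%C * (2 * cauchy_ker tau z w * (poisson tau z w)%:C%C))))
     - re (A w * (u * ((chi w)%:C%C * (2 * cauchy_ker tau zs w * (poisson tau zs w)%:C%C))))
     + re (A w * (u * (dcutoff z1 r w * (cauchy_ker tau z w ^+ 2 - cauchy_ker tau zs w ^+ 2)))).
    by rewrite -reB -reD; congr re; rewrite /d; ring.
  have h4 := le_trans (ler_re _) h2; have h5 := le_trans (ler_re _) h3.
  rewrite mulr1 Ew {Ew}; move: h4 h5; rewrite !ler_norml => /andP[_ h4] /andP[h5 _].
  have tK' : 4 * M * q ^+ 5 / delta ^+ 5 * tau ^+ 2 + 4 * M / r1 ^+ 5 * tau ^+ 2 <= delta.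
    by rewrite -mulrDl mulrC.
  have y2 : 0 <= 4 * M / r1 ^+ 5 * tau ^+ 2.
    apply: mulr_ge0; last exact: sqr_ge0.
    by apply: divr_ge0; [exact: mulr_ge0|exact: exprn_ge0 (ltW r10)].
  have y1 : 0 <= 4 * M * q ^+ 5 / delta ^+ 5 * tau ^+ 2.
    by apply: le_trans h2; exact: modulus_ge0.
  rewrite /O indicE.
  have [sw|nsw] := pselect (sq z r1 w).
    rewrite mem_set// !mulr1.
    have h6 := d_near t0 u1 (sqD w sw) uE (Hsq w sw).2.
    exact: sum_lower_in h6 h4 h5 y2 tK'.
  rewrite memNset// !mulr0 add0r.
  have h6 := d_far t0 u1 r10 Dw dw (dist_sq_ge nsw).
  have := le_trans (ler_re _) h6; rewrite ler_norml => /andP[{}h6 _].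
  rewrite ?add0r ?sub0r; exact: sum_lower_out h6 h4 h5 tK'.
have LL : (0 <= (12 * (1 + L))%:E)%E by rewrite lee_fin mulr_ge0// addr_ge0.
have := le_trans lbE (le_trans (lee_abs _) (le_trans ub (lee_wpmul2l LL bd))).
rewrite -EFinM lee_fin -/V => H.
rewrite [X in _ <= X * V + _]addrC.
(* [54 = 27 * 4 / 2]: the factor [2 / 27] comes from [sqr_ker_mass_ge] and [1 / 4] from the area of
   the small square. *)
have -> : (modulus a - delta) / 54 = (modulus a - delta) * (2 / 27 / 4) by field.
by rewrite -lerBlDl.
Unshelve. all: by end_near. Qed.

End fatou.

Section nontangential.
Variable R : realType.
Notation mu := (@lebesgue_measure R).
Notation P := (measurableTypeR R * measurableTypeR R)%type.

Lemma hol_affine (D : set (R * R)) (F f : R * R -> R[i]) (k c0 z0 : R[i]) : hol D F f ->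
  hol D (fun w => F w - k - c0 * (cx w - z0)) (fun w => f w - c0).
Proof.
move=> H w Dw; have [h1 h2 h3 h4] := H w Dw.
have ccx : ccont (@cx R) w := (test_cont w (@test_cx R)).1.
split.
- have d := cderivD (cderivN (cderivM (cderiv_cst c0 w.1) (cderivD (cderivD
    (cderiv_real (is_derive_id w.1 (1 : R))) (cderiv_cst ('i%C * (w.2)%:C%C) w.1)) (cderiv_cst (- z0) w.1))))
    (cderivD h1 (cderiv_cst (- k) w.1)).
  have -> : (fun x => F (x, w.2) - k - c0 * (cx (x, w.2) - z0)) = (fun t => - (c0 * (t%:C%C + 'i%C * (w.2)%:C%C + - z0)) + (F (t, w.2) + - k)).
    apply/funext => t; rewrite (_ : cx (t, w.2) = t%:C%C + 'i%C * (w.2)%:C%C).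
      by rewrite addrC.
    by apply: cplx_eqP; rewrite /cx !reimE /=; ring.
  move: d; congr cderiv; rewrite !addr0 mul0r addr0 mulr1 addrC //.
- have d := cderivD (cderivN (cderivM (cderiv_cst c0 w.2) (cderivD (cderivD
    (cderiv_cst ((w.1)%:C%C) w.2) (cderivM (cderiv_cst 'i%C w.2) (cderiv_real (is_derive_id w.2 (1 : R))))) (cderiv_cst (- z0) w.2))))
    (cderivD h2 (cderiv_cst (- k) w.2)).
  have -> : (fun y => F (w.1, y) - k - c0 * (cx (w.1, y) - z0)) = (fun t => - (c0 * ((w.1)%:C%C + 'i%C * t%:C%C + - z0)) + (F (w.1, t) + - k)).
    apply/funext => t; rewrite (_ : cx (w.1, t) = (w.1)%:C%C + 'i%C * t%:C%C).
      by rewrite addrC.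
    by apply: cplx_eqP; rewrite /cx !reimE /=; ring.
  move: d; congr cderiv; rewrite !addr0 !mul0r !addr0 add0r mulr1 addrC; ring.
- apply: ccontB; first by apply: ccontB => //; exact: ccont_cst.
  by apply: ccontM; [exact: ccont_cst|apply: ccontB => //; exact: ccont_cst].
- by apply: ccontB => //; exact: ccont_cst.
Qed.

Lemma cdiff_affine (F f : R * R -> R[i]) (k c0 z0 : R[i]) w : cdiff F f w ->
  cdiff (fun w => F w - k - c0 * (cx w - z0)) (fun=> f w - c0) w.
Proof.
move=> H e e0; have := H e e0; apply: filterS => v; congr (modulus _ <= _); ring.
Qed.

Variables (c s L : R) (phi : R -> R).
Hypothesis cs : c ^+ 2 + s ^+ 2 = 1.
Hypothesis lip : forall x y, `|phi x - phi y| <= L * `|x - y|.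
Notation gpt := (gpt c s phi).

Variables (x0 rho h : R) (D : set (R * R)).
Hypothesis (h0 : 0 < h) (oD : open D).
Hypothesis chartD : forall x t, `|x - x0| < rho -> `|t| < h -> (D (gpt x t) <-> 0 < t).
Notation I := (`](x0 - rho)%R, (x0 + rho)%R[%classic : set (measurableTypeR R)).
Variables (F f : R * R -> R[i]) (B : R -> R[i]) (M : R).
Hypothesis hF : hol D F f.
Hypothesis dF : forall w, D w -> cdiff F f w.
Hypothesis M0 : 0 <= M.
Hypothesis FM : forall x t, `|x - x0| < rho -> 0 < t < h -> modulus (F (gpt x t)) <= M.
Hypothesis Bc : forall x, `|x - x0| < rho -> ccont B x.
Hypothesis FB : forall x, `|x - x0| < rho -> forall e, 0 < e -> exists2 d, 0 < d &
  forall t, 0 < t < d -> modulus (F (gpt x t) - B x) < e.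

(** After subtraction of the affine function of slope [c0], the derivative at [z] is [f z - c0] and
    the trace is [o(|x - x1|)], so [fatou_bound] reads [C1 * eta + C2 * delta]. Here [C1] is
    independent of [eta], while [C2] involves [d0] and hence [eta]: first [eta] is fixed, then the
    admissible distance [delta]. *)
Lemma nontangential_limit (x1 kappa : R) (c0 : R[i]) : `|x1 - x0| < rho -> 0 < kappa ->
  (forall e, 0 < e -> exists2 d, 0 < d & forall x, `|x - x0| < rho -> `|x - x1| < d ->
    modulus (B x - B x1 - c0 * (cx (gpt x 0) - cx (gpt x1 0))) <= e * `|x - x1|) ->
  forall e, 0 < e -> exists2 d, 0 < d & forall z, D z -> 0 < dist (gpt x1 0) z < d ->
    (forall x, `|x - x0| < rho -> kappa * dist (gpt x1 0) z <= dist (gpt x 0) z) ->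
    modulus (f z - c0) <= e.
Proof.
move=> x1I k0 dB e e0.
have L0 : 0 <= L by have := lip 1 0; rewrite subr0 normr1 mulr1; apply: le_trans.
have rho0 : 0 < rho by apply: le_lt_trans x1I.
pose A w := F w - B x1 - c0 * (cx w - cx (gpt x1 0)).
pose b x := B x - B x1 - c0 * (cx (gpt x 0) - cx (gpt x1 0)).
pose M' := M + modulus (B x1) + modulus c0 * ((1 + L) * (2 * rho) + h).
have rL0 : 0 <= (1 + L) * (2 * rho) + h.
  by rewrite addr_ge0 ?(ltW h0)// mulr_ge0 ?addr_ge0// mulr_ge0// ltW.
have M'0 : 0 <= M' by rewrite !addr_ge0 ?modulus_ge0// mulr_ge0 ?modulus_ge0.
have hA : hol D A (fun w => f w - c0) by exact: hol_affine.
have Ac w : D w -> ccont A w by move=> /hA[].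
have Aw : weakly_hol D A by exact: hol_weakly hA.
have AM x t : `|x - x0| < rho -> 0 < t < h -> modulus (A (gpt x t)) <= M'.
  move=> xI th; rewrite /A; apply: le_trans (modulusD _ _) _; rewrite modulusN modulusM.
  apply: lerD.
    by apply: le_trans (modulusD _ _) _; rewrite modulusN lerD// FM.
  rewrite ler_wpM2l ?modulus_ge0//; have /andP[t0 th'] := th.
  have x2 : `|x - x1| <= 2 * rho.
    have := ler_normB (x - x0) (x1 - x0); rewrite opprB addrA subrK; lra.
  have -> : (1 + L) * (2 * rho) + h = 2 * rho + (L * (2 * rho) + h) by ring.
  apply: (modulus_pnt_le cs) => //.
  have := lip x x1; have := ler_wpM2l L0 x2; rewrite !ler_norml => k1 /andP[k2 k3].
  apply/andP; split; lra.
have bc x : `|x - x0| < rho -> ccont b x.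
  move=> xI; apply: ccontB.
    by apply: ccontB; [exact: Bc|exact: ccont_cst].
  apply: ccontM; first exact: ccont_cst.
  apply: ccontB; last exact: ccont_cst.
  have [h1 h2] : ccont (@cx R) (gpt x 0) := (test_cont (gpt x 0) (@test_cx R)).1.
  have g0 := @continuous_gptl R c s L phi lip 0 x.
  by split; [exact: (cvg_comp _ _ g0 h1)|exact: (cvg_comp _ _ g0 h2)].
have mb : measurable_fun I (fun x => modulus (b x)).
  apply: open_continuous_measurable_fun; first exact: interval_open.
  by move=> x; rewrite inE /= in_itv/= -ltr_distl => /bc; exact: ccont_modulus.
have Ab x : `|x - x0| < rho -> forall e, 0 < e -> exists2 d, 0 < d &
    forall t, 0 < t < d -> modulus (A (gpt x t) - b x) < e.
  move=> xI e1 e10; have e2 : 0 < e1 / 2 by rewrite divr_gt0.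
  have [d d0 Hd] := FB xI e2.
  have c1 : 0 < modulus c0 + 1 by rewrite ltr_wpDl ?modulus_ge0.
  exists (Num.min d (e1 / 2 / (modulus c0 + 1))); first by rewrite lt_min d0 divr_gt0.
  move=> t /andP[t0]; rewrite lt_min => /andP[td te].
  have -> : A (gpt x t) - b x = (F (gpt x t) - B x) - c0 * (cx (gpt x t) - cx (gpt x 0)).
    by rewrite /A /b; ring.
  apply: le_lt_trans (modulusD _ _) _; rewrite modulusN modulusM (splitr e1).
  apply: ltrD; first by apply: Hd; rewrite t0.
  have k1 : modulus (cx (gpt x t) - cx (gpt x 0)) <= t.
    rewrite -[t in _ <= t]add0r; apply: (modulus_pnt_le cs); first by rewrite subrr normr0.
    by rewrite opprD addrACA subrr add0r subr0 gtr0_norm.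
  apply: (@le_lt_trans _ _ ((modulus c0 + 1) * t)).
    by apply: ler_pM; rewrite ?modulus_ge0// lerDl.
  by rewrite mulrC -ltr_pdivlMr.
pose r := Num.min ((rho - `|x1 - x0|) / 3) (h / (3 * (1 + L))).
have r0 : 0 < r.
  rewrite lt_min !divr_gt0// ?subr_gt0// mulr_gt0//; lra.
have rX : `|x1 - x0| + 3/2 * r < rho.
  have : r <= (rho - `|x1 - x0|) / 3 by rewrite ge_min lexx.
  lra.
have rT : (1 + L) * (3/2 * r) < h.
  have : r <= h / (3 * (1 + L)) by rewrite ge_min lexx orbT.
  have L1 : 0 < 1 + L by lra.
  rewrite ler_pdivlMr; last by rewrite mulr_gt0.
  have := mulr_gt0 L1 r0; move: (1 + L) L1 => L1 _; nra.
pose q := 3 + L + 2 / kappa.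
pose V : R := fine ((@lebesgue_measure R \x @lebesgue_measure R)%E (box (`|(gpt x1 0).1| + `|(gpt x1 0).2| + 2 * r) : set P)).
have V0 : 0 <= V by rewrite fine_ge0.
have k20 : 0 < 2 / kappa by rewrite divr_gt0.
have q0 : 0 < q by rewrite /q; lra.
have [k384 k384E] : exists k : R, k = 384 by exists 384.
have k3840 : 0 <= k384 by rewrite k384E ler0n.
pose C0 := 12 * (1 + L) * (4 * q ^+ 3).
have C00 : 0 <= C0.
  apply: mulr_ge0; first by rewrite mulr_ge0// addr_ge0.
  by apply: mulr_ge0 => //; exact: exprn_ge0 (ltW q0).
pose C1 := 54 * (C0 * pi).
have C10 : 0 <= C1 by rewrite mulr_ge0// mulr_ge0// pi_ge0.
pose eta := e / 2 / (C1 + 1).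
have C1p : 0 < C1 + 1 by rewrite ltr_wpDl.
have eta0 : 0 < eta by rewrite !divr_gt0.
have [d0 d00 Hd0] := dB _ eta0.
pose C2 := 1 + 54 * ((1 + k384 * M' / r ^+ 4) * V + C0 * (2 * rho * (M' / d0 ^+ 3))).
have C20 : 0 < C2.
  rewrite ltr_pwDl// mulr_ge0// addr_ge0//.
    rewrite mulr_ge0// addr_ge0//; apply: divr_ge0; first exact: mulr_ge0.
    exact: exprn_ge0 (ltW r0).
  apply: mulr_ge0 => //; apply: mulr_ge0; first by rewrite mulr_ge0// ltW.
  by apply: divr_ge0 => //; exact: exprn_ge0 (ltW d00).
exists (Num.min (r / 4) (e / 2 / C2)); first by rewrite lt_min !divr_gt0.
move=> z Dz /andP[z0]; rewrite lt_min => /andP[zr ze] zk.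
have := fatou_bound cs lip h0 oD chartD Ac Aw M'0 AM mb Ab r0 rX rT Dz erefl z0 (ltW zr) k0 zk
  (@cdiff_affine F f (B x1) c0 (cx (gpt x1 0)) z (dF Dz)) erefl (ltW eta0) d00 Hd0.
set delta := dist _ z in z0 zr ze *; rewrite -/V -/q -k384E => H.
have E1 : (delta + k384 * M' * delta / r ^+ 4) * V + 12 * (1 + L) * (4 * q ^+ 3 * (eta * pi + 2 * rho * (M' * delta / d0 ^+ 3)))
  = C0 * pi * eta + ((1 + k384 * M' / r ^+ 4) * V + C0 * (2 * rho * (M' / d0 ^+ 3))) * delta.
  by rewrite /C0; ring.
rewrite E1 ler_pdivrMr// in H.
have k1 : C1 * eta <= e / 2.
  clear -e0 C20 C1p; rewrite /eta mulrA ler_pdivrMr// mulrC ler_wpM2l ?divr_ge0 ?(ltW e0)//; lra.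
have k2 : C2 * delta <= e / 2 by rewrite mulrC -ler_pdivlMr// ltW.
have E2 : C1 * eta + C2 * delta = (C0 * pi * eta + ((1 + k384 * M' / r ^+ 4) * V + C0 * (2 * rho * (M' / d0 ^+ 3))) * delta) * 54 + delta.
  by rewrite /C1 /C2; ring.
rewrite lerBlDr -E2 in H; apply: le_trans H _; rewrite [leRHS](splitr e); exact: lerD.
Qed.

End nontangential.

(** * Boundary values of the derivative in a chart *)

Section chart_trace.
Variable R : realType.
Notation mu := (@lebesgue_measure R).
Notation RR := (measurableTypeR R).

Lemma derivable_dist (u : R -> R) (x e : R) : derivable u x 1 -> 0 < e -> exists2 d, 0 < d &
  forall y, `|y - x| < d -> `|u y - u x - 'D_1 u x * (y - x)| <= e * `|y - x|.
Proof.
move=> du e0; have /cvgrPdist_le/(_ _ e0)[d /= d0 Hd] := du.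
exists d => // y yd; have [->|yx] := eqVneq y x; first by rewrite !subrr mulr0 subrr normr0 mulr0.
have yx0 : y - x != 0 by rewrite subr_eq0.
have := Hd (y - x); rewrite /= sub0r normrN => /(_ yd yx0).
rewrite [lim _](_ : _ = 'D_1 u x)// /GRing.scale /= mulr1 subrK; move: ('D_1 u x) => l H.
have -> : u y - u x - l * (y - x) = - ((y - x) * (l - (y - x)^-1 * (u y - u x))).
  by rewrite [(y - x) * (l - _)]mulrBr mulVKf// opprB [l * _]mulrC.
by rewrite normrN normrM mulrC ler_wpM2r.
Qed.

Variables (c s L : R) (phi : R -> R).
Hypothesis cs : c ^+ 2 + s ^+ 2 = 1.
Hypothesis lip : forall x y, `|phi x - phi y| <= L * `|x - y|.
Notation gpt := (gpt c s phi).
Notation pnt := (pnt c s).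

Let L0 : 0 <= L.
Proof. by have := lip 1 0; rewrite subr0 normr1 mulr1; apply: le_trans. Qed.

(** [c0] is the derivative of [B] divided by that of the boundary curve, [g1 = (c - i s) (1 + i p)],
    which never vanishes. The remainders of [re B], [im B] and [phi] cost [1], [1] and [modulus c0]
    shares of the error, whence [k]. *)
Lemma boundary_derivative (B : R -> R[i]) x1 : derivable phi x1 1 ->
  derivable (fun x => re (B x)) x1 1 -> derivable (fun x => im (B x)) x1 1 ->
  exists c0 : R[i], forall e, 0 < e -> exists2 d, 0 < d & forall x, `|x - x1| < d ->
    modulus (B x - B x1 - c0 * (cx (gpt x 0) - cx (gpt x1 0))) <= e * `|x - x1|.
Proof.
move=> dp dr di.
set p := 'D_1 phi x1; set br := 'D_1 (fun x => re (B x)) x1; set bi := 'D_1 (fun x => im (B x)) x1.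
pose g1 : R[i] := (c +i* (- s))%C * (1 +i* p)%C.
have g10 : g1 != 0.
  rewrite mulf_neq0//.
    apply/eqP => /(congr1 (fun z : R[i] => modulus z ^+ 2)).
    by rewrite !modulus_sqr !reimE sqrrN cs expr0n/= addr0 => /eqP; rewrite oner_eq0.
  by apply/eqP => /(congr1 (fun z : R[i] => re z)); rewrite !reimE => /eqP; rewrite oner_eq0.
pose c0 := (br +i* bi)%C / g1; exists c0 => e e0.
pose k := 2 + modulus c0.
have k0 : 0 < k by have := modulus_ge0 c0; rewrite /k; lra.
have ek : 0 < e / k by rewrite divr_gt0.
have [d1 d10 H1] := derivable_dist dp ek; have [d2 d20 H2] := derivable_dist dr ek.
have [d3 d30 H3] := derivable_dist di ek.
exists (Num.min d1 (Num.min d2 d3)); first by rewrite !lt_min d10 d20.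
move=> x; rewrite !lt_min => /andP[/H1 h1 /andP[/H2 h2 /H3 h3]].
pose E1 : R[i] := ((re (B x) - re (B x1) - br * (x - x1)) +i* (im (B x) - im (B x1) - bi * (x - x1)))%C.
pose E2 : R := phi x - phi x1 - p * (x - x1).
have -> : B x - B x1 - c0 * (cx (gpt x 0) - cx (gpt x1 0)) = E1 - c0 * ((c +i* (- s))%C * ('i%C * E2%:C%C)).
  have -> : cx (gpt x 0) - cx (gpt x1 0) = g1 * (x - x1)%:C%C + (c +i* (- s))%C * ('i%C * E2%:C%C).
    by apply: cplx_eqP; rewrite /g1 /E2 /cx /gpt !reimE /=; ring.
  rewrite mulrDr opprD addrA mulrA /c0 divfK//; congr (_ - _).
  by apply: cplx_eqP; rewrite /E1 !reimE /=; ring.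
apply: le_trans (modulusD _ _) _; rewrite modulusN [modulus (c0 * _)]modulusM [modulus ((c +i* _)%C * _)]modulusM [modulus ('i%C * _)]modulusM.
have -> : modulus (c +i* (- s))%C = 1 by rewrite modulusE !reimE sqrrN cs sqrtr1.
rewrite modulus_i modulusC !mul1r.
have h4 : modulus E1 <= 2 * (e / k * `|x - x1|).
  by clear -h2 h3; apply: le_trans (modulus_le _) _; rewrite !reimE; lra.
apply: le_trans (lerD h4 (ler_wpM2l (modulus_ge0 c0) h1)) _.
rewrite -mulrDl -/k mulrA mulrCA divff ?gt_eqF// mulr1 //.
Qed.

Variables (x0 rho h m : R) (D : set (R * R)) (F f : R * R -> R[i]) (N : RR -> \bar R).
Hypotheses (rho0 : 0 < rho) (h0 : 0 < h) (m0 : 0 < m) (oD : open D).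
Hypothesis chartD : forall x t, `|x - x0| < rho -> `|t| < h -> (D (gpt x t) <-> 0 < t).
Hypothesis cone : forall y a b, `|y - x0| < rho -> `|a| < m * b -> 0 < b < h ->
  D (pnt (y + a) (phi y + b)) /\ ((modulus (f (pnt (y + a) (phi y + b))))%:E <= N y)%E.
Hypothesis hF : hol D F f.
Hypothesis dF : forall w, D w -> cdiff F f w.
Hypothesis mN : measurable_fun setT N.
Hypothesis N0 : forall x, (0 <= N x)%E.
Notation I := (`](x0 - rho)%R, (x0 + rho)%R[%classic : set RR).
Hypothesis IN : (\int[mu]_(x in I) N x < +oo)%E.

(** The approach region is described by distances to the arc rather than by a cone, in the form that
    [fatou_bound] uses. All apertures [kappa] are quantified, so a cone of the given family is
    covered as soon as [cone_margin] supplies its [kappa]. *)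
Definition nt_value x1 (c0 : R[i]) := forall kappa, 0 < kappa -> forall e, 0 < e ->
  exists2 d, 0 < d & forall z, D z -> 0 < dist (gpt x1 0) z < d ->
    (forall x, `|x - x0| < rho -> kappa * dist (gpt x1 0) z <= dist (gpt x 0) z) ->
    modulus (f z - c0) <= e.

(** Rademacher's theorem on the line, as the case [N = 1] of [ae_derivable_on]. *)
Lemma ae_derivable_lipschitz : {ae mu, forall x, x0 - rho < x < x0 + rho -> derivable phi x 1}.
Proof.
apply: (@ae_derivable_on R _ _ L phi (cst 1%E)) => //.
- rewrite integral_cst; last exact: measurable_itv.
  have := lebesgue_measure_itv `](x0 - rho), (x0 + rho)[; rewrite /= lte_fin => ->.
  by case: ifPn => _; rewrite -?EFinD mul1e ltry.
move=> x y _ xy _; rewrite integral_cst; last exact: measurable_itv.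
have := lebesgue_measure_itv `]x, y]; rewrite /= lte_fin => ->.
rewrite mul1e; move: xy; rewrite le_eqVlt => /predU1P[->|xy].
  by rewrite subrr normr0 ltxx mule0.
by rewrite xy -EFinD -EFinM lee_fin -[y - x]gtr0_norm ?subr_gt0.
Qed.

Lemma ae_nt_value : {ae mu, forall x, x0 - rho < x < x0 + rho -> exists c0, nt_value x c0}.
Proof.
have L10 : 0 <= 1 + L by rewrite addr_ge0.
have [n [n0 intn nE]] := real_majorant mN N0 IN L10.
have cone' y a b : `|y - x0| < rho -> `|a| < m * b -> 0 < b < h ->
    cdiff F f (pnt (y + a) (phi y + b)) /\ ((modulus (f (pnt (y + a) (phi y + b))))%:E <= N y)%E.
  by move=> yI ab bh; have [Dp fp] := cone yI ab bh; split=> //; exact: dF.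
have [B [FB BL]] := trace_exists cs lip m0 h0 cone' mN N0 IN n0 intn nE.
have [M M0 FM] := trace_bounded cs lip m0 h0 rho0 cone' mN N0 IN n0 intn nE.
have chI x : (x0 - rho < x < x0 + rho) = (`|x - x0| < rho) by rewrite ltr_distl.
have uN (v : R[i] -> R) : (forall z w : R[i], `|v z - v w| <= modulus (z - w)) ->
    {ae mu, forall x, x0 - rho < x < x0 + rho -> derivable (fun x => v (B x)) x 1}.
  move=> vl; apply: (@ae_derivable_on R _ _ (1 + L) _ N) => // x y ax xy yb.
  rewrite -nE// lee_fin; apply: le_trans (vl _ _) _; apply: BL => //; rewrite -chI.
    by rewrite ax (le_lt_trans xy yb).
  by rewrite (lt_le_trans ax xy) yb.
have dr := uN (@re R) (fun z w => le_trans (eq_ind _ (fun t => `|t| <= _) (lexx _) _ (reB z w)) (ler_re (z - w))).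
have di := uN (@im R) (fun z w => le_trans (eq_ind _ (fun t => `|t| <= _) (lexx _) _ (imB z w)) (ler_im (z - w))).
(* [trace_bounded] controls [F] only at heights with [2 t < h], so the chart is used up to height
   [h / 2]. *)
have h20 : 0 < h / 2 by rewrite divr_gt0.
have chartD2 x t : `|x - x0| < rho -> `|t| < h / 2 -> (D (gpt x t) <-> 0 < t).
  by move=> xI th; apply: chartD => //; lra.
have FM2 x t : `|x - x0| < rho -> 0 < t < h / 2 -> modulus (F (gpt x t)) <= M.
  by move=> xI /andP[t0 th]; apply: FM => //; lra.
have Bc x : `|x - x0| < rho -> ccont B x.
  move=> xI; apply/ccontP => e e0; have [d d0 Hd] := Wcont n0 intn e0.
  have xI' := xI; rewrite -chI in xI'.
  have nI : \forall y \near x, x0 - rho < y < x0 + rho.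
    have hx : x \in `](x0 - rho), (x0 + rho)[ by rewrite in_itv.
    by have := near_in_itv hx; apply: filterS => y; rewrite in_itv.
  near=> y.
  have yI : `|y - x0| < rho by rewrite -chI; near: y.
  have yd : `|x - y| < d by near: y; exact: cvgr_dist_lt.
  have [xy|/ltW yx] := leP x y.
    by apply: le_lt_trans (BL _ _ xI yI xy) _; apply: Hd => //; move: yd; rewrite distrC ger0_norm ?subr_ge0.
  rewrite modulusBC; apply: le_lt_trans (BL _ _ yI xI yx) _; apply: Hd => //.
  by move: yd; rewrite ger0_norm ?subr_ge0.
apply: filterS3 ae_derivable_lipschitz dr di; first exact: (ae_filter_ringOfSetsType mu).
move=> x1 k1 k2 k3 x1I.
have [c0 Hc0] := boundary_derivative (k1 x1I) (k2 x1I) (k3 x1I).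
exists c0 => kappa kappa0 e e0.
apply: (nontangential_limit cs lip h20 oD chartD2 hF dF M0 FM2 Bc FB _ kappa0 _ e0).
  by rewrite -chI.
move=> e1 e10; have [d d0 Hd] := Hc0 _ e10.
by exists d => // x _; exact: Hd.
Unshelve. all: by end_near. Qed.

(** By [dist_gT] the point at height [t] is at distance at least [t / (1 + L)] from the graph:
    vertical approach has aperture [1 / (1 + L)]. *)
Lemma nt_value_vertical x c0 : `|x - x0| < rho -> nt_value x c0 ->
  modulus (f (gpt x t)) @[t --> 0^'+] --> modulus c0.
Proof.
move=> xI H; have L1 : 0 < 1 + L by rewrite ltr_pwDl.
have k0 : 0 < (1 + L)^-1 by rewrite invr_gt0.
apply/cvgrPdist_le => e e0; have [d d0 Hd] := H _ k0 _ e0.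
exists (Num.min d h); first by rewrite /= lt_min d0.
move=> t /=; rewrite sub0r normrN => + t0.
rewrite gtr0_norm// lt_min => /andP[td th].
have dt : dist (gpt x 0) (gpt x t) = t.
  apply/eqP; rewrite -(@eqrXn2 _ 2) ?dist_ge0// ?(ltW t0)//.
  by rewrite /dist (modulus_pnt cs) subrr expr0n add0r addr0 addrAC subrr add0r.
rewrite distrC; apply: le_trans (modulus_norm_sub _ _) _; apply: Hd.
- by apply/(chartD xI) => //; rewrite gtr0_norm.
- by rewrite dt t0.
move=> x' x'I; rewrite dt ler_pdivrMl//.
by have := dist_gT cs lip x' (gpt x t); rewrite gT_gpt// gtr0_norm.
Qed.

(** Choosing the limits pointwise would lose measurability. Instead [g] is an upper limit along one
    sequence of heights, measurable on the interval, and it agrees with [modulus c0] wherever a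
    value [c0] exists; [fine] and the absolute value keep it real and nonnegative at the exceptional
    points. *)
Lemma chart_boundary : exists g : R -> R, [/\ measurable_fun I g, forall x, 0 <= g x,
  {ae mu, forall x, I x -> modulus (f (gpt x t)) @[t --> 0^'+] --> g x} &
  {ae mu, forall x, I x -> exists2 c0, modulus c0 = g x & nt_value x c0}].
Proof.
pose tn n : R := h / 2 * harmonic n.
have tn0 n : 0 < tn n by rewrite mulr_gt0 ?divr_gt0// /harmonic /= invr_gt0.
have tnh n : tn n < h.
  apply: (@le_lt_trans _ _ (h / 2)).
    by rewrite ler_piMr ?divr_ge0 ?(ltW h0)// /harmonic /= invf_le1// ler1n.
  by rewrite ltr_pdivrMr// mulr_natr mulr2n ltrDl.
have tncvg : tn n @[n --> \oo] --> (0 : R).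
  by have := cvgM (cvg_cst (h / 2)) (@cvg_harmonic R); rewrite mulr0; apply.
pose gn n (x : RR) : \bar R := (modulus (f (gpt x (tn n))))%:E.
pose g x := `|fine (limn_esup (gn ^~ x))|.
have mgn n : measurable_fun I (gn n).
  apply/measurable_EFinP; apply: open_continuous_measurable_fun; first exact: interval_open.
  move=> x; rewrite inE /= in_itv/= -ltr_distl => xI.
  have Dx : D (gpt x (tn n)) by apply/(chartD xI) => //; rewrite gtr0_norm.
  have [_ _ _ fc] := hF Dx.
  exact: (cvg_comp _ _ (@continuous_gptl R c s L phi lip (tn n) x) (ccont_modulus fc)).
have gE x c0 : `|x - x0| < rho -> nt_value x c0 -> g x = modulus c0.
  move=> xI nt; rewrite /g; have h1 := nt_value_vertical xI nt.
  have h2 : gn n x @[n --> \oo] --> (modulus c0)%:E.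
    apply: cvg_EFin; first by near=> n.
    exact: (cvg_comp _ _ (cvg_seq_right tn0 tncvg) h1).
  by rewrite (cvg_limn_einf_sup h2).2 ger0_norm ?modulus_ge0.
have nt := ae_nt_value.
exists g; split.
- apply: measurableT_comp; first exact: (@normr_measurable R setT).
  apply: measurableT_comp; first exact: (@fine_measurable R setT).
  by apply: measurable_fun_limn_esup.
- by move=> x; exact: normr_ge0.
- apply: filterS nt; first exact: (ae_filter_ringOfSetsType mu).
  move=> x H xI; have xI' : x0 - rho < x < x0 + rho by rewrite /= in_itv in xI.
  have [c0 Hc0] := H xI'; rewrite -ltr_distl in xI'.
  by rewrite (gE _ _ xI' Hc0); exact: nt_value_vertical.
- apply: filterS nt; first exact: (ae_filter_ringOfSetsType mu).
  move=> x H xI; have xI' : x0 - rho < x < x0 + rho by rewrite /= in_itv in xI.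
  have [c0 Hc0] := H xI'; rewrite -ltr_distl in xI'.
  by exists c0 => //; rewrite (gE _ _ xI' Hc0).
Unshelve. all: by end_near. Qed.

End chart_trace.

(** * Representation by boundary integrals *)

Section representation.
Variable R : realType.
Notation mu := (@lebesgue_measure R).
Notation mu2 := (@lebesgue_measure R \x @lebesgue_measure R)%E.
Notation RR := (measurableTypeR R).
Notation P := (measurableTypeR R * measurableTypeR R)%type.

(** A rotated piece of graph over an interval. [arc_g] is meant for the modulus of the boundary
    values of [f], and [arc_C] for the constant of Green's inequality in the chart. *)
Record barc := Arc { arc_c : R; arc_s : R; arc_phi : R -> R; arc_x : R; arc_rho : R;
  arc_g : R -> R; arc_C : R }.

Definition arc_pt (k : barc) (x : R) : R * R := gpt (arc_c k) (arc_s k) (arc_phi k) x 0.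
Definition arc_itv (k : barc) : set RR := `](arc_x k - arc_rho k)%R, (arc_x k + arc_rho k)%R[%classic.
Definition arc_int (k : barc) (u : R * R -> R) : \bar R :=
  ((arc_C k)%:E * \int[mu]_(x in arc_itv k) (arc_g k x * u (arc_pt k x))%:E)%E.

Definition arc_ok (k : barc) := [/\ 0 <= arc_C k, measurable_fun (arc_itv k) (arc_g k : RR -> R),
  forall x, 0 <= arc_g k x & exists L, forall x y, `|arc_phi k x - arc_phi k y| <= L * `|x - y|].

Lemma arc_int_ge0 k (u : R * R -> R) : arc_ok k -> (forall w, 0 <= u w) -> (0 <= arc_int k u)%E.
Proof.
move=> [C0 _ g0 _] u0; apply: mule_ge0; first by rewrite lee_fin.
by apply: integral_ge0 => x _; rewrite lee_fin mulr_ge0.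
Qed.

Lemma arc_int_le k (psi chi : R * R -> R[i]) : arc_ok k -> (forall w, ccont psi w) -> (forall w, ccont chi w) ->
  (forall w, modulus (psi w) <= modulus (chi w)) ->
  (arc_int k (fun w => modulus (psi w)) <= arc_int k (fun w => modulus (chi w)))%E.
Proof.
move=> [C0 mg g0 [L lip]] cp cc le; apply: lee_wpmul2l; first by rewrite lee_fin.
have mc (q : R * R -> R[i]) : (forall w, ccont q w) -> measurable_fun (arc_itv k) (fun x : RR => modulus (q (arc_pt k x))).
  move=> cq; apply: measurable_funTS; apply: continuous_measurable_fun => x.
  exact: (cvg_comp _ _ (@continuous_gptl R _ _ _ _ lip 0 x) (ccont_modulus (cq _))).
apply: ge0_le_integral => //.
- exact: measurable_itv.
- by move=> x _; rewrite lee_fin mulr_ge0// modulus_ge0.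
- by apply/measurable_EFinP; apply: measurable_funM => //; exact: mc.
- by apply/measurable_EFinP; apply: measurable_funM => //; exact: mc.
- by move=> x _; rewrite lee_fin ler_wpM2l.
Qed.

Variables (D : set (R * R)) (f : R * R -> R[i]).
Hypothesis oD : open D.

(** The bracket is [2 dbar] of [psi] times the cutoff, whereas the right-hand side sees only [psi];
    this lets the bound be iterated over several discs. *)
Definition local_bound (a : R * R) (r : R) (k : barc) := forall psi d, test psi d ->
  mu2.-integrable D (fun w : P => (re (f w * ((cutoff a r w)%:C%C * d w + dcutoff a r w * psi w)))%:E) /\
  (`|\int[mu2]_(w in D) (re (f w * ((cutoff a r w)%:C%C * d w + dcutoff a r w * psi w)))%:E| <=
    arc_int k (fun w => modulus (psi w)))%E.

Variables (a : nat -> R * R) (r : nat -> R) (k : nat -> barc).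

(** The partition of unity is built by successive subtraction: the last cutoff times [psi] is
    handled by its disc, and the rest, [(1 - cutoff) psi], vanishes on that disc and is treated by
    induction. Factors [1 - cutoff] lie in [[0, 1]], so every arc keeps the bound with [psi]
    itself. *)
Lemma partition_bound n psi d : (forall i, (i < n)%N -> 0 < r i) ->
  (forall i, (i < n)%N -> local_bound (a i) (r i) (k i)) ->
  (forall i, (i < n)%N -> arc_ok (k i)) ->
  test psi d ->
  (forall w, D w -> (exists2 i, (i < n)%N & dist (a i) w < r i) \/ psi w = 0 /\ d w = 0) ->
  mu2.-integrable D (fun w : P => (re (f w * d w))%:E) /\
  (`|\int[mu2]_(w in D) (re (f w * d w))%:E| <= \sum_(i < n) arc_int (k i) (fun w => modulus (psi w)))%E.
Proof.
have mD : measurable (D : set P) by exact: open_measurable2.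
elim: n psi d => [|n IH] psi d r0 lb ok tpsi cov.
  have z w : D w -> (re (f w * d w))%:E = 0%E :> \bar R.
    by move=> /cov[[i lt0 _]|[_ ->]] //; rewrite mulr0 re0.
  have E : (\int[mu2]_(w in D) (re (f w * d w))%:E = 0)%E.
    by rewrite -(integral0 mu2 D); apply: eq_integral => w; rewrite inE => /z.
  split; last by rewrite E abse0 big_ord0.
  apply: (eq_integrable mD (cst 0%E)) => [w|]; last exact: integrable0.
  by rewrite inE => /z ->.
have lt_n i : (i < n)%N -> (i < n.+1)%N by move=> ?; exact: ltnW.
have [i1 b1] := lb n (ltnSn n) _ _ tpsi.
have tc := test_cutoff (a n) (r n).
have t2 := testB tpsi (testM tc tpsi).
have cov2 w : D w -> (exists2 i, (i < n)%N & dist (a i) w < r i) \/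
   psi w - (cutoff (a n) (r n) w)%:C%C * psi w = 0 /\
   d w - ((cutoff (a n) (r n) w)%:C%C * d w + dcutoff (a n) (r n) w * psi w) = 0.
  move=> /cov[[i lti]|[-> ->]]; last by right; rewrite !mulr0 addr0 subrr.
  move: lti; rewrite ltnS leq_eqVlt => /predU1P[->|lt]; last by left; exists i.
  move=> /ltW dw; have [-> ->] := cutoff_in (r0 n (ltnSn n)) dw.
  by right; rewrite rmorph1 !mul1r mul0r addr0 !subrr.
have [i2 b2] := IH _ _ (fun i h => r0 i (lt_n i h)) (fun i h => lb i (lt_n i h))
  (fun i h => ok i (lt_n i h)) t2 cov2.
have E : (fun w : P => (re (f w * d w))%:E) = (fun w => (re (f w * (d w - ((cutoff (a n) (r n) w)%:C%C * d w + dcutoff (a n) (r n) w * psi w))))%:E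
  + (re (f w * ((cutoff (a n) (r n) w)%:C%C * d w + dcutoff (a n) (r n) w * psi w)))%:E)%E.
  by apply/funext => w; rewrite -EFinD -reD -mulrDr subrK.
split; first by rewrite E; exact: integrableD.
rewrite E integralD// big_ord_recr/=; apply: le_trans (lee_abs_add _ _) _.
apply: leeD => //; apply: le_trans b2 _; apply: lee_sum => i _.
apply: arc_int_le => //.
- by apply: ok; exact: lt_n.
- by move=> w; have [] := test_cont w t2.
- by move=> w; have [] := test_cont w tpsi.
move=> w; have /andP[c0 c1] := cutoff_bounds (a n) (r n) w.
have -> : psi w - (cutoff (a n) (r n) w)%:C%C * psi w = (1 - cutoff (a n) (r n) w)%:C%C * psi w.
  by apply: cplx_eqP; rewrite !reimE; ring.
rewrite modulusM modulusC.
by rewrite ler_piMl ?modulus_ge0// ger0_norm; lra.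
Qed.

(** On this square [den <= 3 tau^2], which gives [2 tau^2 / (3 tau^2)^2]. *)
Lemma poisson_mass (z w : R * R) tau : 0 < tau -> tau / 2 <= w.1 - z.1 <= tau -> tau / 2 <= w.2 - z.2 <= tau ->
  2 / 9 / tau ^+ 2 <= poisson tau z w.
Proof.
move=> t0 h1 h2; have [k1 k2] := small_square t0 h1 h2.
have D0 := den_gt0 z w t0; have T2 := exprn_gt0 2 t0.
rewrite /poisson ler_pdivlMr ?exprn_gt0//.
apply: (@le_trans _ _ (2 / 9 / tau ^+ 2 * (3 * tau ^+ 2) ^+ 2)).
  rewrite ler_wpM2l ?divr_ge0 ?(ltW T2)//.
  by rewrite ler_pXn2r ?nnegrE ?(ltW D0)// mulr_ge0// ltW.
by rewrite le_eqVlt; apply/orP; left; apply/eqP; field; rewrite gt_eqF.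
Qed.

Lemma arc_int_le_dist K z (u : R[i]) tau : arc_ok K -> 0 < tau -> modulus u = 1 ->
  (forall x, arc_itv K x -> 0 < dist z (arc_pt K x)) ->
  (arc_int K (fun w => modulus (u * cauchy_ker tau z w)%R) <= arc_int K (fun w => ((dist z w)^-1)%R))%E.
Proof.
move=> [C0 mg g0 [L lip]] t0 u1 dp; apply: lee_wpmul2l; first by rewrite lee_fin.
have mI : measurable (arc_itv K) by exact: measurable_itv.
have cd : continuous (fun x => dist z (arc_pt K x)).
  move=> x; exact: (cvg_comp _ _ (@continuous_gptl R _ _ _ _ lip 0 x) (@continuous_dist R z _)).
apply: ge0_le_integral => //.
- by move=> x _; rewrite lee_fin mulr_ge0// modulus_ge0.
- apply/measurable_EFinP; apply: measurable_funM => //; apply: measurable_funTS; apply: continuous_measurable_fun => x.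
  have cK := (test_cont (arc_pt K x) (testZ u (test_cauchy_ker z t0))).1.
  exact: (cvg_comp _ _ (@continuous_gptl R _ _ _ _ lip 0 x) (ccont_modulus cK)).
- apply/measurable_EFinP; apply: measurable_funM => //.
  apply: open_continuous_measurable_fun; first exact: interval_open.
  move=> x; rewrite inE => xI; apply: cvgV; first by rewrite gt_eqF ?dp.
  exact: cd.
- move=> x xI; rewrite lee_fin ler_wpM2l// modulusM u1 mul1r.
  exact: cauchy_ker_leV t0 (dp x xI).
Qed.

Lemma dist_eq0 (z w : R * R) : dist z w = 0 -> z = w.
Proof.
move=> d0; have /eqP : cx w - cx z = 0 by apply/eqP; rewrite -modulus_eq0; apply/eqP.
by rewrite subr_eq0 => /eqP; case: z w {d0} => [a1 a2] [b1 b2] [-> ->].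
Qed.

Hypothesis Dfin : exists M, D `<=` box M.
Hypothesis fc : forall w, D w -> ccont f w.

(* [18 = 9 * 4 / 2]: the Poisson kernel is at least [2 / 9 / tau ^+ 2] on a square
   of area [tau ^+ 2 / 4]. *)
Lemma representation n : (forall i, (i < n)%N -> 0 < r i) ->
  (forall i, (i < n)%N -> local_bound (a i) (r i) (k i)) ->
  (forall i, (i < n)%N -> arc_ok (k i)) ->
  (forall w, D w -> exists2 i, (i < n)%N & dist (a i) w < r i) ->
  (forall i x, (i < n)%N -> arc_itv (k i) x -> ~ D (arc_pt (k i) x)) ->
  forall z, D z -> ((modulus (f z))%:E <= 18%:E * \sum_(i < n) arc_int (k i) (fun w => ((dist z w)^-1)%R))%E.
Proof.
move=> r0 lb ok cov nD z Dz.
have mD : measurable (D : set P) by exact: open_measurable2.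
have cov' (psi d : R * R -> R[i]) w : D w -> (exists2 i, (i < n)%N & dist (a i) w < r i) \/ psi w = 0 /\ d w = 0.
  by move=> /cov; left.
have PB psi d (tpsi : test psi d) := partition_bound r0 lb ok tpsi (cov' psi d).
(* The two real coordinates are test functions with [2 dbar] equal to [1] and [i], so the
   integrability part of [partition_bound] makes [re f] and [im f], and hence [modulus f],
   integrable over [D]. *)
have [ire _] := PB _ _ (@test_fst R).
have [iim _] := PB _ _ (@test_snd R).
have iabs : mu2.-integrable D (fun w : P => (modulus (f w))%:E).
  have i1 : mu2.-integrable D (fun w : P => (re (f w))%:E).
    by move: ire; congr (mu2.-integrable D _); apply/funext => w; rewrite mulr1.
  have i2 : mu2.-integrable D (fun w : P => (im (f w))%:E).
    move: (integrableN iim) => /=; congr (mu2.-integrable D _); apply/funext => w.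
    by rewrite /= !reimE; congr EFin; ring.
  apply: (le_integrable mD _ _ (integrableD mD (integrable_abse i1) (integrable_abse i2))).
    apply/measurable_EFinP; apply: open_continuous_measurable2 => // w Dw.
    exact: ccont_modulus (fc Dw).
  move=> w _; rewrite /= lee_fin (ger0_norm (modulus_ge0 _)) (ger0_norm (addr_ge0 _ _))//.
  exact: modulus_le.
pose J := fine (\int[mu2]_(w in D) (modulus (f w))%:E)%E.
have JE : (\int[mu2]_(w in D) (modulus (f w))%:E)%E = J%:E by rewrite fineK//; exact: integrable_fin_num.
have J0 : 0 <= J by apply: fine_ge0; apply: integral_ge0 => w _; rewrite lee_fin modulus_ge0.
have dp i x : (i < n)%N -> arc_itv (k i) x -> 0 < dist z (arc_pt (k i) x).
  move=> ltn xI; rewrite lt_neqAle dist_ge0 andbT eq_sym; apply/eqP => d0.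
  by apply: (nD i x ltn xI); rewrite -(dist_eq0 d0).
set S := (\sum_(i < n) _)%E.
have [u u1 uE] := modulus_phase (f z).
apply/lee_addgt0Pr => e e0.
have e2 : 0 < e / 2 by rewrite divr_gt0.
have [/ltW fe|ef] := ltP (modulus (f z)) (e / 2).
  rewrite -[leLHS]add0e; apply: leeD; last by rewrite lee_fin; lra.
  apply: mule_ge0; first by rewrite lee_fin.
  apply: sume_ge0 => i _; apply: arc_int_ge0 => [|w]; first exact: ok.
  by rewrite invr_ge0 dist_ge0.
have [e1 e10 He1] : exists2 e1, 0 < e1 & forall w, `|z.1 - w.1| < e1 -> `|z.2 - w.2| < e1 ->
    D w /\ modulus (f w - f z) < e / 2.
  have cf : \forall w \near z, modulus (f w - f z) < e / 2 by apply: (ccontP _ _).1 => //; exact: fc.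
  by apply/nbhs2P; near=> w; split; [near: w; exact: open_nbhs_nbhs|near: w; exact: cf].
pose r1 := e1 / 2.
have r10 : 0 < r1 by rewrite divr_gt0.
have r1e : r1 < e1 by rewrite /r1 ltr_pdivrMr// mulr_natr mulr2n ltrDl.
have Hsq w : sq z r1 w -> D w /\ modulus (f w - f z) < e / 2.
  by move=> [w1 w2]; apply: He1; rewrite distrC; [exact: le_lt_trans w1 r1e|exact: le_lt_trans w2 r1e].
pose K : R := 18 * (2 / r1 ^+ 4 * J).
have K0 : 0 <= K.
  apply: mulr_ge0 => //; apply: mulr_ge0 => //; apply: divr_ge0 => //; exact: exprn_ge0 (ltW r10).
have [tau [t0 tr tK]] : exists tau, [/\ 0 < tau, tau <= r1 & tau ^+ 2 * K <= e / 2].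
  have K1 : 0 < K + 1 by rewrite ltr_wpDl.
  exists (Num.min r1 (Num.min 1 (e / 2 / (K + 1)))); split.
  - by rewrite !lt_min r10 ltr01 divr_gt0.
  - by rewrite ge_min lexx.
  set t := Num.min _ _; have t0 : 0 < t by rewrite !lt_min r10 ltr01 divr_gt0.
  have t1 : t <= 1 by rewrite !ge_min lexx !orbT.
  have t2 : t * (K + 1) <= e / 2 by rewrite -ler_pdivlMr// !ge_min lexx !orbT.
  by rewrite expr2; nra.
have [iA bA] := PB _ _ (testZ u (test_cauchy_ker z t0)).
pose d w : R[i] := u * (poisson tau z w)%:C%C.
(* [q] bounds the Poisson kernel off the square, so adding [q * modulus f] makes the integrand
   nonnegative there, at the total cost [q * J], which is small with [tau]. *)
pose q : R := 2 * tau ^+ 2 / r1 ^+ 4.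
have t2 : 0 <= 2 * tau ^+ 2 by apply: mulr_ge0 => //; exact: sqr_ge0.
have q0 : 0 <= q by apply: divr_ge0 => //; exact: exprn_ge0 (ltW r10).
have reE w : re (f w * d w) = poisson tau z w * re (u * f w) by rewrite /d !reimE; ring.
have iA' : mu2.-integrable D (EFin \o (fun w : P => re (f w * d w) + q * modulus (f w))).
  by have := integrableD mD iA (integrableZl mD q iabs); apply: eq_integrable.
have lb' : (((modulus (f z) - e / 2) * (2 / 9 / 4) - 0 * fine (mu2 (box 0 : set P)))%:E <=
    \int[mu2]_(w in D) (re (f w * d w) + q * modulus (f w))%:E)%E.
  apply: (@integral_lower_bound R D _ (fun=> 0) (poisson tau z) z r1 tau) => //.
  - by move=> w /Hsq[].
  - exact: integrable0.
  - by move=> w; rewrite oppr0.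
  - by apply: measurable_cont => w; exact: continuous_poisson.
  - by move=> w; exact: poisson_ge0.
  - by apply: integrable_sq => w; exact: continuous_poisson.
  - by move=> w; exact: poisson_mass.
  - by rewrite subr_ge0.
  move=> w Dw; rewrite mul0r subr0 add0r indicE reE.
  have p0 := poisson_ge0 tau z w.
  have qf0 : 0 <= q * modulus (f w) by rewrite mulr_ge0 ?modulus_ge0.
  have [sw|nsw] := pselect (sq z r1 w).
    rewrite mem_set// mulr1 mulrC; apply: le_trans (_ : poisson tau z w * re (u * f w) <= _); last by rewrite lerDl.
    rewrite ler_wpM2l//; have [_ fw] := Hsq w sw.
    have -> : u * f w = (modulus (f z))%:C%C + u * (f w - f z) by rewrite -uE; ring.
    rewrite reD reC lerD2l; have := ler_re (u * (f w - f z)).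
    rewrite modulusM u1 mul1r ler_norml => /andP[h _].
    by apply: le_trans h; rewrite lerN2 ltW.
  rewrite memNset// !mulr0.
  have dw := dist_sq_ge nsw; have dw0 := lt_le_trans r10 dw.
  have pq : poisson tau z w <= q.
    rewrite /poisson /q (ler_wpM2l t2)//.
    rewrite lef_pV2 ?posrE ?exprn_gt0 ?den_gt0//.
    rewrite (exprM r1 2 2) ler_pXn2r ?nnegrE ?exprn_ge0 ?(ltW r10) ?(ltW (den_gt0 _ _ t0))//.
    rewrite /den; apply: le_trans (_ : dist z w ^+ 2 <= _); last by rewrite lerDl sqr_ge0.
    by rewrite ler_pXn2r ?nnegrE ?(ltW r10)// ltW.
  have h : `|re (u * f w)| <= modulus (f w).
    by apply: le_trans (ler_re _) _; rewrite modulusM u1 mul1r.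
  have : - (q * modulus (f w)) <= poisson tau z w * re (u * f w).
    rewrite -mulrN; move: h; rewrite ler_norml => /andP[h _].
    apply: le_trans (ler_wpM2l p0 h); rewrite !mulrN lerN2 ler_wpM2r ?modulus_ge0//.
  by rewrite -subr_ge0 opprK.
have I2 : (\int[mu2]_(w in D) (re (f w * d w) + q * modulus (f w))%:E <= S + (q * J)%:E)%E.
  under eq_integral do rewrite EFinD EFinM.
  rewrite (integralD mD iA (integrableZl mD q iabs)) integralZl// JE -EFinM.
  rewrite leeD2r//; apply: le_trans (lee_abs _) _; apply: le_trans bA _.
  apply: lee_sum => i _; apply: arc_int_le_dist => //; first exact: ok.
  by move=> x; exact: dp.
have := le_trans lb' I2; rewrite mul0r subr0 => I3.
have : (18%:E * ((modulus (f z) - e / 2) * (2 / 9 / 4))%:E <= 18%:E * (S + (q * J)%:E))%E.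
  by rewrite lee_wpmul2l// lee_fin.
rewrite -EFinM (_ : 18 * _ = modulus (f z) - e / 2); last by field.
have S0 : (0 <= S)%E.
  apply: sume_ge0 => i _; apply: arc_int_ge0 => [|w]; first exact: ok.
  by rewrite invr_ge0 dist_ge0.
have qJ0 : (0 <= (q * J)%:E)%E by rewrite lee_fin mulr_ge0.
rewrite ge0_muleDr//.
move=> I4; have := leeD I4 (lexx (e / 2)%:E); rewrite -EFinD subrK => I5.
apply: le_trans I5 _; rewrite -addeA leeD2l// -EFinM -EFinD lee_fin [leRHS](splitr e) lerD2r.
by move: tK; rewrite /K /q; congr (_ <= _); ring.
Unshelve. all: by end_near. Qed.

End representation.

(** * Green's inequality on interior and on boundary discs *)

Section local_bounds.
Variable R : realType.
Notation mu := (@lebesgue_measure R).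
Notation mu2 := (@lebesgue_measure R \x @lebesgue_measure R)%E.
Notation RR := (measurableTypeR R).
Notation P := (measurableTypeR R * measurableTypeR R)%type.
Variables (D : set (R * R)) (f : R * R -> R[i]).
Hypothesis oD : open D.
Hypothesis fw : weakly_hol D f.

Lemma compact_disc (a : R * R) (e : R) : compact [set w | dist a w <= e].
Proof.
pose M : R := `|a.1| + `|a.2| + `|e|.
apply: (subclosed_compact _ (@compact_closed_box R M)).
  have -> : [set w | dist a w <= e] = dist a @^-1` [set t | t <= e] by [].
  by apply: closed_comp; [move=> w _; exact: continuous_dist|exact: closed_le].
move=> w /= dw; have := ler_re (cx w - cx a); have := ler_im (cx w - cx a).
rewrite -/(dist a w) /cx !reimE /= => h1 h2.
have k1 := ler_normD (w.1 - a.1) a.1; have k2 := ler_normD (w.2 - a.2) a.2.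
rewrite !subrK in k1 k2; have k3 := ler_norm e; have k4 := normr_ge0 a.1; have k5 := normr_ge0 a.2.
by split; rewrite /M; lra.
Qed.

Lemma cutoff_supported (a : R * R) (r : R) (psi : R * R -> R[i]) : 0 < r ->
  supported [set w | dist a w <= 3/2 * r] (fun w => (cutoff a r w)%:C%C * psi w).
Proof.
move=> r0 w /= /negP; rewrite -ltNge => /ltW dw.
by have [-> _] := cutoff_out r0 dw; rewrite mul0r.
Qed.

(** Weak holomorphy makes the localised integral vanish, so the inequality holds with any arc. *)
Lemma local_bound_interior a r k : 0 < r -> [set w | dist a w <= 3/2 * r] `<=` D -> arc_ok k ->
  local_bound D f a r k.
Proof.
move=> r0 sub ok psi d tpsi.
have mD : measurable (D : set P) by exact: open_measurable2.
have [iT eT] := fw (@compact_disc a (3/2 * r)) sub (testM (test_cutoff a r) tpsi) (@cutoff_supported _ _ _ r0).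
split; first exact: (integrableS measurableT).
have -> : (\int[mu2]_(w in D) (re (f w * ((cutoff a r w)%:C%C * d w + dcutoff a r w * psi w)))%:E = 0)%E.
  rewrite -eT [LHS]integral_mkcond; apply: eq_integral => w _; rewrite patchE.
  case: ifPn => // /negP; rewrite inE => nD.
  have dw : 3/2 * r <= dist a w.
    by rewrite leNgt; apply/negP => h; apply: nD; apply: sub; exact: ltW.
  by have [-> ->] := cutoff_out r0 dw; rewrite !mul0r addr0 mulr0 re0.
by rewrite abse0; apply: arc_int_ge0 => // w; exact: modulus_ge0.
Qed.

Hypothesis fc : forall w, D w -> ccont f w.
Variables (c s L : R) (phi : R -> R) (x0 rho h r : R) (N : R -> \bar R) (g : R -> R).
Hypothesis cs : c ^+ 2 + s ^+ 2 = 1.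
Hypothesis lip : forall x y, `|phi x - phi y| <= L * `|x - y|.
Notation gpt := (gpt c s phi).
Hypothesis h0 : 0 < h.
Hypothesis chartD : forall x t, `|x - x0| < rho -> `|t| < h -> (D (gpt x t) <-> 0 < t).
Notation I := (`](x0 - rho)%R, (x0 + rho)%R[%classic : set RR).
Hypothesis mN : measurable_fun (setT : set RR) N.
Hypothesis N0 : forall x, (0 <= N x)%E.
Hypothesis IN : (\int[mu]_(x in I) N x < +oo)%E.
Hypothesis fN : forall x t, `|x - x0| < rho -> 0 < t < h -> ((modulus (f (gpt x t)))%:E <= N x)%E.
Hypothesis mg : measurable_fun I g.
Hypothesis g0 : forall x, 0 <= g x.
Hypothesis fg : {ae mu, forall x, I x -> modulus (f (gpt x t)) @[t --> 0^'+] --> g x}.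
Hypothesis (r0 : 0 < r) (rX : 3/2 * r < rho) (rT : (1 + L) * (3/2 * r) < h).

Lemma local_bound_chart : local_bound D f (gpt x0 0) r (Arc c s phi x0 rho g (12 * (1 + L))).
Proof.
move=> psi d tpsi.
have L0 : 0 <= L by have := lip 1 0; rewrite subr0 normr1 mulr1; apply: le_trans.
have tt := testM (test_cutoff (gpt x0 0) r) tpsi.
have r32 : 0 < 3/2 * r by rewrite mulr_gt0.
have rX' : `|x0 - x0| + 3/2 * r < rho by rewrite subrr normr0 add0r.
have h'0 : 0 < (1 + L) * (3/2 * r) < h by rewrite rT andbT mulr_gt0// ltr_pwDl.
have rho'0 : 0 < 3/2 * r < rho by rewrite rX andbT.
have sp : supported (gpatch c s phi x0 (3/2 * r) (- ((1 + L) * (3/2 * r))) ((1 + L) * (3/2 * r)))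
    (fun w => (cutoff (gpt x0 0) r w)%:C%C * psi w).
  move=> w nw; apply: (@cutoff_supported _ _ _ r0) => dw; apply: nw.
  have [k1 _ k2 _] := disc_chart cs lip rX' rT dw.
  by rewrite subrr normr0 add0r in k1; split => //; rewrite -ler_norml.
split; first exact: (integrable_fd cs lip h0 oD chartD fc tt rho'0 h'0 sp mN N0 IN fN).
apply: le_trans (chart_bound cs lip h0 oD chartD fc fw tt rho'0 h'0 sp mN N0 IN fN mg g0 fg) _.
apply: lee_wpmul2l; first by rewrite lee_fin mulr_ge0// addr_ge0.
have mc (q : R * R -> R[i]) : (forall w, ccont q w) -> measurable_fun I (fun x : RR => modulus (q (gpt x 0))).
  move=> cq; apply: measurable_funTS; apply: continuous_measurable_fun => x.
  exact: (cvg_comp _ _ (@continuous_gptl R _ _ _ _ lip 0 x) (ccont_modulus (cq _))).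
apply: ge0_le_integral => //.
- by move=> x _; rewrite lee_fin mulr_ge0// modulus_ge0.
- apply/measurable_EFinP; apply: measurable_funM => //.
  by apply: (mc (fun w => (cutoff (gpt x0 0) r w)%:C%C * psi w)) => w; have [] := test_cont w tt.
- apply/measurable_EFinP; apply: measurable_funM => //.
  by apply: mc => w; have [] := test_cont w tpsi.
move=> x _; rewrite lee_fin ler_wpM2l// modulusM modulusC.
have /andP[c0 c1] := cutoff_bounds (gpt x0 0) r (gpt x 0).
by rewrite ler_piMl ?modulus_ge0// ger0_norm.
Qed.

End local_bounds.

(** * Integral estimates for the kernel *)

Section power_kernel.
Variable R : realType.
Notation mu := (@lebesgue_measure R).
Notation mu2 := (@lebesgue_measure R \x @lebesgue_measure R)%E.
Notation RR := (measurableTypeR R).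
Notation P := (measurableTypeR R * measurableTypeR R)%type.
Variable theta : R.
Hypothesis theta01 : 0 < theta < 1.

(** A regularisation of the power [- theta] of [|y|], differentiable everywhere and increasing with
    [n]; the exponent is halved because the base is a square. *)
Definition pker (n : nat) (y : R) : R := (y ^+ 2 + harmonic n ^+ 2) `^ (- (theta / 2)).

Let har0 n : 0 < harmonic n :> R. Proof. by rewrite /harmonic /= invr_gt0. Qed.
Let bs0 n (y : R) : 0 < y ^+ 2 + harmonic n ^+ 2.
Proof. by rewrite ltr_wpDl ?sqr_ge0// exprn_gt0. Qed.
Let theta0 : 0 < theta. Proof. by case/andP: theta01. Qed.
Let theta1 : theta < 1. Proof. by case/andP: theta01. Qed.

Lemma powRN_le (a b e : R) : 0 < a -> a <= b -> 0 <= e -> b `^ (- e) <= a `^ (- e).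
Proof.
move=> a0 ab e0; have b0 := lt_le_trans a0 ab.
rewrite !powRN lef_pV2 ?posrE ?powR_gt0//.
by apply: ge0_ler_powR => //; rewrite nnegrE ltW.
Qed.

Lemma is_derive_pker n (y : R) : is_derive y 1 (pker n)
  (- (theta / 2) * (y ^+ 2 + harmonic n ^+ 2) `^ (- (theta / 2) - 1) * (2 * y)).
Proof.
have d1 : is_derive y 1 (fun y : R => y ^+ 2 + harmonic n ^+ 2) (2 * y).
  have := is_derive_add (is_derive_mul (is_derive_id y (1 : R)) (is_derive_id y (1 : R))) (is_derive_cst (harmonic n ^+ 2 : R) y (1 : R)).
  rewrite addr0 mulr1 mul1r; move=> h; apply: is_derive_eq; last by rewrite mulrDl mul1r.
have h := @is_derive1_comp R (@powR R ^~ (- (theta / 2))) (fun y : R => y ^+ 2 + harmonic n ^+ 2) y _ _ (is_derive1_powR (- (theta / 2)) (bs0 n y)) d1.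
exact: h.
Qed.

Lemma pker_ge0 n y : 0 <= pker n y. Proof. exact: powR_ge0. Qed.

Lemma continuous_pker n : continuous (pker n).
Proof. by move=> y; exact: is_derive_cont (is_derive_pker n y). Qed.

Lemma nondecreasing_pker y : nondecreasing_seq (fun n => (pker n y)%:E).
Proof.
move=> m n mn; rewrite lee_fin; apply: powRN_le; [exact: bs0| |by rewrite divr_ge0// ltW].
rewrite lerD2l ler_pXn2r ?nnegrE ?(ltW (har0 _))//.
by rewrite /harmonic /= lef_pV2 ?posrE// ler_nat.
Qed.

(* [`|y| `^ (- theta)], but [+oo] at [0], where [powR] gives [0]. *)
Definition pk (y : R) : \bar R := limn (fun n => (pker n y)%:E).

Lemma pk_ge0 y : (0 <= pk y)%E.
Proof.
apply: lime_ge; first exact: ereal_nondecreasing_is_cvgn (@nondecreasing_pker y).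
by near=> n; rewrite lee_fin pker_ge0.
Unshelve. all: by end_near. Qed.

Lemma measurable_pk : measurable_fun (setT : set RR) (pk : RR -> \bar R).
Proof.
apply: (emeasurable_fun_cvg (fun n (y : RR) => (pker n y)%:E)).
  by move=> n; apply/measurable_EFinP; apply: continuous_measurable_fun; exact: continuous_pker.
by move=> y _; apply: ereal_nondecreasing_is_cvgn; exact: nondecreasing_pker.
Qed.

Lemma le_pk (y d : R) : 0 < d -> `|y| <= d -> ((d `^ (- theta))%:E <= pk y)%E.
Proof.
move=> d0 yd.
have lim : (pker n d)%:E @[n --> \oo] --> (d `^ (- theta))%:E.
  have -> : d `^ (- theta) = (d ^+ 2 + 0 ^+ 2) `^ (- (theta / 2)).
    rewrite expr0n addr0 -powR_mulrn ?(ltW d0)// -powRrM; congr powR; by field.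
  have h2 : (d ^+ 2 + harmonic n ^+ 2) @[n --> \oo] --> d ^+ 2 + 0 ^+ 2.
    apply: cvgD; first exact: cvg_cst.
    by rewrite !expr2; apply: cvgM; exact: cvg_harmonic.
  have b0 : 0 < d ^+ 2 + 0 ^+ 2 by rewrite expr0n addr0 exprn_gt0.
  have h3 := cvg_comp _ _ h2 (is_derive_cont (is_derive1_powR (- (theta / 2)) b0)).
  by apply/fine_cvgP; split; [near=> n|exact: h3].
rewrite -(cvg_lim _ lim)//; apply: lee_lim.
- by apply/cvg_ex; exists (d `^ (- theta))%:E.
- exact: ereal_nondecreasing_is_cvgn (@nondecreasing_pker y).
near=> n; rewrite lee_fin; apply: powRN_le; [exact: bs0| |by rewrite divr_ge0// ltW].
rewrite lerD2r -(real_normK (num_real y)) ler_pXn2r ?nnegrE//; exact: ltW.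
Unshelve. all: by end_near. Qed.

(** No primitive is computed: [y * pker n y] has derivative at least [(1 - theta) * pker n y], and
    its increment over [[- A, A]] is at most [2 A^(1 - theta)] uniformly in [n]. *)
Lemma integral_pker n (A : R) : 0 < A ->
  (\int[mu]_(y in `[(- A)%R, A]) (pker n y)%:E <= (2 * A `^ (1 - theta) / (1 - theta))%:E)%E.
Proof.
move=> A0.
pose F (y : R) := y * pker n y.
pose F' (y : R) := y * (- (theta / 2) * (y ^+ 2 + harmonic n ^+ 2) `^ (- (theta / 2) - 1) * (2 * y)) + 1 * pker n y.
have dF (y : R) : is_derive y 1 F (F' y).
  exact: is_derive_mul (is_derive_id y (1 : R)) (is_derive_pker n y).
have F'ge y : (1 - theta) * pker n y <= F' y.
  have -> : F' y = pker n y - theta * (y ^+ 2 * (y ^+ 2 + harmonic n ^+ 2) `^ (- (theta / 2) - 1)).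
    by rewrite /F'; field.
  rewrite mulrBl mul1r lerD2l lerN2 ler_wpM2l ?(ltW theta0)//.
  have -> : (y ^+ 2 + harmonic n ^+ 2) `^ (- (theta / 2) - 1) = pker n y / (y ^+ 2 + harmonic n ^+ 2).
    rewrite (@powRB R (y ^+ 2 + harmonic n ^+ 2) (- (theta / 2)) 1); first by rewrite (powRr1 (ltW (bs0 n y))).
    by rewrite (gt_eqF (bs0 n y)) implybT.
  rewrite mulrCA ler_piMr ?pker_ge0// ler_pdivrMr ?bs0// mul1r lerDl.
  by rewrite exprn_ge0// ltW.
have cF' : continuous F'.
  move=> y; apply: cvgD; last by apply: cvgM; [exact: cvg_cst|exact: continuous_pker].
  apply: cvgM; first exact: cvg_id.
  apply: cvgM; last by apply: cvgM; [exact: cvg_cst|exact: cvg_id].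
  apply: cvgM; first exact: cvg_cst.
  have h2 : (v ^+ 2 + harmonic n ^+ 2) @[v --> y] --> y ^+ 2 + harmonic n ^+ 2.
    by apply: cvgD; [rewrite !expr2; apply: cvgM; exact: cvg_id|exact: cvg_cst].
  exact: (cvg_comp _ _ h2 (is_derive_cont (is_derive1_powR (- (theta / 2) - 1) (bs0 n y)))).
have AA : - A < A by lra.
have t1 : 0 < 1 - theta by rewrite subr_gt0.
have I1 : (\int[mu]_(y in `[(- A)%R, A]) (F' y)%:E = (F A - F (- A))%:E)%E.
  rewrite (@continuous_FTC2 R _ F _ _ AA) ?EFinB//.
  - exact: continuous_subspaceT.
  - split.
    + by move=> x _; exact: (@ex_derive _ _ _ _ _ _ _ (dF x)).
    + by apply: cvg_at_right_filter; exact: is_derive_cont (dF _).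
    + by apply: cvg_at_left_filter; exact: is_derive_cont (dF _).
  - by move=> x _; rewrite derive1E; exact: (@derive_val _ _ _ _ _ _ _ (dF x)).
have mI : measurable (`[(- A)%R, A]%classic : set RR) by exact: measurable_itv.
have mpk : measurable_fun (`[(- A)%R, A]%classic : set RR) (fun y : RR => (pker n y)%:E).
  by apply/measurable_EFinP; apply: measurable_funTS; apply: continuous_measurable_fun; exact: continuous_pker.
have I2 : ((1 - theta)%:E * \int[mu]_(y in `[(- A)%R, A]) (pker n y)%:E <= (F A - F (- A))%:E)%E.
  rewrite -I1 -ge0_integralZl//; [|by move=> y _; rewrite lee_fin pker_ge0|by rewrite lee_fin ltW].
  apply: ge0_le_integral => //.
  - by move=> y _; rewrite mule_ge0// lee_fin ?pker_ge0// ltW.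
  - by apply: emeasurable_funM => //; exact: measurable_cst.
  - by apply/measurable_EFinP; apply: measurable_funTS; exact: continuous_measurable_fun.
  - by move=> y _; rewrite -EFinM lee_fin.
have FA : F A - F (- A) <= 2 * A `^ (1 - theta).
  have -> : F A - F (- A) = 2 * (A * pker n A) by rewrite /F /pker sqrrN; ring.
  rewrite ler_wpM2l//.
  have -> : A `^ (1 - theta) = A * A `^ (- theta).
    by rewrite (@powRB _ _ 1 theta) ?gt_eqF ?implybT// powRr1 ?(ltW A0)// powRN.
  rewrite ler_wpM2l ?(ltW A0)//.
  have -> : A `^ (- theta) = (A ^+ 2) `^ (- (theta / 2)).
    by rewrite -powR_mulrn ?(ltW A0)// -powRrM; congr powR; by field.
  apply: powRN_le; [by rewrite exprn_gt0| |by rewrite divr_ge0// ltW].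
  by rewrite lerDl exprn_ge0// ltW.
rewrite EFinM -(@lee_pmul2l _ (1 - theta)%:E) ?lte_fin//.
apply: le_trans I2 _; rewrite -EFinM -EFinM lee_fin mulrCA divff ?gt_eqF// mulr1.
exact: FA.
Qed.

Lemma integral_pk (A b : R) (S : set RR) : 0 < A -> measurable S -> (forall x, S x -> `|x - b| <= A) ->
  (\int[mu]_(x in S) pk (x - b)%R <= (2 * A `^ (1 - theta) / (1 - theta))%:E)%E.
Proof.
move=> A0 mS SA.
have mI : measurable (`[(- A)%R, A]%classic : set RR) by exact: measurable_itv.
pose H : RR -> \bar R := pk \_ `[(- A)%R, A].
have mH : measurable_fun setT H by apply/(measurable_restrictT _ mI); apply: measurable_funTS; exact: measurable_pk.
have H0 x : (0 <= H x)%E by rewrite /H patchE; case: ifP => // _; exact: pk_ge0.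
apply: (@le_trans _ _ (\int[mu]_x H (x + - b)%R)%E).
  rewrite integral_mkcond; apply: ge0_le_integral; first exact: measurableT.
  - by move=> x _; rewrite patchE; case: ifP => // _; exact: pk_ge0.
  - apply/(measurable_restrictT _ mS); apply: measurable_funTS; apply: (measurableT_comp measurable_pk).
    by apply: measurable_funB => //; exact: measurable_cst.
  - apply: (measurableT_comp mH); by apply: measurable_funD => //; exact: measurable_cst.
  move=> x _; rewrite patchE; case: ifPn => [Sx|_]; last exact: H0.
  rewrite /H patchE mem_set// /= in_itv/= -ler_norml; apply: SA; by rewrite inE in Sx.
rewrite (ge0_integral_shift _ mH H0) /H -integral_mkcond.
rewrite (monotone_convergence _ mI).
- apply: lime_le; last by near=> n; exact: integral_pker.
  apply: ereal_nondecreasing_is_cvgn => m n mn; apply: ge0_le_integral => //.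
  + by move=> y _; rewrite lee_fin pker_ge0.
  + by apply/measurable_EFinP; apply: measurable_funTS; apply: continuous_measurable_fun; exact: continuous_pker.
  + by apply/measurable_EFinP; apply: measurable_funTS; apply: continuous_measurable_fun; exact: continuous_pker.
  + by move=> y _; exact: nondecreasing_pker.
- by move=> n; apply/measurable_EFinP; apply: measurable_funTS; apply: continuous_measurable_fun; exact: continuous_pker.
- by move=> n y _; rewrite lee_fin pker_ge0.
- by move=> y _; exact: nondecreasing_pker.
Unshelve. all: by end_near. Qed.

End power_kernel.

Section area.
Variable R : realType.
Notation mu := (@lebesgue_measure R).
Notation RR := (measurableTypeR R).
Notation P := (measurableTypeR R * measurableTypeR R)%type.

(* An alias: the canonical sigma-finite structure of a product measure is found
   only for products of finite measures. *)
Definition area : set P -> \bar R := (mu \x mu)%E.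

HB.instance Definition _ := Measure.copy area (mu \x mu)%E.

Let area_sigma_finite : sigma_finite setT area.
Proof.
have /sigma_finiteP[F [TF ndF Foo]] := sigma_finiteT mu.
exists (fun n => F n `*` F n) => [|k].
  rewrite -setXTT TF predeqE => -[x y]; split => [[[n _ Fnx] [k _ Fky]]|[n _ []]].
    exists (maxn n k) => //; split.
    - by move: Fnx; exact/subsetPset/ndF/leq_maxl.
    - by move: Fky; exact/subsetPset/ndF/leq_maxr.
  by move=> ? ?; split; exists n.
have [? ?] := Foo k; split; first exact: measurableX.
by rewrite /area product_measure1E// lte_mul_pinfty// ge0_fin_numE.
Qed.

HB.instance Definition _ := Measure_isSigmaFinite.Build _ _ _ area area_sigma_finite.

End area.

(** * From the pointwise bound to the area integral of the power [p] *)

Section hardy_estimate.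
Variable R : realType.
Notation mu := (@lebesgue_measure R).
Notation mu2 := (@lebesgue_measure R \x @lebesgue_measure R)%E.
Notation RR := (measurableTypeR R).
Notation P := (measurableTypeR R * measurableTypeR R)%type.

Lemma lee_poweR (x y : \bar R) (r : R) : 0 <= r -> (0 <= x)%E -> (x <= y)%E -> (x `^ r <= y `^ r)%E.
Proof.
move=> r0 x0 xy; apply: gt0_ler_poweR => //; rewrite in_itv/= leey andbT//.
exact: le_trans xy.
Qed.

Lemma poweR_sum_le (p : R) n : 0 < p -> exists2 K : R, 0 <= K & forall a : nat -> \bar R,
  (forall i, (i < n)%N -> (0 <= a i)%E) -> ((\sum_(i < n) a i) `^ p <= K%:E * \sum_(i < n) a i `^ p)%E.
Proof.
move=> p0; elim: n => [|n [K K0 IH]].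
  by exists 1 => // a _; rewrite !big_ord0 mule0 poweR0r// gt_eqF.
exists (2 `^ p * (K + 1)) => [|a a0]; first by rewrite mulr_ge0 ?powR_ge0// addr_ge0.
rewrite !big_ord_recr/=.
have a0' i : (i < n)%N -> (0 <= a i)%E by move=> h; apply: a0; exact: ltnW.
set S := (\sum_(i < n) a i)%E; set b := a n.
have S0 : (0 <= S)%E by apply: sume_ge0 => i _; exact: a0'.
have b0 : (0 <= b)%E by exact: a0.
have m0 : (0 <= maxe S b)%E by rewrite le_max S0.
have le1 : (S + b <= 2%:E * maxe S b)%E.
  rewrite mule_natl mule2n; apply: leeD; by rewrite le_max lexx ?orbT.
apply: (le_trans (lee_poweR (ltW p0) (adde_ge0 S0 b0) le1)).
rewrite poweRM// poweR_EFin EFinM -muleA; apply: lee_wpmul2l; first by rewrite lee_fin powR_ge0.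
apply: (@le_trans _ _ (S `^ p + b `^ p)%E).
  by rewrite maxEle; case: ifP => _; rewrite ?leeDl ?leeDr ?poweR_ge0.
have s0 : (0 <= \sum_(i < n) a i `^ p)%E by apply: sume_ge0 => i _; exact: poweR_ge0.
rewrite muleDr ?ge0_adde_def ?inE ?poweR_ge0//; apply: leeD.
  apply: (le_trans (IH a a0')); apply: lee_wpmul2r => //; by rewrite lee_fin lerDl.
by rewrite -[leLHS]mul1e; apply: lee_wpmul2r; [exact: poweR_ge0|rewrite lee_fin lerDr].
Qed.

(* Hoelder's inequality for the splitting [1 = beta / p + theta / q], where
   [theta = 1 - 1 / (2 p)] and [beta = theta + 1 / 2]: as [theta < 1] and
   [beta < 2], [d `^ (- theta)] is integrable on curves and [d `^ (- beta)] on the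
   plane. *)
Lemma holder_kernel (I : set RR) (g d : RR -> R) (p B : R) : measurable I -> measurable_fun I g -> measurable_fun I d ->
  (forall x, 0 <= g x) -> (forall x, I x -> 0 < d x) -> 1 < p -> 0 <= B ->
  (\int[mu]_(x in I) (d x `^ (- (1 - (2 * p)^-1)))%:E <= B%:E)%E ->
  ((\int[mu]_(x in I) (g x / d x)%:E) `^ p <=
    (B `^ (p - 1))%:E * \int[mu]_(x in I) (g x `^ p * d x `^ (- (3/2 - (2 * p)^-1)))%:E)%E.
Proof.
move=> mI mg md g0 d0 p1 B0 IB.
have p0 : 0 < p by lra.
pose q := p / (p - 1).
have q0 : 0 < q by rewrite /q divr_gt0// subr_gt0.
have pq : p^-1 + q^-1 = 1 by rewrite /q; field; apply/andP; split; lra.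
pose u1 (x : RR) := g x * d x `^ (- (3/2 - (2 * p)^-1) / p).
pose u2 (x : RR) := d x `^ (- (1 - (2 * p)^-1) / q).
have mpow r : measurable_fun I (fun x => d x `^ r).
  exact: (measurableT_comp (@measurable_powR R r) md).
have mu1 : measurable_fun setT (u1 \_ I) by apply/(measurable_restrictT _ mI); apply: measurable_funM => //; exact: mpow.
have mU2 : measurable_fun setT (u2 \_ I) by apply/(measurable_restrictT _ mI); exact: mpow.
have H := hoelder mu mu1 mU2 p0 q0 pq.
have E1 : ('N[mu]_1[EFin \o ((u1 \_ I) \* (u2 \_ I))%R] = \int[mu]_(x in I) (g x / d x)%:E)%E.
  rewrite Lnorm1 [RHS]integral_mkcond; apply: eq_integral => x _ /=.
  rewrite !patchE; case: ifPn => [|_]; last by rewrite mulr0 normr0.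
  rewrite inE => xI; have dx := d0 x xI.
  rewrite /u1 /u2 -mulrA -powRD; last by rewrite (gt_eqF dx) implybT.
  have -> : - (3/2 - (2 * p)^-1) / p + - (1 - (2 * p)^-1) / q = -1.
    by rewrite /q; field; apply/andP; split; lra.
  by rewrite powRN powRr1 ?(ltW dx)// ger0_norm// divr_ge0// ltW.
have E2 : ('N[mu]_p%:E[EFin \o (u1 \_ I)] `^ p = \int[mu]_(x in I) (g x `^ p * d x `^ (- (3/2 - (2 * p)^-1)))%:E)%E.
  rewrite (poweR_Lnorm _ _ (lt0r_neq0 p0)) [RHS]integral_mkcond; apply: eq_integral => x _ /=.
  rewrite !patchE; case: ifPn => [_|_]; last by rewrite normr0 powR0// gt_eqF.
  rewrite ger0_norm ?mulr_ge0 ?powR_ge0// /u1 powRM ?powR_ge0// -powRrM.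
  by rewrite divfK// gt_eqF.
have E3 : ('N[mu]_q%:E[EFin \o (u2 \_ I)] `^ q = \int[mu]_(x in I) (d x `^ (- (1 - (2 * p)^-1)))%:E)%E.
  rewrite (poweR_Lnorm _ _ (lt0r_neq0 q0)) [RHS]integral_mkcond; apply: eq_integral => x _ /=.
  rewrite !patchE; case: ifPn => [_|_]; last by rewrite normr0 powR0// gt_eqF.
  rewrite ger0_norm ?powR_ge0// /u2 -powRrM.
  by rewrite divfK// gt_eqF.
rewrite -E1; apply: (le_trans (lee_poweR (ltW p0) (Lnorm_ge0 _ _ _) H)).
rewrite poweRM ?Lnorm_ge0// E2 muleC; apply: lee_wpmul2r.
  by apply: integral_ge0 => x _; rewrite lee_fin mulr_ge0 ?powR_ge0.
(* Since [p / q = p - 1], the second factor becomes the power [p - 1] of its integral, which [B]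
   bounds. *)
have -> : ('N[mu]_q%:E[EFin \o (u2 \_ I)] `^ p = 'N[mu]_q%:E[EFin \o (u2 \_ I)] `^ (q * (p - 1)))%E.
  by congr (_ `^ _)%E; rewrite /q; field; lra.
rewrite poweRrM E3 -poweR_EFin; apply: lee_poweR => //; first lra.
by apply: integral_ge0 => x _; rewrite lee_fin powR_ge0.
Qed.

(** The planar kernel is split into one-dimensional kernels in the two coordinates, with exponents
    [theta] and [1/2], both below [1] and so both integrable. This is why the planar exponent is
    taken as [theta + 1/2]. *)
Lemma dist_powN_le (theta : R) (z q : R * R) : 0 < theta < 1 -> 0 < dist z q ->
  ((dist z q `^ (- (theta + 2^-1)))%:E <= pk theta (z.1 - q.1) * pk 2^-1 (z.2 - q.2))%E.
Proof.
move=> th d0; have half : 0 < (2^-1 : R) < 1 by lra.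
rewrite opprD powRD ?EFinM; last by rewrite (gt_eqF d0) implybT.
have h1 : `|z.1 - q.1| <= dist z q.
  by rewrite distrC; have := ler_re (cx q - cx z); rewrite /cx !reimE.
have h2 : `|z.2 - q.2| <= dist z q.
  by rewrite distrC; have := ler_im (cx q - cx z); rewrite /cx !reimE.
apply: lee_pmul; rewrite ?lee_fin ?powR_ge0//; exact: le_pk.
Qed.

Lemma kernel_mass (theta A : R) : 0 < theta < 1 -> 0 < A -> exists2 B : R, 0 <= B &
  forall (D : set P) (q : R * R), measurable D -> (forall z, D z -> `|z.1 - q.1| <= A /\ `|z.2 - q.2| <= A) ->
    (forall z, D z -> 0 < dist z q) ->
    (\int[mu2]_(z in D) (dist z q `^ (- (theta + 2^-1)))%:E <= B%:E)%E.
Proof.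
move=> th A0; have half : 0 < (2^-1 : R) < 1 by lra.
pose B1 := 2 * A `^ (1 - theta) / (1 - theta); pose B2 := 2 * A `^ (1 - 2^-1) / (1 - 2^-1 : R).
have B10 : 0 <= B1 by apply: divr_ge0; [rewrite mulr_ge0 ?powR_ge0//|lra].
have B20 : 0 <= B2 by apply: divr_ge0; [rewrite mulr_ge0 ?powR_ge0//|lra].
exists (B1 * B2) => [|D q mD Dq D0]; first exact: mulr_ge0.
pose I (b : R) : set RR := `[(b - A)%R, (b + A)%R]%classic.
have mI b : measurable (I b) by exact: measurable_itv.
have inI b x : I b x -> `|x - b| <= A by rewrite /I /= in_itv/= ler_norml => /andP[? ?]; apply/andP; split; lra.
pose h (t b : R) : RR -> \bar R := (fun x : RR => pk t (x - b)%R) \_ (I b).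
have mpk t b : 0 < t < 1 -> measurable_fun setT (fun x : RR => pk t (x - b)%R).
  move=> t01; apply: (measurableT_comp (measurable_pk t01)).
  by apply: measurable_funB => //; exact: measurable_cst.
have mh t b : 0 < t < 1 -> measurable_fun setT (h t b).
  by move=> t01; apply/(measurable_restrictT _ (mI b)); apply: measurable_funTS; exact: mpk.
have h0 t b x : 0 < t < 1 -> (0 <= h t b x)%E.
  by move=> t01; rewrite /h patchE; case: ifP => // _; exact: pk_ge0.
have ih t b : 0 < t < 1 -> (\int[mu]_x h t b x <= (2 * A `^ (1 - t) / (1 - t))%:E)%E.
  by move=> t01; rewrite /h -integral_mkcond; apply: integral_pk => // x; exact: inI.
pose H (w : P) := (h theta q.1 w.1 * h (2^-1)%R q.2 w.2)%E.
have mH : measurable_fun setT H.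
  apply: emeasurable_funM.
    by apply: (measurableT_comp (mh theta q.1 th)); exact: measurable_fst2.
  by apply: (measurableT_comp (mh _ q.2 half)); exact: measurable_snd2.
have H0 w : (0 <= H w)%E by apply: mule_ge0; exact: h0.
have md : measurable_fun D (fun z : P => (dist z q `^ (- (theta + 2^-1)))%:E).
  apply/measurable_EFinP; apply: measurable_funTS; apply: (measurableT_comp (@measurable_powR R _)).
  have -> : (fun z : P => dist z q) = (fun z => dist q z) by apply/funext => z; rewrite distC.
  apply: (@open_continuous_measurable2 R setT (dist q)); first exact: openT.
  by move=> w _; exact: continuous_dist.
apply: (@le_trans _ _ (\int[mu2]_w H w)%E).
  rewrite integral_mkcond; apply: ge0_le_integral; first exact: measurableT.
  - by move=> w _; rewrite patchE; case: ifP => // _; rewrite lee_fin powR_ge0.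
  - exact/(measurable_restrictT _ mD).
  - exact: mH.
  move=> w _; rewrite patchE; case: ifPn => [|_]; last exact: H0.
  rewrite inE => Dw; apply: (le_trans (dist_powN_le th (D0 w Dw))).
  have [w1 w2] := Dq w Dw.
  have i1 : I q.1 w.1 by clear -w1; move: w1; rewrite /I /= in_itv/= ler_norml => /andP[? ?]; apply/andP; split; lra.
  have i2 : I q.2 w.2 by clear -w2; move: w2; rewrite /I /= in_itv/= ler_norml => /andP[? ?]; apply/andP; split; lra.
  by rewrite /H /h !patchE !mem_set.
rewrite (tonelli_xy mH H0).
have -> : (\int[mu]_x \int[mu]_y H (x, y) = \int[mu]_x (h theta q.1 x * \int[mu]_y h (2^-1)%R q.2 y))%E.
  apply: eq_integral => x _; rewrite /H /= ge0_integralZl//.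
  - exact: mh.
  - by move=> y _; exact: h0.
  - exact: h0.
rewrite ge0_integralZr//.
- rewrite EFinM; apply: lee_pmul; last exact: ih half; last exact: ih th.
  + by apply: integral_ge0 => x _; exact: h0.
  + by apply: integral_ge0 => x _; exact: h0.
- exact: mh.
- by move=> x _; exact: h0.
- by apply: integral_ge0 => x _; exact: h0.
Qed.

Definition arc_near (D : set (R * R)) (A : R) (k : barc R) :=
  [/\ arc_c k ^+ 2 + arc_s k ^+ 2 = 1,
      exists L, forall x y, `|arc_phi k x - arc_phi k y| <= L * `|x - y| &
      forall z x, D z -> arc_itv k x ->
        [/\ `|x - gX (arc_c k) (arc_s k) z| <= A, `|z.1 - (arc_pt k x).1| <= A,
           `|z.2 - (arc_pt k x).2| <= A & ~ D (arc_pt k x)]].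

(** Hoelder's inequality on the arc for fixed [z], then Tonelli in [(z, x)]. The majorant [X] is
    measurable by construction, so the potential on the left is never integrated in [z]. *)
Lemma arc_power (p A : R) : 1 < p -> 0 < A -> exists2 K : R, 0 <= K & forall D k (g : R -> R),
  open D -> arc_near D A k -> measurable_fun (arc_itv k) (g : RR -> R) -> (forall x, 0 <= g x) ->
  exists X : P -> \bar R, [/\ measurable_fun setT X, forall z, (0 <= X z)%E,
    forall z, D z -> ((\int[mu]_(x in arc_itv k) (g x * (dist z (arc_pt k x))^-1)%:E) `^ p <= X z)%E &
    (\int[mu2]_z X z <= K%:E * \int[mu]_(x in arc_itv k) (g x `^ p)%:E)%E].
Proof.
move=> p1 A0; pose theta := 1 - (2 * p)^-1.
have ip : 0 < (2 * p)^-1 < 2^-1.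
  by apply/andP; split; [rewrite invr_gt0|rewrite ltf_pV2 ?posrE]; lra.
have th : 0 < theta < 1 by rewrite /theta; lra.
have [B2 B20 mass] := kernel_mass th A0.
pose B := 2 * A `^ (1 - theta) / (1 - theta).
have B0 : 0 <= B by apply: divr_ge0; [rewrite mulr_ge0 ?powR_ge0//|lra].
exists (B `^ (p - 1) * B2) => [|D k g oD [cs [L lip] near] mg g0]; first by rewrite mulr_ge0 ?powR_ge0.
have mD : measurable (D : set P) by exact: open_measurable2.
set I := arc_itv k in near mg *.
have mI : measurable I by exact: measurable_itv.
have dpos z x : D z -> I x -> 0 < dist z (arc_pt k x).
  move=> Dz Ix; rewrite lt_neqAle dist_ge0 andbT eq_sym; apply/eqP => /dist_eq0 e.
  by have [_ _ _] := near z x Dz Ix; rewrite -e.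
have cq x : arc_pt k y @[y --> x] --> arc_pt k x by exact: (@continuous_gptl R _ _ _ _ lip 0 x).
have mq1 : measurable_fun setT (fun x : RR => (arc_pt k x).1).
  by apply: continuous_measurable_fun => x; exact: (cvg_comp _ _ (cq x) cvg_fst).
have mq2 : measurable_fun setT (fun x : RR => (arc_pt k x).2).
  by apply: continuous_measurable_fun => x; exact: (cvg_comp _ _ (cq x) cvg_snd).
pose T := (P * RR)%type.
have md : measurable_fun setT (fun w : T => dist w.1 (arc_pt k w.2)).
  have -> : (fun w : T => dist w.1 (arc_pt k w.2)) =
      (fun v : P => dist (0, 0) v) \o (fun w : T => ((arc_pt k w.2).1 - w.1.1, (arc_pt k w.2).2 - w.1.2) : P).
    by apply/funext => w; rewrite /= /dist; congr modulus; rewrite /cx; apply: cplx_eqP; rewrite !reimE/= !subr0.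
  apply: (@measurableT_comp _ _ _ _ _ _ (fun v : P => dist (0, 0) v)).
    apply: (@open_continuous_measurable2 R setT (dist (0, 0))); first exact: openT.
    by move=> w _; exact: continuous_dist.
  apply: measurable_fun_pair; apply: measurable_funB.
  - exact: (measurableT_comp mq1 measurable_snd).
  - exact: (measurableT_comp measurable_fst measurable_fst).
  - exact: (measurableT_comp mq2 measurable_snd).
  - exact: (measurableT_comp measurable_snd measurable_fst).
pose beta := 3/2 - (2 * p)^-1.
have eb : beta = theta + 2^-1 by rewrite /beta /theta; field; lra.
have mDI : measurable (D `*` I : set T) by exact: measurableX.
pose h (w : T) := (g w.2 `^ p * dist w.1 (arc_pt k w.2) `^ (- beta))%:E.
pose H : T -> \bar R := h \_ (D `*` I).
have mH : measurable_fun setT H.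
  apply/(measurable_restrictT _ mDI)/measurable_EFinP; apply: measurable_funM.
    apply: (measurableT_comp (@measurable_powR R p)).
    apply: (@measurable_comp _ _ _ _ _ _ I g (D `*` I : set T) snd) => //.
    - by move=> _ [w [_ Iw] <-].
    - by apply: measurable_funTS; exact: measurable_snd.
  by apply: measurable_funTS; exact: (measurableT_comp (@measurable_powR R _) md).
have h0 w : (0 <= h w)%E by rewrite lee_fin mulr_ge0 ?powR_ge0.
have H0 w : (0 <= H w)%E by rewrite /H patchE; case: ifP => // _; exact: h0.
pose X z := ((B `^ (p - 1))%:E * \int[mu]_x H (z, x))%E.
have B10 : (0 <= (B `^ (p - 1))%:E)%E by rewrite lee_fin powR_ge0.
have mF : measurable_fun setT (fun z : P => \int[mu]_x H (z, x))%E.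
  exact: (@measurable_fun_fubini_tonelli_F _ _ _ _ _ mu H mH H0).
have I0 z : (0 <= \int[mu]_x H (z, x))%E by exact: integral_ge0.
exists X; split.
- by apply: emeasurable_funM => //; exact: measurable_cst.
- by move=> z; apply: mule_ge0.
- move=> z Dz.
  have mdz : measurable_fun I (fun x : RR => dist z (arc_pt k x)).
    apply: measurable_funTS; exact: (measurableT_comp md (measurable_pair1 _)).
  apply: (le_trans (holder_kernel mI mg mdz g0 (fun x Ix => dpos z x Dz Ix) p1 B0 _)); last first.
    apply: lee_wpmul2l => //; rewrite [leLHS]integral_mkcond le_eqVlt; apply/orP; left; apply/eqP.
    apply: eq_integral => x _; rewrite /H !patchE in_setX /= (mem_set Dz) andTb.
    by [].
  apply: (@le_trans _ _ (\int[mu]_(x in I) pk theta (x - gX (arc_c k) (arc_s k) z)%R)%E).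
    apply: ge0_le_integral => //.
    - by move=> x _; rewrite lee_fin powR_ge0.
    - by apply/measurable_EFinP; apply: (measurableT_comp (@measurable_powR R _)).
    - apply: measurable_funTS; apply: (measurableT_comp (measurable_pk th)).
      by apply: measurable_funB => //; exact: measurable_cst.
    move=> x Ix; apply: le_pk => //; first exact: dpos.
    rewrite distrC; have := dist_gX cs (arc_pt k x) z; rewrite gX_gpt// distrC.
    by rewrite distrC.
  apply: integral_pk => // x Ix; by have [] := near z x Dz Ix.
rewrite /X ge0_integralZl// EFinM -muleA; apply: lee_wpmul2l => //.
have -> : (\int[mu2]_z \int[mu]_x H (z, x) = \int[mu]_x \int[mu2]_z H (z, x))%E.
  exact: (@fubini_tonelli _ _ _ _ _ (@area R) mu H mH H0).
rewrite [in leRHS]integral_mkcond -ge0_integralZl//; last 2 first.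
- by apply/(measurable_restrictT _ mI)/measurable_EFinP; exact: (measurableT_comp (@measurable_powR R p)).
- by move=> x _; rewrite patchE; case: ifP => // _; rewrite lee_fin powR_ge0.
apply: ge0_le_integral => //.
- by move=> x _; exact: integral_ge0.
- exact: (@measurable_fun_fubini_tonelli_G _ _ _ _ _ (@area R) H mH H0).
- apply: emeasurable_funM; first exact: measurable_cst.
  by apply/(measurable_restrictT _ mI)/measurable_EFinP; exact: (measurableT_comp (@measurable_powR R p)).
move=> x _; rewrite patchE; case: ifPn => Ix; last first.
  rewrite mule0 integral0_eq// => z _; rewrite /H patchE in_setX /= (negbTE Ix) andbF//.
have Ix' : I x by rewrite inE in Ix.
have -> : (\int[mu2]_z H (z, x) = (g x `^ p)%:E * \int[mu2]_(z in D) (dist z (arc_pt k x) `^ (- beta))%:E)%E.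
  have mdx : measurable_fun D (fun z : P => (dist z (arc_pt k x) `^ (- beta))%:E).
    apply/measurable_EFinP; apply: measurable_funTS; apply: (measurableT_comp (@measurable_powR R _)).
    exact: (measurableT_comp md (measurable_pair2 x)).
  rewrite -ge0_integralZl//.
  - rewrite [RHS]integral_mkcond; apply: eq_integral => z _.
    by rewrite /H !patchE in_setX /= Ix andbT.
  - by move=> z _; rewrite lee_fin powR_ge0.
  - by rewrite lee_fin powR_ge0.
rewrite muleC; apply: lee_wpmul2r; first by rewrite lee_fin powR_ge0.
rewrite eb; apply: mass => // z Dz; last exact: dpos.
by have [] := near z x Dz Ix'.
Qed.

(** The order of quantifiers matters: [K] is chosen from [p], [A], [M] and [n] alone, before [f] and
    the densities of the arcs. *)
Lemma hardy_estimate (p A M : R) n : 1 < p -> 0 < A -> 0 <= M ->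
  exists2 K : R, 0 < K & forall D (f : R * R -> R[i]) (k : nat -> barc R), open D ->
  (forall z, D z -> ccont f z) ->
  (forall i, (i < n)%N -> arc_near D A (k i)) -> (forall i, (i < n)%N -> arc_ok (k i)) ->
  (forall i, (i < n)%N -> arc_C (k i) <= M) ->
  (forall z, D z -> ((modulus (f z))%:E <= 18%:E * \sum_(i < n) arc_int (k i) (fun w => ((dist z w)^-1)%R))%E) ->
  (\int[mu2]_(z in D) (modulus (f z) `^ p)%:E <=
    K%:E * \sum_(i < n) \int[mu]_(x in arc_itv (k i)) (arc_g (k i) x `^ p)%:E)%E.
Proof.
move=> p1 A0 M0; have p0 : 0 < p by lra.
have [K1 K10 HK1] := arc_power p1 A0; have [K2 K20 HK2] := poweR_sum_le n p0.
have [C eC] : exists C : R, C = 18 by exists 18.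
have C0 : 0 <= C by rewrite eC.
pose K3 := C `^ p * (K2 * M `^ p).
have K30 : 0 <= K3 by apply: mulr_ge0; [exact: powR_ge0|apply: mulr_ge0 => //; exact: powR_ge0].
exists (K3 * K1 + 1) => [|D f k oD cf near ok CM bound]; first by rewrite ltr_wpDl// mulr_ge0.
have mD : measurable (D : set P) by exact: open_measurable2.
have HX (i : 'I_n) : exists X : P -> \bar R, [/\ measurable_fun setT X, forall z, (0 <= X z)%E,
    forall z, D z -> ((\int[mu]_(x in arc_itv (k i)) (arc_g (k i) x * (dist z (arc_pt (k i) x))^-1)%:E) `^ p <= X z)%E &
    (\int[mu2]_z X z <= K1%:E * \int[mu]_(x in arc_itv (k i)) (arc_g (k i) x `^ p)%:E)%E].
  by have [C0' mg g0 _] := ok i (ltn_ord i); apply: HK1 => //; exact: near.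
have [X {}HX] := choice HX.
have s0 : (0 <= \sum_(i < n) \int[mu]_(x in arc_itv (k i)) (arc_g (k i) x `^ p)%:E)%E.
  by apply: sume_ge0 => i _; apply: integral_ge0 => x _; rewrite lee_fin powR_ge0.
apply: (@le_trans _ _ (\int[mu2]_(z in D) (K3%:E * \sum_(i < n) X i z))%E).
  apply: ge0_le_integral => //.
  - by move=> z _; rewrite lee_fin powR_ge0.
  - apply/measurable_EFinP; apply: (measurableT_comp (@measurable_powR R p)).
    by apply: open_continuous_measurable2 => // z Dz; exact: ccont_modulus (cf z Dz).
  - apply: measurable_funTS; apply: emeasurable_funM; first exact: measurable_cst.
    by apply: emeasurable_sum => i; have [] := HX i.
  move=> z Dz; rewrite -poweR_EFin.
  pose b i := arc_int (k i) (fun w => ((dist z w)^-1)%R).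
  have b0 i : (i < n)%N -> (0 <= b i)%E.
    by move=> lin; apply: arc_int_ge0; [exact: ok|move=> w; rewrite invr_ge0 dist_ge0].
  have m0 : (0 <= (modulus (f z))%:E)%E by rewrite lee_fin modulus_ge0.
  have bd := bound z Dz; rewrite -eC in bd.
  apply: (le_trans (lee_poweR (ltW p0) m0 bd)).
  have sb0 : (0 <= \sum_(i < n) b i)%E by apply: sume_ge0 => i _; exact: b0.
  have C0E : (0 <= C%:E)%E by rewrite lee_fin.
  rewrite (poweRM _ C0E sb0).
  rewrite poweR_EFin /K3 EFinM -muleA; apply: lee_wpmul2l; first by rewrite lee_fin powR_ge0.
  apply: (le_trans (HK2 b b0)); rewrite EFinM -muleA; apply: lee_wpmul2l; first by rewrite lee_fin.
  rewrite ge0_sume_distrr; last by move=> i _; have [] := HX i.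
  apply: lee_sum => i _; rewrite /b /arc_int.
  have [Ci0 mg g0 _] := ok i (ltn_ord i).
  rewrite poweRM; [|by rewrite lee_fin|]; last first.
    by apply: integral_ge0 => x _; rewrite lee_fin mulr_ge0// invr_ge0 dist_ge0.
  rewrite poweR_EFin; apply: lee_pmul; [by rewrite lee_fin powR_ge0|exact: poweR_ge0| |].
    by rewrite lee_fin; apply: ge0_ler_powR; rewrite ?nnegrE ?(ltW p0)// CM.
  by have [_ _ h _] := HX i; exact: h.
have mX i : measurable_fun setT (X i) by have [] := HX i.
have X0 i z : (0 <= X i z)%E by have [] := HX i.
rewrite ge0_integralZl//; last 2 first.
- by apply: measurable_funTS; apply: emeasurable_sum.
- by move=> z _; apply: sume_ge0.
rewrite ge0_integral_sum//; last by move=> i; exact: measurable_funTS.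
apply: (@le_trans _ _ ((K3 * K1)%:E * \sum_(i < n) \int[mu]_(x in arc_itv (k i)) (arc_g (k i) x `^ p)%:E)%E); last first.
  by apply: lee_wpmul2r => //; rewrite lee_fin lerDl.
rewrite (EFinM K3 K1) -muleA; apply: lee_wpmul2l; first by rewrite lee_fin.
rewrite ge0_sume_distrr; last by move=> i _; apply: integral_ge0 => x _; rewrite lee_fin powR_ge0.
apply: lee_sum => i _; have [_ _ _ h] := HX i.
apply: le_trans h; apply: ge0_subset_integral => //.
Qed.

End hardy_estimate.

(** * Arc length on a graph *)

Section gap.
Variable R : realType.
Implicit Types (A K : set R[i]^o) (z w : R[i]^o).

Definition gap A z : R := inf [set modulus (w - z) | w in A].

Let has_inf_gap A z : A !=set0 -> has_inf [set modulus (w - z) | w in A].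
Proof.
move=> [w Aw]; split; first by exists (modulus (w - z)), w.
by exists 0 => _ [v _ <-]; exact: modulus_ge0.
Qed.

Lemma gap_le A z w : A w -> gap A z <= modulus (w - z).
Proof.
move=> Aw; apply: ge_inf; last by exists w.
by exists 0 => _ [v _ <-]; exact: modulus_ge0.
Qed.

Lemma le_gap A z c : A !=set0 -> (forall w, A w -> c <= modulus (w - z)) -> c <= gap A z.
Proof.
move=> [w Aw] h; apply: lb_le_inf; first by exists (modulus (w - z)), w.
by move=> _ [v Av <-]; exact: h.
Qed.

Lemma gap_lipschitz A z w : A !=set0 -> gap A z <= gap A w + modulus (z - w).
Proof.
move=> A0; rewrite -lerBlDr; apply: le_gap => // v Av; rewrite lerBlDr.
apply: (le_trans (gap_le z Av)); apply: le_trans (modulus_tri _ _ w) _.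
by rewrite lerD2l modulusBC.
Qed.

Lemma gap_lipschitz_norm A z w : A !=set0 -> `|gap A z - gap A w| <= modulus (z - w).
Proof.
move=> A0; have h1 := gap_lipschitz z w A0; have h2 := gap_lipschitz w z A0.
by rewrite modulusBC in h2; rewrite ler_norml; apply/andP; split; lra.
Qed.

Lemma gap_gt0 A z : A !=set0 -> ~ closure A z -> 0 < gap A z.
Proof.
move=> A0 ncl; apply: contrapT => /negP; rewrite -leNgt => g0; apply: ncl => U /nbhs_modulus[e e0 eU].
have [_ [w Aw <-] lt] : exists2 r, [set modulus (w - z) | w in A] r & r < e.
  apply: inf_lt; first by case: (has_inf_gap z A0).
  exact: le_lt_trans e0.
by exists w; split => //; exact: eU.
Qed.

End gap.

(** * Lebesgue measure of the parameter against arc length *)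

Section arc_measure.
Variable R : realType.
Notation mu := (@lebesgue_measure R).
Notation RR := (measurableTypeR R).
Variables (D : set R[i]^o) (G : R[i]^o -> set R[i]^o).
Notation sigma := (arc_length D).
Hypothesis oD : open D.
Hypothesis vertex : forall z, bd D z -> closure (G z) z.
Hypothesis inside : forall z, bd D z -> closure (G z) `\ z `<=` D.
Hypothesis hGm : nt_measurable D G.

Lemma bd_notin z : bd D z -> ~ D z.
Proof. by move=> [_ h] Dz; apply: h; rewrite /interior; apply: open_nbhs_nbhs. Qed.

(** Such a set has outer measure zero, and Caratheodory's condition then reduces to monotonicity. *)
Lemma measurable_null (A : set R[i]^o) : (forall z, A z -> ~ bd D z) ->
  measurable (A : set (arc_space D)).
Proof.
move=> AbD; apply: le_caratheodory_measurable => X.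
have -> : arc_outer_measure D (X `&` A) = 0%E.
  rewrite /arc_outer_measure /= /arc_outer.
  have -> : X `&` A `&` bd D = set0 by apply/seteqP; split => // z [[_ /AbD]].
  by have := arc_outer0 D; rewrite /arc_outer set0I.
by rewrite add0e; apply: le_outer_measure; exact: subIsetl.
Qed.

Lemma measurable_bd : measurable (bd D : set (arc_space D)).
Proof. by rewrite -[X in measurable X]setCK; apply: measurableC; exact: measurable_null. Qed.

Lemma lipschitz_continuous (u : R[i]^o -> R) (C : R) :
  (forall z w, `|u z - u w| <= C * modulus (z - w)) -> continuous (fun z : R[i]^o => (u z)%:C%C : R[i]^o).
Proof.
move=> lip z A /nbhs_modulus[e e0 eA]; apply/nbhs_modulus.
have C0 : 0 < `|C| + 1 by rewrite ltr_wpDl.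
exists (e / (`|C| + 1)); first exact: divr_gt0.
move=> w wz; apply: eA; rewrite -rmorphB modulusC.
apply: (le_lt_trans (lip w z)).
apply: (@le_lt_trans _ _ ((`|C| + 1) * modulus (w - z))).
  apply: ler_wpM2r; first exact: modulus_ge0.
  by apply: (le_trans (ler_norm C)); rewrite lerDl.
by rewrite mulrC -ltr_pdivlMr.
Qed.

Variables (gam : R -> R[i]^o) (L : R).
Hypothesis lip : forall x y, modulus (gam x - gam y) <= L * `|x - y|.

(* A boundary point [z] lies on the arc iff, for all [n], the maximal function of
   [max 0 (1 - n * gap)] is at least [1] at [z]. *)
Lemma measurable_compact_arc (a b : R) : (forall x, a <= x <= b -> bd D (gam x)) ->
  measurable (gam @` `[a, b] : set (arc_space D)).
Proof.
move=> onbd; have [ab|ba] := leP a b; last first.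
  have -> : gam @` `[a, b] = set0.
    by apply/seteqP; split => // _ [x /= xI _]; move: xI; rewrite in_itv/= => /andP[? ?]; lra.
  exact: measurable0.
pose K : set R[i]^o := gam @` `[a, b].
have K0 : K !=set0 by exists (gam a), a => //=; rewrite in_itv/= lexx.
pose u n z : R := Num.max 0 (1 - n%:R * gap K z).
pose F n (z : R[i]^o) : R[i]^o := (u n z)%:C%C.
have u0 n z : 0 <= u n z by rewrite /u le_max lexx.
have uF n z : modulus (F n z) = u n z by rewrite modulusC ger0_norm.
have mF n : measurable_fun [set: arc_space D] (nt_max G (F n) : arc_space D -> \bar R).
  apply: hGm; apply: continuous_subspaceT; apply: (@lipschitz_continuous _ n%:R) => z w.
  have h1 := gap_lipschitz z w K0; have h2 := gap_lipschitz w z K0; rewrite modulusBC in h2.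
  have n0 : 0 <= n%:R :> R by [].
  have k1 := ler_wpM2l n0 h1; have k2 := ler_wpM2l n0 h2; rewrite !mulrDr in k1 k2.
  rewrite /u /Num.max; rewrite ler_norml.
  move: (n%:R * gap K z) (n%:R * gap K w) (n%:R * modulus (z - w)) k1 k2 => p q r k1 k2.
  by case: ltP => ?; case: ltP => ?; apply/andP; split; lra.
have -> : gam @` `[a, b] = bd D `&` \bigcap_n (nt_max G (F n) @^-1` `[1%E, +oo[).
  rewrite -/K; apply/seteqP; split => [z Kz|z [bz hz]].
    have bz : bd D z by case: Kz => x /= xI <-; apply: onbd; move: xI; rewrite in_itv.
    split => // n _ /=; rewrite in_itv/= andbT.
    apply/lee_addgt0Pr => e e0.
    have d0 : 0 < e / (n%:R + 1) by rewrite divr_gt0// ltr_wpDl.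
    have [w [Gw wz]] : G z `&` [set w | modulus (w - z) < e / (n%:R + 1)] !=set0.
      by apply: (vertex bz); apply/nbhs_modulus; exists (e / (n%:R + 1)).
    rewrite -leeBlDr//; apply: (@le_trans _ _ (modulus (F n w))%:E); last first.
      by apply: ereal_sup_ubound; exists w.
    rewrite uF -EFinB lee_fin /u le_max; apply/orP; right.
    have gw : gap K w <= modulus (w - z) by rewrite modulusBC; exact: gap_le.
    have : n%:R * gap K w <= (n%:R + 1) * (e / (n%:R + 1)).
      apply: (@le_trans _ _ (n%:R * (e / (n%:R + 1)))).
        by apply: ler_wpM2l => //; apply: (le_trans gw); exact: ltW.
      by apply: ler_wpM2r; [exact: ltW|rewrite lerDl].
    rewrite [_ * (e / _)]mulrC divfK ?gt_eqF ?ltr_wpDl// => ?; lra.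
  apply: contrapT => nK.
  have Gne : G z !=set0.
    by have [w [Gw _]] := vertex bz (filterT : nbhs z setT); exists w.
  (* A point of the arc in the closure of [G z] differs from [z], so [inside] would place it in [D],
     although it is a boundary point. Compactness then bounds the gap below by some [c > 0], and for
     [n > 1 / c] the maximal function is at most [0]. *)
  have pos x : a <= x <= b -> 0 < gap (G z) (gam x).
    move=> xI; apply: gap_gt0 => // cl; apply: (bd_notin (onbd x xI)).
    apply: (inside bz); split => // /= e; apply: nK; exists x; rewrite /= ?in_itv//.
  have [x0 x0I min] : exists2 c, c \in `[a, b]%R & forall t, t \in `[a, b]%R -> gap (G z) (gam c) <= gap (G z) (gam t).
    apply: EVT_min => //; apply: continuous_subspaceT => x.
    apply/cvgrPdist_le => e e0.
    have L0 : 0 < `|L| + 1 by rewrite ltr_wpDl.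
    near=> y.
    apply: (le_trans (gap_lipschitz_norm _ _ Gne)); apply: (le_trans (lip _ _)).
    apply: (@le_trans _ _ ((`|L| + 1) * `|x - y|)).
      by apply: ler_wpM2r => //; apply: (le_trans (ler_norm L)); rewrite lerDl.
    rewrite mulrC -ler_pdivlMr//.
    by near: y; apply: cvgr_dist_le => //; rewrite divr_gt0.
  have c0 : 0 < gap (G z) (gam x0) by apply: pos; move: x0I; rewrite in_itv.
  set c := gap _ _ in c0 min.
  have far w : G z w -> c <= gap K w.
    move=> Gw; apply: le_gap => // _ [x /= xI <-].
    by rewrite modulusBC; apply: le_trans (gap_le _ Gw); exact: min.
  have [n cn] : exists n : nat, c^-1 < n%:R.
    by exists (Num.truncn c^-1).+1; rewrite truncnS_gt.
  have := hz n I; rewrite /= in_itv/= andbT; apply/negP; rewrite -ltNge.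
  apply: (@le_lt_trans _ _ 0%E); last by [].
  apply: ge_ereal_sup => _ [w Gw <-]; rewrite uF lee_fin /u ge_max lexx /= subr_le0.
  apply: (@le_trans _ _ (n%:R * c)); last by rewrite ler_wpM2l// far.
  by rewrite -ler_pdivrMr// div1r ltW.
apply: measurableI; first exact: measurable_bd.
apply: bigcap_measurable => [|n _]; first by exists 0%N.
rewrite -[X in measurable X]setTI; apply: mF => //; exact: emeasurable_itv.
Unshelve. all: by end_near. Qed.

Variables (pi : R[i]^o -> R) (x0 rho : R).
Notation I := (`](x0 - rho)%R, (x0 + rho)%R[%classic : set RR).
Hypothesis onbd : forall x, I x -> bd D (gam x).
Hypothesis piK : forall x, I x -> pi (gam x) = x.
Hypothesis pi_lip : forall x y, I x -> I y -> `|x - y| <= modulus (gam x - gam y).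

Lemma measurable_sub_arc t : measurable (gam @` (I `&` `[t, +oo[) : set (arc_space D)).
Proof.
have har n : 0 < harmonic n :> R by rewrite /harmonic /= invr_gt0.
have -> : gam @` (I `&` `[t, +oo[) =
    \bigcup_n (gam @` `[Num.max t (x0 - rho + harmonic n), (x0 + rho - harmonic n)%R]).
  apply/seteqP; split => [_ [x [/= xI xt] <-]|_ [n _ [x /= xn <-]]]; last first.
    exists x => //=; move: xn; rewrite !in_itv/= andbT ge_max => /andP[/andP[tx x1] x2].
    have := har n; rewrite /harmonic /=; move: (n.+1%:R^-1) x1 x2 => q x1 x2 hn; split => //; apply/andP; split; lra.
  move: xI xt; rewrite !in_itv/= andbT => /andP[x1 x2] tx.
  have [n hn] : exists n, harmonic n < Num.min (x - (x0 - rho)) (x0 + rho - x).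
    have m0 : 0 < Num.min (x - (x0 - rho)) (x0 + rho - x) by rewrite lt_min !subr_gt0 x1.
    have : \forall n \near \oo, harmonic n < Num.min (x - (x0 - rho)) (x0 + rho - x).
      exact: (cvgr_lt _ (@cvg_harmonic R)).
    by move=> [n _ /(_ n (leqnn n))]; exists n.
  exists n => //; exists x => //=; rewrite in_itv/= ge_max tx /=.
  move: hn; rewrite lt_min /harmonic /=; move: (n.+1%:R^-1) => q /andP[q1 q2].
  by apply/andP; split; lra.
apply: bigcup_measurable => n _; apply: measurable_compact_arc => x; rewrite ge_max => /andP[/andP[_ ?] ?].
by apply: onbd; rewrite /= in_itv/=; have := har n; move=> ?; apply/andP; split; lra.
Qed.

(* [foot z] is the parameter of [z] on the arc, or an endpoint off the arc. *)
Definition foot (z : arc_space D) : RR := if z \in gam @` I then pi z else x0 + rho.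

Lemma footK x : I x -> foot (gam x) = x.
Proof. by move=> xI; rewrite /foot mem_set ?piK//; exists x. Qed.

Lemma foot_arc z : I (foot z) -> exists2 x, I x & z = gam x.
Proof.
rewrite /foot; case: ifPn => [|_]; last by rewrite /= in_itv/= ltxx andbF.
by rewrite inE => -[x xI <-] _; exists x.
Qed.

Lemma measurable_foot : measurable_fun [set: arc_space D] foot.
Proof.
apply: (measurability (@RGenCInfty.G R)) => [|/= _ [_ [t ->] <-]].
  exact: RGenCInfty.measurableE.
rewrite setTI.
have mS : measurable (gam @` I : set (arc_space D)).
  have -> : gam @` I = gam @` (I `&` `[(x0 - rho)%R, +oo[).
    congr (gam @` _); apply/seteqP; split => [x /= xI|x [] //]; split => //=.
    by move: xI; rewrite !in_itv/= => /andP[/ltW -> _].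
  exact: measurable_sub_arc.
have [rt|tr] := leP t (x0 + rho).
  have -> : foot @^-1` `[t, +oo[ = (gam @` (I `&` `[t, +oo[)) `|` ~` (gam @` I).
    apply/seteqP; split => z /=; rewrite in_itv/= andbT.
      have [zS|nS] := pselect ((gam @` I) z); last by right.
      move=> tz; left; case: zS tz => x xI <-; rewrite footK// => tx.
      by exists x => //; split => //=; rewrite in_itv/= andbT.
    move=> [[x [xI xt] <-]|nS]; first by rewrite footK//; move: xt; rewrite /= in_itv/= andbT.
    by rewrite /foot memNset.
  by apply: measurableU; [exact: measurable_sub_arc|exact: measurableC].
have -> : foot @^-1` `[t, +oo[ = set0.
  apply/seteqP; split => // z /=; rewrite in_itv/= andbT /foot; case: ifPn => [|_]; last by lra.
  by rewrite inE => -[x xI <-]; rewrite piK//; move: xI; rewrite /= in_itv/= => /andP[? ?]; lra.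
exact: measurable0.
Qed.

(** Projection to the parameter does not increase distances, so a cover of the arc by sets of
    diameter [d k] induces a cover of [A] by intervals of half-length [d k] about arbitrary points:
    hence the factor [2]. The scale [1] serves only to make the diameters finite. *)
Lemma lebesgue_le_hausdorff (A : set RR) : measurable A -> A `<=` I ->
  (mu A <= 2%:E * hausdorff1 (gam @` A))%E.
Proof.
move=> mA AI.
suff h1 : (mu A <= 2%:E * hausdorff_delta 1 (gam @` A))%E.
  apply: (le_trans h1); apply: lee_wpmul2l => //; exact: hausdorff_delta_le1.
rewrite -lee_pdivrMl//; apply: le_ereal_inf_tmp => _ [U [cov dU] <-].
rewrite lee_pdivrMl//.
pose d k : R := fine (diam (U k)).
have dE k : diam (U k) = (d k)%:E.
  rewrite /d fineK// ge0_fin_numE ?diam_ge0//; exact: le_lt_trans (dU k) (ltry _).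
have d0 k : 0 <= d k by rewrite -lee_fin -dE diam_ge0.
have HJ k : exists x, forall y, A y -> U k (gam y) -> `|x - y| <= d k.
  have [[x [Ax Ux]]|no] := pselect (exists x, A x /\ U k (gam x)); last first.
    by exists 0 => y Ay Uy; exfalso; apply: no; exists y.
  exists x => y Ay Uy; apply: (le_trans (pi_lip (AI _ Ax) (AI _ Ay))).
  rewrite -lee_fin -dE /diam le_max; apply/orP; right; apply: ereal_sup_ubound.
  by exists (gam x, gam y).
have [xk Hx] := choice HJ.
pose J k : set RR := `[(xk k - d k)%R, (xk k + d k)%R]%classic.
have mJ k : measurable (J k) by exact: measurable_itv.
have AJ : A `<=` \bigcup_k J k.
  move=> y Ay; have [k _ Uk] : (\bigcup_k U k) (gam y) by apply: cov; exists y.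
  exists k => //; rewrite /J /= in_itv/=; have := Hx k y Ay Uk.
  by rewrite distrC ler_norml => /andP[? ?]; apply/andP; split; lra.
apply: (le_trans (measure_sigma_subadditive mu mJ mA AJ)).
rewrite -nneseriesZl; last by move=> k _; exact: diam_ge0.
apply: lee_nneseries => k _ *; first exact: measure_ge0.
rewrite /J [leLHS]lebesgue_measure_itv /= lte_fin dE; case: ifP => _; last first.
  by rewrite -EFinM lee_fin mulr_ge0.
by rewrite -EFinB -EFinM lee_fin; lra.
Qed.

(** Monotonicity with no measurability, straight from the definition by simple functions. It is
    applied to [Phi], of which only positivity is known, for instance when it is built from
    [nt_lim]. *)
Lemma nnintegral_le (d : measure_display) (T : measurableType d) (m : {measure set T -> \bar R})
  (f g : T -> \bar R) : (forall x, (0 <= f x)%E) -> (forall x, (f x <= g x)%E) ->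
  (\int[m]_x f x <= \int[m]_x g x)%E.
Proof.
move=> f0 fg; have g0 x : (0 <= g x)%E by exact: le_trans (fg x).
rewrite !ge0_integralTE//; apply: ge_ereal_sup => _ [h hf <-].
by apply: ereal_sup_ubound; exists h => // x; exact: le_trans (hf x) (fg x).
Qed.

(** Twice the image of arc length under [foot] dominates Lebesgue measure on the interval. Removing
    the null set [Z] first makes the pointwise inequality hold at every remaining parameter. *)
Lemma arc_integral_le (h : RR -> \bar R) (Phi : arc_space D -> \bar R) :
  measurable_fun setT h -> (forall x, (0 <= h x)%E) -> (forall z, (0 <= Phi z)%E) ->
  {ae mu, forall x, I x -> (h x <= Phi (gam x))%E} ->
  (\int[mu]_(x in I) h x <= 2%:E * \int[sigma]_z Phi z)%E.
Proof.
move=> mh h0 P0 [Z [mZ Z0 sub]].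
have mI : measurable I by exact: measurable_itv.
have mCZ : measurable (~` Z) by exact: measurableC.
have mIZ : measurable (I `&` ~` Z) by exact: measurableI.
have -> : (\int[mu]_(x in I) h x = \int[mu]_(x in I `&` ~` Z) h x)%E.
  rewrite -setDE; apply: ge0_negligible_integral => //.
  exact: measurable_funTS.
set S := I `&` ~` Z.
pose push : {measure set RR -> \bar R} := pushforward sigma foot.
pose m2 : {measure set RR -> \bar R} := mscale (NngNum (ler0n R 2)) (push measurable_foot).
pose m1 : {measure set RR -> \bar R} := mrestr mu mIZ.
have -> : (\int[mu]_(x in S) h x = \int[m1]_(x in S) h x)%E.
  by apply: eq_measure_integral => A _ AS; rewrite /m1 /= /mrestr setIidl.
apply: (@le_trans _ _ (\int[m2]_(x in S) h x)%E).
  apply: ge0_le_measure_integral => // A mA.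
  rewrite /m1 /= /mrestr /m2 /= /mscale /=.
  have mAS : measurable (A `&` S) by exact: measurableI.
  apply: (le_trans (lebesgue_le_hausdorff mAS _)); first by move=> x [_ []].
  apply: lee_wpmul2l => //; rewrite /pushforward /arc_length /= /arc_outer.
  apply: ge_ereal_sup => _ [e e0 <-]; apply: le_trans (hausdorff_delta_le1 _ e0).
  apply: le_hausdorff_delta => _ [x [Ax [xI _]] <-]; split; last exact: onbd.
  by rewrite /= footK.
have mhS : measurable_fun S h by exact: measurable_funTS.
have E : (\int[push measurable_foot]_(x in S) h x = \int[sigma]_(z in foot @^-1` S) (h \o foot) z)%E.
  by apply: (ge0_integral_pushforward measurable_foot) => // x _; exact: h0.
have -> : (\int[m2]_(x in S) h x = 2%:E * \int[push measurable_foot]_(x in S) h x)%E.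
  by apply: (ge0_integral_mscale (push measurable_foot) mIZ (NngNum (ler0n R 2))).
rewrite E; apply: lee_wpmul2l => //.
rewrite integral_mkcond; apply: nnintegral_le => z; rewrite patchE.
  by case: ifP => // _; exact: h0.
case: ifPn => // ; rewrite inE /= => -[fI nZ].
have [x xI e] := foot_arc fI; rewrite e footK// in nZ *.
by apply: contrapT => nle; apply: nZ; apply: sub => /= /(_ xI).
Qed.

End arc_measure.

(** * Charts and cones *)

Section complex_derivative.
Variable R : realType.
Implicit Types (F : R[i]^o -> R[i]^o) (w : R * R).

Lemma nbhs_cx (A : set R[i]^o) w : nbhs (cx w : R[i]^o) A -> \forall v \near w, A (cx v).
Proof.
move=> /nbhs_modulus[e e0 eA]; apply/nbhs2P; exists (e / 2) => [|v v1 v2]; first exact: divr_gt0.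
apply: eA; apply: (le_lt_trans (modulus_le _)).
rewrite /cx !reimE distrC [`|v.2 - _|]distrC; lra.
Qed.

Lemma open_cx (D : set R[i]^o) : open D -> open [set w : R * R | D (cx w)].
Proof.
by move=> oD; rewrite openE => w Dw; apply: nbhs_cx; exact: open_nbhs_nbhs.
Qed.

Lemma derivable_cdiff F w : derivable F (cx w) 1 ->
  cdiff (fun v => F (cx v)) (fun v => derive1 F (cx v)) w.
Proof.
move=> dF e e0.
have : (fun h : R[i]^o => h^-1 *: (F (h + cx w) - F (cx w))) @ 0^' --> derive1 F (cx w).
  have E : (fun h : R[i]^o => h^-1 *: (F (h + cx w) - F (cx w))) =
      (fun h : R[i]^o => h^-1 *: ((F \o shift (cx w : R[i]^o)) (h *: (1 : R[i]^o)) - F (cx w))).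
    by apply/funext => h /=; rewrite [h *: _]mulr1.
  by rewrite /derive1 E; exact: dF.
set l := derive1 F (cx w) => cF.
have : nbhs l [set z | modulus (z - l) < e] by apply/nbhs_modulus; exists e.
move=> /cF; rewrite /= /nbhs /= /within /= => /nbhs_modulus[d d0 H].
have : nbhs (cx w : R[i]^o) [set z | modulus (z - cx w) < d] by apply/nbhs_modulus; exists d.
move=> /nbhs_cx; apply: filterS => v vd.
have [evw|vw] := eqVneq (cx v) (cx w).
  have -> : F (cx v) - F (cx w) - l * (cx v - cx w) = 0.
    by rewrite evw; apply: cplx_eqP; rewrite !(reD, imD, reN, imN, reM, imM, re0, im0); ring.
  by rewrite modulus0 mulr_ge0 ?modulus_ge0// ltW.
have vw0 : cx v - cx w != 0 by rewrite subr_eq0.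
have vd' : modulus (cx v - cx w - 0) < d by rewrite subr0; exact: vd.
have lt : modulus ((cx v - cx w)^-1 *: (F (cx v - cx w + cx w) - F (cx w)) - l) < e := H _ vd' vw0.
rewrite subrK in lt.
have -> : F (cx v) - F (cx w) - l * (cx v - cx w) =
    ((cx v - cx w)^-1 *: (F (cx v) - F (cx w)) - l) * (cx v - cx w).
  by rewrite mulrBl /GRing.scale /= mulrAC mulVf// mul1r.
by rewrite modulusM; apply: ler_wpM2r; [exact: modulus_ge0|exact: ltW].
Qed.

Lemma cdiff_ccont (F f : R * R -> R[i]) w : cdiff F f w -> ccont F w.
Proof.
move=> dF; apply/ccontP => e e0.
have k0 : 0 < modulus (f w) + 2 by rewrite ltr_wpDl ?modulus_ge0.
have : nbhs (cx w : R[i]^o) [set z | modulus (z - cx w) < e / (modulus (f w) + 2)].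
  by apply/nbhs_modulus; exists (e / (modulus (f w) + 2)); rewrite ?divr_gt0.
move=> /nbhs_cx; apply: filterS2 (dF 1 ltr01) => v h1 h2.
have {}h2 : modulus (cx v - cx w) < e / (modulus (f w) + 2) := h2.
have h3 := modulusD (F v - F w - f w * (cx v - cx w)) (f w * (cx v - cx w)).
rewrite subrK modulusM in h3; rewrite mul1r in h1; rewrite ltr_pdivlMr// mulrDr in h2.
by have h4 := modulus_ge0 (cx v - cx w); lra.
Qed.

Lemma cdiff_hol (D : set (R * R)) (F f : R * R -> R[i]) :
  (forall w, D w -> cdiff F f w) -> (forall w, D w -> ccont f w) -> hol D F f.
Proof.
move=> dF cf w Dw; split; [| |exact: cdiff_ccont (dF w Dw)|exact: cf].
  have e t : seg (0, w.2) (1, w.2) t = (t, w.2).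
    by rewrite /seg /= subr0 mulr1 add0r subrr mulr0 addr0.
  have := @cderiv_seg R F f (0, w.2) (1, w.2) w.1; rewrite e -surjective_pairing => /(_ (dF w Dw)).
  have -> : (fun t => F (seg (0, w.2) (1, w.2) t)) = (fun x => F (x, w.2)) by apply/funext => t; rewrite e.
  suff -> : f w * (cx (1, w.2) - cx (0, w.2)) = f w by [].
  by apply: cplx_eqP; rewrite /cx !reimE /=; ring.
have e t : seg (w.1, 0) (w.1, 1) t = (w.1, t).
  by rewrite /seg /= subr0 mulr1 add0r subrr mulr0 addr0.
have := @cderiv_seg R F f (w.1, 0) (w.1, 1) w.2; rewrite e -surjective_pairing => /(_ (dF w Dw)).
have -> : (fun t => F (seg (w.1, 0) (w.1, 1) t)) = (fun y => F (w.1, y)) by apply/funext => t; rewrite e.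
suff -> : f w * (cx (w.1, 1) - cx (w.1, 0)) = 'i%C * f w by [].
by apply: cplx_eqP; rewrite /cx !reimE /=; ring.
Qed.

Lemma lipschitzP (phi : R -> R) : lipschitz phi ->
  exists2 L, 0 <= L & forall x y, `|phi x - phi y| <= L * `|x - y|.
Proof.
move=> [M [_ H]]; exists (`|M| + 1) => [|x y]; first by rewrite addr_ge0.
have MM : M < `|M| + 1 by rewrite (le_lt_trans (ler_norm M))// ltrDl.
exact: (H (`|M| + 1) MM (x, y) (conj Logic.I Logic.I)).
Qed.

End complex_derivative.

(** * Rotations and the aperture of nested cones *)

Section rotation.
Variable R : realType.
Implicit Types (z w v : R[i]^o) (t : R).
Local Notation rot := Defs.rot.

Lemma rotateE t z : rot t z = ((cos t * re z - sin t * im z) +i* (sin t * re z + cos t * im z))%C.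
Proof. by rewrite /rot; apply: cplx_eqP; rewrite !reimE //=; ring. Qed.

Lemma rotateK t z : rot t (rot (- t) z) = z.
Proof.
rewrite !rotateE cosN sinN; have h := cos2Dsin2 t; apply: cplx_eqP; rewrite !reimE.
  transitivity ((cos t ^+ 2 + sin t ^+ 2) * re z); [ring|by rewrite h mul1r].
transitivity ((cos t ^+ 2 + sin t ^+ 2) * im z); [ring|by rewrite h mul1r].
Qed.

Lemma rotateNK t z : rot (- t) (rot t z) = z.
Proof. by rewrite -{2}[t]opprK rotateK. Qed.

Lemma rotateB t z w : rot t (z - w) = rot t z - rot t w.
Proof. by rewrite /rot mulrBr. Qed.

Lemma modulus_rotate t z : modulus (rot t z) = modulus z.
Proof.
by rewrite /rot modulusM [modulus (_ +i* _)%C]modulusE !reimE cos2Dsin2 sqrtr1 mul1r.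
Qed.

Lemma rotate_pnt t x y : rot t (cx (pnt (cos t) (sin t) x y)) = (x +i* y)%C.
Proof.
have h := cos2Dsin2 t; rewrite rotateE; apply: cplx_eqP; rewrite /cx /pnt !reimE /=.
  transitivity ((cos t ^+ 2 + sin t ^+ 2) * x); [ring|by rewrite h mul1r].
transitivity ((cos t ^+ 2 + sin t ^+ 2) * y); [ring|by rewrite h mul1r].
Qed.

Lemma rotate_gpt t phi x s : rot t (cx (gpt (cos t) (sin t) phi x s)) = (x +i* (phi x + s))%C.
Proof. exact: rotate_pnt. Qed.

Lemma vertical_coneE t z0 m h v :
  [set rot (- t) w + z0 | w in trunc_cone 0 (0 +i* 1)%C m h] v <->
  0 < im (rot t (v - z0)) < h /\ `|re (rot t (v - z0))| < m * im (rot t (v - z0)).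
Proof.
have e w : trunc_cone 0 (0 +i* 1)%C m h w <-> 0 < im w < h /\ `|re w| < m * im w.
  have ew : (w - 0) * conjc (0 +i* 1)%C = (im w +i* (- re w))%C.
    by apply: cplx_eqP; rewrite !reimE; ring.
  have -> : trunc_cone 0 (0 +i* 1)%C m h w =
    (0 < re ((w - 0) * conjc (0 +i* 1)%C) < h /\
     `|im ((w - 0) * conjc (0 +i* 1)%C)| < m * re ((w - 0) * conjc (0 +i* 1)%C)) by [].
  by rewrite ew reE imE normrN.
split => [[w /e h1 <-]|h1]; first by rewrite addrK rotateK.
by exists (rot t (v - z0)); [exact/e|rewrite rotateNK subrK].
Qed.

Lemma cone_margin t z0 (u : R[i]^o) m h m2 h2 : modulus u = 1 -> 0 < m -> 0 < h -> 0 < m2 -> 0 < h2 ->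
  closure (trunc_cone z0 u m h) `\ z0 `<=` [set rot (- t) w + z0 | w in trunc_cone 0 (0 +i* 1)%C m2 h2] ->
  exists2 kappa, 0 < kappa & exists2 d, 0 < d & forall z v, trunc_cone z0 u m h z ->
    modulus (z - z0) < d -> ~ [set rot (- t) w + z0 | w in trunc_cone 0 (0 +i* 1)%C m2 h2] v ->
    kappa * modulus (z - z0) <= modulus (z - v).
Proof.
move=> u1 m0 h0 m20 h20 sub.
have uJ : u * conjc u = 1 by rewrite mulJ u1 expr1n.
have uJK (w : R[i]^o) : conjc u * (u * w) = w.
  have k := modulus_sqr u; rewrite u1 expr1n in k.
  apply: cplx_eqP; rewrite !(reM, imM, reJ, imJ).
    by transitivity ((re u ^+ 2 + im u ^+ 2) * re w); [ring|rewrite -k mul1r].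
  by transitivity ((re u ^+ 2 + im u ^+ 2) * im w); [ring|rewrite -k mul1r].
have uKJ (w : R[i]^o) : u * (w * conjc u) = w by rewrite -[RHS]uJK; ring.
set a := re (rot t u); set b := im (rot t u).
have pt p q : re (rot t (u * (p +i* q)%C)) = a * p - b * q /\ im (rot t (u * (p +i* q)%C)) = a * q + b * p.
  have -> : rot t (u * (p +i* q)%C) = rot t u * (p +i* q)%C by rewrite /rot mulrA.
  by rewrite reM imM reE imE.
have edge s : s ^+ 2 = 1 -> 0 < m2 * (a * (s * m) + b) - `|a - b * (s * m)|.
  move=> s2; have s1 : `|s| = 1 by apply/eqP; rewrite -sqr_norm_eq1 s2.
  (* A point halfway along the edge of sign [s]. It is in the closure of the open cone but not in
     the cone; shrinking its transverse coordinate by [1 - ep] gives points of the cone near it. *)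
  pose v := z0 + u * ((h / 2) +i* (h / 2 * (s * m)))%C.
  have vz : v - z0 = u * ((h / 2) +i* (h / 2 * (s * m)))%C by rewrite /v addrAC subrr add0r.
  have : (closure (trunc_cone z0 u m h) `\ z0) v.
    split => [U /nbhs_modulus[e e0 eU]|/= vz0]; last first.
      have := vz; rewrite vz0 subrr => /(congr1 (fun w => re (conjc u * w))).
      by rewrite uJK reE reM re0 im0 !mulr0 subr0 => ?; lra.
    pose ep := Num.min (1/2) (e / (h * m)).
    have ep0 : 0 < ep by rewrite lt_min divr_gt0//= divr_gt0// mulr_gt0.
    have ep1 : ep <= 1/2 by rewrite ge_min lexx.
    have ep2 : ep <= e / (h * m) by rewrite ge_min lexx orbT.
    exists (z0 + u * ((h / 2) +i* (h / 2 * (s * m) * (1 - ep)))%C); split.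
      have e1 : (z0 + u * (h / 2 +i* (h / 2 * (s * m) * (1 - ep)))%C - z0) * conjc u =
          (h / 2 +i* (h / 2 * (s * m) * (1 - ep)))%C.
        by rewrite addrAC subrr add0r mulrC uJK.
      rewrite /trunc_cone /= e1 /=; split; first by apply/andP; split; lra.
      have hh : 0 <= h / 2 by lra.
      have e10 : 0 <= 1 - ep by lra.
      rewrite normrM [`|_ * (s * m)|]normrM [`|s * m|]normrM s1 mul1r.
      rewrite (ger0_norm hh) (ger0_norm (ltW m0)) (ger0_norm e10).
      have k0 : 0 < h / 2 * m * ep by rewrite mulr_gt0// mulr_gt0 ?divr_gt0.
      by rewrite mulrBr mulr1 [m * _]mulrC; lra.
    apply: eU; rewrite /v opprD addrACA subrr add0r -mulrBr modulusM u1 mul1r.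
    have -> : ((h / 2 +i* (h / 2 * (s * m) * (1 - ep))) - (h / 2 +i* (h / 2 * (s * m))))%C =
       ((- (h / 2 * (s * m) * ep))%:C * 'i)%C :> R[i].
      by apply: cplx_eqP; rewrite !reimE; ring.
    have hh : 0 <= h / 2 by lra.
    rewrite modulusM modulus_i mulr1 modulusC normrN normrM [`|_ * (s * m)|]normrM [`|s * m|]normrM s1 mul1r.
    rewrite (ger0_norm hh) (ger0_norm (ltW m0)) (ger0_norm (ltW ep0)).
    have hm : 0 < h * m by rewrite mulr_gt0.
    have := ep2; rewrite ler_pdivlMr// => k1.
    have -> : h / 2 * m * ep = ep * (h * m) / 2 by field.
    lra.
  move=> /sub /vertical_coneE [_]; rewrite vz; have [-> ->] := pt (h / 2) (h / 2 * (s * m)).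
  have h20' : 0 < h / 2 by lra.
  have -> : a * (h / 2) - b * (h / 2 * (s * m)) = h / 2 * (a - b * (s * m)) by ring.
  have -> : a * (h / 2 * (s * m)) + b * (h / 2) = h / 2 * (a * (s * m) + b) by ring.
  by rewrite normrM (ger0_norm (ltW h20')) [m2 * (h / 2 * _)]mulrCA ltr_pM2l// subr_gt0.
have e1 := edge 1 (expr1n _ _); have e2 := edge (-1) (etrans (sqrrN 1) (expr1n _ _)).
rewrite !mul1r in e1; rewrite !mulN1r in e2.
set n1 := m2 * (a * m + b) - `|a - b * m| in e1; set n2 := m2 * (a * (- m) + b) - `|a - b * (- m)| in e2.
pose eta := Num.min n1 n2.
have eta0 : 0 < eta by rewrite lt_min e1.
have m10 : 0 < 1 + m by lra.
have m210 : 0 < 1 + m2 by lra.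
pose kappa := eta / ((1 + m) * (1 + m2)).
have k0 : 0 < kappa by rewrite divr_gt0// mulr_gt0.
exists kappa => //; exists (h2 / (1 + kappa)); first by rewrite divr_gt0//; lra.
move=> z v [/andP[p0 _]]; rewrite -/(re _) -/(im _) in p0 *.
set p := re _ in p0 *; set q := im _ => qp zd nv.
have zE : z - z0 = u * (p +i* q)%C.
  rewrite -[(p +i* q)%C](_ : (z - z0) * conjc u = _); last by apply: cplx_eqP.
  by rewrite uKJ.
rewrite leNgt; apply/negP => lt; apply: nv; apply/vertical_coneE.
have [Xe Ye] := pt p q; rewrite -zE in Xe Ye.
set X := re _ in Xe; set Y := im _ in Ye.
have zp : modulus (z - z0) <= (1 + m) * p.
  rewrite zE modulusM u1 mul1r; apply: (le_trans (modulus_le _)).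
  by clear -p0 qp; rewrite reE imE (ger0_norm (ltW p0)); lra.
(* Coefficients of [z - z0] along the two edges: [p = A + B] and [q = (A - B) m], both positive
   because [|q| < m p]. *)
pose A := (p + q / m) / 2; pose B := (p - q / m) / 2.
have qm : `|q / m| < p by rewrite normrM normfV (ger0_norm (ltW m0)) ltr_pdivrMr// mulrC.
have [A0 B0] : 0 < A /\ 0 < B by clear -qm; move: qm; rewrite ltr_norml => /andP[? ?]; rewrite /A /B; split; lra.
have pAB : p = A + B by rewrite /A /B; field; rewrite gt_eqF.
have qAB : q = (A - B) * m by rewrite /A /B; field; rewrite gt_eqF.
clearbody A B.
have key : eta * p <= m2 * Y - `|X|.
  have XE : X = A * (a - b * m) + B * (a - b * (- m)) by rewrite Xe pAB qAB; ring.
  have YE : Y = A * (a * m + b) + B * (a * (- m) + b) by rewrite Ye pAB qAB; ring.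
  have X1 : `|X| <= A * `|a - b * m| + B * `|a - b * (- m)|.
    by rewrite XE; apply: (le_trans (ler_normD _ _)); rewrite !normrM (ger0_norm (ltW A0)) (ger0_norm (ltW B0)).
  have g1 : A * eta <= A * n1 by rewrite ler_wpM2l ?(ltW A0)// /eta ge_min lexx.
  have g2 : B * eta <= B * n2 by rewrite ler_wpM2l ?(ltW B0)// /eta ge_min lexx orbT.
  have -> : eta * p = A * eta + B * eta by rewrite pAB; ring.
  apply: (le_trans (lerD g1 g2)).
  have -> : A * n1 + B * n2 = m2 * Y - (A * `|a - b * m| + B * `|a - b * (- m)|).
    by rewrite YE /n1 /n2; ring.
  by rewrite lerD2l lerN2.
have dv : modulus (rot t (v - z0) - rot t (z - z0)) = modulus (z - v).
  rewrite -rotateB modulus_rotate -modulusN; congr modulus.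
  by rewrite opprB opprB addrA subrK.
set Xv := re (rot t (v - z0)); set Yv := im (rot t (v - z0)).
have hX : `|Xv - X| <= modulus (z - v) by rewrite -dv /Xv /X -reB; exact: ler_re.
have hY : `|Yv - Y| <= modulus (z - v) by rewrite -dv /Yv /Y -imB; exact: ler_im.
have small : (1 + m2) * modulus (z - v) < eta * p.
  apply: (@lt_le_trans _ _ ((1 + m2) * (kappa * modulus (z - z0)))); first by rewrite ltr_pM2l.
  apply: (@le_trans _ _ ((1 + m2) * (kappa * ((1 + m) * p)))).
    by rewrite ler_wpM2l ?(ltW m210)// ler_wpM2l ?(ltW k0).
  rewrite le_eqVlt; apply/orP; left; apply/eqP; rewrite /kappa; field.
  by apply/andP; split; rewrite gt_eqF.
have Xv1 : `|Xv| <= `|X| + modulus (z - v).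
  by clear -hX; have := ler_normD (Xv - X) X; rewrite subrK => h1; lra.
have Yv1 : Y - modulus (z - v) <= Yv.
  by clear -hY; move: hY; rewrite ler_norml => /andP[? _]; lra.
have Yv2 : m2 * Y - m2 * modulus (z - v) <= m2 * Yv by rewrite -mulrBr ler_wpM2l ?(ltW m20).
have XY : `|Xv| < m2 * Yv.
  by clear -small key Xv1 Yv2; move: small key; rewrite mulrDl mul1r; lra.
split => //; apply/andP; split.
  by rewrite -(pmulr_rgt0 _ m20); apply: le_lt_trans XY.
have Yle : Yv <= modulus (v - z0).
  by rewrite -(modulus_rotate t); apply: le_trans (ler_norm _) (ler_im _).
apply: (le_lt_trans Yle); apply: (le_lt_trans (modulus_tri v z0 z)).
rewrite modulusBC; apply: (@lt_le_trans _ _ ((1 + kappa) * modulus (z - z0))).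
  by clear -lt; rewrite mulrDl mul1r; lra.
by clear -zd k0; move: zd; rewrite ltr_pdivlMr; [rewrite mulrC => /ltW|lra].
Qed.

End rotation.

Section boundary_chart.
Variable R : realType.
Local Notation rot := Defs.rot.
Variables (D : set R[i]^o) (t L : R) (phi : R -> R) (Q Q' : set R[i]^o).
Hypothesis oD : open D.
Hypothesis lip : forall x y, `|phi x - phi y| <= L * `|x - y|.
Hypothesis graph : (rot t @` D) `&` Q = [set z | Q z /\ phi (complex.Re z) < complex.Im z].
Hypothesis rQ' : open_rectangle Q'.
Hypothesis Q'Q : Q' `<=` Q.

Notation gpt := (gpt (cos t) (sin t) phi).

Let L0 : 0 <= L.
Proof. by have := lip 1 0; rewrite subr0 normr1 mulr1; apply: le_trans. Qed.

Lemma graph_mem z : Q (rot t z) -> (D z <-> phi (re (rot t z)) < im (rot t z)).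
Proof.
move=> Qz; have := congr1 (fun A : set _ => A (rot t z)) graph => /= e.
split => [Dz|lt].
  have : ((rot t @` D) `&` Q) (rot t z) by split => //; exists z.
  by rewrite graph => -[].
have : [set z | Q z /\ phi (complex.Re z) < complex.Im z] (rot t z) by split.
by rewrite -graph => -[[w Dw /(congr1 (rot (- t)))]]; rewrite !rotateNK => <-.
Qed.

Lemma rectangle_near w : Q' w -> exists2 e, 0 < e &
  forall v, `|re v - re w| < e -> `|im v - im w| < e -> Q' v.
Proof.
move: rQ' => [x1 [x2 [y1 [y2 [_ _ ->]]]]] /= [/andP[a1 a2] /andP[b1 b2]].
exists (Num.min (Num.min (re w - x1) (x2 - re w)) (Num.min (im w - y1) (y2 - im w))).
  by rewrite !lt_min !subr_gt0 a1 a2 b1 b2.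
move=> v; rewrite !lt_min -!andbA => /and4P[c1 c2 _ _] /and4P[_ _ d1 d2].
move: c1 c2 d1 d2; rewrite -!/(re _) -!/(im _).
move: (re v) (re w) (im v) (im w) => p q r s.
by rewrite !ltr_norml => /andP[? ?] /andP[? ?] /andP[? ?] /andP[? ?]; split; apply/andP; split; lra.
Qed.

(** A boundary point above the graph would lie in the open set [D], and one strictly below has a
    disc free of [D] since the slope is at most [L]. Conversely a point of the graph is not in [D]
    but is a limit of points above it. *)
Lemma bd_graph z : Q' (rot t z) -> (bd D z <-> im (rot t z) = phi (re (rot t z))).
Proof.
move=> Qz; have [e e0 near] := rectangle_near Qz.
have nearz v : modulus (v - z) < e -> Q' (rot t v).
  move=> vz; apply: near; rewrite -?reB -?imB -rotateB.
    by apply: le_lt_trans (ler_re _) _; rewrite modulus_rotate.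
  by apply: le_lt_trans (ler_im _) _; rewrite modulus_rotate.
have shift (s : R) : modulus (z + rot (- t) (s%:C * 'i)%C - z) = `|s|.
  by rewrite addrAC subrr add0r modulus_rotate modulusM modulus_i mulr1 modulusC.
have rshift (s : R) : rot t (z + rot (- t) (s%:C * 'i)%C) = rot t z + (s%:C * 'i)%C.
  have rD (a b : R[i]^o) : rot t (a + b) = rot t a + rot t b by rewrite /Defs.rot mulrDr.
  by rewrite rD rotateK.
split => [bz|ez].
  have nD : ~ D z by exact: bd_notin bz.
  apply: le_anti; apply/andP; split.
    rewrite leNgt; apply/negP => lt; apply: nD; apply/graph_mem => //; exact: Q'Q.
  rewrite leNgt; apply/negP => lt.
  pose d := phi (re (rot t z)) - im (rot t z).
  have d0 : 0 < d by rewrite subr_gt0.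
  (* A displacement smaller than [d / (2 (1 + L))] changes the height by at most itself and the
     graph by at most [L] times itself, together at most [d / 2], so the displaced point is still
     below the graph. *)
  pose e1 := Num.min e (d / (2 * (1 + L))).
  have L1 : 0 < 1 + L by have hL := L0; lra.
  have e10 : 0 < e1 by rewrite lt_min e0 divr_gt0// mulr_gt0.
  have e1e : e1 <= e by rewrite ge_min lexx.
  have e1d : e1 * (2 * (1 + L)) <= d by rewrite -ler_pdivlMr ?mulr_gt0// ge_min lexx orbT.
  have [v [Dv]] : D `&` [set v | modulus (v - z) < e1] !=set0.
    by apply: bz.1; apply/nbhs_modulus; exists e1.
  move=> /= vz; have Qv : Q (rot t v) by apply: Q'Q; apply: nearz; exact: lt_le_trans e1e.
  have /(graph_mem Qv) := Dv.
  have h1 : `|re (rot t v) - re (rot t z)| <= modulus (v - z).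
    by rewrite -reB -rotateB -(modulus_rotate t); exact: ler_re.
  have h2 : `|im (rot t v) - im (rot t z)| <= modulus (v - z).
    by rewrite -imB -rotateB -(modulus_rotate t); exact: ler_im.
  have h3 := lip (re (rot t v)) (re (rot t z)).
  have h4 : L * `|re (rot t v) - re (rot t z)| <= L * e1.
    by rewrite ler_wpM2l//; apply: (le_trans h1); exact: ltW.
  move: h2 h3; rewrite !ler_norml => /andP[_ h2] /andP[h3 _] h5.
  have dE : d = phi (re (rot t z)) - im (rot t z) by [].
  have e1d' : 2 * e1 + 2 * (L * e1) <= d by apply: le_trans e1d; rewrite le_eqVlt; apply/orP; left; apply/eqP; ring.
  by have := ltW e10; have := mulr_ge0 L0 (ltW e10); lra.
split; last first.
  move=> /= /(@interior_subset _ _ _) Dz.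
  by move: Dz => /(graph_mem (Q'Q Qz)); rewrite ez ltxx.
move=> U /nbhs_modulus[e1 e10 eU].
pose s := Num.min e e1 / 2.
have s0 : 0 < s by rewrite divr_gt0// lt_min e0.
have m1 : Num.min e e1 <= e by rewrite ge_min lexx.
have m2 : Num.min e e1 <= e1 by rewrite ge_min lexx orbT.
have sm : s < Num.min e e1 by rewrite ltr_pdivrMr// mulr_natr mulr2n ltrDl lt_min e0.
exists (z + rot (- t) (s%:C * 'i)%C); split.
  apply/graph_mem.
    apply: Q'Q; apply: nearz; rewrite shift ger0_norm ?(ltW s0)//; exact: lt_le_trans m1.
  have er (q : R[i]^o) : re (q + (s%:C * 'i)%C) = re q by rewrite !reimE; ring.
  have ei (q : R[i]^o) : im (q + (s%:C * 'i)%C) = im q + s by rewrite !reimE; ring.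
  by rewrite rshift er ei ez ltrDl.
by apply: eU; rewrite shift ger0_norm ?(ltW s0)//; exact: lt_le_trans m2.
Qed.

Lemma gpt_Q x0 : Q' (rot t (cx (gpt x0 0))) -> exists2 rho, 0 < rho & exists2 h, 0 < h &
  forall x s, `|x - x0| < rho -> `|s| < h -> Q' (rot t (cx (gpt x s))).
Proof.
move=> /rectangle_near[e e0 near]; rewrite rotate_gpt in near.
have L1 : 0 < 1 + L by have hL := L0; lra.
exists (e / (2 * (1 + L))); first by rewrite divr_gt0// mulr_gt0.
exists (e / 2) => [|x s xx ss]; first by rewrite divr_gt0.
rewrite ltr_pdivlMr ?mulr_gt0// in xx; rewrite rotate_gpt.
have LL := lip x x0; have k1 := normr_ge0 (x - x0); have k2 := mulr_ge0 L0 k1.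
have xx' : 2 * `|x - x0| + 2 * (L * `|x - x0|) < e.
  by apply: le_lt_trans xx; rewrite le_eqVlt; apply/orP; left; apply/eqP; ring.
apply: near; rewrite ?reE ?imE; first lra.
have -> : phi x + s - (phi x0 + 0) = (phi x - phi x0) + s by ring.
apply: (le_lt_trans (ler_normD _ _)); lra.
Qed.

End boundary_chart.

(** * Densities on the arcs and their control by arc length *)

Section boundary_control.
Variable R : realType.
Notation mu := (@lebesgue_measure R).
Notation RR := (measurableTypeR R).
Local Notation rot := Defs.rot.

Lemma trunc_cone_vertex (z u : R[i]^o) (m h : R) : modulus u = 1 -> 0 < m -> 0 < h ->
  closure (trunc_cone z u m h) z.
Proof.
move=> u1 m0 h0 U /nbhs_modulus[e e0 eU].
pose s := Num.min h e / 2.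
have s0 : 0 < s by rewrite divr_gt0// lt_min h0.
have sh : s < Num.min h e by rewrite ltr_pdivrMr// mulr_natr mulr2n ltrDl lt_min h0.
have k : (z + u * s%:C%C - z) * conjc u = s%:C%C.
  have h1 := modulus_sqr u; rewrite u1 expr1n in h1.
  rewrite [z + _]addrC addrK; apply: cplx_eqP; rewrite !(reM, imM, reJ, imJ, reC, imC).
    by transitivity ((re u ^+ 2 + im u ^+ 2) * s); [ring|rewrite -h1 mul1r].
  by ring.
exists (z + u * s%:C%C); split.
  have : (0 < re s%:C%C < h) /\ `|im s%:C%C| < m * re s%:C%C.
    rewrite reC imC normr0; split; last exact: mulr_gt0.
    by apply/andP; split => //; apply: (lt_le_trans sh); rewrite ge_min lexx.
  have E : trunc_cone z u m h (z + u * s%:C%C) =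
    (0 < re ((z + u * s%:C%C - z) * conjc u) < h /\
     `|im ((z + u * s%:C%C - z) * conjc u)| < m * re ((z + u * s%:C%C - z) * conjc u)) by [].
  by rewrite E k.
apply: eU; rewrite addrAC subrr add0r modulusM u1 mul1r modulusC ger0_norm ?(ltW s0)//.
by apply: (lt_le_trans sh); rewrite ge_min lexx orbT.
Qed.

Lemma lsc_measurable (a b : R) (S : RR -> \bar R) :
  (forall x, a < x < b -> forall c, (c%:E < S x)%E -> \forall y \near x, (c%:E < S y)%E) ->
  measurable_fun (`]a, b[%classic : set RR) S.
Proof.
move=> lsc; apply: (measurability _ (@ErealGenOInfty.measurableE R)) => _ [_ [c ->] <-].
apply: open_measurable; rewrite openE => x [/= xI cS]; rewrite in_itv/= in xI.
have xo : nbhs x (`]a, b[%classic : set R).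
  by apply: open_nbhs_nbhs; split; [exact: interval_open|rewrite /= in_itv].
have := lsc x xI c; rewrite in_itv/= andbT in cS; move=> /(_ cS).
by apply: filterS2 xo => y yI cy; split => //=; rewrite in_itv/= andbT.
Qed.

Lemma le_poweR_add1 (y : \bar R) (p : R) : 1 < p -> (0 <= y)%E -> (y <= 1 + y `^ p)%E.
Proof.
move=> p1; have p0 : 0 < p by lra.
case: y => [y| |] // y0; last by rewrite poweRyr ?gt_eqF// addey.
rewrite poweR_EFin -EFinD lee_fin; rewrite lee_fin in y0.
have [y1|y1] := leP y 1; first by apply: (le_trans y1); rewrite lerDl powR_ge0.
apply: (@le_trans _ _ (y `^ p)); last by rewrite lerDr.
by rewrite -[leLHS]powRr1// ler_powR// ltW.
Qed.

Definition with_density (k : barc R) (g : R -> R) :=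
  Arc (arc_c k) (arc_s k) (arc_phi k) (arc_x k) (arc_rho k) g (arc_C k).

Variables (D : set R[i]^o) (G : R[i]^o -> set R[i]^o) (p : R).
Hypotheses (oD : open D) (p1 : 1 < p).
Hypothesis trunc : forall z, bd D z -> is_trunc_cone z (G z).
Hypothesis inside : forall z, bd D z -> closure (G z) `\ z `<=` D.
Hypothesis hGm : nt_measurable D G.
Notation D2 := [set w : R * R | D (cx w)].

(* The disc and the arc do not depend on [F], only the density [g] does. *)
Definition controlled (a : R * R) (r : R) (k : barc R) : Prop :=
  [/\ [/\ 0 < r, 0 <= arc_C k, arc_c k ^+ 2 + arc_s k ^+ 2 = 1 &
       exists L, forall x y, `|arc_phi k x - arc_phi k y| <= L * `|x - y|],
      forall x, arc_itv k x -> bd D (cx (arc_pt k x)) &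
      forall F, holomorphic D F -> hardy D G p (derive1 F) ->
      exists g, [/\ arc_ok (with_density k g),
        local_bound D2 (fun w => derive1 F (cx w)) a r (with_density k g),
        (\int[mu]_(x in arc_itv k) (g x `^ p)%:E <=
          2%:E * \int[arc_length D]_z `|nt_max G (derive1 F) z| `^ p)%E &
        (\int[mu]_(x in arc_itv k) (g x `^ p)%:E <=
          2%:E * \int[arc_length D]_z (modulus (nt_lim G (derive1 F) z) `^ p)%:E)%E]].

Lemma vertex_closure z : bd D z -> closure (G z) z.
Proof. by move=> /trunc[u [m [h [u1 m0 h0 ->]]]]; exact: trunc_cone_vertex. Qed.

Lemma holomorphic_hol F : holomorphic D F -> holomorphic D (derive1 F) ->
  hol D2 (fun w => F (cx w)) (fun w => derive1 F (cx w)).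
Proof.
move=> hF hf; apply: cdiff_hol => w Dw; first by apply: derivable_cdiff; exact: hF.
by apply: cdiff_ccont; apply: derivable_cdiff; exact: hf.
Qed.

(** The localised integral vanishes on an interior disc, so its arc may be empty: [arc_rho = 0]
    makes the parameter interval empty. *)
Lemma controlled_interior a : D (cx a) -> exists r k, controlled a r k.
Proof.
move=> Da; have : nbhs (cx a : R[i]^o) D by exact: open_nbhs_nbhs.
move=> /nbhs_modulus[e e0 eD].
pose k := @Arc R 1 0 (cst 0) 0 0 (cst 0) 0.
have kE x : ~ arc_itv k x by rewrite /arc_itv /= in_itv/= subr0 addr0 => /andP[? ?]; lra.
exists (e / 2), k; split => [|x /kE//|F hF [hf _]].
  split; rewrite ?divr_gt0//= ?expr1n ?expr0n ?addr0//.
  by exists 0 => x y; rewrite subrr normr0 mul0r.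
exists (cst 0); have ok : arc_ok (with_density k (cst 0)).
  by split => //=; exists 0 => x y; rewrite subrr normr0 mul0r.
split => //.
  apply: local_bound_interior => //; [exact: open_cx| |by rewrite divr_gt0|].
    exact: hol_weakly_deriv (open_cx oD) (holomorphic_hol hF hf).
  move=> w /= dw; apply: eD; rewrite -/(dist a w); apply: (le_lt_trans dw); lra.
have i0 : (\int[mu]_(x in arc_itv k) ((cst 0 x : R) `^ p)%:E = 0)%E.
    by rewrite integral0_eq// => x xI; case: (kE x).
  rewrite i0; apply: mule_ge0 => //; apply: integral_ge0 => z _; exact: poweR_ge0.
rewrite integral0_eq => [|x xI]; last by case: (kE x).
apply: mule_ge0 => //; apply: integral_ge0 => z _; by rewrite lee_fin powR_ge0.
Qed.

Section chart.
Variables (t L m1 h1 m2 h2 : R) (phi : R -> R) (Q Q' : set R[i]^o).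
Hypothesis lip : forall x y, `|phi x - phi y| <= L * `|x - y|.
Hypothesis graph : (rot t @` D) `&` Q = [set z | Q z /\ phi (complex.Re z) < complex.Im z].
Hypothesis rQ' : open_rectangle Q'.
Hypothesis Q'Q : Q' `<=` Q.
Hypotheses (m10 : 0 < m1) (h10 : 0 < h1) (m20 : 0 < m2) (h20 : 0 < h2).
Hypothesis cones : forall z, bd D z -> Q' (rot t z) ->
  [/\ [set rot (- t) w + z | w in trunc_cone 0 (0 +i* 1)%C m1 h1] `<=` G z,
      G z `<=` closure (G z) `\ z,
      closure (G z) `\ z `<=` [set rot (- t) w + z | w in trunc_cone 0 (0 +i* 1)%C m2 h2] &
      [set rot (- t) w + z | w in trunc_cone 0 (0 +i* 1)%C m2 h2] `<=` D].
Notation c := (cos t).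
Notation s := (sin t).
Notation gpt := (gpt c s phi).
Notation pnt := (pnt c s).
Let cs : c ^+ 2 + s ^+ 2 = 1 := cos2Dsin2 t.

Let L0 : 0 <= L.
Proof. by have := lip 1 0; rewrite subr0 normr1 mulr1; apply: le_trans. Qed.

Variables (x0 rho h : R).
Hypotheses (rho0 : 0 < rho) (h0 : 0 < h) (hh1 : h <= h1).
Hypothesis inQ : forall x u, `|x - x0| < rho -> `|u| < h -> Q' (rot t (cx (gpt x u))).
Notation I := (`](x0 - rho)%R, (x0 + rho)%R[%classic : set RR).

Let inI x : I x -> `|x - x0| < rho.
Proof. by rewrite /= in_itv/= => /andP[? ?]; rewrite ltr_norml; apply/andP; split; lra. Qed.

Lemma chart_mem x u : `|x - x0| < rho -> `|u| < h -> (D2 (gpt x u) <-> 0 < u).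
Proof.
move=> xx uu; have := graph_mem graph (Q'Q (inQ xx uu)).
by rewrite rotate_gpt reE imE ltrDl.
Qed.

Lemma chart_bd x : `|x - x0| < rho -> bd D (cx (gpt x 0)).
Proof.
move=> xx; have u0 : `|0 : R| < h by rewrite normr0.
apply/(bd_graph oD lip graph rQ' Q'Q (inQ xx u0)).
by rewrite rotate_gpt reE imE addr0.
Qed.

Lemma chart_Q x : `|x - x0| < rho -> Q' (rot t (cx (gpt x 0))).
Proof. by move=> xx; apply: inQ => //; rewrite normr0. Qed.

Lemma cone_point x a b : `|x - x0| < rho -> `|a| < m1 * b -> 0 < b < h ->
  G (cx (gpt x 0)) (cx (pnt (x + a) (phi x + b))).
Proof.
move=> xx ab /andP[b0 bh]; have [sub _ _ _] := cones (chart_bd xx) (chart_Q xx).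
apply: sub; apply/vertical_coneE.
have -> : rot t (cx (pnt (x + a) (phi x + b)) - cx (gpt x 0)) = (a +i* b)%C.
  by rewrite rotateB rotate_gpt rotate_pnt; apply: cplx_eqP; rewrite !reimE; ring.
by rewrite reE imE b0 (lt_le_trans bh hh1).
Qed.

Lemma cone_sub z : bd D z -> Q' (rot t z) -> G z `<=` D.
Proof.
by move=> bz Qz w Gw; have [_ h3 h4 h5] := cones bz Qz; apply: h5; apply: h4; exact: h3.
Qed.

Section density.
Variable F : R[i]^o -> R[i]^o.
Hypotheses (hF : holomorphic D F) (hf : holomorphic D (derive1 F)).
Hypothesis Lp : in_Lp p (nt_max G (derive1 F) : arc_space D -> \bar R).
Notation f := (fun w => derive1 F (cx w)).

(** The cone has the same shape over every [x], so this is a supremum of functions continuous in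
    [x]: lower semicontinuous, hence measurable in the parameter. For [nt_max] only measurability
    with respect to arc length is available. *)
Definition vmax (x : R) : \bar R := ereal_sup [set (modulus (f (pnt (x + u.1) (phi x + u.2))))%:E |
  u in [set u : R * R | `|u.1| < m1 * u.2 /\ 0 < u.2 < h]].

Definition arc_max : RR -> \bar R := vmax \_ I.

Lemma vmax_le x : `|x - x0| < rho -> (vmax x <= nt_max G (derive1 F) (cx (gpt x 0)))%E.
Proof.
move=> xx; apply: ge_ereal_sup => _ [u [u1 u2] <-]; apply: ereal_sup_ubound.
by exists (cx (pnt (x + u.1) (phi x + u.2))) => //; exact: cone_point.
Qed.

Lemma le_vmax x a b : `|a| < m1 * b -> 0 < b < h ->
  ((modulus (f (pnt (x + a) (phi x + b))))%:E <= vmax x)%E.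
Proof. by move=> ab bh; apply: ereal_sup_ubound; exists (a, b). Qed.

Lemma vmax_ge0 x : (0 <= vmax x)%E.
Proof.
apply: le_trans (@le_vmax x 0 (h / 2) _ _); first by rewrite lee_fin modulus_ge0.
  by rewrite normr0 mulr_gt0// divr_gt0.
by have hh := h0; apply/andP; split; lra.
Qed.

Lemma arc_max_ge0 x : (0 <= arc_max x)%E.
Proof. by rewrite /arc_max patchE; case: ifP => // _; exact: vmax_ge0. Qed.

Lemma arc_maxE x : I x -> arc_max x = vmax x.
Proof. by move=> xI; rewrite /arc_max patchE mem_set. Qed.

Lemma measurable_arc_max : measurable_fun setT arc_max.
Proof.
have mI : measurable I by exact: measurable_itv.
apply/(measurable_restrictT _ mI); apply: lsc_measurable => x xI k kx.
have xx : `|x - x0| < rho by move: xI => /andP[? ?]; rewrite ltr_norml; apply/andP; split; lra.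
have [_ [u [u1 u2] <-] ku] := ereal_sup_gt kx.
have cpath : ccont (fun y : R => f (pnt (y + u.1) (phi y + u.2))) x.
  apply: (@ccont_comp _ _ _ (fun y : R => pnt (y + u.1) (phi y + u.2)) f).
    have xa : y + u.1 @[y --> x] --> x + u.1 by apply: cvgD; [exact: cvg_id|exact: cvg_cst].
    have pb : phi y + u.2 @[y --> x] --> phi x + u.2.
      by apply: cvgD; [exact: (lip_cont lip)|exact: cvg_cst].
    by apply: cvg_to_pair; apply: cvgD; apply: cvgM; do ?exact: cvg_cst.
  apply: cdiff_ccont; apply: derivable_cdiff; apply: hf.
  exact: cone_sub (chart_bd xx) (chart_Q xx) _ (cone_point xx u1 u2).
have := ccont_modulus cpath; rewrite lte_fin in ku.
move=> /(cvgr_gt _)/(_ _ ku); apply: filterS => y ky.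
by apply: lt_le_trans (le_vmax y u1 u2); rewrite lte_fin.
Qed.

Lemma chart_lipschitz x y : modulus (cx (gpt x 0) - cx (gpt y 0)) <= (1 + L) * `|x - y|.
Proof.
rewrite -(modulus_rotate t) rotateB !rotate_gpt; apply: (le_trans (modulus_le _)).
by rewrite !reimE !addr0 mulrDl mul1r lerD2l.
Qed.

Lemma chart_integral_le (H : RR -> \bar R) (Phi : arc_space D -> \bar R) :
  measurable_fun setT H -> (forall x, (0 <= H x)%E) -> (forall z, (0 <= Phi z)%E) ->
  {ae mu, forall x, I x -> (H x <= Phi (cx (gpt x 0)))%E} ->
  (\int[mu]_(x in I) H x <= 2%:E * \int[arc_length D]_z Phi z)%E.
Proof.
apply: (arc_integral_le oD vertex_closure inside hGm (gam := fun x => cx (gpt x 0)) (L := 1 + L)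
  (pi := fun z => re (rot t z)) chart_lipschitz).
- by move=> x /inI; exact: chart_bd.
- by move=> x _; rewrite rotate_gpt reE.
- move=> x y _ _; rewrite -(modulus_rotate t) rotateB !rotate_gpt.
  by apply: le_trans (ler_re _); rewrite !reimE.
Qed.

(** On a bounded interval [arc_max] is at most [1] plus its power [p], and that power is compared
    with the maximal function on [bD]. This supplies the integrability of [N] assumed in every chart
    argument. *)
Lemma integral_arc_max : (\int[mu]_(x in I) arc_max x < +oo)%E.
Proof.
have p0 : 0 < p := lt_trans ltr01 p1.
have mI : measurable I by exact: measurable_itv.
have mNp : measurable_fun setT (fun x : RR => arc_max x `^ p)%E.
  exact: (measurableT_comp (@measurable_poweR R p) measurable_arc_max).
apply: (@le_lt_trans _ _ (\int[mu]_(x in I) (1 + arc_max x `^ p))%E).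
  apply: ge0_le_integral => //.
  - by move=> x _; exact: arc_max_ge0.
  - by apply: measurable_funTS; exact: measurable_arc_max.
  - by apply: measurable_funTS; apply: emeasurable_funD => //; exact: measurable_cst.
  - by move=> x _; apply: le_poweR_add1 => //; exact: arc_max_ge0.
rewrite ge0_integralD//; last 2 first.
- by move=> x _; exact: poweR_ge0.
- exact: measurable_funTS.
apply: lte_add_pinfty.
  have -> : (\int[mu]_(x in I) 1 = mu I)%E by rewrite (integral_cst mu mI 1%E) mul1e.
  rewrite lebesgue_measure_itv /=; case: ifP => _ //; by rewrite -EFinB ltry.
have [_ fin] := Lp.
have := poweR_lty p fin; rewrite poweR_Lnorm ?gt_eqF// => fin'.
apply: le_lt_trans (lte_mul_pinfty _ _ fin').
- apply: chart_integral_le => //.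
  + by move=> x; exact: poweR_ge0.
  + by move=> z; exact: poweR_ge0.
  apply: aeW => x xI; rewrite arc_maxE//; apply: lee_poweR; [exact: ltW|exact: vmax_ge0|].
  apply: (le_trans (vmax_le (inI xI))); exact: lee_abs.
- by [].
- by [].
Qed.

(** Points of the arc are not in [D], hence not in the larger cone that contains the closure of [G]
    less its vertex; [cone_margin] turns this into the approach condition of [nt_value]. *)
Lemma nt_value_lim x c0 : `|x - x0| < rho -> nt_value c s phi x0 rho D2 f x c0 ->
  nt_lim G (derive1 F) (cx (gpt x 0)) = c0.
Proof.
move=> xx nt; set z0 : R[i]^o := cx (gpt x 0).
have bz := chart_bd xx; have Qz := chart_Q xx; rewrite -/z0 in bz Qz.
have [u [m [k [u1 m0 k0 GE]]]] := trunc bz.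
have [_ sub2 sub3 sub4] := cones bz Qz.
have GD := cone_sub bz Qz.
rewrite GE in sub3; have [kappa kap0 [d d0 margin]] := cone_margin u1 m0 k0 m20 h20 sub3.
have prop : ProperFilter (within (G z0) (nbhs z0)).
  by apply: within_nbhs_proper; exact: vertex_closure.
apply: cvg_lim; first exact: norm_hausdorff.
move=> U /nbhs_modulus[e e0 eU].
have [d' d'0 Hd] := nt kappa kap0 (e / 2) (divr_gt0 e0 (ltr0Sn _ 1)).
apply/nbhs_modulus; exists (Num.min d d'); first by rewrite lt_min d0.
move=> z; rewrite lt_min => /andP[zd zd'] Gz; apply: eU.
pose w : R * R := (re z, im z).
have zE : z = cx w by rewrite /cx /= cplx_eta.
have dz : dist (gpt x 0) w = modulus (z - z0) by rewrite zE.
apply: (@le_lt_trans _ _ (e / 2)); last by rewrite ltr_pdivrMr// mulr_natr mulr2n ltrDl.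
have -> : derive1 F z = f w by rewrite zE.
apply: Hd.
- by rewrite /= -zE; exact: GD.
- rewrite dz zd' andbT modulus_gt0 subr_eq0; apply/eqP => zz.
  by have [_ /=] := sub2 z Gz; apply.
move=> y yy; rewrite dz.
have -> : dist (gpt y 0) w = modulus (z - cx (gpt y 0)) by rewrite /dist -zE.
apply: margin => //; first by rewrite -GE.
by move=> /sub4 Dy; exact: (bd_notin oD (chart_bd yy) Dy).
Qed.

Lemma controlled_density r : 0 < r -> 3/2 * r < rho -> (1 + L) * (3/2 * r) < h ->
  exists g, [/\ arc_ok (Arc c s phi x0 rho g (12 * (1 + L))),
        local_bound D2 f (gpt x0 0) r (Arc c s phi x0 rho g (12 * (1 + L))),
        (\int[mu]_(x in I) (g x `^ p)%:E <=
          2%:E * \int[arc_length D]_z `|nt_max G (derive1 F) z| `^ p)%E &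
        (\int[mu]_(x in I) (g x `^ p)%:E <=
          2%:E * \int[arc_length D]_z (modulus (nt_lim G (derive1 F) z) `^ p)%:E)%E].
Proof.
move=> r0 r1 r2; have p0 : 0 < p := lt_trans ltr01 p1.
have mI : measurable I by exact: measurable_itv.
have oD2 := open_cx oD.
have cf w : D2 w -> ccont f w.
  by move=> Dw; apply: cdiff_ccont; apply: derivable_cdiff; exact: hf.
have cone : forall y a b, `|y - x0| < rho -> `|a| < m1 * b -> 0 < b < h ->
    D2 (pnt (y + a) (phi y + b)) /\ ((modulus (f (pnt (y + a) (phi y + b))))%:E <= arc_max y)%E.
  move=> y a b yy ab bh; split.
    exact: cone_sub (chart_bd yy) (chart_Q yy) _ (cone_point yy ab bh).
  rewrite arc_maxE; first exact: le_vmax.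
  by move: yy; rewrite /= in_itv/= ltr_norml => /andP[? ?]; apply/andP; split; lra.
have dF w : D2 w -> cdiff (fun w => F (cx w)) f w.
  by move=> Dw; apply: derivable_cdiff; exact: hF.
have [g [mg g0 fg ntg]] := chart_boundary cs lip rho0 h0 m10 oD2 chart_mem cone
  (holomorphic_hol hF hf) dF measurable_arc_max arc_max_ge0 integral_arc_max.
have bound (Phi : arc_space D -> \bar R) : (forall z, (0 <= Phi z)%E) ->
    {ae mu, forall x, I x -> ((g x `^ p)%:E <= Phi (cx (gpt x 0)))%E} ->
    (\int[mu]_(x in I) (g x `^ p)%:E <= 2%:E * \int[arc_length D]_z Phi z)%E.
  move=> P0 le.
  have -> : (\int[mu]_(x in I) (g x `^ p)%:E = \int[mu]_(x in I) ((fun x : RR => (g x `^ p)%:E) \_ I) x)%E.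
    by apply: eq_integral => x xI; rewrite patchE xI.
  apply: chart_integral_le => //.
  - apply/(measurable_restrictT _ mI)/measurable_EFinP; exact: (measurableT_comp (@measurable_powR R p)).
  - by move=> x; rewrite patchE; case: ifP => // _; rewrite lee_fin powR_ge0.
  by apply: (filterS _ le) => x H xI; rewrite patchE mem_set//; exact: H.
exists g; split.
- by split => //=; [apply: mulr_ge0 => //; have := L0; lra|exists L].
- apply: (local_bound_chart oD2 (hol_weakly_deriv oD2 (holomorphic_hol hF hf)) cf cs lip h0 chart_mem
    measurable_arc_max arc_max_ge0 integral_arc_max) => // x u xx uh.
  have u0 : `|0 : R| < m1 * u by rewrite normr0 mulr_gt0//; case/andP: uh.
  by have [_] := cone x 0 u xx u0 uh; rewrite addr0.
(* [g] is almost everywhere a limit of [modulus f] along the axis of the cone, so it is at most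
   [vmax], which is at most [nt_max] at the same boundary point. *)
- apply: bound => [z|]; first exact: poweR_ge0.
  apply: (filterS _ fg) => x H xI; have xx := inI xI; rewrite -poweR_EFin.
  apply: lee_poweR; [exact: ltW|by rewrite lee_fin|].
  apply: (le_trans _ (le_trans (vmax_le xx) (lee_abs _))).
  rewrite leNgt; apply/negP => lt.
  have v0 := vmax_ge0 x; move: lt v0; case E : (vmax x) => [v| |] // lt _; rewrite lte_fin in lt.
  have := cvgr_gt _ (H xI) _ lt; move=> [d /= d0 Hd].
  pose u := Num.min d h / 2.
  have u0 : 0 < u by rewrite divr_gt0// lt_min d0.
  have um : u < Num.min d h by rewrite ltr_pdivrMr// mulr_natr mulr2n ltrDl lt_min d0.
  have ud : u < d by apply: (lt_le_trans um); rewrite ge_min lexx.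
  have uh : u < h by apply: (lt_le_trans um); rewrite ge_min lexx orbT.
  have := Hd u; rewrite /= sub0r normrN gtr0_norm// => /(_ ud u0); apply/negP; rewrite -leNgt.
  have a0 : `|0 : R| < m1 * u by rewrite normr0 mulr_gt0.
  have bu : 0 < u < h by rewrite u0.
  by have := le_vmax x a0 bu; rewrite addr0 E lee_fin.
- apply: bound => [z|]; first by rewrite lee_fin powR_ge0.
apply: (filterS _ ntg) => x H xI; have [c0 c0g ntx] := H xI.
by rewrite (nt_value_lim (inI xI) ntx) c0g.
Qed.

End density.

Lemma controlled_chart : exists r k, controlled (gpt x0 0) r k.
Proof.
have L1 : 0 < 1 + L by have := L0; lra.
(* With this radius the support of the cutoff, of radius [3/2 * r], uses at most three quarters of
   the width [rho] and of the height [h]. *)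
pose r := Num.min (rho / 2) (h / (2 * (1 + L))).
have r0 : 0 < r by rewrite lt_min !divr_gt0// mulr_gt0.
have ra : r <= rho / 2 by rewrite ge_min lexx.
have rb : r <= h / (2 * (1 + L)) by rewrite ge_min lexx orbT.
have rc : r * (2 * (1 + L)) <= h by rewrite -ler_pdivlMr// mulr_gt0.
exists r, (Arc c s phi x0 rho (cst 0) (12 * (1 + L))); split => //=.
- by split => //; [rewrite mulr_ge0// ltW|exists L].
- by move=> x /inI; exact: chart_bd.
move=> F hF [hf Lp]; apply: controlled_density => //; first lra.
have -> : (1 + L) * (3/2 * r) = r * (2 * (1 + L)) * (3/4) by field.
have := h0; lra.
Qed.

End chart.

End boundary_control.

(** * The Dirichlet bound *)

Section dirichlet_bound.
Variable R : realType.
Notation mu := (@lebesgue_measure R).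
Notation mu2 := (@lebesgue_measure R \x @lebesgue_measure R)%E.
Notation RR := (measurableTypeR R).
Notation P := (measurableTypeR R * measurableTypeR R)%type.
Local Notation rot := Defs.rot.
Variables (D : set R[i]^o) (G : R[i]^o -> set R[i]^o) (p : R).
Hypotheses (hD : bounded_domain D) (hG : cone_family D G) (hGm : nt_measurable D G) (p1 : 1 < p).
Notation D2 := [set w : R * R | D (cx w)].

Let oD : open D. Proof. by case: hD. Qed.

Lemma bounded_modulus : exists2 M, 0 < M & forall z, closure D z -> modulus z <= M.
Proof.
have [_ _ _ [A [Areal HA]]] := hD.
have A1 : A < `|A| + 1 by apply: le_lt_trans (real_ler_norm Areal) _; rewrite ltrDl.
exists (modulus A + 1) => [|z clz]; first by rewrite ltr_wpDl ?modulus_ge0.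
apply/ler_addgt0Pr => e e0.
have [w [Dw /= wz]] : D `&` [set w | modulus (w - z) < e] !=set0.
  by apply: clz; apply/nbhs_modulus; exists e.
have : (modulus w)%:C%C <= (modulus A + 1)%:C%C.
  by rewrite rmorphD rmorph1 -!normE; exact: HA.
rewrite lecR => wM.
have := modulusD (z - w) w; rewrite subrK modulusBC; lra.
Qed.

Lemma cone_inside z : bd D z -> closure (G z) `\ z `<=` D.
Proof.
move=> bz; have [_ [n [Q [theta [phi [Q' [_ _ cov]]]]]]] := hG.
move=> /= H; have [j Qj] := cov z bz; have [D1 [D2' [_ _ /(_ z bz Qj)[_ _ h3 h4]]]] := H j.
by move=> w /h3/h4[].
Qed.

Lemma controlled_boundary a : bd D (cx a) -> exists r k, controlled D G p a r k.
Proof.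
move=> ba; have [trunc [n [Q [theta [phi [Q' [[_ lips _ graphs] rects cov H]]]]]]] := hG.
have [j Qj] := cov _ ba; have [D1 [D2' [v1 v2 cones]]] := H j.
have [rQ' _ clQ] := rects j.
have Q'Q : Q' j `<=` Q j by move=> w Qw; apply: clQ; exact: subset_closure.
have [m1 [h1 [m10 h10 E1]]] := v1; have [m2 [h2 [m20 h20 E2]]] := v2.
set t := theta j in Qj cones graphs *; have [L L0 lip] := lipschitzP (lips j).
have graph := graphs j; rewrite -/t in graph.
have mem z : (rot (- t) @` Q' j) z <-> Q' j (rot t z).
  by split => [[w Qw <-]|Qz]; [rewrite rotateK|exists (rot t z); rewrite // rotateNK].
have Qa := (mem _).1 Qj.
pose x0 := re (rot t (cx a)).
have aE : a = gpt (cos t) (sin t) (phi j) x0 0.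
  have e : rot t (cx (gpt (cos t) (sin t) (phi j) x0 0)) = rot t (cx a).
    rewrite rotate_gpt addr0 -((bd_graph oD lip graph rQ' Q'Q Qa).1 ba); exact: cplx_eta.
  have := congr1 (rot (- t)) e; rewrite !rotateNK => e'.
  by apply: dist_eq0; rewrite /dist e' subrr modulus0.
have Qx0 : Q' j (rot t (cx (gpt (cos t) (sin t) (phi j) x0 0))) by rewrite -aE.
have [rho rho0 [h h0 inQ]] := gpt_Q lip rQ' Qx0.
have hm0 : 0 < Num.min h h1 by rewrite lt_min h0.
have inQ' x u : `|x - x0| < rho -> `|u| < Num.min h h1 -> Q' j (rot t (cx (gpt (cos t) (sin t) (phi j) x u))).
  by rewrite lt_min => xx /andP[uh _]; exact: inQ.
have hh1 : Num.min h h1 <= h1 by rewrite ge_min lexx orbT.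
have cones' z : bd D z -> Q' j (rot t z) ->
  [/\ [set rot (- t) w + z | w in trunc_cone 0 (0 +i* 1)%C m1 h1] `<=` G z,
      G z `<=` closure (G z) `\ z,
      closure (G z) `\ z `<=` [set rot (- t) w + z | w in trunc_cone 0 (0 +i* 1)%C m2 h2] &
      [set rot (- t) w + z | w in trunc_cone 0 (0 +i* 1)%C m2 h2] `<=` D].
  move=> bz Qz; have [c1 c2 c3 c4] := cones z bz ((mem z).2 Qz).
  by rewrite -E1 -E2; split => // w /c4[].
rewrite aE; exact: (controlled_chart oD p1 trunc cone_inside hGm lip graph rQ' Q'Q m10 m20 h20 cones' rho0 hm0 hh1 inQ').
Qed.

Lemma closure_cx a : closure D2 a -> closure D (cx a).
Proof.
by move=> cla U /nbhs_cx /cla[v [Dv Uv]]; exists (cx v).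
Qed.

(** Each point of the compact closure receives a disc and an arc chosen without reference to any
    [F], so the finite subcover and its constants are uniform in [F]. *)
Lemma controlled_cover : exists n (a : nat -> R * R) (r : nat -> R) (k : nat -> barc R),
  (forall i, (i < n)%N -> controlled D G p (a i) (r i) (k i)) /\
  forall w, D2 w -> exists2 i, (i < n)%N & dist (a i) w < r i.
Proof.
have [M M0 HM] := bounded_modulus.
have cpt : compact (closure D2).
  apply: (subclosed_compact _ (@compact_closed_box R M)); first exact: closed_closure.
  move=> w /closure_cx/HM wM.
  by split; [apply: le_trans (ler_re (cx w)) _|apply: le_trans (ler_im (cx w)) _].
have HC a : exists rk : R * barc R, closure D2 a -> controlled D G p a rk.1 rk.2.
  have [cla|ncl] := pselect (closure D2 a); last by exists (0, @Arc R 1 0 (cst 0) 0 0 (cst 0) 0).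
  have [Da|nDa] := pselect (D (cx a)).
    by have [r [k H]] := controlled_interior G p oD Da; exists (r, k).
  have ba : bd D (cx a) by split; [exact: closure_cx|move=> /interior_subset].
  by have [r [k H]] := controlled_boundary ba; exists (r, k).
have [rk Hrk] := choice HC.
pose disc (a : R * R) : set R[i]^o := [set z | modulus (z - cx a) < (rk a).1].
have odisc a : closure D2 a -> open (disc a).
  move=> _; rewrite openE => z za; apply/nbhs_modulus; exists ((rk a).1 - modulus (z - cx a)).
    by rewrite subr_gt0.
  by move=> w wz; apply: (le_lt_trans (modulus_tri w (cx a) z)); rewrite -ltrBrDr.
have : compact ((@cx R : R * R -> R[i]^o) @` closure D2).
  by apply: continuous_compact => //; apply: continuous_subspaceT => w A; exact: nbhs_cx.
rewrite compact_cover => /(_ _ (closure D2) disc odisc)[_ [a cla <-]|S SD cov].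
  exists a => //=; have [[r0 _ _ _] _ _] := Hrk a cla.
  have -> : disc a (cx a) = (modulus (cx a - cx a) < (rk a).1) by [].
  by rewrite subrr modulus0.
pose s : seq (R * R) := finmap.enum_fset S.
exists (size s), (nth (0, 0) s), (fun i => (rk (nth (0, 0) s i)).1), (fun i => (rk (nth (0, 0) s i)).2).
split => [i lt|w Dw].
  apply: Hrk; have := SD (nth (0, 0) s i); rewrite inE; apply.
  exact: mem_nth.
have cw : ((@cx R : R * R -> R[i]^o) @` closure D2) (cx w) by exists w => //; exact: subset_closure.
have [a /= aS aw] := cov _ cw.
exists (index a s); first by rewrite index_mem.
by rewrite nth_index.
Qed.

Lemma dirichlet_bound : exists2 K : R, 0 < K &
  forall F, holomorphic D F -> hardy D G p (derive1 F) ->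
  (dirichlet_integral D p F <= K%:E * \int[arc_length D]_z `|nt_max G (derive1 F) z| `^ p)%E /\
  (dirichlet_integral D p F <= K%:E * \int[arc_length D]_z (modulus (nt_lim G (derive1 F) z) `^ p)%:E)%E.
Proof.
have [M M0 HM] := bounded_modulus; have p0 : 0 < p := lt_trans ltr01 p1.
have [n [a [r [k [ctl cov]]]]] := controlled_cover.
(* [2 * M] bounds the distance between any two points of the closure of [D], which is the size
   required by [arc_near]. *)
have A0 : 0 < 2 * M by rewrite mulr_gt0.
pose B := \sum_(i < n) arc_C (k i).
have C0 (i : nat) : (i < n)%N -> 0 <= arc_C (k i) by move=> /ctl[[]].
have B0 : 0 <= B by apply: sumr_ge0 => i _; exact: C0.
have CB i : (i < n)%N -> arc_C (k i) <= B.
  move=> lt; rewrite /B (bigD1 (Ordinal lt))//= lerDl; apply: sumr_ge0 => j _; exact: C0.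
have [K K0 HK] := hardy_estimate n p1 A0 B0.
have [two e2] : exists two : R, two = 2 by exists 2.
exists (K * (n%:R * two) + 1).
  by rewrite ltr_wpDl// mulr_ge0 ?(ltW K0)// mulr_ge0// e2.
move=> F hF hd.
have HG (i : 'I_n) : exists g, [/\ arc_ok (with_density (k i) g),
    local_bound D2 (fun w => derive1 F (cx w)) (a i) (r i) (with_density (k i) g),
    (\int[mu]_(x in arc_itv (k i)) (g x `^ p)%:E <=
      two%:E * \int[arc_length D]_z `|nt_max G (derive1 F) z| `^ p)%E &
    (\int[mu]_(x in arc_itv (k i)) (g x `^ p)%:E <=
      two%:E * \int[arc_length D]_z (modulus (nt_lim G (derive1 F) z) `^ p)%:E)%E].
  by rewrite e2; have [_ _ H] := ctl i (ltn_ord i); exact: H.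
have [g0 Hg0] := choice HG.
pose g (i : nat) : R -> R := if insub i is Some j then g0 j else cst 0.
have gE (i : 'I_n) : g i = g0 i by rewrite /g valK.
pose k' i := with_density (k i) (g i).
have Hg i : (i < n)%N -> [/\ arc_ok (k' i),
    local_bound D2 (fun w => derive1 F (cx w)) (a i) (r i) (k' i),
    (\int[mu]_(x in arc_itv (k i)) (g i x `^ p)%:E <=
      two%:E * \int[arc_length D]_z `|nt_max G (derive1 F) z| `^ p)%E &
    (\int[mu]_(x in arc_itv (k i)) (g i x `^ p)%:E <=
      two%:E * \int[arc_length D]_z (modulus (nt_lim G (derive1 F) z) `^ p)%:E)%E].
  by move=> lt; have := Hg0 (Ordinal lt); rewrite /k' -(gE (Ordinal lt)).
have oD2 := open_cx oD.
have cf w : D2 w -> ccont (fun w => derive1 F (cx w)) w.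
  by move=> Dw; apply: cdiff_ccont; apply: derivable_cdiff; apply: hd.1.
have onbd i x : (i < n)%N -> arc_itv (k i) x -> bd D (cx (arc_pt (k i) x)).
  by move=> /ctl[_ H _]; exact: H.
have near i : (i < n)%N -> arc_near D2 (2 * M) (k' i).
  move=> lt; have [[r0 _ cs [L lip]] H _] := ctl i lt.
  split => //=; first by exists L.
  move=> z x Dz xI; have bx := onbd i x lt xI.
  set q := arc_pt _ x; have -> : q = arc_pt (k i) x by [].
  have mq : modulus (cx (arc_pt (k i) x)) <= M by apply: HM; case: bx.
  have mz : modulus (cx z) <= M by apply: HM; exact: subset_closure.
  have dq : dist z (arc_pt (k i) x) <= 2 * M.
    apply: (le_trans (modulusD _ _)); rewrite modulusN; lra.
  split.
  - apply: le_trans dq; have := dist_gX cs (arc_pt (k i) x) z.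
    by rewrite (gX_gpt _ cs).
  - apply: le_trans dq; rewrite distrC.
    by have := ler_re (cx (arc_pt (k i) x) - cx z); rewrite /cx !reimE.
  - apply: le_trans dq; rewrite distrC.
    by have := ler_im (cx (arc_pt (k i) x) - cx z); rewrite /cx !reimE.
  - exact: (bd_notin oD bx).
have rep := @representation R D2 (fun w => derive1 F (cx w)) oD2 a r k' cf n
  (fun i lt => let: And3 (And4 r0 _ _ _) _ _ := ctl i lt in r0)
  (fun i lt => let: And4 _ lb _ _ := Hg i lt in lb)
  (fun i lt => let: And4 ok _ _ _ := Hg i lt in ok) cov
  (fun i x lt xI => bd_notin oD (onbd i x lt xI)).
have est := HK D2 (fun w => derive1 F (cx w)) k' oD2 cf near
  (fun i lt => let: And4 ok _ _ _ := Hg i lt in ok) CB rep.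
have fin (J : \bar R) : (0 <= J)%E ->
    (forall i, (i < n)%N -> (\int[mu]_(x in arc_itv (k i)) (g i x `^ p)%:E <= two%:E * J)%E) ->
    (dirichlet_integral D p F <= (K * (n%:R * two) + 1)%:E * J)%E.
  move=> J0 le; apply: (le_trans est).
  apply: (@le_trans _ _ ((K * (n%:R * two))%:E * J)%E); last first.
    by apply: lee_wpmul2r => //; rewrite lee_fin lerDl.
  rewrite EFinM -muleA; apply: lee_wpmul2l; first by rewrite lee_fin ltW.
  rewrite EFinM -muleA; apply: (@le_trans _ _ (\sum_(i < n) (two%:E * J))%E).
    by apply: lee_sum => i _; exact: le.
  by rewrite sumr_const card_ord mule_natl.
split; apply: fin.
- by apply: integral_ge0 => z _; exact: poweR_ge0.
- by move=> i /Hg[].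
- by apply: integral_ge0 => z _; rewrite lee_fin powR_ge0.
- by move=> i /Hg[].
Qed.

End dirichlet_bound.

Theorem theorem3p3 (R : realType) (D : set R[i]^o)
    (G : R[i]^o -> set R[i]^o) (p : R) (alpha : R[i]^o)
    (hD : bounded_domain D) (hsc : simply_connected D)
    (hLip : lipschitz_domain D)
    (hG : cone_family D G) (hGm : nt_measurable D G)
    (hp : 1 < p) (halpha : D alpha) :
  (forall F : R[i]^o -> R[i]^o,
     sobolev_hardy D G p alpha F -> dirichlet D p alpha F) /\
  exists2 C : R, 0 < C &
    forall F : R[i]^o -> R[i]^o, sobolev_hardy D G p alpha F ->
      (dirichlet_norm D p F <= C%:E * sobolev_hardy_norm D G p F)%E.
Proof.
have p0 : 0 < p := lt_trans ltr01 hp.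
have [K K0 HK] := dirichlet_bound hD hG hGm hp.
split=> [F [hF hd Fa]|].
  (* Membership uses the bound by the maximal function, whose norm is finite by definition of
     [hardy]; the bound by boundary values is kept for the norm inequality. *)
  have [le _] := HK F hF hd; split => //; apply: (le_lt_trans le).
  apply: lte_mul_pinfty => //; first by rewrite lee_fin ltW.
  have [_ [_ fin]] := hd.
  by have := poweR_lty p fin; rewrite poweR_Lnorm ?gt_eqF.
exists (K `^ p^-1) => [|F [hF hd Fa]]; first exact: powR_gt0.
have [_ le] := HK F hF hd.
have D0 : (0 <= dirichlet_integral D p F)%E.
  by apply: integral_ge0 => w _; rewrite lee_fin powR_ge0.
have ip0 : 0 <= p^-1 by rewrite invr_ge0 ltW.
rewrite /dirichlet_norm; apply: (le_trans (lee_poweR ip0 D0 le)).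
have J0 : (0 <= \int[arc_length D]_z (modulus (nt_lim G (derive1 F) z) `^ p)%:E)%E.
  by apply: integral_ge0 => z _; rewrite lee_fin powR_ge0.
rewrite poweRM//; last by rewrite lee_fin ltW.
rewrite poweR_EFin; apply: lee_wpmul2l; first by rewrite lee_fin powR_ge0.
rewrite /sobolev_hardy_norm unlock.
rewrite le_eqVlt; apply/orP; left; apply/eqP.
apply: (congr1 (poweR ^~ p^-1)); apply: eq_integral => z _.
by rewrite abse_EFin ger0_norm ?modulus_ge0.
Qed.
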